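(* Let $\Sigma^2\subseteq\mathbb{R}^3$ be a translator with finite entropy contained in a vertical slab. Assume that there exists a regular value $a\in\mathbb{R}$ of (the restriction to $\Sigma$ of) $x_3$ such that $\Sigma\cap\{x_3=a\}$ is a straight line parallel to the slab and that $\Sigma\cap\{x_3<a\}\ne\emptyset$. Then $\Sigma$ must be a vertical plane parallel to the slab.
   Context: Coordinates $(x_1,x_2,x_3)$ and standard orthonormal basis $(e_1,e_2,e_3)$ of Euclidean $\mathbb{R}^3$ are fixed. A translator $\Sigma^2\subseteq\mathbb{R}^3$ is a smooth, connected, (immersed) surface without boundary, complete in the induced metric, satisfying $\mathbf{H}=e_3^{\perp}$, where $\mathbf{H}$ is the mean curvature vector (the trace of the vector-valued second fundamental form, i.e. of the generalized Hessian of the immersion) and $(\cdot)^\perp$ is the projection onto the normal bundle of $\Sigma$. A vertical slab is a set $\{p\in\mathbb{R}^3: b<\langle p,v\rangle<b+\omega\}$ with $b\in\mathbb{R}$, $0<\omega<\infty$ and $v$ a unit vector orthogonal to $e_3$; a line or plane is parallel to the slab if it is parallel to the planes $\{\langle p,v\rangle=\mathrm{const}\}$. Entropy: $\lambda(\Sigma)=\sup_{x_0\in\mathbb{R}^3,\,t_0>0}\frac{1}{4\pi t_0}\int_\Sigma e^{-\|x-x_0\|^2/(4t_0)}\,d\mathrm{vol}_\Sigma$; finite entropy means $\lambda(\Sigma)<\infty$. *)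

(* Defs.v *)
From HB Require Import structures.
From mathcomp Require Import all_boot all_order all_algebra.
From mathcomp Require Import all_classical all_reals all_analysis.

Set Implicit Arguments.
Unset Strict Implicit.
Unset Printing Implicit Defensive.

Import Order.TTheory GRing.Theory Num.Theory.
Import numFieldNormedType.Exports.

Local Open Scope classical_set_scope.
Local Open Scope ring_scope.

(* The library norm on 'rV[R]_3 is the sup norm, hence the explicit Euclidean
   structure.  Rows are 3-vectors; the coordinates x_1, x_2, x_3 are the
   entries of index 0, 1, 2. *)
Definition dot (R : realType) (u v : 'rV[R]_3) : R :=
  \sum_(i < 3) u 0 i * v 0 i.

Definition enorm (R : realType) (u : 'rV[R]_3) : R := Num.sqrt (dot u u).

Definition e3 (R : realType) : 'rV[R]_3 := delta_mx 0 ord_max.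

Definition x3 (R : realType) (p : 'rV[R]_3) : R := p 0 ord_max.

(* C^oo on the open set A: every iterated directional derivative is
   differentiable at every point of A. *)
Definition smooth_on (R : realType) (V W : normedModType R) (A : set V)
    (f : V -> W) : Prop :=
  forall (s : seq V) (x : V), A x ->
    differentiable (foldr (fun (v : V) (g : V -> W) (y : V) => 'D_v g y) f s) x.

(* A homeomorphism from the open set cdom of M onto the open set ccod of R^2;
   the values of crd off cdom and of par off ccod are irrelevant. *)
Record chart (R : realType) (M : topologicalType) := Chart {
  cdom : set M;
  ccod : set (R * R);
  crd : M -> R * R;
  par : R * R -> M;
  cdom_open : open cdom;
  ccod_open : open ccod;
  crd_ccod : forall p, cdom p -> ccod (crd p);
  par_cdom : forall x, ccod x -> cdom (par x);
  crdK : forall p, cdom p -> par (crd p) = p;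
  parK : forall x, ccod x -> crd (par x) = x;
  crd_continuous : forall p, cdom p -> {for p, continuous crd};
  par_continuous : forall x, ccod x -> {for x, continuous par}
}.

(* Connected smooth 2-manifold without boundary.  The existence of a countable
   atlas expresses second countability; charts with empty domain are allowed,
   so finite atlases are covered as well. *)
Record surface (R : realType) := Surface {
  carrier :> topologicalType;
  atlas : nat -> chart R carrier;
  surface_hausdorff : hausdorff_space carrier;
  surface_connected : connected [set: carrier];
  atlas_cover : forall p : carrier, exists n, cdom (atlas n) p;
  atlas_smooth : forall m n,
    smooth_on (ccod (atlas m) `&` par (atlas m) @^-1` cdom (atlas n))
              (crd (atlas n) \o par (atlas m))
}.

Section LocalGeometry.
Variables (R : realType) (X : R * R -> 'rV[R]_3).

Definition basis2 (i : 'I_2) : R * R := if i == 0 then (1, 0) else (0, 1).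

Definition pd (i : 'I_2) (x : R * R) : 'rV[R]_3 := 'D_(basis2 i) X x.

Definition pd2 (i j : 'I_2) (x : R * R) : 'rV[R]_3 :=
  'D_(basis2 i) (pd j) x.

Definition gram (x : R * R) : 'M[R]_2 :=
  \matrix_(i, j) dot (pd i x) (pd j x).

Definition area_density (x : R * R) : R := Num.sqrt (\det (gram x)).

Definition normal_part (x : R * R) (w : 'rV[R]_3) : 'rV[R]_3 :=
  w - \sum_(i < 2) \sum_(j < 2)
        (invmx (gram x) i j * dot w (pd i x)) *: pd j x.

(* The trace g^{ij} II_ij of the second fundamental form
   II_ij = (d_i d_j X)^perp; it is not divided by 2. *)
Definition mean_curvature (x : R * R) : 'rV[R]_3 :=
  \sum_(i < 2) \sum_(j < 2)
    invmx (gram x) i j *: normal_part x (pd2 i j x).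

End LocalGeometry.

Section Immersed.
Variables (R : realType) (S : surface R) (F : S -> 'rV[R]_3).

Definition local_param (n : nat) : R * R -> 'rV[R]_3 := F \o par (atlas S n).

Definition smooth_immersion : Prop :=
  forall n, smooth_on (ccod (atlas S n)) (local_param n) /\
    forall x, ccod (atlas S n) x ->
      forall u : R * R, 'D_u (local_param n) x = 0 -> u = 0.

(* Curves are defined on all of R but only their restriction to [0, 1] is
   used: every C^1 curve on [0, 1] has a C^1 extension to R. *)
Definition C1_curve (c : R -> S) : Prop :=
  continuous c /\
  forall n t, cdom (atlas S n) (c t) ->
    derivable (crd (atlas S n) \o c) t 1 /\
    {for t, continuous (fun s => 'D_1 (crd (atlas S n) \o c) s)}.

(* The length of c for the metric induced by F: the velocity of c has norm
   |(F o c)'|. *)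
Definition curve_length (c : R -> S) : \bar R :=
  (\int[lebesgue_measure]_(t in `[0%R, 1%R]) (enorm ('D_1 (F \o c) t))%:E)%E.

Definition induced_dist (p q : S) : \bar R :=
  ereal_inf [set curve_length c | c in
    [set c : R -> S | [/\ C1_curve c, c 0 = p & c 1 = q]]].

Definition complete_immersion : Prop :=
  forall u : nat -> S,
    (forall e : R, 0 < e -> exists N : nat, forall m n,
       (N <= m)%N -> (N <= n)%N -> (induced_dist (u m) (u n) < e%:E)%E) ->
    exists p : S, (fun n => induced_dist (u n) p) @ \oo --> 0%E.

Definition translator : Prop :=
  [/\ smooth_immersion, complete_immersion &
    forall n x, ccod (atlas S n) x ->
      mean_curvature (local_param n) x
        = normal_part (local_param n) x (e3 R)].

(* The integral of f >= 0 against the induced area measure: the n-th chart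
   contributes the part of its domain not covered by the earlier charts. *)
Definition surface_integral (f : S -> R) : \bar R :=
  (\sum_(0 <= n <oo)
    \int[lebesgue_measure \x lebesgue_measure]_(x in
      ccod (atlas S n) `&`
      par (atlas S n) @^-1` seqDU (fun k => cdom (atlas S k)) n)
      (f (par (atlas S n) x) * area_density (local_param n) x)%:E)%E.

Definition entropy : \bar R :=
  ereal_sup [set (((4 * pi * z.2)^-1)%:E * surface_integral
      (fun p => expR (- (enorm (F p - z.1) ^+ 2 / (4 * z.2)))))%E
    | z in [set z : 'rV[R]_3 * R | 0 < z.2]].

Definition regular_value (h : 'rV[R]_3 -> R) (a : R) : Prop :=
  forall p : S, h (F p) = a ->
    forall n, cdom (atlas S n) p ->
      exists u : R * R, 'D_u (h \o local_param n) (crd (atlas S n) p) != 0.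

End Immersed.

Definition vertical_slab (R : realType) (b w : R) (v : 'rV[R]_3) :
    set 'rV[R]_3 := [set p | b < dot p v < b + w].

Definition line (R : realType) (q d : 'rV[R]_3) : set 'rV[R]_3 :=
  [set q + t *: d | t in [set: R]].

(* Main.v *)
Require Import Defs.
From HB Require Import structures.
From mathcomp Require Import all_boot all_order all_algebra.
From mathcomp Require Import all_classical all_reals all_analysis.
From mathcomp Require Import measurable_realfun.
From mathcomp Require Import ring lra.
Set Implicit Arguments.
Unset Strict Implicit.
Unset Printing Implicit Defensive.
Import Order.TTheory GRing.Theory Num.Theory.
Import numFieldNormedType.Exports.
Local Open Scope classical_set_scope.
Local Open Scope ring_scope.

(** Let z = x_3, u = <., v> - c for the constant c of the line, and y = <., d> with d horizontal and
    orthogonal to v.  On a translator the operator L = Laplacian + <grad z, grad .> satisfies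
    L u = L y = 0 and L z = 1.

    Below the line.  For eps > 0 the function w = u - eps (1 + a - z + y^2/4) satisfies L w >= eps/2,
    is negative on {z = a} and, u being bounded on the slab, is positive in {z < a} only over a bounded
    set of R^3.  So the field (w+)^2 e^z grad w, extended by 0 from {z < a}, has nonnegative divergence,
    is bounded and has bounded extrinsic support; by finite entropy it is integrable.  Integrating against
    cutoff functions of the intrinsic distance, which have compact support by completeness, forces
    w <= 0, so u <= 0 and, by symmetry, u = 0 on {z < a}.

    Unique continuation.  Where du is close to 0, (y, z) are local coordinates and du = al dy + be dz;
    the equations d(du) = 0 and L u = 0 make f = al - i be satisfy |dbar f| <= C |f|, and the L^2 estimate
    with weights |zeta|^{-n}, zeta = y + i z - const, shows that the set where u = 0 near p is closed.
    Hence u = 0 everywhere.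

    Covering.  Now (y, z) is a local isometry from a complete connected surface to the plane.  If it has no
    section over a ball of radius s centred at p, then it has none over a ball of radius 3s/4 centred at some
    q with d(p, q) <= 2s, which completeness forbids; the resulting global section has open and closed image. *)

(** * C^1 functions of two real variables *)

(** Completeness is intrinsic and the immersion is not assumed proper, so the part of the surface in
    a ball of R^3 need not be relatively compact and the barrier need not attain a maximum. This is
    why the comparison is an integral one: a cutoff of Lipschitz constant 1/r leaves an error of
    size 1/r times the integral of the field. In the barrier, y^2/4 confines y at a cost of at most
    1/2, because L(y^2) = 2 |grad y|^2 <= 2, while 1 + a - z confines z from below and gains L(z) =
    1. In the continuation step the pole of the weight is not p but a nearby point with f = 0 in a
    whole neighbourhood. The singular product then extends by 0, and no vanishing of infinite order
    at p has to be established. In the covering step, midpoints of radii of the ball of radius s lie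
    in the half ball, where sections over balls of radius 3s/4 reach far enough to be patched. As
    3/4 < 1, the radii of a failing iteration are summable. The same scheme gives the compactness of
    intrinsic balls. *)

Lemma is_diff_of_approx (R : numFieldType) (V W : normedModType R) (f : V -> W)
    (df : {linear V -> W}) x : continuous df ->
  (forall e, 0 < e -> \forall h \near (0 : V), `|f (h + x) - f x - df h| <= e * `|h|) ->
  is_diff x f df.
Proof.
move=> cdf H; have E : f \o shift x = cst (f x) + df +o_ 0 id.
  apply/eqaddoP => e e0; apply: filterS (H e e0) => h /=.
  suff -> : (f \o shift x - (cst (f x) + df)) h = f (h + x) - f x - df h by [].
  by transitivity (f (h + x) - (f x + df h)) => //; rewrite opprD addrA.
have dE := diff_unique cdf E.
by split=> //; apply/diff_locallyP; rewrite dE.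
Qed.

Section Calc.
Variable R : realType.
Implicit Types (U : set (R * R)) (f g : R * R -> R) (x : R * R).

(** Packaged as a linear map, this is the differential of a function with partial derivatives [a]
    and [b]. *)
Definition lin2 (a b : R) (h : R * R) : R := h.1 * a + h.2 * b.

Lemma lin2_linear a b : linear (lin2 a b).
Proof. by move=> k [u1 u2] [v1 v2]; rewrite /lin2 /= /GRing.scale /=; ring. Qed.

HB.instance Definition _ a b :=
  GRing.isLinear.Build R (R * R)%type R _ (lin2 a b) (lin2_linear a b).

Lemma lin2_cont a b : continuous (lin2 a b).
Proof.
move=> x; apply: (@continuousD _ _ _ (fun h : R * R => h.1 * a) (fun h => h.2 * b)).
  by apply: (@continuousM _ _ (fun h : R * R => h.1) (fun _ => a)); [exact: cvg_fst|exact: cvg_cst].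
by apply: (@continuousM _ _ (fun h : R * R => h.2) (fun _ => b)); [exact: cvg_snd|exact: cvg_cst].
Qed.

Lemma is_diff2P f x a b : is_diff x f (lin2 a b) <->
  forall e, 0 < e -> \forall h \near (0 : R * R),
    `|f (h + x) - f x - lin2 a b h| <= e * `|h|.
Proof.
split=> [[df dE] e e0|H].
  have := diff_locally df => /eqaddoP /(_ e e0); rewrite dE.
  apply: filterS => h /=.
  suff -> : (f \o shift x - (cst (f x) + lin2 a b)) h = f (h + x) - f x - lin2 a b h by [].
  by transitivity (f (h + x) - (f x + lin2 a b h)) => //; rewrite opprD addrA.
by apply: is_diff_of_approx => //; exact: lin2_cont.
Qed.

Lemma is_diff2_near f g x a b : {near x, f =1 g} ->
  is_diff x f (lin2 a b) -> is_diff x g (lin2 a b).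
Proof.
move=> fg /is_diff2P H; apply/is_diff2P => e e0.
have fgx := nbhs_singleton fg.
have : \forall h \near (0 : R * R), f (h + x) = g (h + x).
  by move: fg; rewrite (near_shift (0 : R * R) x) subr0.
by apply: filterS2 (H e e0) => h + <-; rewrite fgx.
Qed.

(* f1 and f2 are the partial derivatives of f. *)
Definition hasC1 U f f1 f2 := forall x, U x ->
  [/\ is_diff x f (lin2 (f1 x) (f2 x)),
      {for x, continuous f1} & {for x, continuous f2}].

Lemma hasC1_cont U f f1 f2 x : hasC1 U f f1 f2 -> U x -> {for x, continuous f}.
Proof. by move=> h /h[[/differentiable_continuous]]. Qed.

Lemma hasC1_D U f f1 f2 x v : hasC1 U f f1 f2 -> U x -> 'D_v f x = v.1 * f1 x + v.2 * f2 x.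
Proof. by move=> h /h[[d e] _ _]; rewrite deriveE// e. Qed.

Lemma hasC1_sub U V f f1 f2 : V `<=` U -> hasC1 U f f1 f2 -> hasC1 V f f1 f2.
Proof. by move=> VU h x /VU; exact: h. Qed.

Lemma near_of_open U (f g : R * R -> R) x : open U -> U x ->
  (forall y, U y -> f y = g y) -> {near x, f =1 g}.
Proof. by move=> oU Ux fg; apply: filterS (open_nbhs_nbhs (conj oU Ux)) => y /fg. Qed.

Lemma cont_near f g x : {near x, f =1 g} -> {for x, continuous f} -> {for x, continuous g}.
Proof.
move=> fg cf; suff : g y @[y --> x] --> g x by [].
rewrite -(nbhs_singleton fg); apply: cvg_trans cf; apply: near_eq_cvg; by apply: filterS fg => y ->.
Qed.

Lemma hasC1_ext U f f1 f2 g g1 g2 : open U -> hasC1 U f f1 f2 ->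
  (forall y, U y -> [/\ f y = g y, f1 y = g1 y & f2 y = g2 y]) -> hasC1 U g g1 g2.
Proof.
move=> oU h e x Ux; have [d c1 c2] := h x Ux.
have [_ e1 e2] := e x Ux; rewrite -e1 -e2.
split.
- by apply: is_diff2_near d; apply: (near_of_open oU Ux) => y /e[].
- by apply: cont_near c1; apply: (near_of_open oU Ux) => y /e[].
- by apply: cont_near c2; apply: (near_of_open oU Ux) => y /e[].
Qed.

Lemma is_diff_to f x (d d' : R * R -> R) : is_diff x f d -> d =1 d' -> is_diff x f d'.
Proof. by move=> h /funext <-. Qed.

Lemma hasC1_cst U (k : R) : hasC1 U (fun=> k) (fun=> 0) (fun=> 0).
Proof.
move=> x _; split; [|exact: cvg_cst|exact: cvg_cst].
by apply: is_diff_to => h; rewrite /lin2 !mulr0 addr0.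
Qed.

Lemma is_diff_fst x : is_diff x (fun h : R * R => h.1) (lin2 1 0).
Proof.
by apply/is_diff2P => e e0; near=> h; rewrite /lin2 /= mulr1 mulr0 addr0 addrK subrr normr0 mulr_ge0// ltW.
Unshelve. all: by end_near. Qed.

Lemma is_diff_snd x : is_diff x (fun h : R * R => h.2) (lin2 0 1).
Proof.
by apply/is_diff2P => e e0; near=> h; rewrite /lin2 /= mulr1 mulr0 add0r addrK subrr normr0 mulr_ge0// ltW.
Unshelve. all: by end_near. Qed.

Lemma hasC1_fst U : hasC1 U (fun h => h.1) (fun=> 1) (fun=> 0).
Proof. by move=> x _; split; [exact: is_diff_fst|exact: cvg_cst|exact: cvg_cst]. Qed.

Lemma hasC1_snd U : hasC1 U (fun h => h.2) (fun=> 0) (fun=> 1).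
Proof. by move=> x _; split; [exact: is_diff_snd|exact: cvg_cst|exact: cvg_cst]. Qed.

Lemma hasC1_add U f f1 f2 g g1 g2 : hasC1 U f f1 f2 -> hasC1 U g g1 g2 ->
  hasC1 U (fun x => f x + g x) (fun x => f1 x + g1 x) (fun x => f2 x + g2 x).
Proof.
move=> hf hg x Ux; have [df cf1 cf2] := hf x Ux; have [dg cg1 cg2] := hg x Ux; split.
- apply: (@is_diff_to _ _ (lin2 (f1 x) (f2 x) + lin2 (g1 x) (g2 x))).

  by move=> h; transitivity (lin2 (f1 x) (f2 x) h + lin2 (g1 x) (g2 x) h) => //; rewrite /lin2; ring.
- exact: continuousD.
- exact: continuousD.
Qed.

Lemma hasC1_mul U f f1 f2 g g1 g2 : hasC1 U f f1 f2 -> hasC1 U g g1 g2 ->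
  hasC1 U (fun x => f x * g x) (fun x => f1 x * g x + f x * g1 x)
    (fun x => f2 x * g x + f x * g2 x).
Proof.
move=> hf hg x Ux; have [df cf1 cf2] := hf x Ux; have [dg cg1 cg2] := hg x Ux.
have cf := hasC1_cont hf Ux; have cg := hasC1_cont hg Ux; split.
- apply: (@is_diff_to _ _ (f x *: lin2 (g1 x) (g2 x) + g x *: lin2 (f1 x) (f2 x))).

  by move=> h; transitivity (f x * lin2 (g1 x) (g2 x) h + g x * lin2 (f1 x) (f2 x) h) => //; rewrite /lin2; ring.
- by apply: continuousD; apply: continuousM.
- by apply: continuousD; apply: continuousM.
Qed.

Lemma hasC1_opp U f f1 f2 : hasC1 U f f1 f2 ->
  hasC1 U (fun x => - f x) (fun x => - f1 x) (fun x => - f2 x).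
Proof.
move=> hf x Ux; have [df cf1 cf2] := hf x Ux; split.
- apply: (@is_diff_to _ _ (- lin2 (f1 x) (f2 x))).
  by move=> h; transitivity (- lin2 (f1 x) (f2 x) h) => //; rewrite /lin2; ring.
- exact: continuousN.
- exact: continuousN.
Qed.

Lemma hasC1_sub' U f f1 f2 g g1 g2 : hasC1 U f f1 f2 -> hasC1 U g g1 g2 ->
  hasC1 U (fun x => f x - g x) (fun x => f1 x - g1 x) (fun x => f2 x - g2 x).
Proof. by move=> hf hg; exact: (hasC1_add hf (hasC1_opp hg)). Qed.

Lemma hasC1_scale U k f f1 f2 : hasC1 U f f1 f2 ->
  hasC1 U (fun x => k * f x) (fun x => k * f1 x) (fun x => k * f2 x).
Proof.
move=> hf x Ux; have [df cf1 cf2] := hf x Ux; split.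
- apply: (@is_diff_to _ _ (k *: lin2 (f1 x) (f2 x))).
  by move=> h; transitivity (k * lin2 (f1 x) (f2 x) h) => //; rewrite /lin2; ring.
- by apply: continuousM => //; exact: cvg_cst.
- by apply: continuousM => //; exact: cvg_cst.
Qed.

Lemma hasC1_comp1 U (V : set R) (F F' : R -> R) f f1 f2 :
  (forall t, V t -> is_derive t 1 F (F' t)) ->
  (forall t, V t -> {for t, continuous F'}) ->
  hasC1 U f f1 f2 -> (forall x, U x -> V (f x)) ->
  hasC1 U (fun x => F (f x)) (fun x => F' (f x) * f1 x) (fun x => F' (f x) * f2 x).
Proof.
move=> dF cF hf UV x Ux; have [df cf1 cf2] := hf x Ux.
have cf := hasC1_cont hf Ux; have := dF _ (UV x Ux) => -[dFx eF].
have cFf : {for x, continuous (fun y => F' (f y))}.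
  by apply: continuous_comp => //; exact/cF/UV.
split.
- have dFd : is_diff (f x) F ( *:%R^~ (F' (f x)) : R -> R).
    split; first exact/derivable1_diffP.
    by rewrite deriv1E// derive1E eF.
  apply: (@is_diff_to _ _ (( *:%R^~ (F' (f x)) : R -> R) \o lin2 (f1 x) (f2 x))).

  by move=> h; rewrite /= /GRing.scale /= /lin2; ring.
- exact: continuousM.
- exact: continuousM.
Qed.

Lemma hasC1_comp2 U V p p1 p2 q q1 q2 f f1 f2 :
  hasC1 U p p1 p2 -> hasC1 U q q1 q2 -> hasC1 V f f1 f2 ->
  (forall x, U x -> V (p x, q x)) ->
  hasC1 U (fun x => f (p x, q x))
    (fun x => p1 x * f1 (p x, q x) + q1 x * f2 (p x, q x))
    (fun x => p2 x * f1 (p x, q x) + q2 x * f2 (p x, q x)).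
Proof.
move=> hp hq hf UV x Ux; have [dp cp1 cp2] := hp x Ux; have [dq cq1 cq2] := hq x Ux.
have [df cf1 cf2] := hf _ (UV x Ux).
have cp := hasC1_cont hp Ux; have cq := hasC1_cont hq Ux.
have cpq : (p y, q y) @[y --> x] --> (p x, q x) by exact: (cvg_pair cp cq).
have cc (k : R * R -> R) : {for (p x, q x), continuous k} -> {for x, continuous (fun y => k (p y, q y))}.
  by move=> ck; apply: (@continuous_comp _ _ _ (fun y => (p y, q y)) k).
split.
- apply: (@is_diff_to _ _ (lin2 (f1 (p x, q x)) (f2 (p x, q x)) \o
     (fun y => (lin2 (p1 x) (p2 x) y, lin2 (q1 x) (q2 x) y)))).

  by move=> h; rewrite /= /lin2 /=; ring.
- by apply: continuousD; apply: continuousM => //; exact: cc.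
- by apply: continuousD; apply: continuousM => //; exact: cc.
Qed.

Lemma hasC1_curve U f f1 f2 (p q : R -> R) (p' q' : R) t :
  hasC1 U f f1 f2 -> U (p t, q t) -> is_derive t 1 p p' -> is_derive t 1 q q' ->
  is_derive t 1 (fun s => f (p s, q s)) (p' * f1 (p t, q t) + q' * f2 (p t, q t)).
Proof.
move=> hf Ut [dp ep] [dq eq]; have [df _ _] := hf _ Ut.
have dd (k : R -> R) k' : derivable k t 1 -> 'D_1 k t = k' -> is_diff t k ( *:%R^~ k' : R -> R).
  move=> dk ek; split; first exact/derivable1_diffP.
  by rewrite deriv1E// derive1E ek.
have [D E] := @is_diff_comp _ _ _ _ (fun s => (p s, q s)) _ f _ t
   (is_diff_pair (dd _ _ dp ep) (dd _ _ dq eq)) df.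
split; first exact/derivable1_diffP.
by rewrite deriveE// E /= /lin2 /= /GRing.scale /= !mul1r; ring.
Qed.

(* [f] is only C^1 on [U]: the product is the extension by 0 of [chi f], since [chi] vanishes off [K]. *)
Lemma hasC1_zero_ext U (K : set (R * R)) chi chi1 chi2 f f1 f2 : open U -> closed K -> K `<=` U ->
  hasC1 setT chi chi1 chi2 -> (forall x, ~ K x -> chi x = 0) ->
  hasC1 U f f1 f2 ->
  hasC1 setT (fun x => chi x * f x) (fun x => chi1 x * f x + chi x * f1 x)
    (fun x => chi2 x * f x + chi x * f2 x).
Proof.
move=> oU cK KU hc c0 hf x _.
have [Ux|nUx] := pselect (U x).
  exact: (hasC1_mul (hasC1_sub (@subsetT _ U) hc) hf).
have oK : open (~` K) by exact: closed_openC.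
have nK : (~` K) x by move=> /KU.
have hK : hasC1 (~` K) chi (fun=> 0) (fun=> 0).
  by refine (hasC1_ext oK (hasC1_cst (U := ~` K) 0) _) => y Ky; split=> //; rewrite c0.
have z y : (~` K) y -> chi y = 0 /\ chi1 y = 0 /\ chi2 y = 0.
  move=> Ky; split; first exact: c0.
  have e1 := hasC1_D (1, 0) hc (I : setT y); have e2 := hasC1_D (0, 1) hc (I : setT y).
  move: (hasC1_D (1, 0) hK Ky) (hasC1_D (0, 1) hK Ky).
  by rewrite e1 e2 /= !mul1r !mul0r !addr0 !add0r.
suff /(_ x nK) : hasC1 (~` K) (fun x => chi x * f x) (fun x => chi1 x * f x + chi x * f1 x)
    (fun x => chi2 x * f x + chi x * f2 x) by [].
refine (hasC1_ext oK (hasC1_cst (U := ~` K) 0) _) => y /z[-> [-> ->]].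
by rewrite !mul0r addr0.
Qed.

Lemma near_box (P : set (R * R)) x : (\forall y \near x, P y) ->
  exists2 r, 0 < r & forall a b, `|a - x.1| < r -> `|b - x.2| < r -> P (a, b).
Proof.
move=> /nbhs_ballP[r /= r0 h]; exists r => // a b ha hb; apply: h.
by split; rewrite /ball /= distrC.
Qed.

Lemma MVT_cc (f df : R -> R) (a b : R) : a < b ->
  (forall t, a <= t <= b -> is_derive t 1 f (df t)) ->
  exists2 c, a < c < b & f b - f a = df c * (b - a).
Proof.
move=> ab h.
have H1 t : t \in `]a, b[ -> is_derive t 1 f (df t).
  by rewrite in_itv /= => /andP[/ltW ? /ltW ?]; apply: h; lra.
have H2 : {within `[a, b], continuous f}.
  apply: derivable_within_continuous => t; rewrite in_itv /= => ht.
  by have [] := h t ht.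
have [c cab ->] := MVT ab H1 H2.
by exists c => //; move: cab; rewrite in_itv.
Qed.

Lemma hasC1_slice1 U f f1 f2 a b : hasC1 U f f1 f2 -> U (a, b) ->
  is_derive a 1 (fun s => f (s, b)) (f1 (a, b)).
Proof.
move=> hf Uab; have := hasC1_curve (p := id) (q := fun=> b) hf Uab (is_derive_id a 1) (is_derive_cst b a 1).
by rewrite mul1r mul0r addr0.
Qed.

Lemma hasC1_slice2 U f f1 f2 a b : hasC1 U f f1 f2 -> U (a, b) ->
  is_derive b 1 (fun s => f (a, s)) (f2 (a, b)).
Proof.
move=> hf Uab; have := hasC1_curve (p := fun=> a) (q := id) hf Uab (is_derive_cst a b 1) (is_derive_id b 1).
by rewrite mul1r mul0r add0r.
Qed.

Lemma cont_near_lt f x e : {for x, continuous f} -> 0 < e ->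
  \forall y \near x, `|f y - f x| < e.
Proof. by move=> cf e0; have /cvgrPdist_lt /(_ e e0) := cf; apply: filterS => y; rewrite distrC. Qed.

(** The second difference of [f] over a square of side [k] with corner [x] is k^2 times a value of
    [f12] and also k^2 times a value of [f21], by two mean value theorems in either order. For small
    [k] both values are within [e] of those at [x], which is impossible if 2 e is the distance
    between the latter. *)
Lemma hasC1_schwarz U f f1 f2 f11 f12 f21 f22 x : open U ->
  hasC1 U f f1 f2 -> hasC1 U f1 f11 f12 -> hasC1 U f2 f21 f22 -> U x ->
  f12 x = f21 x.
Proof.
move=> oU hf hf1 hf2 Ux; apply/eqP; case: (eqVneq (f12 x) (f21 x)) => // ne; exfalso.
have [_ _ c12] := hf1 x Ux; have [_ c21 _] := hf2 x Ux.
pose e := `|f12 x - f21 x| / 2.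
have e0 : 0 < e by rewrite divr_gt0// normr_gt0 subr_eq0.
have : \forall y \near x, [/\ U y, `|f12 y - f12 x| < e & `|f21 y - f21 x| < e].
  near=> y; split; near: y; [exact: open_nbhs_nbhs|exact: cont_near_lt|exact: cont_near_lt].
move=> /near_box[r r0 h]; case: x => a b /= in Ux ne c12 c21 e e0 h *.
pose k : R := r / 2; have k0 : 0 < k by rewrite /k; lra.
have ab (t u : R) : a <= t <= a + k -> b <= u <= b + k ->
    [/\ U (t, u), `|f12 (t, u) - f12 (a, b)| < e & `|f21 (t, u) - f21 (a, b)| < e].
  by move=> ht hu; apply: h; rewrite /= ltr_norml; rewrite /k in ht hu k0; lra.
have aak : a < a + k by lra.
have bbk : b < b + k by lra.
have bk1 : b <= b + k <= b + k by lra.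
have bk0 : b <= b <= b + k by lra.
have ak1 : a <= a + k <= a + k by lra.
have ak0 : a <= a <= a + k by lra.
have H1 t : a <= t <= a + k -> is_derive t 1 (fun t => f (t, b + k) - f (t, b))
    (f1 (t, b + k) - f1 (t, b)).
  move=> ht; have [u1 _ _] := ab t _ ht bk1; have [u0 _ _] := ab t _ ht bk0.
  exact: (is_deriveB (hasC1_slice1 hf u1) (hasC1_slice1 hf u0)).
have [c hc ec] := MVT_cc aak H1.
have hc' : a <= c <= a + k by lra.
have H2 u : b <= u <= b + k -> is_derive u 1 (fun u => f1 (c, u)) (f12 (c, u)).
  by move=> hu; have [u0 _ _] := ab c u hc' hu; exact: (hasC1_slice2 hf1 u0).
have [d hd ed] := MVT_cc bbk H2.
have H3 u : b <= u <= b + k -> is_derive u 1 (fun u => f (a + k, u) - f (a, u))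
    (f2 (a + k, u) - f2 (a, u)).
  move=> hu; have [u1 _ _] := ab _ u ak1 hu; have [u0 _ _] := ab _ u ak0 hu.
  exact: (is_deriveB (hasC1_slice2 hf u1) (hasC1_slice2 hf u0)).
have [c2 hc2 ec2] := MVT_cc bbk H3.
have hc2' : b <= c2 <= b + k by lra.
have H4 t : a <= t <= a + k -> is_derive t 1 (fun t => f2 (t, c2)) (f21 (t, c2)).
  by move=> ht; have [u0 _ _] := ab t c2 ht hc2'; exact: (hasC1_slice1 hf2 u0).
have [d2 hd2 ed2] := MVT_cc aak H4.
have hd' : b <= d <= b + k by lra.
have hd2' : a <= d2 <= a + k by lra.
have [_ hA _] := ab c d hc' hd'; have [_ _ hB] := ab d2 c2 hd2' hc2'.
have E : f12 (c, d) = f21 (d2, c2).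
  have kk : k * k != 0 by rewrite mulf_neq0// gt_eqF.
  apply: (mulIf kk).
  have e1 : a + k - a = k by ring.
  have e2 : b + k - b = k by ring.
  rewrite e1 in ec ed2; rewrite e2 in ed ec2.
  have E1 := ec; rewrite ed in E1; have E2 := ec2; rewrite ed2 in E2.
  by move: E1 E2; rewrite -/k; lra.
rewrite E in hA.
have : `|f12 (a, b) - f21 (a, b)| < e + e.
  have -> : f12 (a, b) - f21 (a, b) = - (f21 (d2, c2) - f12 (a, b)) + (f21 (d2, c2) - f21 (a, b)) by ring.
  by apply: le_lt_trans (ler_normD _ _) _; rewrite normrN; exact: ltrD.
by rewrite /e; lra.
Unshelve. all: by end_near. Qed.

(** A continuous linear functional turns vector-valued derivatives into scalar partial derivatives;
    with coordinate functionals, smooth maps become [hasC1] componentwise. *)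
Lemma hasC1_of_diff (W : normedModType R) U (f : R * R -> W) (L : {linear W -> R}) :
  continuous L ->
  (forall x, U x -> differentiable f x) ->
  (forall v x, U x -> {for x, continuous ('D_v f)}) ->
  hasC1 U (L \o f) (L \o 'D_(1, 0) f) (L \o 'D_(0, 1) f).
Proof.
move=> cL df cDf x Ux; have dfx := df x Ux.
split.
- have dL : is_diff (f x) L L by split; [exact: linear_differentiable|exact: diff_lin].
  have [D1 D2] := @is_diff_comp _ _ _ _ f _ L L x (differentiableP dfx) dL.
  split=> //; rewrite D2; apply/funext => h /=.
  rewrite !deriveE// /lin2 -!linearZ /= -linearD; congr (L _).
  rewrite -linearD; congr ('d f x _).
  transitivity ((h.1 * 1 + h.2 * 0, h.1 * 0 + h.2 * 1) : R * R); last by [].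
  by case: h => a b; rewrite !mulr1 !mulr0 addr0 add0r.
- by apply: continuous_comp; [exact: cDf|exact: cL].
- by apply: continuous_comp; [exact: cDf|exact: cL].
Qed.

Definition coord3 (c : 'I_3) (p : 'rV[R]_3) : R := p 0 c.
Lemma coord3_linear c : linear (coord3 c).
Proof. by move=> k u v; rewrite /coord3 !mxE. Qed.
HB.instance Definition _ c :=
  GRing.isLinear.Build R 'rV[R]_3 R _ (coord3 c) (coord3_linear c).
Lemma coord3_continuous c : continuous (coord3 c).
Proof. by move=> p; exact: coord_continuous. Qed.


(** In the list of directions the last one is applied first, so a derivative taken before all others
    is appended at the end. *)
Lemma smooth_D (V W : normedModType R) (A : set V) (f : V -> W) v :
  smooth_on A f -> smooth_on A ('D_v f).
Proof.
move=> sf s x Ax; have := sf (rcons s v) x Ax.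
by rewrite -cats1 foldr_cat.
Qed.

Lemma smooth_diff (V W : normedModType R) (A : set V) (f : V -> W) (x : V) :
  smooth_on A f -> A x -> differentiable f x.
Proof. by move=> sf /(sf [::]). Qed.

Lemma smooth_hasC1 (W : normedModType R) U (f : R * R -> W) (L : {linear W -> R}) :
  continuous L -> smooth_on U f ->
  hasC1 U (L \o f) (L \o 'D_(1, 0) f) (L \o 'D_(0, 1) f).
Proof.
move=> cL sf; apply: hasC1_of_diff => // [x|v x] Ux; first exact: smooth_diff sf Ux.
have sv : smooth_on U ('D_v f) by exact: smooth_D.
by apply: differentiable_continuous; apply: smooth_diff sv Ux.
Qed.


Lemma smooth_coord U (X : R * R -> 'rV[R]_3) c : smooth_on U X ->
  hasC1 U (fun x => X x 0 c) (fun x => pd X 0 x 0 c) (fun x => pd X 1 x 0 c).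
Proof. by move=> sX; exact: (smooth_hasC1 (coord3_continuous (c := c)) sX). Qed.

Lemma smooth_pd U (X : R * R -> 'rV[R]_3) i : smooth_on U X -> smooth_on U (pd X i).
Proof. exact: smooth_D. Qed.

End Calc.

(** * Integration over the plane *)

Section Plane.
Variable R : realType.

Definition lam2 := (@lebesgue_measure R \x @lebesgue_measure R)%E.

(** The product sigma-algebra is generated by rectangles, so the open set is written as a countable
    union of open squares with rational centre and half-side. *)
Lemma open_measurable2 (A : set (R * R)) : open A ->
  measurable (A : set (measurableTypeR R * measurableTypeR R)).
Proof.
move=> oA.
pose box (q1 q2 q3 : rat) : set (R * R) :=
  `](ratr q1 - ratr q3 : R), (ratr q1 + ratr q3)[ `*` `](ratr q2 - ratr q3), (ratr q2 + ratr q3)[.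
pose F q1 q2 q3 : set (R * R) := if `[< box q1 q2 q3 `<=` A >] then box q1 q2 q3 else set0.
have -> : A = \bigcup_q1 \bigcup_q2 \bigcup_q3 F q1 q2 q3.
  apply/seteqP; split=> [[a b] Aab|x [q1 _ [q2 _ [q3 _]]]]; last first.
    by rewrite /F; case: asboolP => // h /h.
  have [r r0 h] := near_box (open_nbhs_nbhs (conj oA Aab)).
  (* A centre within r/4 of the point in each coordinate and a half-side between r/4 and r/2 put the
     point in the square and the square within 3r/4 of the point. *)
  have [|q3] := @rat_in_itvoo R (r / 4) (r / 2); first by lra.
  rewrite in_itv /= => hq3.
  have [|q1] := @rat_in_itvoo R (a - r / 4) (a + r / 4); first by lra.
  rewrite in_itv /= => hq1.
  have [|q2] := @rat_in_itvoo R (b - r / 4) (b + r / 4); first by lra.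
  rewrite in_itv /= => hq2.
  exists q1 => //; exists q2 => //; exists q3 => //; rewrite /F.
  case: asboolP => [_|]; first by split; rewrite /= in_itv /=; lra.
  case=> -[x y]; rewrite /box /= !in_itv /= => -[hx hy].
  by apply: h; rewrite /= ltr_norml; lra.
apply: bigcupT_measurable_rat => q1; apply: bigcupT_measurable_rat => q2.
apply: bigcupT_measurable_rat => q3; rewrite /F; case: asboolP => // _.
by apply: measurableX; exact: measurable_itv.
Qed.

Lemma continuous_on_measurable2 (A : set (R * R)) (f : R * R -> R) : open A ->
  (forall x, A x -> {for x, continuous f}) ->
  measurable_fun (A : set (measurableTypeR R * measurableTypeR R)) (f : _ -> measurableTypeR R).
Proof.
move=> oA cf.
apply: (measurability (@RGenOInfty.G R) (@RGenOInfty.measurableE R)).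
move=> _ [_ [a ->] <-]; apply: open_measurable2.
rewrite openE => x [Ax fx]; rewrite /interior.
near=> y; split; first by near: y; exact: open_nbhs_nbhs.
near: y; apply: (cf x Ax); apply: open_nbhs_nbhs; split; first exact: interval_open.
exact: fx.
Unshelve. all: by end_near. Qed.

(** The measure [|a|] times the image of Lebesgue measure under x -> a x + b agrees with Lebesgue
    measure on half-open intervals, hence everywhere by uniqueness. For a < 0 the preimage of such
    an interval is closed on the left instead of the right. *)
Lemma lebesgue_affine1 (a b : R) (f : R -> \bar R) : a != 0 ->
  measurable_fun [set: R] f -> (forall x, 0 <= f x)%E ->
  (\int[lebesgue_measure]_x f x =
   `|a|%:E * \int[lebesgue_measure]_x f (a * x + b)%R)%E.
Proof.
move=> a0 mf f0.
pose T (x : measurableTypeR R) : measurableTypeR R := a * x + b.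
have mT : measurable_fun setT T.
  by apply: continuous_measurable_fun => x; apply: (@continuousD _ _ _ ( *%R a) (fun=> b)); [exact: mulrl_continuous|exact: cvg_cst].
pose m : {measure set (measurableTypeR R) -> \bar R} :=
  mscale (NngNum (normr_ge0 a)) (pushforward lebesgue_measure T).
have E (A : set (measurableTypeR R)) : measurable A -> lebesgue_measure A = m mT A.
  move=> mA; apply: lebesgue_measure_unique => // X [[x y] /= _ <-].
  rewrite /m /mscale /= /pushforward /= lebesgue_measure_itv /=.
  have [ap|an] : 0 < a \/ a < 0 by case: (ltgtP a 0) a0 => //; [right|left].
    have -> : T @^-1` `]x, y] = `](x - b) / a, (y - b) / a]%classic.
      apply/seteqP; split=> z /=; rewrite !in_itv /= /T ltr_pdivrMr// ler_pdivlMr//.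
        by move=> ?; lra.
      by move=> ?; lra.
    rewrite lebesgue_measure_itv /= !lte_fin ltr_pM2r ?invr_gt0// ltrD2r.
    case: ifPn => // _; last by rewrite mule0.
    by rewrite -!EFinD -EFinM gtr0_norm//; congr (_%:E); field.
  have -> : T @^-1` `]x, y] = `[(y - b) / a, (x - b) / a[%classic.
    apply/seteqP; split=> z /=; rewrite !in_itv /= /T ltr_ndivlMr// ler_ndivrMr//.
      by move=> ?; lra.
    by move=> ?; lra.
  rewrite lebesgue_measure_itv /= !lte_fin ltr_nM2r ?invr_lt0// ltrD2r.
  case: ifPn => // _; last by rewrite mule0.
  by rewrite -!EFinD -EFinM ltr0_norm//; congr (_%:E); field.
rewrite (eq_measure_integral (m mT)); last by move=> A mA _; exact: E.
by rewrite ge0_integral_mscale//= ge0_integral_pushforward.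
Qed.

Lemma cont_measurable2 (f : R * R -> R) : continuous f ->
  measurable_fun [set: measurableTypeR R * measurableTypeR R] (f : _ -> measurableTypeR R).
Proof. by move=> cf; exact: (continuous_on_measurable2 (@openT (R * R)%type) (fun x _ => cf x)). Qed.

Lemma lin2_aff_cont (a b e : R) : continuous (fun x : R * R => a * x.1 + b * x.2 + e).
Proof.
move=> x; apply: (@continuousD _ _ _ (fun x : R * R => a * x.1 + b * x.2) (fun=> e)); last exact: cvg_cst.
apply: (@continuousD _ _ _ (fun x : R * R => a * x.1) (fun x => b * x.2)).
  by apply: (@continuousM _ _ (fun=> a) (fun x : R * R => x.1)); [exact: cvg_cst|exact: cvg_fst].
by apply: (@continuousM _ _ (fun=> b) (fun x : R * R => x.2)); [exact: cvg_cst|exact: cvg_snd].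
Qed.

Definition aff (a b e c d g : R) (x : R * R) : R * R :=
  (a * x.1 + b * x.2 + e, c * x.1 + d * x.2 + g).

Lemma measurable_aff a b e c d g :
  measurable_fun [set: measurableTypeR R * measurableTypeR R]
    (aff a b e c d g : _ -> measurableTypeR R * measurableTypeR R).
Proof. by apply: measurable_fun_pair; apply: cont_measurable2; exact: lin2_aff_cont. Qed.

Implicit Type f : R * R -> \bar R.

Lemma lam2_swap f :
  measurable_fun [set: measurableTypeR R * measurableTypeR R] f -> (forall x, 0 <= f x)%E ->
  (\int[lam2]_x f x = \int[lam2]_x f (x.2, x.1))%E.
Proof.
move=> mf f0; rewrite fubini_tonelli1// fubini_tonelli2//.
apply: measurableT_comp => //.
by apply: measurable_fun_pair; [exact: measurable_snd|exact: measurable_fst].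
Qed.

(** The map factors as (x, y) -> (a x + b y + e, y) followed by the map [A], which changes only the
    second coordinate. By Tonelli each factor is a family of one-dimensional affine substitutions,
    of ratios a and (a d - b c) / a. *)
Lemma lam2_affine_a a b e c d g f : a != 0 -> a * d - b * c != 0 ->
  measurable_fun [set: measurableTypeR R * measurableTypeR R] f -> (forall x, 0 <= f x)%E ->
  (\int[lam2]_x f x = `|a * d - b * c|%:E * \int[lam2]_x f (aff a b e c d g x))%E.
Proof.
move=> a0 D0 mf f0.
have mfa : measurable_fun [set: measurableTypeR R * measurableTypeR R] (f \o aff a b e c d g).
  by apply: measurableT_comp => //; exact: measurable_aff.
pose A : R * R -> R * R := aff 1 0 0 (c / a) ((a * d - b * c) / a) (g - c / a * e).
have mA : measurable_fun [set: measurableTypeR R * measurableTypeR R] (f \o A).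
  by apply: measurableT_comp => //; exact: measurable_aff.
have E1 (y : R) : (fubini_G lebesgue_measure (f \o aff a b e c d g) y =
    `|a|^-1%:E * fubini_G lebesgue_measure (f \o A) y)%E.
  rewrite /fubini_G /= (@lebesgue_affine1 a (b * y + e) (fun x => f (A (x, y))))//.
    rewrite muleA -EFinM mulVf ?normr_eq0// mul1e; apply: eq_integral => x _; congr f.
    by rewrite /A /aff /=; congr (_, _); field.
  apply: (measurableT_comp (mA : measurable_fun setT _)); exact: pair2_measurable.
have f0a x : (0 <= (f \o aff a b e c d g) x)%E by exact: f0.
have f0A x : (0 <= (f \o A) x)%E by exact: f0.
have S1 : (\int[lam2]_x (f \o aff a b e c d g) x = `|a|^-1%:E * \int[lam2]_x (f \o A) x)%E.
  rewrite (fubini_tonelli2 _ mfa f0a) (fubini_tonelli2 _ mA f0A).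
  rewrite -ge0_integralZl//; first by apply: eq_integral => y _; exact: E1.
  - exact: measurable_fun_fubini_tonelli_G.
  - by move=> y _; apply: integral_ge0.
have E2 (x : R) : (fubini_F lebesgue_measure (f \o A) x =
    (`|a| / `|a * d - b * c|)%:E * fubini_F lebesgue_measure f x)%E.
  rewrite /fubini_F /= (@lebesgue_affine1 ((a * d - b * c) / a) (c / a * x + (g - c / a * e)) (fun y => f (x, y)))//.
  - rewrite muleA -EFinM normrM normfV mulrA mulfVK ?normr_eq0// mulfV ?normr_eq0// mul1e.
    apply: eq_integral => y _; congr f.
    by rewrite /A /aff /=; congr (_, _); field.
  - by rewrite mulf_neq0// invr_eq0.
  - apply: (measurableT_comp (mf : measurable_fun setT _)); exact: pair1_measurable.
have S2 : (\int[lam2]_x (f \o A) x = (`|a| / `|a * d - b * c|)%:E * \int[lam2]_x f x)%E.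
  rewrite (fubini_tonelli1 _ mA f0A) (fubini_tonelli1 _ mf f0).
  rewrite -ge0_integralZl//; first by apply: eq_integral => y _; exact: E2.
  - exact: measurable_fun_fubini_tonelli_F.
  - by move=> y _; apply: integral_ge0.
rewrite [X in (_ = _ * X)%E]S1 S2 !muleA -!EFinM.
have -> : `|a * d - b * c| / `|a| * (`|a| / `|a * d - b * c|) = 1.
  by rewrite -mulrA mulKf ?normr_eq0// mulfV ?normr_eq0.
by rewrite mul1e.
Qed.

(** If a = 0 then b is nonzero, and exchanging the two source coordinates reduces to the previous
    case. *)
Lemma lam2_affine a b e c d g f : a * d - b * c != 0 ->
  measurable_fun [set: measurableTypeR R * measurableTypeR R] f -> (forall x, 0 <= f x)%E ->
  (\int[lam2]_x f x = `|a * d - b * c|%:E * \int[lam2]_x f (aff a b e c d g x))%E.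
Proof.
move=> D0 mf f0; have [a0|a0] := eqVneq a 0; last exact: lam2_affine_a.
have b0 : b != 0 by apply: contra_neq D0 => ->; rewrite a0; ring.
rewrite (@lam2_affine_a b a e d c g)//; last first.
  by apply: contra_neq D0 => h; rewrite -[LHS]opprK; apply/eqP; rewrite oppr_eq0 -h; apply/eqP; ring.
rewrite lam2_swap//; last first.
  by apply: measurableT_comp => //; exact: measurable_aff.
congr (_%:E * _)%E; first by rewrite distrC; congr `|_|; ring.
by apply: eq_integral => x _; congr f; rewrite /aff /=; congr (_, _); ring.
Qed.

End Plane.

(** * Integrals of continuous functions with compact support in the plane *)

Section CompactSupport.
Variable R : realType.
Implicit Types f g : R * R -> R.
Local Notation lam2 := (@lam2 R).

(* continuous with compact support *)
Definition cc (f : R * R -> R) :=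
  continuous f /\ exists M, forall x, f x != 0 -> `|x| <= M.

Definition I2 (f : R * R -> R) : R := \int[lam2]_x f x.

Definition cbox (M : R) : set (R * R) := `[- M, M]%classic `*` `[- M, M]%classic.

Lemma cboxP M (x : R * R) : cbox M x <-> `|x| <= M.
Proof.
case: x => a b; rewrite /cbox /= !in_itv /= prod_normE /= ge_max !ler_norml.
by split=> [[-> ->]|/andP[-> ->]].
Qed.

Lemma cbox_compact M : compact (cbox M).
Proof. by apply: compact_setX; exact: segment_compact. Qed.

Lemma lam2_box (a b c d : R) : a <= b -> c <= d ->
  lam2 (`[a, b]%classic `*` `[c, d]%classic) = ((b - a) * (d - c))%:E.
Proof.
move=> ab cd; rewrite /lam2 product_measure1E; [|exact: measurable_itv..].
have e (u v : R) : u <= v -> lebesgue_measure `[u, v]%classic = (v - u)%:E.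
  rewrite le_eqVlt lebesgue_measure_itv /= lte_fin.
  by move=> /predU1P[->|->//]; rewrite ltxx subrr.
by rewrite EFinM; congr (_ * _)%E; exact: e.
Qed.

Lemma cbox_measurable M : measurable (cbox M : set (measurableTypeR R * measurableTypeR R)).
Proof. by apply: measurableX; exact: measurable_itv. Qed.

Lemma compact_bounded_fun (T : topologicalType) (A : set T) (f : T -> R) :
  compact A -> {within A, continuous f} -> exists2 C, 0 <= C & forall x, A x -> `|f x| <= C.
Proof.
move=> cA cf; have := continuous_compact cf cA => /compact_bounded[C [_ hC]].
exists (`|C| + 1); first by rewrite addr_ge0.
move=> x Ax; apply: (hC (`|C| + 1)); last by exists x.
by rewrite (le_lt_trans (ler_norm _))// ltrDl.
Qed.

Lemma cc_box f : cc f -> exists2 M, 0 < M & forall x, ~ cbox M x -> f x = 0.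
Proof.
move=> [_ [M hM]]; exists (`|M| + 1); first by rewrite ltr_wpDl.
move=> x /cboxP nx; apply/eqP; case: eqVneq => // /hM h; exfalso; apply: nx.
by apply: (le_trans h); apply: (le_trans (ler_norm M)); rewrite lerDl.
Qed.

Lemma cc_integrable f : cc f -> lam2.-integrable setT (EFin \o f).
Proof.
move=> ccf; have [M M0 h0] := cc_box ccf; have [cf _] := ccf.
have -> : EFin \o f = (EFin \o f) \_ (cbox M).
  apply/funext => x; rewrite patchE; case: ifPn => //.
  by rewrite notin_setE => /h0 /= ->.
apply/(integrable_mkcond _ (cbox_measurable M)).
apply: measurable_bounded_integrable; first exact: cbox_measurable.
- suff : (lam2 (cbox M) < +oo)%E by [].
  by rewrite /cbox lam2_box ?ltry//; lra.
- by apply: measurable_funTS; exact: cont_measurable2.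
- have [C C0 hC] := compact_bounded_fun (@cbox_compact M) (continuous_subspaceT cf).
  exists C; split; first exact: num_real.
  by move=> y Cy x /= /hC /le_trans; apply; exact: ltW.
Qed.

Lemma ccD f g : cc f -> cc g -> cc (fun x => f x + g x).
Proof.
move=> ccf ccg; have [M M0 hM] := cc_box ccf; have [N N0 hN] := cc_box ccg.
split; first by move=> x; apply: continuousD; [exact: ccf.1|exact: ccg.1].
exists (Num.max M N) => x; apply: contraNT; rewrite -ltNge gt_max => /andP[h1 h2].
by rewrite hM ?hN ?addr0// => /cboxP; rewrite leNgt ?h1 ?h2.
Qed.

Lemma ccMl f g : continuous g -> cc f -> cc (fun x => g x * f x).
Proof.
move=> cg [cf [M hM]]; split; first by move=> x; apply: continuousM; [exact: cg|exact: cf].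
by exists M => x; rewrite mulf_eq0 negb_or => /andP[_ /hM].
Qed.

Lemma ccMr f g : continuous g -> cc f -> cc (fun x => f x * g x).
Proof. by move=> cg ccf; under eq_fun do rewrite mulrC; exact: ccMl. Qed.

Lemma ccZ k f : cc f -> cc (fun x => k * f x).
Proof. by apply: ccMl => x; exact: cvg_cst. Qed.

Lemma ccN f : cc f -> cc (fun x => - f x).
Proof. by move=> /(ccZ (-1)); under eq_fun do rewrite mulN1r. Qed.

Lemma ccB f g : cc f -> cc g -> cc (fun x => f x - g x).
Proof. by move=> cf /ccN; exact: ccD. Qed.

Lemma cc_norm f : cc f -> cc (fun x => `|f x|).
Proof.
move=> [cf [M hM]]; split; last by exists M => x; rewrite normr_eq0 => /hM.
by move=> x; apply: (continuous_comp (cf x)); exact: norm_continuous.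
Qed.

Lemma I2D f g : cc f -> cc g -> I2 (fun x => f x + g x) = I2 f + I2 g.
Proof. by move=> cf cg; apply: RintegralD => //; exact: cc_integrable. Qed.

Lemma I2Z k f : cc f -> I2 (fun x => k * f x) = k * I2 f.
Proof. by move=> cf; apply: RintegralZl => //; exact: cc_integrable. Qed.

Lemma I2N f : cc f -> I2 (fun x => - f x) = - I2 f.
Proof. by move=> cf; under eq_fun do rewrite -mulN1r; rewrite I2Z// mulN1r. Qed.

Lemma I2B f g : cc f -> cc g -> I2 (fun x => f x - g x) = I2 f - I2 g.
Proof. by move=> cf cg; rewrite I2D ?I2N//; exact: ccN. Qed.

Lemma I2_le f g : cc f -> cc g -> (forall x, f x <= g x) -> I2 f <= I2 g.
Proof. by move=> cf cg fg; apply: le_Rintegral => //; exact: cc_integrable. Qed.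

Lemma I2_0 : I2 (fun=> 0) = 0.
Proof. by rewrite /I2 Rintegral_cst// mul0r. Qed.

Lemma cc0 : cc (fun=> 0).
Proof. by split; [move=> x; exact: cvg_cst|exists 0 => x; rewrite eqxx]. Qed.

Lemma I2_ge0 f : cc f -> (forall x, 0 <= f x) -> 0 <= I2 f.
Proof. by move=> cf f0; rewrite -I2_0; apply: I2_le => //; exact: cc0. Qed.

Lemma I2_abs f : cc f -> `|I2 f| <= I2 (fun x => `|f x|).
Proof. by move=> cf; apply: le_normr_Rintegral => //; exact: cc_integrable. Qed.

Lemma I2_ereal f : cc f -> ((I2 f)%:E = \int[lam2]_x (f x)%:E)%E.
Proof.
move=> cf; rewrite /I2 /Rintegral fineK//.
by apply: integrable_fin_num => //; exact: cc_integrable.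
Qed.

Lemma I2_shift f v : cc f -> I2 (fun x => f (x + v)) = I2 f.
Proof.
move=> [cf _]; rewrite /I2 /Rintegral; congr fine.
have mf : measurable_fun [set: measurableTypeR R * measurableTypeR R] (EFin \o f).
  by apply/measurable_EFinP; exact: cont_measurable2.
have affE x : aff 1 0 v.1 0 1 v.2 x = x + v.
  by rewrite /aff !mul0r !mul1r addr0 add0r; case: x; case: (v).
have D1 : 1 * 1 - 0 * 0 = 1 :> R by ring.
have n0 : 1 * 1 - 0 * 0 != 0 :> R by rewrite D1 oner_eq0.
rewrite integralE [RHS]integralE; congr (_ - _)%E.
  rewrite [RHS](@lam2_affine R 1 0 v.1 0 1 v.2)//; last exact: measurable_funepos.
  by rewrite D1 normr1 mul1e; apply: eq_integral => x _; rewrite affE ?funeposE ?funenegE.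
rewrite [RHS](@lam2_affine R 1 0 v.1 0 1 v.2)//; last exact: measurable_funeneg.
by rewrite D1 normr1 mul1e; apply: eq_integral => x _; rewrite affE ?funeposE ?funenegE.
Qed.

Lemma integral_derive0 (g g' : R -> R) (M : R) : 0 < M ->
  (forall t : R, is_derive t 1 g (g' t)) -> continuous g' ->
  (forall t, M <= `|t| -> g t = 0) -> (forall t, M < `|t| -> g' t = 0) ->
  (\int[lebesgue_measure]_t (g' t)%:E = 0)%E.
Proof.
move=> M0 dg cg' g0 g'0.
have -> : (fun t => (g' t)%:E) = (EFin \o g') \_ `[- M, M]%classic.
  apply/funext => x; rewrite patchE; case: ifPn => //.
  by rewrite notin_setE /= in_itv /= -ler_norml => /negP; rewrite -ltNge => /g'0 ->.
rewrite -integral_mkcond (@continuous_FTC2 R g' g (- M) M); first last.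
- by move=> x _; rewrite derive1E; have [] := dg x.
- have cg x : {for x, continuous g}.
    by apply: differentiable_continuous; apply/derivable1_diffP; have [] := dg x.
  split; first by move=> x _; have [] := dg x.
  + by apply: cvg_at_right_filter; exact: cg.
  + by apply: cvg_at_left_filter; exact: cg.
- exact: continuous_subspaceT.
- lra.
by rewrite !g0 ?normrN ?gtr0_norm// subee.
Qed.

Lemma hasC1_unique (U : set (R * R)) f f1 f2 g1 g2 x :
  hasC1 U f f1 f2 -> hasC1 U f g1 g2 -> U x -> f1 x = g1 x /\ f2 x = g2 x.
Proof.
move=> hf hg Ux; have := hasC1_D (1, 0) hf Ux; have := hasC1_D (0, 1) hf Ux.
by rewrite (hasC1_D _ hg Ux) (hasC1_D _ hg Ux) /= !mul1r !mul0r !addr0 !add0r => -> ->.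
Qed.

Lemma hasC1_off f f1 f2 (K : set (R * R)) x : hasC1 setT f f1 f2 -> closed K ->
  (forall y, ~ K y -> f y = 0) -> ~ K x -> f1 x = 0 /\ f2 x = 0.
Proof.
move=> hf cK f0 nKx; have oK : open (~` K) by exact: closed_openC.
have h1 : hasC1 (~` K) f f1 f2 by exact: hasC1_sub hf.
have h2 : hasC1 (~` K) f (fun=> 0) (fun=> 0).
  by refine (hasC1_ext oK (hasC1_cst (U := ~` K) 0) _) => y Ky; split=> //; rewrite f0.
exact: hasC1_unique h1 h2 nKx.
Qed.

Lemma cbox_closed M : closed (cbox M).
Proof. by apply: compact_closed; [exact: norm_hausdorff|exact: cbox_compact]. Qed.

Lemma hasC1_cc f f1 f2 M : hasC1 setT f f1 f2 ->
  (forall x, ~ cbox M x -> f x = 0) -> [/\ cc f, cc f1 & cc f2].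
Proof.
move=> hf f0.
have off x : f x != 0 -> `|x| <= M.
  by apply: contraNT => /negP h; apply/eqP/f0 => /cboxP.
have off1 x : f1 x != 0 -> `|x| <= M.
  apply: contraNT => /negP h; apply/eqP; apply: (hasC1_off (x := x) hf (@cbox_closed M) f0 _).1.
  by move=> /cboxP.
have off2 x : f2 x != 0 -> `|x| <= M.
  apply: contraNT => /negP h; apply/eqP; apply: (hasC1_off (x := x) hf (@cbox_closed M) f0 _).2.
  by move=> /cboxP.
split; (split; last by exists M) => x.
- exact: hasC1_cont hf I.
- by have [] := hf x I.
- by have [] := hf x I.
Qed.

(** Fubini and the fundamental theorem of calculus on each line parallel to an axis: the slices
    vanish outside a bounded interval. *)
Lemma I2_deriv f f1 f2 M : hasC1 setT f f1 f2 ->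
  (forall x, ~ cbox M x -> f x = 0) -> I2 f1 = 0 /\ I2 f2 = 0.
Proof.
move=> hf f0; have [ccf ccf1 ccf2] := hasC1_cc hf f0.
(* [M] may be nonpositive; [|M| + 1] is a positive bound beyond which the function and both partial
   derivatives vanish. *)
have z a b : `|M| + 1 <= `|a| \/ `|M| + 1 <= `|b| -> [/\ f (a, b) = 0, f1 (a, b) = 0 & f2 (a, b) = 0].
  move=> h; have nK : ~ cbox M (a, b).
    move=> /cboxP; rewrite prod_normE /= ge_max => /andP[h1 h2].
    by have := ler_norm M; lra.
  have [-> ->] := hasC1_off hf (@cbox_closed M) f0 nK; split => //; exact: f0.
have M0 : 0 < `|M| + 1 by rewrite ltr_wpDl.
have slice_cont (k : R * R -> R) (a : R) : continuous k -> continuous (fun t => k (t, a)) /\ continuous (fun t => k (a, t)).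
  move=> ck; split=> t.
    have c : (s, a) @[s --> t] --> (t, a) by exact: (cvg_pair cvg_id (cvg_cst a)).
    exact: (@continuous_comp _ _ _ (fun t => (t, a)) k t c (ck _)).
  have c : (a, s) @[s --> t] --> (a, t) by exact: (cvg_pair (cvg_cst a) cvg_id).
  exact: (@continuous_comp _ _ _ (fun t => (a, t)) k t c (ck _)).
split.
  rewrite /I2 /Rintegral -integral21_prod_meas1; last exact: cc_integrable.
  rewrite integral0_eq// => y _.
  apply: (@integral_derive0 (fun t => f (t, y)) _ (`|M| + 1)) => //.
  - by move=> t; exact: hasC1_slice1 hf I.
  - by have [] := slice_cont f1 y ccf1.1.
  - by move=> t ht; have [] := z t y (or_introl ht).
  - by move=> t /ltW ht; have [] := z t y (or_introl ht).
rewrite /I2 /Rintegral -integral12_prod_meas1; last exact: cc_integrable.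
rewrite integral0_eq// => y _.
apply: (@integral_derive0 (fun t => f (y, t)) _ (`|M| + 1)) => //.
- by move=> t; exact: hasC1_slice2 hf I.
- by have [] := slice_cont f2 y ccf2.1.
- by move=> t ht; have [] := z y t (or_intror ht).
- by move=> t /ltW ht; have [] := z y t (or_intror ht).
Qed.

End CompactSupport.

(** * Change of variables *)

Lemma sq_shift (R : realType) (a s k x t : R) : a <= x < a + s -> `|t| <= k * s ->
  a - k * s <= x + t < a - k * s + (s + 2 * k * s).
Proof. by rewrite ler_norml => *; lra. Qed.

Lemma sum_le_pair1 (R : realType) (a b c d : R) : 0 <= a -> 0 <= c -> d + b <= a + b + c + d.
Proof. by move=> *; lra. Qed.

Lemma sum_le_pair2 (R : realType) (a b c d : R) : 0 <= b -> 0 <= d -> a + c <= a + b + c + d.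
Proof. by move=> *; lra. Qed.

Lemma near_le (R : realType) (x y e : R) : `|x - y| < e -> x <= y + e /\ y <= x + e.
Proof. by rewrite ltr_distlC => *; lra. Qed.

Lemma sqr_one_two (R : realType) (k : R) : 0 <= k -> 2 * k <= 1 -> (1 + 2 * k) ^+ 2 <= 1 + 6 * k.
Proof. by move=> *; nra. Qed.

Section ChangeOfVariables.
Variable R : realType.
Local Notation lam2 := (@lam2 R).
Local Notation mR2 := (measurableTypeR R * measurableTypeR R)%type.

Definition hsq (a b s : R) : set (R * R) := `[a, a + s[%classic `*` `[b, b + s[%classic.

Lemma hsqP a b s (x : R * R) : hsq a b s x <-> (a <= x.1 < a + s) /\ (b <= x.2 < b + s).
Proof. by rewrite /hsq /= !in_itv. Qed.

Lemma measurable_hsq a b s : measurable (hsq a b s : set mR2).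
Proof. by apply: measurableX; exact: measurable_itv. Qed.

Lemma lam2_hsq a b s : 0 <= s -> lam2 (hsq a b s) = (s ^+ 2)%:E.
Proof.
move=> s0; rewrite /lam2 product_measure1E; [|exact: measurable_itv..].
have e (u : R) : lebesgue_measure `[u, u + s[%classic = s%:E.
  move: s0; rewrite le_eqVlt lebesgue_measure_itv /= lte_fin ltrDl => /predU1P[<-|->]; first by rewrite ltxx.
  by rewrite -EFinD addrC addKr.
by rewrite expr2 EFinM; congr (_ * _)%E; exact: e.
Qed.

(** Repeated passage to a quarter with property [P] gives nested squares whose corners converge. The
    limit point is only known to lie in the closed squares, hence the weak inequalities. *)
Lemma bisection_point (P : R -> R -> R -> Prop) a0 b0 s0 : 0 < s0 -> P a0 b0 s0 ->
  (forall a b s, 0 < s -> P a b s -> exists a' b',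
     [/\ P a' b' (s / 2), a' = a \/ a' = a + s / 2 & b' = b \/ b' = b + s / 2]) ->
  exists x : R * R, forall d, 0 < d -> exists a b s,
    [/\ P a b s, 0 < s < d, a <= x.1 <= a + s & b <= x.2 <= b + s].
Proof.
move=> s00 P0 step.
(* As an implication, the successor relation is total, as the choice of [f] requires. *)
pose good (q q' : R * R * R) := P q.1.1 q.1.2 q.2 -> 0 < q.2 ->
  [/\ P q'.1.1 q'.1.2 q'.2, q'.2 = q.2 / 2,
     q'.1.1 = q.1.1 \/ q'.1.1 = q.1.1 + q.2 / 2 &
     q'.1.2 = q.1.2 \/ q'.1.2 = q.1.2 + q.2 / 2].
have /choice[f fP] : forall q, exists q', good q q'.
  move=> [[a b] s]; have [h|h] := pselect (P a b s /\ 0 < s); last first.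
    by exists (a, b, s) => h1 h2; exfalso; apply: h.
  have [a' [b' [h1 h2 h3]]] := step a b s h.2 h.1.
  by exists (a', b', s / 2) => _ _.
pose q n := iter n f (a0, b0, s0).
have qP n : P (q n).1.1 (q n).1.2 (q n).2 /\ (q n).2 = s0 / 2 ^+ n.
  elim: n => [|n [IH1 IH2]]; first by rewrite expr0 divr1.
  have [||h1 h2 _ _] := fP (q n) => //; first by rewrite IH2 divr_gt0// exprn_gt0.
  by split=> //; rewrite {1}/q iterS -/(q n) h2 IH2 exprSr invfM mulrA.
have s_gt0 n : 0 < (q n).2 by rewrite (qP n).2 divr_gt0// exprn_gt0.
have stepq n : [/\ (q n.+1).2 = (q n).2 / 2,
     (q n.+1).1.1 = (q n).1.1 \/ (q n.+1).1.1 = (q n).1.1 + (q n).2 / 2 &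
     (q n.+1).1.2 = (q n).1.2 \/ (q n.+1).1.2 = (q n).1.2 + (q n).2 / 2].
  by have [h1 h2 h3 h4] := fP (q n) (qP n).1 (s_gt0 n).
have mono (c : R * R * R -> R) : (forall n, c (q n.+1) = c (q n) \/ c (q n.+1) = c (q n) + (q n).2 / 2) ->
    exists x, forall n, c (q n) <= x <= c (q n) + (q n).2.
  move=> hc.
  have up n k : c (q n) <= c (q (n + k)%N) /\ c (q (n + k)%N) + (q (n + k)%N).2 <= c (q n) + (q n).2.
    elim: k => [|k [IH1 IH2]]; first by rewrite addn0.
    rewrite addnS; have := s_gt0 (n + k)%N; have [-> _ _] := stepq (n + k)%N.
    by have [->|->] := hc (n + k)%N; lra.
  have le nn m : c (q m) <= c (q nn) + (q nn).2.
    have [/subnKC h|/ltnW /subnKC h] := leqP nn m.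
      by have := up nn (m - nn)%N; rewrite h; have := s_gt0 m; lra.
    by have := up m (nn - m)%N; rewrite h; have := s_gt0 nn; lra.
  have hs : has_sup (range (c \o q)).
    by split; [exists (c (q 0%N)), 0%N|exists (c (q 0%N) + (q 0%N).2) => _ [m _ <-]; exact: le].
  exists (sup (range (c \o q))) => n; apply/andP; split.
    by apply: sup_upper_bound => //; exists n.
  by apply: ge_sup; [exists (c (q 0%N)), 0%N|move=> _ [m _ <-]; exact: le].
have [x hx] := mono (fun q => q.1.1) (fun n => let: And3 _ h _ := stepq n in h).
have [y hy] := mono (fun q => q.1.2) (fun n => let: And3 _ _ h := stepq n in h).
exists (x, y) => d d0.
have [n hn] : exists n, s0 / 2 ^+ n < d.
  pose n := Num.bound (s0 / d); exists n.
  rewrite ltr_pdivrMr ?exprn_gt0// mulrC -ltr_pdivrMr//.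
  apply: (lt_le_trans (archi_boundP _)); first by rewrite divr_ge0// ltW.
  by rewrite -natrX ler_nat ltnW// ltn_expl.
exists (q n).1.1, (q n).1.2, (q n).2; split; [exact: (qP n).1| |exact: hx|exact: hy].
by rewrite s_gt0 (qP n).2.
Qed.

Variables (O O' : set (R * R)) (phi psi : R * R -> R * R) (p1 p2 q1 q2 : R * R -> R).
Variable F : R * R -> R.
Hypotheses (oO : open O) (oO' : open O').
Hypothesis hphi1 : hasC1 O (fun x => (phi x).1) p1 p2.
Hypothesis hphi2 : hasC1 O (fun x => (phi x).2) q1 q2.
Hypothesis phiO : forall x, O x -> O' (phi x).
Hypothesis psiO : forall y, O' y -> O (psi y).
Hypothesis psiK : forall y, O' y -> phi (psi y) = y.
Hypothesis cpsi : forall y, O' y -> {for y, continuous psi}.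
Hypothesis F0 : forall y, O' y -> 0 <= F y.
Hypothesis cF : forall y, O' y -> {for y, continuous F}.
Let J x := p1 x * q2 x - p2 x * q1 x.
Hypothesis J0 : forall x, O x -> J x != 0.
Let G x := F (phi x) * `|J x|.

Let cphi x : O x -> {for x, continuous phi}.
Proof.
move=> Ox; have c1 := hasC1_cont hphi1 Ox; have c2 := hasC1_cont hphi2 Ox.
have -> : phi = fun x => ((phi x).1, (phi x).2) by apply/funext => y; case: (phi y).
exact: (cvg_pair c1 c2).
Qed.

Let cG x : O x -> {for x, continuous G}.
Proof.
move=> Ox; have [_ c1 c2] := hphi1 Ox; have [_ c3 c4] := hphi2 Ox.
apply: continuousM.
  by apply: (@continuous_comp _ _ _ phi F); [exact: cphi|exact/cF/phiO].
apply: (@continuous_comp _ _ _ J Num.norm); last exact: norm_continuous.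
by apply: continuousB; exact: continuousM.
Qed.

Let G0 x : O x -> 0 <= G x. Proof. by move=> Ox; rewrite mulr_ge0// F0//; exact: phiO. Qed.

Let mO : measurable (O : set mR2). Proof. exact: open_measurable2. Qed.
Let mO' : measurable (O' : set mR2). Proof. exact: open_measurable2. Qed.

Let mF : measurable_fun (O' : set mR2) (EFin \o F).
Proof. by apply/measurable_EFinP; apply: continuous_on_measurable2. Qed.
Let mG : measurable_fun (O : set mR2) (EFin \o G).
Proof. by apply/measurable_EFinP; apply: continuous_on_measurable2. Qed.

Let mpre_sq a b s : measurable (O' `&` psi @^-1` hsq a b s : set mR2).
Proof.
have m1 : measurable_fun (O' : set mR2) (fun y => (psi y).1 : measurableTypeR R).
  apply: (continuous_on_measurable2 oO') => y Oy.
  by apply: (@continuous_comp _ _ _ psi fst); [exact: cpsi|exact: cvg_fst].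
have m2 : measurable_fun (O' : set mR2) (fun y => (psi y).2 : measurableTypeR R).
  apply: (continuous_on_measurable2 oO') => y Oy.
  by apply: (@continuous_comp _ _ _ psi snd); [exact: cpsi|exact: cvg_snd].
have -> : O' `&` psi @^-1` hsq a b s =
    (O' `&` (fun y => (psi y).1) @^-1` `[a, a + s[%classic) `&`
    (O' `&` (fun y => (psi y).2) @^-1` `[b, b + s[%classic).
  by apply/seteqP; split=> y /=; rewrite /hsq /=; tauto.
by apply: measurableI; [apply: m1|apply: m2] => //; exact: measurable_itv.
Qed.

Let open_pre (V : set (R * R)) : open V -> open (O' `&` psi @^-1` V).
Proof.
move=> oV; rewrite openE => y [Oy Vy].
have n1 : nbhs y O' by exact: open_nbhs_nbhs.
have n2 : nbhs y (psi @^-1` V) by apply: (cpsi Oy); exact: open_nbhs_nbhs.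
exact: filterI.
Qed.

Let mpre_closed (K : set (R * R)) : closed K -> measurable (O' `&` psi @^-1` K : set mR2).
Proof.
move=> cK; have -> : O' `&` psi @^-1` K = O' `\` (O' `&` psi @^-1` (~` K)).
  apply/seteqP; split=> y /=; first by move=> [Oy Ky]; split=> // -[_]; apply.
  by move=> [Oy h]; split=> //; apply: contrapT => h'; apply: h.
by apply: measurableD => //; apply: open_measurable2; apply: open_pre; exact: closed_openC.
Qed.

(* The image under phi of a small square Q around x0 lies in a parallelogram slightly larger than the
   image of Q under the differential of phi, hence an error of at most e |Q|. *)
Lemma cov_local x0 e : O x0 -> 0 < e -> exists2 d, 0 < d & forall a b s,
  0 < s < d -> a <= x0.1 <= a + s -> b <= x0.2 <= b + s ->
  hsq a b s `<=` O /\
  (\int[lam2]_(y in O' `&` psi @^-1` hsq a b s) (F y)%:E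
     <= \int[lam2]_(x in hsq a b s) (G x)%:E + (e * s ^+ 2)%:E)%E.
Proof.
move=> Ox0 e0; have jn0 := J0 Ox0.
pose j : R := `|J x0|; have j0 : 0 < j by rewrite normr_gt0.
pose f0 := F (phi x0); have f00 : 0 <= f0 by apply/F0/phiO.
pose m : R := (`|p1 x0| + `|p2 x0| + `|q1 x0| + `|q2 x0|) / j.
have m0 : 0 <= m.
  by apply: divr_ge0; [rewrite !addr_ge0|exact: ltW].
(* [c] collects the coefficients of [eta] in the expansion of (f0 + eta) j (1 + 6 m eta), with eta^2
   bounded by eta, plus 1 for the error in the integral of [G]. *)
pose c : R := 6 * m * f0 * j + j + 6 * m * j + 1.
have j00 := ltW j0.
have cge1 : 1 <= c.
  have h1 : 0 <= 6 * m * f0 * j by do 3?apply: mulr_ge0.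
  have h2 : 0 <= 6 * m * j by do 2?apply: mulr_ge0.
  by rewrite /c; lra.
have c0 : 0 < c := lt_le_trans ltr01 cge1.
pose eta : R := Num.min 1 (Num.min (2 * m + 1)^-1 (e / c)).
have eta0 : 0 < eta by rewrite !lt_min ltr01 invr_gt0 divr_gt0// ltr_wpDl// mulr_ge0.
have eta1 : eta <= 1 by rewrite ge_min lexx.
have eta2 : 2 * m * eta <= 1.
  have : eta <= (2 * m + 1)^-1 by rewrite !ge_min lexx orbT.
  have h : 0 < 2 * m + 1 by rewrite ltr_wpDl// mulr_ge0.
  rewrite -[X in _ <= X]div1r ler_pdivlMr// => h2.
  by apply: le_trans h2; rewrite mulrDr mulr1 mulrC lerDl ltW.
have eta3 : eta * c <= e.
  by rewrite -ler_pdivlMr// !ge_min lexx !orbT.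
have [d1 c1 c2] := hphi1 Ox0; have [d2 c3 c4] := hphi2 Ox0.
have H1 := (is_diff2P _ _ _ _).1 d1 _ eta0; have H2 := (is_diff2P _ _ _ _).1 d2 _ eta0.
rewrite (near_shift x0 (0 : R * R)) sub0r in H1; rewrite (near_shift x0 (0 : R * R)) sub0r in H2.
have nO : nbhs x0 O by exact: open_nbhs_nbhs.
have cFphi : {for x0, continuous (fun x => F (phi x))}.
  by apply: (@continuous_comp _ _ _ phi F); [exact: cphi|exact/cF/phiO].
have H3 := cont_near_lt cFphi eta0.
have H4 := cont_near_lt (cG Ox0) eta0.
have : \forall x \near x0, [/\ O x,
    `|(phi x).1 - (phi x0).1 - lin2 (p1 x0) (p2 x0) (x - x0)| <= eta * `|x - x0|,
    `|(phi x).2 - (phi x0).2 - lin2 (q1 x0) (q2 x0) (x - x0)| <= eta * `|x - x0|,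
    `|F (phi x) - f0| < eta & `|G x - G x0| < eta].
  near=> x; split.
  - by near: x.
  - by have : (+%R^~ (- x0) @^-1` [set h | `|(phi (h + x0)).1 - (phi x0).1 - lin2 (p1 x0) (p2 x0) h| <= eta * `|h| ]) x; [near: x|rewrite /= subrK].
  - by have : (+%R^~ (- x0) @^-1` [set h | `|(phi (h + x0)).2 - (phi x0).2 - lin2 (q1 x0) (q2 x0) h| <= eta * `|h| ]) x; [near: x|rewrite /= subrK].
  - by near: x.
  - by near: x.
move=> /near_box[d dd0 hd]; exists d => // a b s /andP[s0 sd] ha hb.
have near_sq x : hsq a b s x -> `|x.1 - x0.1| <= s /\ `|x.2 - x0.2| <= s.
  by move=> /hsqP[hx1 hx2]; rewrite !ler_norml; lra.
have hd' x : hsq a b s x -> _ := fun h => hd x.1 x.2 (le_lt_trans (near_sq x h).1 sd) (le_lt_trans (near_sq x h).2 sd).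
have sub : hsq a b s `<=` O by move=> [x1 x2] /hd' [].
split=> //.
pose k : R := m * eta.
have k0 : 0 <= k by rewrite mulr_ge0// ltW.
(* [M] is the inverse of the affine approximation of [phi] at [x0]. On the image of the square it
   differs from [psi] by at most k s in each coordinate, so this image lies in the preimage under
   [M] of the enlarged square [Qp]. *)
pose M := aff (q2 x0 / J x0) (- p2 x0 / J x0) (x0.1 - (q2 x0 * (phi x0).1 - p2 x0 * (phi x0).2) / J x0)
     (- q1 x0 / J x0) (p1 x0 / J x0) (x0.2 - (p1 x0 * (phi x0).2 - q1 x0 * (phi x0).1) / J x0).
pose Qp := hsq (a - k * s) (b - k * s) (s + 2 * k * s).
have mbnd (u v r1 r2 : R) : `|u| + `|v| <= m * j -> `|r1| <= eta * s -> `|r2| <= eta * s ->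
    `|(u * r1 - v * r2) / J x0| <= k * s.
  move=> huv h1 h2; rewrite normrM normfV -/j ler_pdivrMr//.
  apply: (le_trans (ler_normB _ _)); rewrite !normrM.
  have : `|u| * `|r1| <= `|u| * (eta * s) by rewrite ler_wpM2l.
  have : `|v| * `|r2| <= `|v| * (eta * s) by rewrite ler_wpM2l.
  have : (`|u| + `|v|) * (eta * s) <= (m * j) * (eta * s) by rewrite ler_wpM2r// mulr_ge0// ltW.
  by rewrite /k; lra.
have mj : m * j = `|p1 x0| + `|p2 x0| + `|q1 x0| + `|q2 x0| by rewrite /m divfK// gt_eqF.
have inc : O' `&` psi @^-1` hsq a b s `<=` M @^-1` Qp.
  move=> y [Oy Qy] /=; set x := psi y in Qy *.
  have [_ h1 h2 _ _] := hd' x Qy; have [n1 n2] := near_sq x Qy.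
  have nx : `|x - x0| <= s by rewrite prod_normE /= ge_max n1 n2.
  have ex : phi x = y by exact: psiK.
  have es : eta * `|x - x0| <= eta * s by rewrite ler_wpM2l// ltW.
  rewrite /= -surjective_pairing ex in h1 h2.
  have {}h1 := le_trans h1 es; have {}h2 := le_trans h2 es.
  set r1 := y.1 - _ - _ in h1; set r2 := y.2 - _ - _ in h2.
  have jn : p1 x0 * q2 x0 - p2 x0 * q1 x0 != 0 by exact: jn0.
  have e1 : (M y).1 = x.1 + (q2 x0 * r1 - p2 x0 * r2) / J x0.
    by rewrite /M /aff /r1 /r2 /lin2 /J /=; field.
  have e2 : (M y).2 = x.2 + (p1 x0 * r2 - q1 x0 * r1) / J x0.
    by rewrite /M /aff /r1 /r2 /lin2 /J /=; field.
  have b1 : `|(q2 x0 * r1 - p2 x0 * r2) / J x0| <= k * s.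
    by apply: mbnd => //; rewrite mj; exact: sum_le_pair1.
  have b2 : `|(p1 x0 * r2 - q1 x0 * r1) / J x0| <= k * s.
    by apply: mbnd => //; rewrite mj; exact: sum_le_pair2.
  by move/hsqP : Qy => [Q1 Q2]; apply/hsqP; rewrite e1 e2; split; exact: sq_shift.
have mM : measurable (M @^-1` Qp : set mR2).
  by rewrite -[X in measurable X]setTI; apply: measurable_aff => //; exact: measurable_hsq.
have vol : lam2 (M @^-1` Qp) = (j * (s + 2 * k * s) ^+ 2)%:E.
  have sk : 0 <= s + 2 * k * s.
    have : 0 <= k * s by apply: mulr_ge0 => //; exact: ltW.
    lra.
  have D : q2 x0 / J x0 * (p1 x0 / J x0) - - p2 x0 / J x0 * (- q1 x0 / J x0) = (J x0)^-1.
    by rewrite /J; field; exact: jn0.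
  have := @lam2_affine R (q2 x0 / J x0) (- p2 x0 / J x0) (x0.1 - (q2 x0 * (phi x0).1 - p2 x0 * (phi x0).2) / J x0)
     (- q1 x0 / J x0) (p1 x0 / J x0) (x0.2 - (p1 x0 * (phi x0).2 - q1 x0 * (phi x0).1) / J x0) (fun x => (\1_Qp x)%:E).
  rewrite D invr_eq0 => /(_ jn0) h.
  have mQ : measurable (Qp : set mR2) by exact: measurable_hsq.
  have m1 : measurable_fun [set: mR2] (fun x : R * R => (\1_Qp x : R)%:E).
    by apply/measurable_EFinP; exact: measurable_indic.
  have m2 (x : R * R) : (0 <= (\1_Qp x : R)%:E)%E by rewrite lee_fin.
  have I1 : (\int[lam2]_x (\1_Qp x)%:E)%E = ((s + 2 * k * s) ^+ 2)%:E.
    by rewrite integral_indic// setIT; exact: lam2_hsq.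
  have I2 : (\int[lam2]_x (\1_Qp (M x))%:E)%E = lam2 (M @^-1` Qp).
    transitivity (\int[lam2]_x (\1_(M @^-1` Qp) x)%:E)%E; first by [].
    by rewrite integral_indic// setIT.
  rewrite EFinM -I1 (h m1 m2) -I2.
  by rewrite muleA -EFinM normfV mulfV ?mul1e// gt_eqF.
have fe0 : 0 <= f0 + eta by rewrite addr_ge0// ltW.
have A1 : (\int[lam2]_(y in O' `&` psi @^-1` hsq a b s) (F y)%:E
    <= ((f0 + eta) * (j * (s + 2 * k * s) ^+ 2))%:E)%E.
  apply: (@le_trans _ _ (\int[lam2]_(y in O' `&` psi @^-1` hsq a b s) (cst (f0 + eta)%:E y))%E).
    apply: ge0_le_integral => //.
    - by move=> y [Oy _]; rewrite lee_fin F0.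
    - by apply: measurable_funS mF => // y [].
    - move=> y [Oy Qy]; rewrite lee_fin; have [_ _ _ h _] := hd' _ Qy.
      by rewrite /= -surjective_pairing psiK// in h; have [] := near_le h.
  rewrite integral_cst// EFinM lee_wpmul2l ?lee_fin// -vol.
  by apply: le_measure => //; rewrite inE.
apply: (le_trans A1).
have A2 : ((f0 * j * s ^+ 2)%:E <= \int[lam2]_(x in hsq a b s) (G x)%:E + (eta * s ^+ 2)%:E)%E.
  have mQ : measurable (hsq a b s : set mR2) by exact: measurable_hsq.
  have cQ (r : R) : (r * s ^+ 2)%:E = (\int[lam2]_(x in hsq a b s) (cst r%:E x))%E.
    by rewrite integral_cst// EFinM; congr (_ * _)%E; apply/esym/lam2_hsq/ltW.
  rewrite !cQ.
  have mGQ : measurable_fun (hsq a b s : set mR2) (fun x => (G x)%:E) by apply: measurable_funS mG.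
  rewrite -ge0_integralD//; first last.
  - by move=> x _; rewrite lee_fin ltW.
  - by move=> x /sub Ox; rewrite lee_fin G0.
  apply: ge0_le_integral => //.
  - by move=> x _; rewrite lee_fin mulr_ge0// ltW.
  - by apply: emeasurable_funD.
  - move=> x Qx; rewrite -EFinD lee_fin; have [_ _ _ _ h] := hd' _ Qx.
    by rewrite -surjective_pairing in h; rewrite -/(G x0); have [] := near_le h.
have e_eta : 0 <= (e - eta) * s ^+ 2.
  apply: mulr_ge0; last exact: sqr_ge0.
  by rewrite subr_ge0 (le_trans _ eta3)// ler_peMr// ltW.
have -> : (e * s ^+ 2)%:E = ((eta * s ^+ 2)%:E + ((e - eta) * s ^+ 2)%:E)%E.
  by rewrite -EFinD; congr (_%:E); ring.
rewrite addeA; apply: (@le_trans _ _ ((f0 * j * s ^+ 2)%:E + ((e - eta) * s ^+ 2)%:E)%E); last exact: leeD2r.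
rewrite -EFinD lee_fin.
have -> : (f0 + eta) * (j * (s + 2 * k * s) ^+ 2) = ((f0 + eta) * j * (1 + 2 * k) ^+ 2) * s ^+ 2 by ring.
rewrite -mulrDl ler_wpM2r ?sqr_ge0//.
have k1 : (1 + 2 * k) ^+ 2 <= 1 + 6 * k.
  by apply: sqr_one_two => //; rewrite /k mulrA.
apply: (@le_trans _ _ ((f0 + eta) * j * (1 + 6 * k))); first by rewrite ler_wpM2l// mulr_ge0// ltW.
have kj : 0 <= m * j by rewrite mulr_ge0// ltW.
have : eta * (eta * (m * j)) <= 1 * (eta * (m * j)) by rewrite ler_wpM2r// mulr_ge0// ltW.
have : eta * (6 * m * f0 * j + j + 6 * m * j + 1) <= e by exact: eta3.
by rewrite /k; lra.
Unshelve. all: by end_near. Qed.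

(** The error term e s^2 is additive under quartering. If the inequality with this error failed on
    some square, it would by bisection fail on squares shrinking to a point. At a point of [O] this
    contradicts the local estimate, and the closed sets [K n] exclude limit points outside [O]. *)
Lemma cov_le : (\int[lam2]_(y in O') (F y)%:E <= \int[lam2]_(x in O) (G x)%:E)%E.
Proof.
(* An exhaustion of [O] by bounded closed sets: the second factor keeps distance at least 1/(n+1)
   from the complement. *)
pose K n := [set x : R * R | `|x| <= n%:R] `&` [set x | forall z, `|z - x| < n.+1%:R^-1 -> O z].
have cK n : closed (K n).
  apply: closedI.
    have -> : [set x : R * R | `|x| <= n%:R] = cbox n%:R.
      by apply/seteqP; split=> x /= /cboxP.
    exact: cbox_closed.
  have -> : [set x | forall z, `|z - x| < n.+1%:R^-1 -> O z] =
      ~` (\bigcup_(z in ~` O) ball z n.+1%:R^-1).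
    apply/seteqP; split=> x /=.
      by move=> h [z nOz]; rewrite -ball_normE /= => /h.
    move=> h z hz; apply: contrapT => nOz; apply: h; exists z => //.
    by rewrite -ball_normE.
  by apply: open_closedC; apply: bigcup_open => z _; exact: ball_open.
have KO n : K n `<=` O by move=> x [_ h]; apply: h; rewrite subrr normr0 invr_gt0.
have mK n : measurable (O' `&` psi @^-1` K n : set mR2) by exact: mpre_closed.
have mKQ n a b s : measurable (O' `&` psi @^-1` (K n `&` hsq a b s) : set mR2).
  have -> : O' `&` psi @^-1` (K n `&` hsq a b s) = (O' `&` psi @^-1` K n) `&` (O' `&` psi @^-1` hsq a b s).
    by apply/seteqP; split=> y /=; tauto.
  exact: measurableI.
have mQO a b s : measurable (O `&` hsq a b s : set mR2).
  by apply: measurableI => //; exact: measurable_hsq.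
pose A n a b s := (\int[lam2]_(y in O' `&` psi @^-1` (K n `&` hsq a b s)) (F y)%:E)%E.
pose B e a b s := (\int[lam2]_(x in O `&` hsq a b s) (G x)%:E + (e * s ^+ 2)%:E)%E.
have split4 a b s : 0 < s -> hsq a b s =
    (hsq a b (s / 2) `|` hsq a (b + s / 2) (s / 2)) `|` (hsq (a + s / 2) b (s / 2) `|` hsq (a + s / 2) (b + s / 2) (s / 2)).
  move=> s0; apply/seteqP; split=> x /=; rewrite /hsq /= !in_itv /=.
    have [h1|h1] := ltP x.1 (a + s / 2); have [h2|h2] := ltP x.2 (b + s / 2) => h; [left; left|left; right|right; left|right; right]; lra.
  by move=> [[h|h]|[h|h]]; lra.
have disj a b s : [disjoint hsq a b (s / 2) & hsq a (b + s / 2) (s / 2)].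
  by apply/disj_setPS => x []; rewrite /hsq /= !in_itv /=; lra.
have disj2 a b s : [disjoint hsq a b (s / 2) `|` hsq a (b + s / 2) (s / 2) &
     hsq (a + s / 2) b (s / 2) `|` hsq (a + s / 2) (b + s / 2) (s / 2)].
  by apply/disj_setPS => x [[|] + [|]]; rewrite /hsq /= !in_itv /=; lra.
have FU n (X Y : set (R * R)) : measurable (O' `&` psi @^-1` (K n `&` X) : set mR2) ->
    measurable (O' `&` psi @^-1` (K n `&` Y) : set mR2) -> [disjoint X & Y] ->
    (\int[lam2]_(y in O' `&` psi @^-1` (K n `&` (X `|` Y))) (F y)%:E =
    \int[lam2]_(y in O' `&` psi @^-1` (K n `&` X)) (F y)%:E + \int[lam2]_(y in O' `&` psi @^-1` (K n `&` Y)) (F y)%:E)%E.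
  move=> mX mY /disj_setPS XY.
  rewrite setIUr preimage_setU setIUr ge0_integral_setU//.
  - by apply: measurable_funS mF => //; rewrite -setIUr; exact: subIsetl.
  - by move=> y [] [Oy _]; rewrite lee_fin F0.
  - apply/disj_setPS => y /= [[_ [_ h1]] [_ [_ h2]]]; exact: (XY (psi y)).
have GU (X Y : set (R * R)) : measurable (O `&` X : set mR2) -> measurable (O `&` Y : set mR2) -> [disjoint X & Y] ->
    (\int[lam2]_(y in O `&` (X `|` Y)) (G y)%:E =
    \int[lam2]_(y in O `&` X) (G y)%:E + \int[lam2]_(y in O `&` Y) (G y)%:E)%E.
  move=> mX mY /disj_setPS XY.
  rewrite setIUr ge0_integral_setU//.
  - by apply: measurable_funS mG => //; rewrite -setIUr; exact: subIsetl.
  - by move=> y [] [Oy _]; rewrite lee_fin G0.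
  - by apply/disj_setPS => y /= [[_ h1] [_ h2]]; exact: (XY y).
have mU1 n a b s : measurable (O' `&` psi @^-1` (K n `&` (hsq a b (s / 2) `|` hsq a (b + s / 2) (s / 2))) : set mR2).
  by rewrite setIUr preimage_setU setIUr; apply: measurableU.
have mU2 a b s : measurable (O `&` (hsq a b (s / 2) `|` hsq a (b + s / 2) (s / 2)) : set mR2).
  by rewrite setIUr; apply: measurableU.
have key n e : 0 < e -> forall a b s, 0 < s -> (A n a b s <= B e a b s)%E.
  move=> e0 a b s s0; rewrite leNgt; apply/negP => h.
  have [|x hx] := @bisection_point (fun a b s => (B e a b s < A n a b s)%E) a b s s0 h.
    move=> {h s0}a {}b {}s s0 h; apply: contrapT => nex.
    have le a' b' : a' = a \/ a' = a + s / 2 -> b' = b \/ b' = b + s / 2 -> (A n a' b' (s / 2)%R <= B e a' b' (s / 2)%R)%E.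
      by move=> ha hb; rewrite leNgt; apply/negP => h'; apply: nex; exists a', b'.
    move: h; apply/negP; rewrite -leNgt /A /B split4// !FU// !GU//.
    have -> : (e * s ^+ 2)%:E = ((e * (s / 2) ^+ 2)%:E + (e * (s / 2) ^+ 2)%:E + ((e * (s / 2) ^+ 2)%:E + (e * (s / 2) ^+ 2)%:E))%E.
      by rewrite -!EFinD; congr (_%:E); field.
    rewrite [leRHS]addeACA; apply: leeD; rewrite [leRHS]addeACA; apply: leeD; apply: le; tauto.
  have [Kx|nKx] := pselect (K n x).
    have [d d0 hd] := cov_local (KO n x Kx) e0.
    have [a' [b' [s' [h' s'd ha hb]]]] := hx d d0.
    have [sub ineq] := hd a' b' s' s'd ha hb.
    move: h'; apply/negP; rewrite -leNgt /A /B (setIidr sub); apply: le_trans ineq.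
    apply: ge0_subset_integral => //.
    - by apply: measurable_funS mF => // y [].
    - by move=> y [Oy _]; rewrite lee_fin F0.
    - by move=> y [Oy [_ Qy]].
  have [r r0 hr] : exists2 r, 0 < r & forall a b, `|a - x.1| < r -> `|b - x.2| < r -> (~` K n) (a, b).
    by apply: near_box; apply: open_nbhs_nbhs; split=> //; exact: closed_openC.
  have [a' [b' [s' [h' /andP[s'0 s'd] ha hb]]]] := hx r r0.
  move: h'; apply/negP; rewrite -leNgt /A.
  have -> : O' `&` psi @^-1` (K n `&` hsq a' b' s') = set0.
    rewrite -subset0 => y [_ [Ky /hsqP Qy]]; have := hr (psi y).1 (psi y).2.
    by rewrite -surjective_pairing; apply => //; rewrite ltr_norml; lra.
  rewrite integral_set0 /B; apply: adde_ge0; last by rewrite lee_fin mulr_ge0 ?sqr_ge0// ltW.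
  by apply: integral_ge0 => y [Oy _]; rewrite lee_fin G0.
have bnd n : (\int[lam2]_(y in O' `&` psi @^-1` K n) (F y)%:E <= \int[lam2]_(x in O) (G x)%:E)%E.
  apply/lee_addgt0Pr => e e0.
  (* The half-open square with corner (-n, -n) and side 2n + 1 contains all points of norm at most
     n; the rate e / s^2 makes the total error equal to [e]. *)
  pose s : R := 2 * n%:R + 1.
  have s0 : 0 < s by rewrite ltr_wpDl// mulr_ge0.
  have e's : 0 < e / s ^+ 2 by rewrite divr_gt0// exprn_gt0.
  have := key n _ e's (- n%:R) (- n%:R) s s0; rewrite /A /B divfK; last by rewrite expf_neq0// gt_eqF.
  have KQ : K n `<=` hsq (- n%:R) (- n%:R) s.
    move=> x [/cboxP]; rewrite /cbox /hsq /= !in_itv /= /s => h _; lra.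
  rewrite (setIidl KQ) => /le_trans; apply; apply: leeD2r.
  by apply: ge0_subset_integral.
have Kmono : {homo (fun n => O' `&` psi @^-1` K n) : n m / (n <= m)%N >-> (n <= m)%O}.
  move=> n m nm; apply/subsetPset => y [Oy [h1 h2]]; split=> //; split.
    by apply: (le_trans h1); rewrite ler_nat.
  move=> z hz; apply: h2; apply: (lt_le_trans hz).
  by rewrite lef_pV2 ?posrE// ler_nat.
have mFK n : measurable_fun (O' `&` psi @^-1` K n : set mR2) (EFin \o F).
  by apply: measurable_funS mF => // y [].
have FK0 n y : (O' `&` psi @^-1` K n) y -> (0 <= (EFin \o F) y)%E.
  by move=> [Oy _]; rewrite lee_fin F0.
have cv := @ge0_nondecreasing_set_cvg_integral _ _ _ _ _ lam2 Kmono mK mFK FK0.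
have UK : \bigcup_n (O' `&` psi @^-1` K n) = O'.
  apply/seteqP; split=> [y [n _ []]//|y Oy].
  have [r r0 hr] := near_box (open_nbhs_nbhs (conj oO (psiO Oy))).
  pose n := maxn (Num.bound `|psi y|) (Num.bound r^-1).
  exists n => //; split=> //; split.
    rewrite /=; apply: ltW; apply: (lt_le_trans (archi_boundP (normr_ge0 _))).
    by rewrite ler_nat leq_maxl.
  move=> z hz.
  have nr : n.+1%:R^-1 < r.
    rewrite invf_plt ?posrE//; apply: (lt_le_trans (archi_boundP _)); first by rewrite invr_ge0 ltW.
    by rewrite ler_nat; apply: leqW; rewrite leq_maxr.
  have : `|z - psi y| < r by exact: lt_trans hz nr.
  rewrite prod_normE /= gt_max => /andP[h1 h2]; rewrite [z]surjective_pairing.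
  exact: hr.
rewrite UK in cv; rewrite -(cvg_lim _ cv)//.
by apply: lime_le; [apply/cvg_ex; exists (\int[lam2]_(y in O') (F y)%:E)%E|exact: nearW].
Qed.

End ChangeOfVariables.

Section ChangeOfVariablesEq.
Variable R : realType.
Local Notation lam2 := (@lam2 R).

Lemma hasC1_fst_snd_comp (U V : set (R * R)) (phi : R * R -> R * R) p1 p2 q1 q2 (f f1 f2 : R * R -> R) :
  hasC1 U (fun x => (phi x).1) p1 p2 -> hasC1 U (fun x => (phi x).2) q1 q2 ->
  hasC1 V f f1 f2 -> (forall x, U x -> V (phi x)) ->
  hasC1 U (fun x => f (phi x)) (fun x => p1 x * f1 (phi x) + q1 x * f2 (phi x))
    (fun x => p2 x * f1 (phi x) + q2 x * f2 (phi x)).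
Proof.
move=> h1 h2 hf UV; have e x : ((phi x).1, (phi x).2) = phi x by case: (phi x).
have := hasC1_comp2 h1 h2 hf; under eq_fun do rewrite e.
under [fun x => p1 x * _ + _]eq_fun do rewrite e.
under [fun x => p2 x * _ + _]eq_fun do rewrite e.
by apply => x Ux; rewrite e; exact: UV.
Qed.

Lemma jacobian_inverse (O O' : set (R * R)) (phi psi : R * R -> R * R)
    (p1 p2 q1 q2 a1 a2 b1 b2 : R * R -> R) : open O ->
  hasC1 O (fun x => (phi x).1) p1 p2 -> hasC1 O (fun x => (phi x).2) q1 q2 ->
  hasC1 O' (fun x => (psi x).1) a1 a2 -> hasC1 O' (fun x => (psi x).2) b1 b2 ->
  (forall x, O x -> O' (phi x)) -> (forall x, O x -> psi (phi x) = x) ->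
  forall x, O x ->
  (p1 x * q2 x - p2 x * q1 x) * (a1 (phi x) * b2 (phi x) - a2 (phi x) * b1 (phi x)) = 1.
Proof.
move=> oO hp hq ha hb OO' K x Ox.
have c1 := hasC1_fst_snd_comp hp hq ha OO'; have c2 := hasC1_fst_snd_comp hp hq hb OO'.
have d1 : hasC1 O (fun x => (psi (phi x)).1) (fun=> 1) (fun=> 0).
  by refine (hasC1_ext oO (hasC1_fst (U := O)) _) => y Oy; rewrite K.
have d2 : hasC1 O (fun x => (psi (phi x)).2) (fun=> 0) (fun=> 1).
  by refine (hasC1_ext oO (hasC1_snd (U := O)) _) => y Oy; rewrite K.
have [e1 e2] := hasC1_unique c1 d1 Ox; have [e3 e4] := hasC1_unique c2 d2 Ox.
transitivity ((p1 x * a1 (phi x) + q1 x * a2 (phi x)) * (p2 x * b1 (phi x) + q2 x * b2 (phi x)) -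
  (p2 x * a1 (phi x) + q2 x * a2 (phi x)) * (p1 x * b1 (phi x) + q1 x * b2 (phi x))); first by ring.
by rewrite e1 e2 e3 e4; ring.
Qed.

(** The inequality [cov_le], applied to [phi] and to its inverse, gives both directions, because the
    two Jacobians multiply to 1 at corresponding points. *)
Theorem change_of_variables (O O' : set (R * R)) (phi psi : R * R -> R * R)
    (p1 p2 q1 q2 a1 a2 b1 b2 F : R * R -> R) : open O -> open O' ->
  hasC1 O (fun x => (phi x).1) p1 p2 -> hasC1 O (fun x => (phi x).2) q1 q2 ->
  hasC1 O' (fun x => (psi x).1) a1 a2 -> hasC1 O' (fun x => (psi x).2) b1 b2 ->
  (forall x, O x -> O' (phi x)) -> (forall y, O' y -> O (psi y)) ->
  (forall x, O x -> psi (phi x) = x) -> (forall y, O' y -> phi (psi y) = y) ->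
  (forall y, O' y -> 0 <= F y) -> (forall y, O' y -> {for y, continuous F}) ->
  (\int[lam2]_(y in O') (F y)%:E =
   \int[lam2]_(x in O) (F (phi x) * `|p1 x * q2 x - p2 x * q1 x|)%:E)%E.
Proof.
move=> oO oO' hp hq ha hb OO' O'O K1 K2 F0 cF.
have J1 := jacobian_inverse oO hp hq ha hb OO' K1.
have J2 := jacobian_inverse oO' ha hb hp hq O'O K2.
have cpair (U : set (R * R)) (f : R * R -> R * R) u1 u2 v1 v2 : hasC1 U (fun x => (f x).1) u1 u2 ->
    hasC1 U (fun x => (f x).2) v1 v2 -> forall x, U x -> {for x, continuous f}.
  move=> h1 h2 x Ux.
  have -> : f = fun x => ((f x).1, (f x).2) by apply/funext => y; case: (f y).
  exact: (cvg_pair (hasC1_cont h1 Ux) (hasC1_cont h2 Ux)).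
have J1n x : O x -> p1 x * q2 x - p2 x * q1 x != 0.
  by move=> /J1 h; apply/eqP => z; move/eqP: h; rewrite z mul0r eq_sym oner_eq0.
have J2n x : O' x -> a1 x * b2 x - a2 x * b1 x != 0.
  by move=> /J2 h; apply/eqP => z; move/eqP: h; rewrite z mul0r eq_sym oner_eq0.
apply/eqP; rewrite eq_le; apply/andP; split.
  by apply: (cov_le oO oO' hp hq OO' O'O K2 (cpair _ _ _ _ _ _ ha hb) F0 cF J1n).
apply: (@le_trans _ _ (\int[lam2]_(y in O') (F (phi (psi y)) *
   `|p1 (psi y) * q2 (psi y) - p2 (psi y) * q1 (psi y)| * `|a1 y * b2 y - a2 y * b1 y|)%:E)%E).
  apply: (cov_le (F := fun x => F (phi x) * `|p1 x * q2 x - p2 x * q1 x|) oO' oO ha hb O'O OO' K1 (cpair _ _ _ _ _ _ hp hq) _ _ J2n).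
    by move=> x Ox; rewrite mulr_ge0// F0//; exact: OO'.
  move=> x Ox; have [_ c1 c2] := hp x Ox; have [_ c3 c4] := hq x Ox.
  apply: continuousM.
    by apply: (@continuous_comp _ _ _ phi F); [exact: cpair hp hq x Ox|apply/cF/OO'].
  apply: (@continuous_comp _ _ _ (fun x => p1 x * q2 x - p2 x * q1 x) Num.norm); last exact: norm_continuous.
  by apply: continuousB; exact: continuousM.
rewrite le_eqVlt; apply/orP; left; apply/eqP/eq_integral => y /set_mem Oy.
by rewrite K2// -mulrA -normrM [X in `|X|]mulrC J2// normr1 mulr1.
Qed.

End ChangeOfVariablesEq.

(** * Charts, Gram matrices and the area integral *)

Section Dot.
Variable R : realType.
Implicit Types (u v w : 'rV[R]_3) (X : R * R -> 'rV[R]_3) (U : set (R * R)).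

Lemma dotE u v : dot u v = u 0 0 * v 0 0 + u 0 1 * v 0 1 + u 0 ord_max * v 0 ord_max.
Proof.
rewrite /dot !big_ord_recr big_ord0 /= add0r.
by congr (_ * _ + _ * _ + _ * _); congr (_ 0 _); apply: val_inj.
Qed.

Lemma dotC u v : dot u v = dot v u. Proof. by rewrite !dotE; ring. Qed.
Lemma dotDl u v w : dot (u + v) w = dot u w + dot v w.
Proof. by rewrite !dotE !mxE; ring. Qed.
Lemma dotZl k u w : dot (k *: u) w = k * dot u w.
Proof. by rewrite !dotE !mxE; ring. Qed.
Lemma dotDr u v w : dot w (u + v) = dot w u + dot w v.
Proof. by rewrite !dotE !mxE; ring. Qed.
Lemma dotZr k u w : dot w (k *: u) = k * dot w u.
Proof. by rewrite !dotE !mxE; ring. Qed.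
Lemma dotNl u w : dot (- u) w = - dot u w.
Proof. by rewrite !dotE !mxE; ring. Qed.
Lemma dotBl u v w : dot (u - v) w = dot u w - dot v w.
Proof. by rewrite dotDl dotNl. Qed.
Lemma dot0l w : dot 0 w = 0.
Proof. by rewrite !dotE !mxE; ring. Qed.
Lemma dot_ge0 u : 0 <= dot u u.
Proof. by rewrite dotE -!expr2 !addr_ge0 ?sqr_ge0. Qed.
Lemma dot_eq0 u : dot u u = 0 -> u = 0.
Proof.
rewrite dotE -!expr2 => h.
have [h0 h1 h2] : [/\ u 0 0 ^+ 2 = 0, u 0 1 ^+ 2 = 0 & u 0 ord_max ^+ 2 = 0].
  have := sqr_ge0 (u 0 0); have := sqr_ge0 (u 0 1); have := sqr_ge0 (u 0 ord_max).
  by split; lra.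
apply/rowP => i; rewrite mxE; case: i => -[|[|[|//]]] hi; apply/eqP; rewrite -sqrf_eq0; apply/eqP.
- by rewrite -[RHS]h0; congr (u _ _ ^+ 2); apply: val_inj.
- by rewrite -[RHS]h1; congr (u _ _ ^+ 2); apply: val_inj.
- by rewrite -[RHS]h2; congr (u _ _ ^+ 2); apply: val_inj.
Qed.
Lemma dot_gt0 u : u != 0 -> 0 < dot u u.
Proof. by move=> u0; rewrite lt_def dot_ge0 andbT; apply: contra_neq u0 => /dot_eq0. Qed.

Lemma dot_cauchy u v : dot u v ^+ 2 <= dot u u * dot v v.
Proof.
rewrite -subr_ge0.
have -> : dot u u * dot v v - dot u v ^+ 2 =
  (u 0 0 * v 0 1 - u 0 1 * v 0 0) ^+ 2 + (u 0 0 * v 0 ord_max - u 0 ord_max * v 0 0) ^+ 2 +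
  (u 0 1 * v 0 ord_max - u 0 ord_max * v 0 1) ^+ 2 by rewrite !dotE; ring.
by rewrite !addr_ge0 ?sqr_ge0.
Qed.

Lemma enorm_ge0 u : 0 <= enorm u. Proof. exact: sqrtr_ge0. Qed.
Lemma enorm_sqr u : enorm u ^+ 2 = dot u u. Proof. by rewrite sqr_sqrtr// dot_ge0. Qed.
Lemma enormZ k u : enorm (k *: u) = `|k| * enorm u.
Proof. by rewrite /enorm dotZl dotZr mulrA -expr2 sqrtrM ?sqr_ge0// sqrtr_sqr. Qed.
Lemma enorm0 : enorm (0 : 'rV[R]_3) = 0. Proof. by rewrite /enorm dot0l sqrtr0. Qed.
Lemma enormN u : enorm (- u) = enorm u.
Proof. by rewrite -scaleN1r enormZ normrN normr1 mul1r. Qed.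
Lemma dot_le u v : `|dot u v| <= enorm u * enorm v.
Proof.
rewrite -(@ler_pXn2r _ 2)// ?nnegrE ?mulr_ge0 ?enorm_ge0//.
by rewrite -normrX ger0_norm ?sqr_ge0// exprMn !enorm_sqr dot_cauchy.
Qed.
Lemma enormD u v : enorm (u + v) <= enorm u + enorm v.
Proof.
rewrite -(@ler_pXn2r _ 2)// ?nnegrE ?addr_ge0 ?enorm_ge0//.
rewrite enorm_sqr sqrrD !enorm_sqr dotDl !dotDr (dotC v u).
have := le_trans (ler_norm _) (dot_le u v); lra.
Qed.

Definition hasC1v U X X1 X2 := forall c, hasC1 U (fun x => X x 0 c) (fun x => X1 x 0 c) (fun x => X2 x 0 c).

Lemma hasC1_dot U X X1 X2 Y Y1 Y2 : open U -> hasC1v U X X1 X2 -> hasC1v U Y Y1 Y2 ->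
  hasC1 U (fun x => dot (X x) (Y x)) (fun x => dot (X1 x) (Y x) + dot (X x) (Y1 x))
    (fun x => dot (X2 x) (Y x) + dot (X x) (Y2 x)).
Proof.
move=> oU hX hY.
have h c := hasC1_mul (hX c) (hY c).
refine (hasC1_ext oU (hasC1_add (hasC1_add (h 0) (h 1)) (h ord_max)) _) => y Uy.
by split; rewrite !dotE //; ring.
Qed.

Lemma hasC1v_cst U (p : 'rV[R]_3) : hasC1v U (fun=> p) (fun=> 0) (fun=> 0).
Proof.
move=> c; have -> : (fun=> (0 : 'rV[R]_3) 0 c) = (fun=> 0) :> (R * R -> R) by apply/funext => x; rewrite mxE.
exact: hasC1_cst.
Qed.

Definition d1 X := pd X 0.
Definition d2 X := pd X 1.
Definition d11 X := pd2 X 0 0.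
Definition d12 X := pd2 X 0 1.
Definition d21 X := pd2 X 1 0.
Definition d22 X := pd2 X 1 1.

Lemma hasC1v_X U X : smooth_on U X -> hasC1v U X (d1 X) (d2 X).
Proof. by move=> sX c; exact: smooth_coord. Qed.
Lemma hasC1v_d1 U X : smooth_on U X -> hasC1v U (d1 X) (d11 X) (d21 X).
Proof. by move=> sX c; exact: (smooth_coord _ (smooth_pd 0 sX)). Qed.
Lemma hasC1v_d2 U X : smooth_on U X -> hasC1v U (d2 X) (d12 X) (d22 X).
Proof. by move=> sX c; exact: (smooth_coord _ (smooth_pd 1 sX)). Qed.

Definition EE X x := dot (d1 X x) (d1 X x).
Definition FF X x := dot (d1 X x) (d2 X x).
Definition GG X x := dot (d2 X x) (d2 X x).
Definition DD X x := EE X x * GG X x - FF X x ^+ 2.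

Lemma det2 (A : 'M[R]_2) : \det A = A 0 0 * A 1 1 - A 0 1 * A 1 0.
Proof.
rewrite (expand_det_row _ 0) !big_ord_recl big_ord0 /cofactor !det_mx11 !mxE /=.
rewrite /bump /= addn0 expr0 expr1 addr0 mul1r mulN1r mulrN.
congr (_ * A _ _ - A _ _ * A _ _); exact: val_inj.
Qed.

Lemma gramE X x i j : gram X x i j = dot (pd X i x) (pd X j x).
Proof. by rewrite mxE. Qed.

Lemma gram_det X x : \det (gram X x) = DD X x.
Proof.
have gen (a b : 'rV[R]_3) : dot a a * dot b b - dot a b * dot b a = dot a a * dot b b - dot a b ^+ 2.
  by rewrite expr2 (dotC b a).
by rewrite det2 !gramE; exact: (gen (d1 X x) (d2 X x)).
Qed.

Lemma area_densityE X x : area_density X x = Num.sqrt (DD X x).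
Proof. by rewrite /area_density gram_det. Qed.

(** The vector [w] is |a|^2 times the component of [b] orthogonal to [a]. *)
Lemma dot_gram (a b : 'rV[R]_3) (w := dot a a *: b - dot a b *: a) :
  dot w w = dot a a * (dot a a * dot b b - dot a b ^+ 2).
Proof. by rewrite /w !dotE !mxE; ring. Qed.

Lemma comb_coord (s t : R) u v (c : 'I_3) : (s *: u + t *: v) 0 c = s * u 0 c + t * v 0 c.
Proof. by rewrite !mxE. Qed.

Lemma dot_sym_sum u v : dot u v + dot v u = 2 * dot u v.
Proof. by rewrite (dotC v u); ring. Qed.

Lemma add_dotC (s : R) u v : s + dot u v = s + dot v u.
Proof. by rewrite (dotC u v). Qed.

Lemma enorm_comb_le (s t : R) u v : enorm (s *: u + t *: v) <= `|s| * enorm u + `|t| * enorm v.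
Proof. by apply: le_trans (enormD _ _) _; rewrite !enormZ. Qed.

Definition immersed U X := smooth_on U X /\
  forall x, U x -> forall u : R * R, 'D_u X x = 0 -> u = 0.

Lemma derive_d U X x (u : R * R) : smooth_on U X -> U x -> 'D_u X x = u.1 *: d1 X x + u.2 *: d2 X x.
Proof.
move=> sX Ux; have dX := smooth_diff sX Ux.
have dXu : derivable X x u by exact: diff_derivable.
apply/rowP => c; have h := hasC1_D u (hasC1v_X sX c) Ux.
by rewrite (derive_mx dXu) mxE h; exact/esym/comb_coord.
Qed.

Lemma d12C U X x : open U -> smooth_on U X -> U x -> d12 X x = d21 X x.
Proof.
move=> oU sX Ux; apply/rowP => c.
by have /esym := hasC1_schwarz oU (hasC1v_X sX c) (hasC1v_d1 sX c) (hasC1v_d2 sX c) Ux.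
Qed.
End Dot.

#[global] Opaque d1 d2 d11 d12 d21 d22 dot.

Section Charts.
Variable R : realType.
Implicit Types (u v w : 'rV[R]_3) (X : R * R -> 'rV[R]_3) (U : set (R * R)).

(** If the Gram determinant were nonpositive, the component of [d2 X x] orthogonal to [d1 X x] would
    vanish by [dot_gram], a linear relation that contradicts the immersion property. *)
Lemma DD_gt0 U X x : immersed U X -> U x -> 0 < DD X x.
Proof.
move=> [sX iX] Ux; rewrite ltNge; apply/negP => h.
have E0 : 0 < EE X x.
  apply: dot_gt0; apply/eqP => z; have := iX x Ux (1, 0).
  rewrite (derive_d _ sX Ux) /= scale1r z scale0r addr0 => /(_ erefl) [/eqP].
  by rewrite oner_eq0.
have ww : dot (EE X x *: d2 X x - FF X x *: d1 X x) (EE X x *: d2 X x - FF X x *: d1 X x) = EE X x * DD X x := dot_gram (d1 X x) (d2 X x).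
have w0 : EE X x *: d2 X x - FF X x *: d1 X x = 0.
  apply: dot_eq0; apply/eqP; rewrite eq_le dot_ge0 andbT ww.
  by rewrite pmulr_rle0.
have := iX x Ux (- FF X x, EE X x).
rewrite (derive_d _ sX Ux) /= scaleNr addrC w0 => /(_ erefl) [_ e].
by rewrite e ltxx in E0.
Qed.

Lemma hasC1_EE U X : open U -> smooth_on U X -> hasC1 U (EE X)
  (fun x => 2 * dot (d11 X x) (d1 X x)) (fun x => 2 * dot (d21 X x) (d1 X x)).
Proof.
move=> oU sX; refine (hasC1_ext oU (hasC1_dot oU (hasC1v_d1 sX) (hasC1v_d1 sX)) _) => y Uy.
by split; [reflexivity|exact: dot_sym_sum|exact: dot_sym_sum].
Qed.
Lemma hasC1_GG U X : open U -> smooth_on U X -> hasC1 U (GG X)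
  (fun x => 2 * dot (d12 X x) (d2 X x)) (fun x => 2 * dot (d22 X x) (d2 X x)).
Proof.
move=> oU sX; refine (hasC1_ext oU (hasC1_dot oU (hasC1v_d2 sX) (hasC1v_d2 sX)) _) => y Uy.
by split; [reflexivity|exact: dot_sym_sum|exact: dot_sym_sum].
Qed.
Lemma hasC1_FF U X : open U -> smooth_on U X -> hasC1 U (FF X)
  (fun x => dot (d11 X x) (d2 X x) + dot (d12 X x) (d1 X x))
  (fun x => dot (d21 X x) (d2 X x) + dot (d22 X x) (d1 X x)).
Proof.
move=> oU sX; refine (hasC1_ext oU (hasC1_dot oU (hasC1v_d1 sX) (hasC1v_d2 sX)) _) => y Uy.
by split; [reflexivity|exact: add_dotC|exact: add_dotC].
Qed.

Lemma DD_cont U X x : open U -> smooth_on U X -> U x -> {for x, continuous (DD X)}.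
Proof.
move=> oU sX Ux.
have cE := hasC1_cont (hasC1_EE oU sX) Ux; have cF := hasC1_cont (hasC1_FF oU sX) Ux.
have cG := hasC1_cont (hasC1_GG oU sX) Ux.
have -> : DD X = fun x => EE X x * GG X x - FF X x * FF X x by apply/funext => y; rewrite /DD expr2.
exact: (continuousB (continuousM cE cG) (continuousM cF cF)).
Qed.

Lemma area_cont U X x : open U -> smooth_on U X -> U x -> {for x, continuous (area_density X)}.
Proof.
move=> oU sX Ux; have -> : area_density X = Num.sqrt \o DD X by apply/funext => y; exact: area_densityE.
by apply: continuous_comp; [exact: DD_cont oU sX Ux|exact: sqrt_continuous].
Qed.

Lemma area_ge0 X x : 0 <= area_density X x. Proof. exact: sqrtr_ge0. Qed.

Lemma area_gt0 U X x : immersed U X -> U x -> 0 < area_density X x.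
Proof. by move=> iX Ux; rewrite area_densityE sqrtr_gt0 (DD_gt0 iX). Qed.

End Charts.

(** * Changes of chart and the area integral *)

Lemma adde_cancel_fin (R : realType) (a b c : \bar R) :
  c \is a fin_num -> (a + c = b + c)%E -> a = b.
Proof. by move=> fc e; rewrite -[a](@addeK _ c)// e addeK. Qed.

Section SurfaceIntegral.
Variables (R : realType) (S : surface R) (F : S -> 'rV[R]_3).
Hypothesis imm : smooth_immersion F.
Local Notation lam2 := (@lam2 R).
Local Notation mR2 := (measurableTypeR R * measurableTypeR R)%type.
Local Notation U n := (ccod (atlas S n)).
Local Notation par n := (par (atlas S n)).
Local Notation crd n := (crd (atlas S n)).
Local Notation cdom n := (cdom (atlas S n)).
Local Notation X n := (local_param F n).

Lemma immX n : immersed (U n) (X n). Proof. exact: imm. Qed.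
Lemma smX n : smooth_on (U n) (X n). Proof. exact: (imm n).1. Qed.
Lemma oU n : open (U n). Proof. exact: ccod_open. Qed.

Lemma open_par n (W : set S) : open W -> open (U n `&` par n @^-1` W).
Proof.
move=> oW; rewrite openE => y [Uy Wy].
have n1 : nbhs y (U n) by apply: open_nbhs_nbhs; split=> //; exact: oU.
have n2 : nbhs y (par n @^-1` W) by apply: (par_continuous Uy); exact: open_nbhs_nbhs.
exact: filterI.
Qed.

(* (tr_ij) is the Jacobian matrix of the change of charts [tr m n]. *)
Definition tr m n := crd n \o par m.
Definition trdom m n := U m `&` par m @^-1` cdom n.
Definition tr11 m n x := ('D_(1, 0) (tr m n) x).1.
Definition tr12 m n x := ('D_(0, 1) (tr m n) x).1.
Definition tr21 m n x := ('D_(1, 0) (tr m n) x).2.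
Definition tr22 m n x := ('D_(0, 1) (tr m n) x).2.

Lemma open_trdom m n : open (trdom m n).
Proof. by apply: open_par; exact: cdom_open. Qed.

Lemma lin2_10 (x : R * R) : lin2 1 0 x = x.1. Proof. by rewrite /lin2 mulr1 mulr0 addr0. Qed.
Lemma lin2_01 (x : R * R) : lin2 0 1 x = x.2. Proof. by rewrite /lin2 mulr1 mulr0 add0r. Qed.

Lemma hasC1_tr1 m n : hasC1 (trdom m n) (fun x => (tr m n x).1) (tr11 m n) (tr12 m n).
Proof.
refine (hasC1_ext (@open_trdom m n) (smooth_hasC1 (@lin2_cont R 1 0) (@atlas_smooth _ S m n)) _) => y _.
by split; exact: lin2_10.
Qed.

Lemma hasC1_tr2 m n : hasC1 (trdom m n) (fun x => (tr m n x).2) (tr21 m n) (tr22 m n).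
Proof.
refine (hasC1_ext (@open_trdom m n) (smooth_hasC1 (@lin2_cont R 0 1) (@atlas_smooth _ S m n)) _) => y _.
by split; exact: lin2_01.
Qed.

Local Opaque tr11 tr12 tr21 tr22.

Lemma tr_dom m n x : trdom m n x -> trdom n m (tr m n x).
Proof.
move=> [Ux dx]; split; first exact: crd_ccod.
by rewrite /tr /= crdK//; exact: par_cdom.
Qed.

Lemma trK m n x : trdom m n x -> tr n m (tr m n x) = x.
Proof. by move=> [Ux dx]; rewrite /tr /= crdK// parK. Qed.

Lemma X_tr m n x : trdom m n x -> X m x = X n (tr m n x).
Proof. by move=> [Ux dx]; rewrite /local_param /tr /= crdK. Qed.

Lemma d_tr m n x : trdom m n x ->
  d1 (X m) x = tr11 m n x *: d1 (X n) (tr m n x) + tr21 m n x *: d2 (X n) (tr m n x) /\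
  d2 (X m) x = tr12 m n x *: d1 (X n) (tr m n x) + tr22 m n x *: d2 (X n) (tr m n x).
Proof.
move=> Ox; have hX c := hasC1v_X (@smX m) c.
have hc c := hasC1_fst_snd_comp (@hasC1_tr1 m n) (@hasC1_tr2 m n) (hasC1v_X (@smX n) c) (fun x h => (tr_dom h).1).
have hd c : hasC1 (trdom m n) (fun x => X n (tr m n x) 0 c) (fun x => d1 (X m) x 0 c) (fun x => d2 (X m) x 0 c).
  refine (hasC1_ext (@open_trdom m n) (hasC1_sub _ (hX c)) _); first by move=> y [].
  by move=> y Oy; rewrite (X_tr Oy).
by split; apply/rowP => c; have [e1 e2] := hasC1_unique (hc c) (hd c) Ox; 
  rewrite comb_coord; apply/esym.
Qed.

Definition trJ m n x := tr11 m n x * tr22 m n x - tr12 m n x * tr21 m n x.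

(** The Gram determinant of two linear combinations of a pair is multiplied by the square of the
    determinant of the coefficients. *)
Lemma area_tr m n x : trdom m n x ->
  area_density (X m) x = area_density (X n) (tr m n x) * `|trJ m n x|.
Proof.
move=> Ox; have [e1 e2] := d_tr Ox.
have gen (a b : 'rV[R]_3) (p q r s : R) (u := p *: a + q *: b) (v := r *: a + s *: b) :
    dot u u * dot v v - dot u v ^+ 2 = (dot a a * dot b b - dot a b ^+ 2) * (p * s - r * q) ^+ 2.
  by rewrite /u /v !dotE !mxE; ring.
rewrite !area_densityE; have -> : DD (X m) x = DD (X n) (tr m n x) * trJ m n x ^+ 2.
  by rewrite /DD /EE /FF /GG e1 e2 gen.
rewrite sqrtrM ?sqrtr_sqr//.
by apply: ltW; apply: (DD_gt0 (immX n)); exact: (tr_dom Ox).1.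
Qed.

Lemma tr_integral m n (W : set S) (f : S -> R) : open W -> continuous f -> (forall p, 0 <= f p) ->
  (\int[lam2]_(y in U n `&` par n @^-1` (W `&` cdom m)) (f (par n y) * area_density (X n) y)%:E =
   \int[lam2]_(x in U m `&` par m @^-1` (W `&` cdom n)) (f (par m x) * area_density (X m) x)%:E)%E.
Proof.
move=> oW cf f0.
have sub a b : U a `&` par a @^-1` (W `&` cdom b) `<=` trdom a b by move=> x [Ux [Wx dx]].
have o a b : open (U a `&` par a @^-1` (W `&` cdom b)).
  by apply: open_par; apply: openI => //; exact: cdom_open.
have dom a b x : (U a `&` par a @^-1` (W `&` cdom b)) x -> (U b `&` par b @^-1` (W `&` cdom a)) (tr a b x).
  move=> [Ux [Wx dx]]; split; first exact: crd_ccod.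
  by rewrite /tr /= crdK//; split=> //; exact: par_cdom.
rewrite (change_of_variables (o m n) (o n m) (hasC1_sub (sub m n) (@hasC1_tr1 m n)) (hasC1_sub (sub m n) (@hasC1_tr2 m n))
   (hasC1_sub (sub n m) (@hasC1_tr1 n m)) (hasC1_sub (sub n m) (@hasC1_tr2 n m)) (dom m n) (dom n m)).
- apply: eq_integral => x /set_mem Ox; have Ox' := sub _ _ _ Ox.
  rewrite (area_tr Ox') mulrA; congr (_ * _ * _)%:E; congr f.
  by rewrite /tr /= crdK//; exact: Ox'.2.
- by move=> x /sub; exact: trK.
- by move=> x /sub; exact: trK.
- by move=> y _; rewrite mulr_ge0// area_ge0.
- move=> y [Uy _]; apply: continuousM.
    by apply: continuous_comp; [exact: (par_continuous Uy)|exact: cf].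
  exact: area_cont (@oU n) (@smX n) Uy.
Qed.

Implicit Types f g : S -> R.

(* the domain of integration of chart n in [surface_integral] *)
Definition piece n := U n `&` par n @^-1` seqDU (fun k => cdom k) n.
Definition dens n (f : S -> R) y := f (par n y) * area_density (X n) y.

Lemma dens_cont n f y : continuous f -> U n y -> {for y, continuous (dens n f)}.
Proof.
move=> cf Uy; apply: continuousM.
  by apply: continuous_comp; [exact: (par_continuous Uy)|exact: cf].
exact: area_cont (@oU n) (@smX n) Uy.
Qed.

Lemma dens_meas n f : continuous f -> measurable_fun (U n : set mR2) (fun y => (dens n f y)%:E).
Proof.
move=> cf; apply/measurable_EFinP; apply: (continuous_on_measurable2 (@oU n)) => y Uy.
exact: dens_cont.
Qed.

Lemma open_cover_lt n : open (\bigcup_(k in `I_n) cdom k).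
Proof. by apply: bigcup_open => k _; exact: cdom_open. Qed.

Lemma seqDU_cdom n : seqDU (fun k => cdom k) n = cdom n `\` \bigcup_(k in `I_n) cdom k.
Proof. by rewrite /seqDU bigcup_mkord. Qed.

Lemma mopen n (W : set S) : open W -> measurable (U n `&` par n @^-1` W : set mR2).
Proof. by move=> oW; apply: open_measurable2; exact: open_par. Qed.

Lemma piece_split m n :
  U m `&` par m @^-1` seqDU (fun k => cdom k) n =
  (U m `&` par m @^-1` cdom n) `\` (U m `&` par m @^-1` (\bigcup_(k in `I_n) cdom k `&` cdom n)).
Proof. by rewrite seqDU_cdom; apply/seteqP; split=> x /=; tauto. Qed.

Lemma mpiece m n : measurable (U m `&` par m @^-1` seqDU (fun k => cdom k) n : set mR2).
Proof.
rewrite piece_split; apply: measurableD; apply: mopen; first exact: cdom_open.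
by apply: openI; [exact: open_cover_lt|exact: cdom_open].
Qed.

Lemma surface_integralE f :
  surface_integral F f = (\sum_(0 <= n <oo) \int[lam2]_(x in piece n) (dens n f x)%:E)%E.
Proof. by []. Qed.

(** The pieces in [surface_integral] are differences of open sets, to which the change of variables
    does not apply directly. Each piece is an open set minus an open subset [E]; both integrals
    transfer to chart [m], and finiteness allows the subtraction. *)
Lemma chart_integral m f : continuous f -> (forall p, 0 <= f p) ->
  (forall p, ~ cdom m p -> f p = 0) ->
  (\int[lam2]_(x in U m) (dens m f x)%:E < +oo)%E ->
  surface_integral F f = (\int[lam2]_(x in U m) (dens m f x)%:E)%E.
Proof.
move=> cf f0 foff fin.
have d0 n y : (0 <= (dens n f y)%:E)%E by rewrite lee_fin mulr_ge0// area_ge0.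
pose D n := seqDU (fun k => cdom k) n.
have UmE : U m = \bigcup_n (U m `&` par m @^-1` D n).
  rewrite -setI_bigcupr -preimage_bigcup -seqDU_bigcup_eq.
  apply/seteqP; split=> [x Ux|x []//]; split=> //.
  by have [n dn] := atlas_cover (par m x); exists n.
have mD n : measurable (U m `&` par m @^-1` D n : set mR2) by exact: mpiece.
transitivity (\sum_(0 <= n <oo) \int[lam2]_(x in U m `&` par m @^-1` D n) (dens m f x)%:E)%E; last first.
  rewrite -ge0_integral_bigcup -?UmE//; first exact: dens_meas.
  apply/trivIsetP => i j _ _ ij; have /trivIsetP /(_ i j I I ij) := @trivIset_seqDU S (fun k => cdom k).
  by rewrite -subset0 => h; rewrite -subset0 => x [[_ xi] [_ xj]]; apply: (h (par m x)).
rewrite surface_integralE; apply: eq_eseriesr => n _.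
pose E := \bigcup_(k in `I_n) cdom k `&` cdom n.
have oE : open E by apply: openI; [exact: open_cover_lt|exact: cdom_open].
have mUn W : open W -> measurable (U n `&` par n @^-1` W : set mR2) by exact: mopen.
have mUm W : open W -> measurable (U m `&` par m @^-1` W : set mR2) by exact: mopen.
have meas k W : open W -> measurable_fun (U k `&` par k @^-1` W : set mR2) (fun y => (dens k f y)%:E).
  move=> oW; apply: measurable_funS (@dens_meas k _ cf) => //.
  by apply: open_measurable2; exact: oU.
(* Outside the domain of chart [m] the integrand is 0, so the domain of integration may be
   intersected with it. *)
have cut k W : open W -> (\int[lam2]_(y in U k `&` par k @^-1` W) (dens k f y)%:E =
    \int[lam2]_(y in U k `&` par k @^-1` (W `&` cdom m)) (dens k f y)%:E)%E.
  move=> oW; rewrite [LHS]integral_mkcond [RHS]integral_mkcond; apply: eq_integral => y _.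
  rewrite !patchE; have [dm|ndm] := pselect (cdom m (par k y)).
    have -> // : (y \in U k `&` par k @^-1` W) = (y \in U k `&` par k @^-1` (W `&` cdom m)).
    by apply/idP/idP; rewrite !inE /=; tauto.
  by have -> : (dens k f y)%:E = 0%E; [rewrite /dens foff// mul0r|case: ifP; case: ifP].
have step W : open W -> W `<=` cdom n ->
    (\int[lam2]_(y in U n `&` par n @^-1` W) (dens n f y)%:E =
     \int[lam2]_(y in U m `&` par m @^-1` W) (dens m f y)%:E)%E.
  move=> oW Wn; rewrite [LHS](cut n W oW).
  by have := tr_integral m n oW cf f0; rewrite (setIidl Wn); apply.
have subE k : U k `&` par k @^-1` E `<=` U k `&` par k @^-1` cdom n by move=> x [Ux [_ ?]].
have decomp k : (\int[lam2]_(y in U k `&` par k @^-1` cdom n) (dens k f y)%:E =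
   \int[lam2]_(y in U k `&` par k @^-1` D n) (dens k f y)%:E + \int[lam2]_(y in U k `&` par k @^-1` E) (dens k f y)%:E)%E.
  have oC : open (cdom n) by exact: cdom_open.
  have mC := meas k _ oC.
  have mUC : measurable (U k `&` par k @^-1` cdom n : set mR2) by exact: mopen.
  have mUE : measurable (U k `&` par k @^-1` E : set mR2) by exact: mopen.
  rewrite /D piece_split -ge0_integral_setU//.
  - by congr integral; rewrite setDE setUIl setUCl setIT (setUidl (subE k)).
  - exact: measurableD.
  - by rewrite setDE setUIl setUCl setIT (setUidl (subE k)).
  - by apply/disj_setPS => x /= [[_ h1] h2].
have lt_oo W : open W -> (\int[lam2]_(y in U m `&` par m @^-1` W) (dens m f y)%:E < +oo)%E.
  move=> oW; apply: le_lt_trans fin; apply: ge0_subset_integral => //.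
  - exact: mopen.
  - by apply: open_measurable2; exact: oU.
  - exact: dens_meas.
have sC := step _ (cdom_open (atlas S n)) (@subset_refl _ _).
have sE := step _ oE (fun x h => h.2).
have := decomp n; rewrite sC (decomp m) sE => /esym.
have f_fin : (\int[lam2]_(y in U m `&` par m @^-1` E) (dens m f y)%:E)%E \is a fin_num.
  rewrite ge0_fin_numE; first exact: lt_oo.
  by apply: integral_ge0 => y _; exact: d0.
exact: adde_cancel_fin f_fin.
Qed.

Lemma measurable_piece n : measurable (piece n : set mR2).
Proof. exact: mpiece. Qed.

Lemma dens_piece n f : continuous f -> measurable_fun (piece n : set mR2) (fun y => (dens n f y)%:E).
Proof.
by move=> cf; apply: measurable_funS (@dens_meas n _ cf) => //; [apply: open_measurable2; exact: oU|by move=> ? []].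
Qed.

Lemma dens_ge0 n f y : (forall p, 0 <= f p) -> (0 <= (dens n f y)%:E)%E.
Proof. by move=> f0; rewrite lee_fin mulr_ge0// area_ge0. Qed.

Lemma surface_integral_ge0 f : (forall p, 0 <= f p) -> (0 <= surface_integral F f)%E.
Proof.
move=> f0; rewrite surface_integralE; apply: nneseries_ge0 => n _ _.
by apply: integral_ge0 => y _; exact: dens_ge0.
Qed.

Lemma surface_integralD f g : continuous f -> continuous g -> (forall p, 0 <= f p) -> (forall p, 0 <= g p) ->
  (surface_integral F (fun p => (f p + g p)%R) = surface_integral F f + surface_integral F g)%E.
Proof.
move=> cf cg f0 g0; rewrite !surface_integralE -nneseriesD.
- apply: eq_eseriesr => n _; rewrite -ge0_integralD.
  + by apply: eq_integral => y _; rewrite /dens mulrDl EFinD.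
  + exact: measurable_piece.
  + by move=> y _; exact: dens_ge0.
  + exact: dens_piece.
  + by move=> y _; exact: dens_ge0.
  + exact: dens_piece.
- by move=> n _ _; apply: integral_ge0 => y _; exact: dens_ge0.
- by move=> n _ _; apply: integral_ge0 => y _; exact: dens_ge0.
Qed.

Lemma surface_integralZ (k : R) f : continuous f -> (forall p, 0 <= f p) -> 0 <= k ->
  (surface_integral F (fun p => (k * f p)%R) = k%:E * surface_integral F f)%E.
Proof.
move=> cf f0 k0; rewrite !surface_integralE -nneseriesZl.
- apply: eq_eseriesr => n _; rewrite -ge0_integralZl//.
  + by apply: eq_integral => y _; rewrite /dens -mulrA EFinM.
  + exact: measurable_piece.
  + exact: dens_piece.
  + by move=> y _; exact: dens_ge0.
- by move=> n _; apply: integral_ge0 => y _; exact: dens_ge0.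
Qed.

Lemma surface_integral_le f g : continuous f -> continuous g -> (forall p, 0 <= f p) ->
  (forall p, f p <= g p) -> (surface_integral F f <= surface_integral F g)%E.
Proof.
move=> cf cg f0 fg; rewrite !surface_integralE; apply: lee_nneseries.
  by move=> n _ _; apply: integral_ge0 => y _; exact: dens_ge0.
move=> n _; apply: ge0_le_integral.
- exact: measurable_piece.
- by move=> y _; exact: dens_ge0.
- exact: dens_piece.
- exact: dens_piece.
- by move=> y _; rewrite lee_fin ler_wpM2r// area_ge0.
Qed.

End SurfaceIntegral.

(** * Curves and chains of chart segments *)

(** If [P A] failed, the sets whose complement in [A] has property [P] would form a proper filter
    containing [A]. At a cluster point of this filter, a neighbourhood with property [P] would have
    its complement in the filter. *)
Lemma compact_ind (T : topologicalType) (A : set T) (P : set T -> Prop) :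
  compact A -> P set0 -> (forall B C, B `<=` C -> P C -> P B) ->
  (forall B C, P B -> P C -> P (B `|` C)) ->
  (forall x, A x -> exists2 N, nbhs x N & P N) -> P A.
Proof.
move=> cA P0 Pmono PU loc; apply: contrapT => nPA.
pose G : set_system T := [set C | P (A `\` C)].
have FG : ProperFilter G.
  apply: Build_ProperFilter_ex; last first.
    split; first by rewrite /G /= setDT.
      move=> B C /= PB PC; rewrite /G /= setDIr; exact: PU.
    by move=> B C BC; apply: Pmono => x [Ax nC]; split=> // /BC.
  move=> C GC; apply: contrapT => nC; apply: nPA.
  by apply: Pmono GC => x Ax; split=> // Cx; apply: nC; exists x.
have GA : G A by rewrite /G /= setDv.
have [x [Ax clx]] := cA G FG GA.
have [N nN PN] := loc x Ax.
have GN : G (~` N) by apply: Pmono PN => y [_ /contrapT].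
by have [y [nNy Ny]] := clx _ _ GN nN.
Qed.

Lemma connected_clopen (T : topologicalType) (A : set T) : connected [set: T] ->
  A !=set0 -> open A -> closed A -> A = setT.
Proof.
by move=> cT A0 oA cA; apply: cT => //; exists A => //; rewrite setTI.
Qed.

Lemma compact_setU (T : topologicalType) (A B : set T) : compact A -> compact B -> compact (A `|` B).
Proof.
move=> cA cB.
have -> : A `|` B = \big[setU/set0]_(b <- [:: true; false]) (if b then A else B).
  by rewrite !big_cons big_nil setU0.
by apply: bigsetU_compact => -[].
Qed.

(** * A C^1 step function from squares of positive parts *)

Section SquarePositivePart.
Variable R : realType.

Definition pos (t : R) : R := Num.max t 0.
Definition sqp (t : R) : R := pos t ^+ 2.

Lemma pos_ge0 t : 0 <= pos t. Proof. by rewrite /pos le_max lexx orbT. Qed.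
Lemma pos_id t : 0 <= t -> pos t = t. Proof. by move=> t0; rewrite /pos; apply/max_idPl. Qed.
Lemma pos_0 t : t <= 0 -> pos t = 0. Proof. by move=> t0; rewrite /pos; apply/max_idPr. Qed.

Lemma pos_cont : continuous pos.
Proof. by move=> t; apply: continuous_max; [exact: cvg_id|exact: cvg_cst]. Qed.

Lemma sqp_derive (t : R) : is_derive t 1 sqp (2 * pos t).
Proof.
case: (ltgtP t 0) => t0.
- rewrite pos_0 ?ltW// mulr0; apply: (@near_eq_is_derive _ _ _ (cst 0)).
  near=> s; rewrite /sqp pos_0 ?expr0n//; apply: ltW; near: s; exact: lt_nbhsl.
- rewrite pos_id ?ltW//; apply: (@near_eq_is_derive _ _ _ (fun s : R => s ^+ 2)).
    near=> s; rewrite /sqp pos_id//; apply: ltW; near: s; exact: lt_nbhsr.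
  have [d e] := @is_deriveX R R id 2 t 1 1 (is_derive_id t 1).
  by split; [exact: d|rewrite [LHS]e /GRing.scale /= mulr1 expr1].
(* At 0 the difference quotient of [sqp] is [pos], which is continuous with value 0. *)
- rewrite t0 pos_0// mulr0; apply/is_derive1_caratheodory; exists pos; split.
  + move=> z; rewrite /sqp (pos_0 (lexx 0)) expr0n subr0 subr0 expr2.
    by have [z0|z0] := ltP 0 z; [rewrite (pos_id (ltW z0))|rewrite (pos_0 z0) !mul0r].
  + exact: pos_cont.
  + exact: pos_0.
Unshelve. all: by end_near. Qed.

Lemma sqp_ge0 t : 0 <= sqp t. Proof. exact: sqr_ge0. Qed.
Lemma sqp_0 t : t <= 0 -> sqp t = 0. Proof. by move=> t0; rewrite /sqp pos_0// expr0n. Qed.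
Lemma sqp_gt0 t : 0 < t -> 0 < sqp t. Proof. by move=> t0; rewrite /sqp pos_id ?ltW// exprn_gt0. Qed.

(* a C^1 step function: 0 for t <= 0, 1 for t >= 1, piecewise quadratic in between *)
Definition sigma (t : R) : R := 2 * sqp t - 4 * sqp (t - 2^-1) + 2 * sqp (t - 1).
Definition sigma' (t : R) : R := 4 * pos t - 8 * pos (t - 2^-1) + 4 * pos (t - 1).

Lemma sigma_derive (t : R) : is_derive t 1 sigma (sigma' t).
Proof.
have h (c : R) : is_derive t 1 (fun s => sqp (s - c)) (2 * pos (t - c)).
  have d : is_derive t 1 (fun s : R => s - c) 1.
    by have [? e] := is_deriveB (is_derive_id t 1) (is_derive_cst c t 1); split=> //; rewrite e subr0.
  have [d1 e] := @is_derive1_comp R sqp (fun s => s - c) t _ _ (sqp_derive (t - c)) d.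
  by split; [exact: d1|rewrite [LHS]e mulr1].
have h0 : is_derive t 1 sqp (2 * pos t) := sqp_derive t.
have [d e] := is_deriveD (is_deriveB (is_deriveZ 2 h0) (is_deriveZ 4 (h 2^-1))) (is_deriveZ 2 (h 1)).
split; first exact: d.
transitivity (2 *: (2 * pos t) - 4 *: (2 * pos (t - 2^-1)) + 2 *: (2 * pos (t - 1))); first exact: e.
by rewrite /GRing.scale /= /sigma'; ring.
Qed.

Lemma pos_cases (t : R) : (t <= 0 /\ pos t = 0) \/ (0 <= t /\ pos t = t).
Proof. by have [h|/ltW h] := leP t 0; [left|right]; split=> //; [exact: pos_0|exact: pos_id]. Qed.

Lemma sigma'_bound t : 0 <= sigma' t <= 2.
Proof.
rewrite /sigma'; have [[h1 ->]|[h1 ->]] := pos_cases t;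
have [[h2 ->]|[h2 ->]] := pos_cases (t - 2^-1);
have [[h3 ->]|[h3 ->]] := pos_cases (t - 1); lra.
Qed.

Lemma sigma'_cont : continuous sigma'.
Proof.
move=> t.
have h (c : R) : {for t, continuous (fun s : R => pos (s - c) : R)}.
  apply: (@continuous_comp _ _ _ (fun s : R => s - c) pos); last exact: pos_cont.
  by apply: (@continuousB _ _ _ id (fun=> c)); [exact: cvg_id|exact: cvg_cst].
apply: (@continuousD _ _ _ (fun s => 4 * pos s - 8 * pos (s - 2^-1)) (fun s => 4 * pos (s - 1))).
  apply: (@continuousB _ _ _ (fun s => 4 * pos s) (fun s => 8 * pos (s - 2^-1))).
    by apply: (@continuousM _ _ (fun=> 4) pos); [exact: cvg_cst|exact: pos_cont].
  by apply: (@continuousM R R (fun=> 8) (fun s : R => pos (s - 2^-1))); [exact: cvg_cst|exact: h].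
by apply: (@continuousM R R (fun=> 4) (fun s : R => pos (s - 1))); [exact: cvg_cst|exact: h].
Qed.

Lemma sigma_0 t : t <= 0 -> sigma t = 0.
Proof. by move=> t0; rewrite /sigma !sqp_0; lra. Qed.

Lemma sigma_1 t : 1 <= t -> sigma t = 1.
Proof. by move=> t0; rewrite /sigma /sqp !pos_id; try lra; rewrite ?expr2; field. Qed.

Lemma sigma_01 t : 0 <= sigma t <= 1.
Proof.
have nd (a b : R) : a < b -> sigma a <= sigma b.
  move=> ab; have [c _ e] := MVT_cc ab (fun t _ => sigma_derive t).
  rewrite -subr_ge0 e mulr_ge0//; last by rewrite subr_ge0 ltW.
  by have /andP[] := sigma'_bound c.
apply/andP; split.
  by have [h|h] := leP t 0; [rewrite sigma_0|rewrite -(sigma_0 (lexx 0)); exact: nd].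
by have [h|h] := leP 1 t; [rewrite sigma_1|rewrite -(sigma_1 (lexx 1)); exact: nd].
Qed.

Lemma sigma_continuous : continuous sigma.
Proof.
by move=> t; apply: differentiable_continuous; apply/derivable1_diffP; have [] := sigma_derive t.
Qed.

End SquarePositivePart.

(** * C^1 curves *)

Section Curves.
Variable R : realType.

Lemma is_derive_pair (f g : R -> R) (t a b : R) : is_derive t 1 f a -> is_derive t 1 g b ->
  is_derive t 1 (fun s => (f s, g s)) (a, b).
Proof.
move=> [df ef] [dg eg].
have dd (k : R -> R) k' : derivable k t 1 -> 'D_1 k t = k' -> is_diff t k ( *:%R^~ k' : R -> R).
  move=> dk ek; split; first exact/derivable1_diffP.
  by rewrite deriv1E// derive1E ek.
have [D E] := is_diff_pair (dd _ _ df ef) (dd _ _ dg eg).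
split; first exact/derivable1_diffP.
by rewrite deriveE// E /= !scale1r.
Qed.


Definition c1at (V : normedModType R) (f : R -> V) (t : R) :=
  (\forall s \near t, derivable f s 1) /\ {for t, continuous ('D_1 f)}.

Lemma c1at_near (V : normedModType R) (f g : R -> V) t :
  {near t, f =1 g} -> c1at f t -> c1at g t.
Proof.
move=> fg [df cf]; have fg2 := near_join fg.
have eD : {near t, 'D_1 f =1 'D_1 g} by apply: filterS fg2 => s h; exact: near_eq_derive.
split.
  apply: filterS2 fg2 df => s h d.
  by have [? _] := near_eq_is_derive h (derivableP d).
suff : 'D_1 g s @[s --> t] --> 'D_1 g t by [].
rewrite -(nbhs_singleton eD); apply: cvg_trans cf; apply: near_eq_cvg.
by apply: filterS eD => y ->.
Qed.

Lemma c1at_of (V : normedModType R) (f f' : R -> V) (t : R) :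
  (\forall s \near t, is_derive s (1 : R) f (f' s)) -> {for t, continuous f'} -> c1at f t.
Proof.
move=> df cf'; split; first by apply: filterS df => s [].
suff : 'D_1 f s @[s --> t] --> 'D_1 f t by [].
have e : {near t, f' =1 'D_1 f} by apply: filterS df => s [_ ->].
rewrite -(nbhs_singleton e); apply: cvg_trans cf'; apply: near_eq_cvg.
by apply: filterS e => y ->.
Qed.

Lemma c1at_D (V : normedModType R) (f g : R -> V) t : c1at f t -> c1at g t -> c1at (fun s => f s + g s) t.
Proof.
move=> [df cf] [dg cg]; apply: (@c1at_of _ _ (fun s => 'D_1 f s + 'D_1 g s)); last exact: continuousD.
apply: filterS2 df dg => s d1 d2.
exact: (is_deriveD (derivableP d1) (derivableP d2)).
Qed.

Lemma c1at_cst (V : normedModType R) (a : V) t : c1at (fun=> a) t.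
Proof.
apply: (@c1at_of _ _ (fun=> 0)); last exact: cvg_cst.
by near=> s; exact: is_derive_cst.
Unshelve. all: by end_near. Qed.

Lemma c1at_affine (V : normedModType R) (f : R -> V) (k l : R) t : c1at f (k * t + l) ->
  c1at (fun s => f (k * s + l)) t /\ 'D_1 (fun s => f (k * s + l)) t = k *: 'D_1 f (k * t + l).
Proof.
move=> [df cf].
have ca (s : R) : (k * u + l) @[u --> s] --> k * s + l.
  by apply: (@continuousD _ _ _ ( *%R k) (fun=> l)); [exact: mulrl_continuous|exact: cvg_cst].
have da (s : R) : is_derive s 1 (fun u : R => k * u + l) k.
  have [d e] := is_deriveD (is_deriveZ k (is_derive_id s 1)) (is_derive_cst l s 1).
  split; first exact: d.
  by transitivity (k *: 1 + 0 : R); [exact: e|rewrite addr0 /GRing.scale /= mulr1].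
have H s : derivable f (k * s + l) 1 -> is_derive s 1 (fun u => f (k * u + l)) (k *: 'D_1 f (k * s + l)).
  move=> dfs; have [dd ee] := da s.
  have h1 : is_diff s (fun u : R => k * u + l) ( *:%R^~ k : R -> R).
    by split; [exact/derivable1_diffP|rewrite deriv1E// derive1E ee].
  have h2 : is_diff (k * s + l) f ( *:%R^~ ('D_1 f (k * s + l)) : R -> V).
    by split; [exact/derivable1_diffP|rewrite deriv1E// derive1E].
  have [D E] := is_diff_comp h1 h2.
  split; first exact/derivable1_diffP.
  by rewrite deriveE// E /= scale1r.
split; last by have [_ ->] := H t (nbhs_singleton df).
apply: (@c1at_of _ _ (fun s => k *: 'D_1 f (k * s + l))).
  by have h := ca t _ df; near=> s; apply: H; near: s; exact: h.
have c2 : {for t, continuous (fun s => 'D_1 f (k * s + l))}.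
  exact: (@continuous_comp _ _ _ (fun s : R => k * s + l) ('D_1 f) t (ca t) cf).
by apply: continuousZr.
Unshelve. all: by end_near. Qed.

(** The two-sided derivative exists, so it equals the left one. This is used at the junction of two
    curves. *)
Lemma derive_const_left (V : normedModType R) (f : R -> V) (t : R) a : derivable f t 1 ->
  (forall s, s <= t -> f s = a) -> 'D_1 f t = 0.
Proof.
move=> df fa.
have := df => /cvg_ex[l hl]; have e : 'D_1 f t = l by apply: cvg_lim.
rewrite e; have hl2 := cvg_dnbhs_at_left hl.
apply: (cvg_unique _ hl2) => //; apply: cvg_near_cst.
near=> h; rewrite /= (fa t)// fa ?subrr ?scaler0// /GRing.scale /= mulr1 gerDr.
by apply: ltW; near: h; exact: nbhs_left_lt.
Unshelve. all: by end_near. Qed.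

Lemma derive_const_right (V : normedModType R) (f : R -> V) (t : R) a : derivable f t 1 ->
  (forall s, t <= s -> f s = a) -> 'D_1 f t = 0.
Proof.
move=> df fa.
have := df => /cvg_ex[l hl]; have e : 'D_1 f t = l by apply: cvg_lim.
rewrite e; have hl2 := cvg_dnbhs_at_right hl.
apply: (cvg_unique _ hl2) => //; apply: cvg_near_cst.
near=> h; rewrite /= (fa t)// fa ?subrr ?scaler0// /GRing.scale /= mulr1 lerDr.
by apply: ltW; near: h; exact: nbhs_right_gt.
Unshelve. all: by end_near. Qed.

End Curves.

Lemma is_derive_diff (R : realType) (V W : normedModType R) (g : R -> V) (f : V -> W) t a :
  is_derive t (1 : R) g a -> differentiable f (g t) -> is_derive t (1 : R) (f \o g) ('D_a f (g t)).
Proof.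
move=> [dg eg] df; have dgt : differentiable g t by exact/derivable1_diffP.
have [D E] := is_diff_comp (differentiableP dgt) (differentiableP df).
split; first exact/derivable1_diffP.
rewrite deriveE//; transitivity ('d f (g t) ('d g t (1 : R))); first by rewrite E.
by rewrite -(deriveE _ df) -(deriveE _ dgt) eg.
Qed.

(** The two basis vectors are hidden behind an existential so that they remain abstract. *)
Lemma derive_split (R : realType) : exists v1 v2 : R * R, forall (W : normedModType R) (f : R * R -> W) x (u : R * R),
  differentiable f x -> 'D_u f x = u.1 *: 'D_v1 f x + u.2 *: 'D_v2 f x.
Proof.
exists (1, 0), (0, 1) => W f x u df.
have -> : u = u.1 *: ((1, 0) : R * R) + u.2 *: ((0, 1) : R * R).
  case: u => a b; transitivity (a * 1 + b * 0, a * 0 + b * 1) => //.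
  by rewrite !mulr1 !mulr0 addr0 add0r.
rewrite (deriveE _ df) linearD !linearZ /= -!(deriveE _ df).
by congr (_ *: _ + _ *: _); rewrite /GRing.scale /=; ring.
Qed.

Lemma fst_cont (R : realType) : continuous (fst : R * R -> R).
Proof. by move=> x; exact: cvg_fst. Qed.

Lemma snd_cont (R : realType) : continuous (snd : R * R -> R).
Proof. by move=> x; exact: cvg_snd. Qed.

Lemma c1at_comp (R : realType) (W : normedModType R) V (f : R * R -> W) (g g' : R -> R * R) t :
  open V -> smooth_on V f -> V (g t) -> (\forall s \near t, is_derive s (1 : R) g (g' s)) ->
  {for t, continuous g'} -> c1at (f \o g) t.
Proof.
have [v1 [v2 split12]] := derive_split R.
move=> oV sf Vt dg cg'.
have cg : {for t, continuous g}.
  have [d _] := nbhs_singleton dg; exact: differentiable_continuous (proj1 (derivable1_diffP _ _) d).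
have Vs : \forall s \near t, V (g s).
  by apply: cg; apply: open_nbhs_nbhs.
apply: (@c1at_of _ _ _ (fun s => (g' s).1 *: 'D_v1 f (g s) + (g' s).2 *: 'D_v2 f (g s))).
  apply: filterS2 dg Vs => s ds Vgs.
  have df := smooth_diff sf Vgs.
  by rewrite -(split12 _ _ _ _ df); exact: is_derive_diff.
have c1 : {for t, continuous (fun s => (g' s).1)}.
  exact: (cvg_comp g' fst cg' (@fst_cont R (g' t))).
have c2 : {for t, continuous (fun s => (g' s).2)}.
  exact: (cvg_comp g' snd cg' (@snd_cont R (g' t))).
have cD v : {for t, continuous (fun s => 'D_v f (g s))}.
  apply: (@continuous_comp _ _ _ g ('D_v f)) => //; apply: differentiable_continuous.
  exact: (smooth_diff (smooth_D v sf) Vt).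
by apply: continuousD; apply: continuousZ.
Qed.

Lemma enorm_cont (R : realType) : continuous (@enorm R).
Proof.
have cd : continuous (fun u : 'rV[R]_3 => dot u u).
  have E : (fun u : 'rV[R]_3 => dot u u) = (fun u => u 0 0 * u 0 0 + u 0 1 * u 0 1 + u 0 ord_max * u 0 ord_max).
    by apply/funext => u; rewrite dotE.
  rewrite E => u.
  have cc c : {for u, continuous (fun u : 'rV[R]_3 => u 0 c * u 0 c)}.
    by apply: continuousM; exact: coord3_continuous.
  exact: (@continuousD _ _ _ (fun u : 'rV[R]_3 => u 0 0 * u 0 0 + u 0 1 * u 0 1) (fun u => u 0 ord_max * u 0 ord_max) u (@continuousD _ _ _ (fun u : 'rV[R]_3 => u 0 0 * u 0 0) (fun u => u 0 1 * u 0 1) u (cc 0) (cc 1)) (cc ord_max)).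
move=> u; exact: (continuous_comp (cd u) (@sqrt_continuous R (dot u u))).
Qed.

(** * Curves on the surface and chains of segments *)

Section Chains.
Variables (R : realType) (S : surface R) (F : S -> 'rV[R]_3).
Hypothesis imm : smooth_immersion F.
Local Notation U n := (ccod (atlas S n)).
Local Notation par n := (par (atlas S n)).
Local Notation crd n := (crd (atlas S n)).
Local Notation cdom n := (cdom (atlas S n)).
Local Notation X n := (local_param F n).

Lemma near_dom n (q : S) : cdom n q -> \forall q' \near q, cdom n q'.
Proof. by move=> h; apply: open_nbhs_nbhs; split=> //; exact: cdom_open. Qed.

Definition vel n x (v : R * R) : 'rV[R]_3 := v.1 *: d1 (X n) x + v.2 *: d2 (X n) x.
Definition spd n x v := enorm (vel n x v).

Lemma velE n x v : U n x -> 'D_v (X n) x = vel n x v.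
Proof. by move=> Ux; exact: (derive_d v (@smX _ _ _ imm n) Ux). Qed.

Definition c1c (c : R -> S) := continuous c /\ forall n t, cdom n (c t) -> c1at (crd n \o c) t.

Lemma c1c_curve c : c1c c -> C1_curve c.
Proof. by move=> [cc h]; split=> // n t /h[d c']; split=> //; exact: nbhs_singleton d. Qed.

Lemma curve_c1c c : C1_curve c -> c1c c.
Proof.
move=> [cc h]; split=> // n t dt; split; last by have [] := h n t dt.
have nd : \forall s \near t, cdom n (c s) by exact: cc _ _ (near_dom dt).
by apply: filterS nd => s ds; have [] := h n s ds.
Qed.

Lemma near_X (c : R -> S) n (t : R) : continuous c -> cdom n (c t) -> \forall s \near t, (X n \o (crd n \o c)) s = (F \o c) s.
Proof.
move=> cc dt; have nd : \forall s \near t, cdom n (c s) by exact: cc _ _ (near_dom dt).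
by apply: filterS nd => s ds; rewrite /= /local_param /= crdK.
Qed.

Lemma F_derive c n t : c1c c -> cdom n (c t) ->
  is_derive t (1 : R) (F \o c) (vel n (crd n (c t)) ('D_1 (crd n \o c) t)).
Proof.
move=> [cc h] dt; have [d _] := h n t dt.
apply: (near_eq_is_derive (near_X cc dt)).
have Ut := crd_ccod dt.
rewrite -(velE _ Ut); apply: is_derive_diff; first exact: derivableP (nbhs_singleton d).
exact: smooth_diff (@smX _ _ _ imm n) Ut.
Qed.

Lemma F_c1at c t : c1c c -> c1at (F \o c) t.
Proof.
move=> [cc h]; have [n dt] := atlas_cover (c t); have [d c'] := h n t dt.
apply: (c1at_near (near_X cc dt)).
apply: (@c1at_comp _ _ (U n) _ _ ('D_1 (crd n \o c))) => //.
- exact: oU.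
- exact: smX.
- exact: crd_ccod.
- by apply: filterS d => s; exact: derivableP.
Qed.

Lemma chart_curve n (g g' : R -> R * R) : (forall t, is_derive t (1 : R) g (g' t)) -> continuous g' ->
  (forall t, U n (g t)) -> c1c (par n \o g) /\
  forall t, 'D_1 (F \o (par n \o g)) t = vel n (g t) (g' t).
Proof.
move=> dg cg' Ug.
have cg : continuous g.
  move=> t; have [d _] := dg t; exact: differentiable_continuous (proj1 (derivable1_diffP _ _) d).
split; first split.
- by move=> t; apply: continuous_comp; [exact: cg|exact: par_continuous].
- move=> m t dt; change (c1at (tr S n m \o g) t); apply: (@c1at_comp _ _ (trdom S n m) (tr S n m) g g') => //.
  + exact: open_trdom.
  + exact: atlas_smooth.
  + by near=> s; exact: dg.
  + exact: cg'.
- move=> t; rewrite -(velE _ (Ug t)).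
  have dX := smooth_diff (@smX _ _ _ imm n) (Ug t).
  by have [_] := is_derive_diff (dg t) dX.
Unshelve. all: by end_near. Qed.


(** The curves are constant outside [[0, l]], so their velocity vanishes at both ends and two of
    them join in a C^1 way. *)
Definition gcurve (l : R) (p q : S) (c : R -> S) :=
  [/\ c1c c, forall t, enorm ('D_1 (F \o c) t) <= 1,
      forall t, t <= 0 -> c t = p & forall t, l <= t -> c t = q].

Definition segm (x x' : R * R) (t : R) : R * R := (x.1 + t * (x'.1 - x.1), x.2 + t * (x'.2 - x.2)).
Definition diffp (x x' : R * R) : R * R := (x'.1 - x.1, x'.2 - x.2).

(* Chains of chart segments of speed at most c stand in for curves: [reach l p q] means that a chain
   of total length at most l joins p to q, and reparametrizing each segment by [sigma] turns the
   chain into a C^1 curve. *)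
Definition step (c : R) (p q : S) := 0 < c /\ exists n x x',
  [/\ p = par n x, q = par n x', forall t, 0 <= t <= 1 -> U n (segm x x' t) &
      forall t, 0 <= t <= 1 -> spd n (segm x x' t) (diffp x x') <= c].

Lemma spdZ n x k v : spd n x (k * v.1, k * v.2) = `|k| * spd n x v.
Proof. by rewrite /spd /vel /= -!scalerA -scalerDr enormZ. Qed.

Lemma sigma_affine_derive (a k b t : R) :
  is_derive t (1 : R) (fun s => a + sigma (k * s) * b) (k * sigma' (k * t) * b).
Proof.
have d1 : is_derive t (1 : R) (fun s : R => k * s) k.
  have [d e] := is_deriveZ k (is_derive_id t 1).
  by split; [exact: d|rewrite [LHS]e /GRing.scale /= mulr1].
have d2 : is_derive t (1 : R) (fun s => sigma (k * s)) (k * sigma' (k * t)).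
  have [d e] := @is_derive1_comp R (@sigma R) (fun s => k * s) t _ _ (sigma_derive (k * t)) d1.
  by split; [exact: d|rewrite [LHS]e mulrC].
have [d e] := is_deriveD (is_derive_cst a t 1) (is_deriveZ b d2).
have E : (fun s => a + sigma (k * s) * b) = cst a + b *: (fun s => sigma (k * s)).
  by apply/funext => s /=; rewrite mulrC.
split; rewrite E; first exact: d.
by rewrite [LHS]e /GRing.scale /= add0r mulrC.
Qed.

(** The parameter sigma(t / (2 c)) has derivative at most 1 / c because [sigma'] is at most 2; a
    segment of speed at most [c] thus becomes a curve of speed at most 1 over a time of 2 c. *)
Lemma step_gcurve c p q : step c p q -> exists cv, gcurve (2 * c) p q cv.
Proof.
move=> [c0 [n [x [x' [-> -> hU hs]]]]].
have c2 : 0 < 2 * c by rewrite mulr_gt0.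
pose k : R := (2 * c)^-1; have k0 : 0 < k by rewrite invr_gt0.
pose g t := segm x x' (sigma (k * t)).
pose g' t : R * R := (k * sigma' (k * t) * (x'.1 - x.1), k * sigma' (k * t) * (x'.2 - x.2)).
have ck : continuous (fun t : R => sigma' (k * t)).
  by move=> t; apply: (@continuous_comp _ _ _ ( *%R k) (@sigma' R)); [exact: mulrl_continuous|exact: sigma'_cont].
have dg t : is_derive t (1 : R) g (g' t) by apply: is_derive_pair; exact: sigma_affine_derive.
have cg' : continuous g'.
  have cm (y : R) : continuous (fun t => k * sigma' (k * t) * y).
    move=> t; apply: (@continuousM _ _ (fun t => k * sigma' (k * t)) (fun=> y)); last exact: cvg_cst.
    by apply: (@continuousM _ _ (fun=> k) (fun t => sigma' (k * t))); [exact: cvg_cst|exact: ck].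
  by move=> t; exact: (cvg_pair (cm _ t) (cm _ t)).
have [cv Dv] := chart_curve dg cg' (fun t => hU _ (sigma_01 (k * t))).
exists (par n \o g); split; first exact: cv.
- move=> t; rewrite Dv -/(spd _ _ _).
  have -> : spd n (g t) (g' t) = `|k * sigma' (k * t)| * spd n (g t) (diffp x x') by rewrite -spdZ.
  have /andP[s0 s2] := sigma'_bound (k * t).
  rewrite ger0_norm; last by rewrite mulr_ge0// ltW.
  have h := hs _ (sigma_01 (k * t)); rewrite -/(g t) in h.
  have hk : k * (2 * c) = 1 by rewrite mulVf// gt_eqF.
  have sp0 : 0 <= spd n (g t) (diffp x x') by exact: enorm_ge0.
  rewrite -hk -mulrA ler_pM2l//; apply: ler_pM => //.
- move=> t t0; rewrite /g /= sigma_0 ?pmulr_rle0// /segm !mul0r !addr0; by case: (x).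
- move=> t t0; rewrite /g /= sigma_1; last by rewrite mulrC ler_pdivlMr// mul1r.
  by rewrite /segm !mul1r !(addrC _ (_ - _)) !subrK; case: (x').
Qed.

Lemma gcurve_cat (l1 l2 : R) p q r c1 c2 : 0 <= l1 -> 0 <= l2 -> gcurve l1 p q c1 -> gcurve l2 q r c2 ->
  exists c, gcurve (l1 + l2) p r c.
Proof.
move=> l10 l20 [[cc1 h1] s1 a1 b1] [[cc2 h2] s2 a2 b2].
pose c (t : R) := if t <= l1 then c1 t else c2 (1 * t + - l1).
have cl t : t <= l1 -> c t = c1 t by rewrite /c => ->.
have cr t : l1 <= t -> c t = c2 (1 * t + - l1).
  rewrite /c => t1; case: ifPn => // t2; have -> : t = l1 by apply/eqP; rewrite eq_le t2.
  by rewrite mul1r subrr b1// a2.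
have aff (t : R) : (1 * u + - l1) @[u --> t] --> 1 * t + - l1.
  by apply: (@continuousD _ _ _ ( *%R (1 : R)) (fun=> - l1)); [exact: mulrl_continuous|exact: cvg_cst].
have cc2' : continuous (fun t : R => c2 (1 * t + - l1)).
  by move=> t; apply: (@continuous_comp _ _ _ (fun t : R => 1 * t + - l1) c2); [exact: aff|exact: cc2].
(* At every time at least one of the two curves sits at [q]. In any coordinates the joined curve is
   therefore a sum of two C^1 curves minus a constant, which settles its regularity at the
   junction. *)
have EE (V : zmodType) (f : S -> V) (t : R) : f (c t) = f (c1 t) + f (c2 (1 * t + - l1)) - f q.
  have [t1|/ltW t1] := leP t l1.
    by rewrite cl// (a2 (1 * t + - l1)) ?mul1r ?subr_le0// addrK.
  by rewrite cr// (b1 t t1) [RHS]addrC addKr.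
have cc : continuous c.
  move=> t; have [t1|t1|t1] := ltgtP t l1.
  - suff : c s @[s --> t] --> c t by [].
    rewrite cl ?ltW//; apply: cvg_trans (cc1 t); apply: near_eq_cvg.
    by near=> s; rewrite cl//; apply: ltW; near: s; exact: lt_nbhsl.
  - suff : c s @[s --> t] --> c t by [].
    rewrite cr ?ltW//; apply: cvg_trans (cc2' t); apply: near_eq_cvg.
    by near=> s; rewrite cr//; apply: ltW; near: s; exact: lt_nbhsr.
  - move=> W; rewrite cl ?t1//= => nW.
    have n1 := cc1 t W; rewrite t1 in n1; have /n1 h3 := nW.
    have e : c1 l1 = c2 (1 * l1 + - l1) by rewrite b1// a2// mul1r subrr.
    have n2 := cc2' l1 W; rewrite /= -e in n2; have /n2 h4 := nW.
    have h3' : \forall s \near l1, W (c1 s) by exact: h3.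
    have h4' : \forall s \near l1, W (c2 (1 * s + - l1)) by exact: h4.
    suff : \forall s \near l1, W (c s) by [].
    apply: filterS2 h3' h4' => s w1 w2.
    by have [t2|/ltW t2] := leP s l1; [rewrite cl|rewrite cr].
have D1 t : derivable (F \o c1) t 1 by exact: nbhs_singleton (F_c1at t (conj cc1 h1)).1.
have D2 t : derivable (F \o c2) t 1 by exact: nbhs_singleton (F_c1at t (conj cc2 h2)).1.
have D2' t : is_derive t (1 : R) (fun s : R => (F \o c2) (1 * s + - l1)) ('D_1 (F \o c2) (1 * t + - l1)).
  have [[d _] e] := c1at_affine (F_c1at (1 * t + - l1) (conj cc2 h2)).
  by split; [exact: nbhs_singleton d|rewrite [LHS]e scale1r].
exists c; split.
- split=> // n t dt.
  have [t1|t1|t1] := ltgtP t l1.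
  + rewrite cl ?(ltW t1)// in dt; apply: c1at_near (h1 n t dt).
    by near=> s; rewrite /= cl//; apply: ltW; near: s; exact: lt_nbhsl.
  + rewrite cr ?(ltW t1)// in dt; apply: c1at_near (c1at_affine (h2 n _ dt)).1.
    by near=> s; rewrite /= cr//; apply: ltW; near: s; exact: lt_nbhsr.
  + have d1 : cdom n (c1 t) by rewrite -cl ?t1// -t1.
    have d2 : cdom n (c2 (1 * t + - l1)) by rewrite -cr ?t1// -t1.
    have := c1at_D (c1at_D (h1 n t d1) (c1at_affine (h2 n _ d2)).1) (c1at_cst (- crd n q) t).
    by apply: c1at_near; near=> s; rewrite /= EE.
- move=> t; have E : F \o c = (F \o c1) + (fun s : R => (F \o c2) (1 * s + - l1)) + cst (- F q).
    by apply/funext => s; rewrite /= EE.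
  have [_ e] := is_deriveD (is_deriveD (derivableP (D1 t)) (D2' t)) (is_derive_cst (- F q) t 1).
  have -> : 'D_1 (F \o c) t = 'D_1 (F \o c1) t + 'D_1 (F \o c2) (1 * t + - l1).
    by rewrite E; transitivity ('D_1 (F \o c1) t + 'D_1 (F \o c2) (1 * t + - l1) + 0); [exact: e|rewrite addr0].
  have [t1|/ltW t1] := leP t l1.
    rewrite (derive_const_left (a := F q) (D2 _)) ?addr0//.
    move=> s st; rewrite /= a2//; apply: le_trans st _; by rewrite mul1r subr_le0.
  rewrite (derive_const_right (a := F q) (D1 _)) ?add0r//.
  by move=> s st; rewrite /= b1//; apply: le_trans st.
- by move=> t t0; rewrite cl ?a1//; apply: le_trans l10.
- move=> t t0; rewrite cr; last by apply: le_trans t0; rewrite lerDl.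
  by rewrite b2// mul1r lerBrDl.
Unshelve. all: by end_near. Qed.

Lemma gcurve_dist (l : R) p q c : 0 < l -> gcurve l p q c -> (induced_dist F p q <= l%:E)%E.
Proof.
move=> l0 [cc s1 a1 b1]; have [c0 h0] := cc.
pose c' (t : R) := c (l * t + 0).
have ca (t : R) : (l * u + 0) @[u --> t] --> l * t + 0.
  by apply: (@continuousD _ _ _ ( *%R l) (fun=> (0 : R))); [exact: mulrl_continuous|exact: cvg_cst].
have cc' : c1c c'.
  split; first by move=> t; apply: (@continuous_comp _ _ _ (fun t : R => l * t + 0) c); [exact: ca|exact: c0].
  by move=> n t dt; exact: (c1at_affine (h0 n _ dt)).1.
have sp t : enorm ('D_1 (F \o c') t) <= l.
  have [_ e] := c1at_affine (F_c1at (l * t + 0) cc).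
  have -> : 'D_1 (F \o c') t = l *: 'D_1 (F \o c) (l * t + 0) by exact: e.
  by rewrite enormZ gtr0_norm// -[leRHS]mulr1 ler_pM2l.
apply: (@le_trans _ _ (curve_length F c')).
  apply: ereal_inf_lbound; exists c' => //; split.
  - exact: c1c_curve.
  - by rewrite /c' a1// mulr0 addr0.
  - by rewrite /c' b1// mulr1 addr0.
have cD : continuous ('D_1 (F \o c')) by move=> t; exact: (F_c1at t cc').2.
rewrite /curve_length; apply: (@le_trans _ _ (\int[lebesgue_measure]_(t in `[0%R, 1%R]) (cst l%:E) t)%E); last first.
  by rewrite integral_cst//= lebesgue_measure_itv /= lte01 sube0 mule1.
apply: ge0_le_integral => //=.
- by move=> t _; rewrite lee_fin enorm_ge0.
- apply: measurableT_comp => //; apply: measurable_funS (continuous_measurable_fun _) => //.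
  by move=> t; exact: (continuous_comp (cD t) (@enorm_cont R _)).
- by move=> t _; rewrite lee_fin.
Qed.

Inductive reach : R -> S -> S -> Prop :=
| reach0 p : reach 0 p p
| reachS l c p q r : reach l p q -> step c q r -> reach (l + c) p r.

Lemma reach_ge0 l p q : reach l p q -> 0 <= l.
Proof. by elim=> {l p q} // l c p q r _ l0 [c0 _]; rewrite addr_ge0// ltW. Qed.

Lemma reach_gcurve l p q : reach l p q -> exists c, gcurve (2 * l) p q c.
Proof.
elim=> {l p q} [p|l c p q r hr [c1 h1] st].
  exists (cst p); split=> //.
  - split; first exact: cst_continuous.
    by move=> n t dt; exact: (c1at_cst (crd n p) t).
  - by move=> t; rewrite (_ : F \o cst p = cst (F p))// derive_cst enorm0.
have [c2 h2] := step_gcurve st; rewrite mulrDr; apply: gcurve_cat h1 h2.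
  by rewrite mulr_ge0//; exact: reach_ge0 hr.
by rewrite mulr_ge0//; case: st => /ltW.
Qed.

Lemma reach_dist (l l' : R) p q : reach l p q -> 0 < l' -> 2 * l <= l' -> (induced_dist F p q <= l'%:E)%E.
Proof.
move=> hr l0 ll; have [c [h1 h2 h3 h4]] := reach_gcurve hr.
apply: (@gcurve_dist _ _ _ c) => //; split=> // t t0; apply: h4; exact: le_trans ll t0.
Qed.


Lemma segm_0 x x' : segm x x' 0 = x.
Proof. by rewrite /segm !mul0r !addr0; case: (x). Qed.

Lemma segm_1 x x' : segm x x' 1 = x'.
Proof. by rewrite /segm !mul1r !(addrC _ (_ - _)) !subrK; case: (x'). Qed.

Lemma segm_part x x' s t r : segm (segm x x' s) (segm x x' t) r = segm x x' (s + r * (t - s)).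
Proof. by rewrite /segm /=; congr pair; ring. Qed.

Lemma diffp_part x x' s t : diffp (segm x x' s) (segm x x' t) = ((t - s) * (diffp x x').1, (t - s) * (diffp x x').2).
Proof. by rewrite /diffp /segm /=; congr pair; ring. Qed.

Lemma convex01 (s t r : R) : 0 <= s <= 1 -> 0 <= t <= 1 -> 0 <= r <= 1 -> 0 <= s + r * (t - s) <= 1.
Proof.
move=> /andP[s0 s1] /andP[t0 t1] /andP[r0 r1].
have -> : s + r * (t - s) = (1 - r) * s + r * t by ring.
have h1 : 0 <= (1 - r) * s by rewrite mulr_ge0// subr_ge0.
have h2 : 0 <= r * t by rewrite mulr_ge0.
have h3 : 0 <= (1 - r) * (1 - s) by rewrite mulr_ge0// subr_ge0.
have h4 : 0 <= r * (1 - t) by rewrite mulr_ge0// subr_ge0.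
by apply/andP; split; nra.
Qed.

Lemma step_part n x x' c s t : s != t -> 0 < c -> 0 <= s <= 1 -> 0 <= t <= 1 ->
  (forall t, 0 <= t <= 1 -> U n (segm x x' t)) ->
  (forall t, 0 <= t <= 1 -> spd n (segm x x' t) (diffp x x') <= c) ->
  step (`|t - s| * c) (par n (segm x x' s)) (par n (segm x x' t)).
Proof.
move=> st c0 s01 t01 hU hs; split; first by rewrite mulr_gt0// normr_gt0 subr_eq0 eq_sym.
exists n, (segm x x' s), (segm x x' t); split=> // r r01; rewrite segm_part.
  by apply: hU; exact: convex01.
by rewrite diffp_part spdZ ler_wpM2l// hs//; exact: convex01.
Qed.

Lemma step_sym c p q : step c p q -> step c q p.
Proof.
move=> [c0 [n [x [x' [-> -> hU hs]]]]].
have := @step_part n x x' c 1 0 _ c0 _ _ hU hs.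
rewrite sub0r normrN normr1 mul1r segm_0 segm_1; apply; rewrite ?oner_eq0 ?lexx ?ler01//.
Qed.


Lemma reach1 c p q : step c p q -> reach c p q.
Proof. by move=> st; rewrite -[c]add0r; apply: reachS st; exact: reach0. Qed.

Lemma reach_trans l1 l2 p q r : reach l1 p q -> reach l2 q r -> reach (l1 + l2) p r.
Proof.
move=> h1 h2; elim: h2 h1 => {l2 q r} [q|l c q r s _ IH st] h1; first by rewrite addr0.
by rewrite addrA; apply: reachS st; exact: IH.
Qed.

Lemma reach_sym l p q : reach l p q -> reach l q p.
Proof.
elim=> {l p q} [p|l c p q r _ IH st]; first exact: reach0.
by rewrite addrC; apply: reach_trans IH; apply: reach1; exact: step_sym.
Qed.

(** A chain can be cut at any length: inside a segment of bound [c] the cut is made at the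
    proportional parameter, and each part keeps the proportional bound. *)
Lemma reach_split (l m : R) p q : reach l p q -> 0 <= m <= l -> exists2 r, reach m p r & reach (l - m) r q.
Proof.
move=> h; elim: h m => {l p q} [p|l c p q r hl IH st] m /andP[m0 ml].
  have -> : m = 0 by apply/eqP; rewrite eq_le ml.
  by exists p; rewrite ?subrr; exact: reach0.
have [ml'|lm] := leP m l.
  have [|s h1 h2] := IH m; first by rewrite m0.
  by exists s => //; rewrite addrAC; apply: reachS st.
have [e|ne] := eqVneq m (l + c).
  by exists r; rewrite e ?subrr; [exact: reachS st|exact: reach0].
have {ne ml} ml : m < l + c by rewrite lt_neqAle ne.
have [c0 [n [x [x' [qe re hU hs]]]]] := st.
pose t := (m - l) / c.
have t0 : 0 < t by rewrite divr_gt0// subr_gt0.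
have t1 : t < 1 by rewrite ltr_pdivrMr// mul1r ltrBlDl.
have t01 : 0 <= t <= 1 by rewrite !ltW.
have z01 : 0 <= (0 : R) <= 1 by rewrite lexx ler01.
have o01 : 0 <= (1 : R) <= 1 by rewrite lexx ler01.
have s1 := @step_part n x x' c 0 t (negbT (lt_eqF t0)) c0 z01 t01 hU hs.
have s2 := @step_part n x x' c t 1 (negbT (lt_eqF t1)) c0 t01 o01 hU hs.
have ce : c != 0 by rewrite gt_eqF.
rewrite subr0 gtr0_norm// segm_0 -qe /t mulfVK// in s1.
rewrite gtr0_norm ?subr_gt0// segm_1 -re mulrBl mul1r {1}/t mulfVK// in s2.
exists (par n (segm x x' t)).
  by rewrite -[m](subrK l) addrC; apply: reachS s1.
rewrite (_ : l + c - m = c - (m - l)); last by ring.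
exact: reach1.
Qed.

Lemma normal_box_le (x y : R * R) t : 0 <= t <= 1 -> `|(segm x y t).1 - x.1| <= `|y.1 - x.1| /\ `|(segm x y t).2 - x.2| <= `|y.2 - x.2|.
Proof.
move=> /andP[t0 t1]; rewrite /segm /= !(addrC _ (t * _)) !addrK !normrM (ger0_norm t0).
by split; rewrite ler_piMl.
Qed.

Lemma spd_sqr n y v : spd n y v ^+ 2 =
  v.1 ^+ 2 * EE (X n) y + 2 * v.1 * v.2 * FF (X n) y + v.2 ^+ 2 * GG (X n) y.
Proof.
rewrite /spd enorm_sqr /vel /EE /FF /GG; set a := d1 _ _; set b := d2 _ _; clearbody a b.
by rewrite !(dotDl, dotDr, dotZl, dotZr) (dotC b a); ring.
Qed.

Lemma EE_ge0 n y : 0 <= EE (X n) y. Proof. exact: dot_ge0. Qed.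
Lemma GG_ge0 n y : 0 <= GG (X n) y. Proof. exact: dot_ge0. Qed.
Lemma DDE n y : DD (X n) y = EE (X n) y * GG (X n) y - FF (X n) y ^+ 2. Proof. by []. Qed.
Lemma sqrt_EE n y : enorm (d1 (X n) y) = Num.sqrt (EE (X n) y). Proof. by []. Qed.
Lemma sqrt_GG n y : enorm (d2 (X n) y) = Num.sqrt (GG (X n) y). Proof. by []. Qed.

Local Opaque EE FF GG DD.

(** Completing squares: [EE] times the squared speed is v_2^2 times [DD] plus a square, and
    symmetrically with [GG]. This bounds the coordinates of [v]; the upper bound is the triangle
    inequality. *)
Lemma spd_bounds n y (k d : R) : EE (X n) y <= k -> GG (X n) y <= k -> 0 < d -> 0 < k -> d <= DD (X n) y ->
  forall v, [/\ Num.sqrt (d / k) * `|v.1| <= spd n y v, Num.sqrt (d / k) * `|v.2| <= spd n y v &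
    spd n y v <= Num.sqrt k * (`|v.1| + `|v.2|)].
Proof.
move=> Ek Gk d0 k0 dD v.
have s0 : 0 <= spd n y v by exact: enorm_ge0.
have sq := spd_sqr n y v.
have lb (a : R) : a ^+ 2 * DD (X n) y <= k * spd n y v ^+ 2 -> Num.sqrt (d / k) * `|a| <= spd n y v.
  move=> h; rewrite -(ler_pXn2r (n := 2))// ?nnegrE ?mulr_ge0 ?sqrtr_ge0//.
  rewrite exprMn sqr_sqrtr ?divr_ge0 ?(ltW d0) ?(ltW k0)// (real_normK (num_real a)) mulrAC ler_pdivrMr// [leRHS]mulrC.
  by apply: le_trans h; rewrite mulrC ler_wpM2l// sqr_ge0.
have b2 : 0 <= spd n y v ^+ 2 by exact: sqr_ge0.
split.
- apply: lb; apply: (@le_trans _ _ (GG (X n) y * spd n y v ^+ 2)); last exact: (ler_wpM2r b2 Gk).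
  rewrite sq DDE -subr_ge0.
  have -> : GG (X n) y * (v.1 ^+ 2 * EE (X n) y + 2 * v.1 * v.2 * FF (X n) y + v.2 ^+ 2 * GG (X n) y) -
    v.1 ^+ 2 * (EE (X n) y * GG (X n) y - FF (X n) y ^+ 2) = (v.1 * FF (X n) y + v.2 * GG (X n) y) ^+ 2 by ring.
  exact: sqr_ge0.
- apply: lb; apply: (@le_trans _ _ (EE (X n) y * spd n y v ^+ 2)); last exact: (ler_wpM2r b2 Ek).
  rewrite sq DDE -subr_ge0.
  have -> : EE (X n) y * (v.1 ^+ 2 * EE (X n) y + 2 * v.1 * v.2 * FF (X n) y + v.2 ^+ 2 * GG (X n) y) -
    v.2 ^+ 2 * (EE (X n) y * GG (X n) y - FF (X n) y ^+ 2) = (v.2 * FF (X n) y + v.1 * EE (X n) y) ^+ 2 by ring.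
  exact: sqr_ge0.
- have : spd n y v <= `|v.1| * enorm (d1 (X n) y) + `|v.2| * enorm (d2 (X n) y) := enorm_comb_le _ _ _ _.
  move=> /le_trans; apply; rewrite mulrDr sqrt_EE sqrt_GG ![_ * Num.sqrt _]mulrC.
  exact: lerD (ler_wpM2r (normr_ge0 _) (ler_wsqrtr Ek)) (ler_wpM2r (normr_ge0 _) (ler_wsqrtr Gk)).
Qed.

(** Near a point [EE] and [GG] stay below a common [k] and [DD] stays above half its value, so the
    metric is uniformly comparable to the coordinate norm. *)
Lemma chart_bounds n x : U n x -> exists r K m : R, [/\ 0 < r, 0 < K, 0 < m &
  forall y, `|y.1 - x.1| <= r -> `|y.2 - x.2| <= r -> U n y /\ forall v,
    [/\ m * `|v.1| <= spd n y v, m * `|v.2| <= spd n y v & spd n y v <= K * (`|v.1| + `|v.2|)]].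
Proof.
move=> Ux; have oUn := @oU _ S n; have sX := @smX _ _ _ imm n.
have E0 : 0 <= EE (X n) x by exact: EE_ge0.
have G0 : 0 <= GG (X n) x by exact: GG_ge0.
have aux (a b g : R) : a - b < 1 -> 0 <= b -> 0 <= g -> a <= b + g + 1 /\ 0 < b + g + 1 by lra.
have aux2 (a b : R) : b - a < b / 2 -> b / 2 <= a by lra.
have D0 : 0 < DD (X n) x by exact: DD_gt0 (immX imm n) Ux.
have D20 : 0 < DD (X n) x / 2 by rewrite divr_gt0.
have nU : \forall y \near x, U n y by apply: open_nbhs_nbhs.
have cE := cont_near_lt (hasC1_cont (hasC1_EE oUn sX) Ux) ltr01.
have cG := cont_near_lt (hasC1_cont (hasC1_GG oUn sX) Ux) ltr01.
have cD := cont_near_lt (DD_cont oUn sX Ux) D20.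
have [r r0 hr] := near_box (filterI (filterI nU cE) (filterI cG cD)).
pose k := EE (X n) x + GG (X n) x + 1.
have k0 : 0 < k by exact: ltr_wpDl (addr_ge0 E0 G0) ltr01.
have r2 : r / 2 < r by rewrite ltr_pdivrMr// ltr_pMr// ltr1n.
exists (r / 2), (Num.sqrt k), (Num.sqrt (DD (X n) x / 2 / k)); split; try by rewrite ?sqrtr_gt0 ?divr_gt0.
move=> y y1 y2.
have := hr y.1 y.2 (le_lt_trans y1 r2) (le_lt_trans y2 r2); rewrite -surjective_pairing.
move=> [[Uy hE] [hG hD]]; split; first exact: Uy.
apply: spd_bounds; [| |exact: D20|exact: k0|].
- exact: (aux _ _ _ (ltr_normlW hE) E0 G0).1.
- by rewrite /k (addrC (EE _ _)); exact: (aux _ _ _ (ltr_normlW hG) G0 E0).1.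
- by apply: aux2; apply: ltr_normlW; rewrite distrC.
Qed.

Lemma near_step p e : 0 < e -> \forall q \near p, step e p q.
Proof.
move=> e0; have [n dp] := atlas_cover p; have Ux := crd_ccod dp.
have [r [K [m [r0 K0 m0 H]]]] := chart_bounds Ux.
(* The bound [r] keeps the segment in the box of [chart_bounds], and K (s + s) <= e bounds its
   speed. *)
pose s := Num.min r (e / (2 * K)).
have s0 : 0 < s by rewrite lt_min r0 divr_gt0// mulr_gt0.
have cc := crd_continuous dp.
have c1 : \forall q \near p, `|(crd n q).1 - (crd n p).1| < s.
  have := cvg_comp (crd n) fst cc (@fst_cont R (crd n p)) => /cvgrPdist_lt/(_ s s0).
  by apply: filterS => q; rewrite distrC.
have c2 : \forall q \near p, `|(crd n q).2 - (crd n p).2| < s.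
  have := cvg_comp (crd n) snd cc (@snd_cont R (crd n p)) => /cvgrPdist_lt/(_ s s0).
  by apply: filterS => q; rewrite distrC.
have near_d := near_dom dp; near=> q.
have dq : cdom n q by near: q.
have h1 : `|(crd n q).1 - (crd n p).1| <= s by apply: ltW; near: q.
have h2 : `|(crd n q).2 - (crd n p).2| <= s by apply: ltW; near: q.
have sr : s <= r by rewrite ge_min lexx.
have se : s <= e / (2 * K) by rewrite ge_min lexx orbT.
split=> //; exists n, (crd n p), (crd n q); rewrite !crdK//; split=> // t t01.
  have [b1 b2] := normal_box_le (crd n p) (crd n q) t01.
  by have [] := H (segm (crd n p) (crd n q) t) (le_trans b1 (le_trans h1 sr)) (le_trans b2 (le_trans h2 sr)).
have [b1 b2] := normal_box_le (crd n p) (crd n q) t01.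
have [_ h] := H (segm (crd n p) (crd n q) t) (le_trans b1 (le_trans h1 sr)) (le_trans b2 (le_trans h2 sr)).
have [_ _ h3] := h (diffp (crd n p) (crd n q)); apply: le_trans h3 _.
apply: (@le_trans _ _ (K * (s + s))); first by rewrite ler_pM2l// lerD.
by rewrite -mulr2n -mulr_natl mulrCA mulrA -ler_pdivlMl ?mulr_gt0// mulrC.
Unshelve. all: by end_near. Qed.

Lemma hasC1_dotX n (e : 'rV[R]_3) :
  hasC1 (U n) (fun x => dot (X n x) e) (fun x => dot (d1 (X n) x) e) (fun x => dot (d2 (X n) x) e).
Proof.
have oUn := @oU _ S n; have sX := @smX _ _ _ imm n.
apply: (hasC1_ext oUn (hasC1_dot oUn (hasC1v_X sX) (hasC1v_cst e))) => y _.
by split=> //; rewrite (dotC _ 0) dot0l addr0.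
Qed.

Lemma affine_derive (a k t : R) : is_derive t (1 : R) (fun s => a + s * k) k.
Proof.
have [d E] := is_deriveD (is_derive_cst a t 1) (is_deriveM (is_derive_id t 1) (is_derive_cst k t 1)).
split; first exact: d.
by rewrite [LHS]E /= scaler0 add0r /GRing.scale /= mulr1 add0r.
Qed.

Lemma segm_derive U' f f1 f2 x x' t : hasC1 U' f f1 f2 -> U' (segm x x' t) ->
  is_derive t (1 : R) (fun s => f (segm x x' s))
    ((diffp x x').1 * f1 (segm x x' t) + (diffp x x').2 * f2 (segm x x' t)).
Proof.
move=> hX Ut.
exact: (@hasC1_curve _ _ _ _ _ (fun s => x.1 + s * (x'.1 - x.1)) (fun s => x.2 + s * (x'.2 - x.2)) _ _ t hX Ut (affine_derive _ _ _) (affine_derive _ _ _)).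
Qed.




End Chains.

(** * Bump functions *)

Section Bump.
Variable R : realType.

(** A C^1 plateau: 1 for |t| <= 1/2 and 0 for |t| >= 1. *)
Definition BB (t : R) : R := sigma (2 + 2 * t) * sigma (2 - 2 * t).
Definition BB' (t : R) : R :=
  2 * sigma' (2 + 2 * t) * sigma (2 - 2 * t) - sigma (2 + 2 * t) * (2 * sigma' (2 - 2 * t)).

Lemma sigma_comp_derive (k a t : R) : is_derive t (1 : R) (fun s => sigma (a + k * s)) (k * sigma' (a + k * t)).
Proof.
have d1 : is_derive t (1 : R) (fun s : R => a + k * s) k.
  have [d e] := is_deriveD (is_derive_cst a t 1) (is_deriveZ k (is_derive_id t 1)).
  by split; [exact: d|rewrite [LHS]e /GRing.scale /= mulr1 add0r].
have [d e] := @is_derive1_comp R (@sigma R) (fun s => a + k * s) t _ _ (sigma_derive (a + k * t)) d1.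
by split; [exact: d|rewrite [LHS]e mulrC].
Qed.

Lemma BB_derive (t : R) : is_derive t 1 BB (BB' t).
Proof.
have E (s : R) : 2 - 2 * s = 2 + - 2 * s by rewrite mulNr.
have [d e] := is_deriveM (sigma_comp_derive 2 2 t) (sigma_comp_derive (- 2) 2 t).
have EB : BB = (fun s : R => sigma (2 + 2 * s)) * (fun s : R => sigma (2 + - 2 * s)).
  by apply/funext => s; rewrite /BB E.
split; first by rewrite EB; exact: d.
by rewrite EB [LHS]e /BB' E /GRing.scale /=; ring.
Qed.

Lemma cont_affine (a k : R) : continuous (fun s : R => a + k * s).
Proof. by move=> t; apply: (@continuousD _ _ _ (fun=> a) ( *%R k)); [exact: cvg_cst|exact: mulrl_continuous]. Qed.

Lemma BB'_cont : continuous BB'.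
Proof.
move=> t; rewrite /BB'.
have E : (fun s : R => 2 - 2 * s) = (fun s => 2 + - 2 * s) by apply/funext => s; rewrite mulNr.
have cs (k : R) : {for t, continuous (fun s => sigma (2 + k * s))}.
  by apply: (@continuous_comp _ _ _ (fun s : R => 2 + k * s) (@sigma R)); [exact: cont_affine|exact: sigma_continuous].
have cs' (k : R) : {for t, continuous (fun s => 2 * sigma' (2 + k * s))}.
  apply: (@continuousM _ _ (fun=> 2) (fun s => sigma' (2 + k * s))); first exact: cvg_cst.
  by apply: (@continuous_comp _ _ _ (fun s : R => 2 + k * s) (@sigma' R)); [exact: cont_affine|exact: sigma'_cont].
have h := @continuousB _ _ _ (fun s : R => 2 * sigma' (2 + 2 * s) * sigma (2 + - 2 * s))
   (fun s : R => sigma (2 + 2 * s) * (2 * sigma' (2 + - 2 * s))) t (continuousM (cs' 2) (cs (- 2))) (continuousM (cs 2) (cs' (- 2))).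
suff -> : (fun t0 : R => 2 * sigma' (2 + 2 * t0) * sigma (2 - 2 * t0) - sigma (2 + 2 * t0) * (2 * sigma' (2 - 2 * t0))) =
  (fun s => 2 * sigma' (2 + 2 * s) * sigma (2 + - 2 * s) - sigma (2 + 2 * s) * (2 * sigma' (2 + - 2 * s))) by exact: h.
by apply/funext => s; rewrite mulNr.
Qed.

Lemma BB_01 t : 0 <= BB t <= 1.
Proof.
have /andP[a0 a1] := sigma_01 (2 + 2 * t); have /andP[b0 b1] := sigma_01 (2 - 2 * t).
by rewrite /BB mulr_ge0//= mulr_ile1.
Qed.

Lemma BB'_le t : `|BB' t| <= 8.
Proof.
have /andP[a0 a1] := sigma_01 (2 + 2 * t); have /andP[b0 b1] := sigma_01 (2 - 2 * t).
have /andP[c0 c1] := sigma'_bound (2 + 2 * t); have /andP[e0 e1] := sigma'_bound (2 - 2 * t).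
have h (x y : R) : 0 <= x <= 2 -> 0 <= y <= 1 -> 0 <= x * y <= 2.
  by move=> /andP[x0 x2] /andP[y0 y1]; rewrite mulr_ge0//= -[2]mulr1 ler_pM.
have /andP[u0 u1] := h _ _ (sigma'_bound (2 + 2 * t)) (sigma_01 (2 - 2 * t)).
have /andP[v0 v1] := h _ _ (sigma'_bound (2 - 2 * t)) (sigma_01 (2 + 2 * t)).
rewrite ler_norml /BB'; move: u0 u1 v0 v1; set A := sigma' _; set B := sigma _; set C := sigma' _; set D := sigma _.
by clearbody A B C D => *; apply/andP; split; lra.
Qed.

Lemma BB_1 t : `|t| <= 2^-1 -> BB t = 1.
Proof. by rewrite ler_norml => /andP[a b]; rewrite /BB !sigma_1 ?mulr1//; lra. Qed.

Lemma BB_0 t : 1 <= `|t| -> BB t = 0.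
Proof.
rewrite /BB; have [t0|t0] := ger0P t => h.
  by rewrite (@sigma_0 _ (2 - 2 * t)) ?mulr0//; lra.
by rewrite (@sigma_0 _ (2 + 2 * t)) ?mul0r//; lra.
Qed.

Lemma BB_neq0 t : BB t != 0 -> `|t| < 1.
Proof. by apply: contraNT; rewrite -leNgt => /BB_0 ->. Qed.

(** A product of two plateaus: 1 on the square of half-side r/2 around [x] and 0 outside that of
    half-side r; [chi1] and [chi2] are its partial derivatives. *)
Definition chi (x : R * R) (r : R) (y : R * R) : R := BB ((y.1 - x.1) * r^-1) * BB ((y.2 - x.2) * r^-1).
Definition chi1 (x : R * R) (r : R) (y : R * R) : R := BB' ((y.1 - x.1) * r^-1) * r^-1 * BB ((y.2 - x.2) * r^-1).
Definition chi2 (x : R * R) (r : R) (y : R * R) : R := BB ((y.1 - x.1) * r^-1) * (BB' ((y.2 - x.2) * r^-1) * r^-1).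

Definition box (x : R * R) (r : R) : set (R * R) := [set y | `|y.1 - x.1| <= r /\ `|y.2 - x.2| <= r].

Lemma hasC1_chi x r : hasC1 setT (chi x r) (chi1 x r) (chi2 x r).
Proof.
have h1 := hasC1_mul (hasC1_sub' (@hasC1_fst R setT) (@hasC1_cst R setT x.1)) (@hasC1_cst R setT r^-1).
have h2 := hasC1_mul (hasC1_sub' (@hasC1_snd R setT) (@hasC1_cst R setT x.2)) (@hasC1_cst R setT r^-1).
have g1 := @hasC1_comp1 R setT setT BB BB' _ _ _ (fun t _ => BB_derive t) (fun t _ => @BB'_cont t) h1 (fun _ _ => I).
have g2 := @hasC1_comp1 R setT setT BB BB' _ _ _ (fun t _ => BB_derive t) (fun t _ => @BB'_cont t) h2 (fun _ _ => I).
apply: (hasC1_ext openT (hasC1_mul g1 g2)) => y _; rewrite /chi /chi1 /chi2; split=> //=.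
  by rewrite !(subr0, mul1r, mulr0, mul0r, addr0, add0r).
by rewrite !(subr0, mul1r, mulr0, mul0r, addr0, add0r).
Qed.

Lemma chi_01 x (r : R) y : 0 <= chi x r y <= 1.
Proof.
have /andP[a0 a1] := BB_01 ((y.1 - x.1) * r^-1); have /andP[b0 b1] := BB_01 ((y.2 - x.2) * r^-1).
by rewrite /chi mulr_ge0//= mulr_ile1.
Qed.

Lemma chi_0 x (r : R) y : 0 < r -> ~ box x r y -> chi x r y = 0.
Proof.
move=> r0 nb; apply/eqP/negPn/negP; rewrite /chi mulf_eq0 negb_or => /andP[/BB_neq0 h1 /BB_neq0 h2].
by apply: nb; split; apply: ltW; [move: h1|move: h2]; rewrite normrM normfV (gtr0_norm r0) ltr_pdivrMr// mul1r.
Qed.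

Lemma chi_1 x (r : R) y : 0 < r -> box x (r / 2) y -> chi x r y = 1.
Proof.
by move=> r0 [h1 h2]; rewrite /chi !BB_1 ?mulr1// normrM normfV (gtr0_norm r0) ler_pdivrMr// mulrC.
Qed.

Lemma chi_le x (r : R) y : 0 < r -> `|chi1 x r y| <= 8 / r /\ `|chi2 x r y| <= 8 / r.
Proof.
move=> r0; have ri : 0 <= r^-1 by rewrite invr_ge0 ltW.
have /andP[a0 a1] := BB_01 ((y.1 - x.1) * r^-1); have /andP[b0 b1] := BB_01 ((y.2 - x.2) * r^-1).
have h (a b : R) : 0 <= b <= 1 -> `|a| <= 8 -> `|a * r^-1 * b| <= 8 / r.
  move=> /andP[? ?] ?; rewrite !normrM (ger0_norm ri) (@ger0_norm _ b)// -[leRHS]mulr1.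
  by apply: ler_pM => //; [rewrite mulr_ge0|rewrite ler_wpM2r].
rewrite /chi1 /chi2 (mulrC (BB _) (_ * _)).
by split; apply: h; rewrite ?BB'_le ?BB_01.
Qed.

Lemma box_compact x r : compact (box x r).
Proof.
have -> : box x r = `[x.1 - r, x.1 + r] `*` `[x.2 - r, x.2 + r].
  by apply/seteqP; split=> y; rewrite /= !in_itv /= /box /= !ler_distl => -[h1 h2]; split.
by apply: compact_setX; exact: segment_compact.
Qed.

Lemma box_closed x r : closed (box x r).
Proof. by apply: compact_closed; [exact: norm_hausdorff|exact: box_compact]. Qed.

Lemma box_center x r : 0 <= r -> box x r x.
Proof. by move=> r0; split; rewrite subrr normr0. Qed.

Lemma box_le x r s : r <= s -> box x r `<=` box x s.
Proof. by move=> rs y [h1 h2]; split; exact: le_trans rs. Qed.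

Lemma nbhs_box x r : 0 < r -> nbhs x (box x r).
Proof.
move=> r0; have h1 := cont_near_lt (@fst_cont R x) r0; have h2 := cont_near_lt (@snd_cont R x) r0.
by apply: filterS2 h1 h2 => y a b; split; exact: ltW.
Qed.

Lemma nbhs_box_in x (P : set (R * R)) : nbhs x P -> exists2 r, 0 < r & box x r `<=` P.
Proof.
move=> /near_box[r r0 h]; exists (r / 2); first by rewrite divr_gt0.
have r2 : r / 2 < r by rewrite ltr_pdivrMr// ltr_pMr// ltr1n.
by move=> [a b] [h1 h2]; apply: h; exact: le_lt_trans r2.
Qed.

Lemma BB'_flat (t : R) : `|t| <= 2^-1 -> BB' t = 0.
Proof.
have s1 (u : R) : 1 <= u -> sigma' u = 0 by move=> u1; rewrite /sigma' !pos_id; lra.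
by rewrite ler_norml => /andP[t0 t1]; rewrite /BB' !s1; lra.
Qed.

Lemma chi_d0 (x : R * R) (r : R) w : 0 < r -> box x (r / 2) w -> chi1 x r w = 0 /\ chi2 x r w = 0.
Proof.
move=> r0 [h1 h2]; rewrite /chi1 /chi2 !BB'_flat ?mul0r ?mulr0//.
- by rewrite normrM normfV (gtr0_norm r0) ler_pdivrMr// mulrC.
- by rewrite normrM normfV (gtr0_norm r0) ler_pdivrMr// mulrC.
Qed.

End Bump.
Local Opaque BB BB' chi chi1 chi2.

(** The local partial derivatives agree with directional derivatives of [f], which are globally
    defined functions and therefore patch. *)
Lemma hasC1_local (R : realType) (U : set (R * R)) (f : R * R -> R) :
  (forall x, U x -> exists V g1 g2, [/\ open V, V x & hasC1 V f g1 g2]) ->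
  exists f1 f2, hasC1 U f f1 f2.
Proof.
move=> H.
have [v1 [v2 [e1 e2 e3 e4]]] : exists v1 v2 : R * R, [/\ v1.1 = 1, v1.2 = 0, v2.1 = 0 & v2.2 = 1].
  by exists (1, 0), (0, 1).
exists ('D_v1 f), ('D_v2 f) => x Ux; have [V [g1 [g2 [oV Vx hV]]]] := H x Ux.
have E1 y : V y -> g1 y = 'D_v1 f y by move=> Vy; rewrite (hasC1_D v1 hV Vy) e1 e2 mul1r mul0r addr0.
have E2 y : V y -> g2 y = 'D_v2 f y by move=> Vy; rewrite (hasC1_D v2 hV Vy) e3 e4 mul0r mul1r add0r.
by apply: (hasC1_ext oV hV) => // y Vy; rewrite E1// E2.
Qed.

(** * C^1 functions on the surface and Lipschitz bumps *)

Section Functions.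
Variables (R : realType) (S : surface R) (F : S -> 'rV[R]_3).
Hypothesis imm : smooth_immersion F.
Local Notation U n := (ccod (atlas S n)).
Local Notation par n := (par (atlas S n)).
Local Notation crd n := (crd (atlas S n)).
Local Notation cdom n := (cdom (atlas S n)).
Local Notation spd := (@spd R S F).

Definition sC1 (f : S -> R) := forall n, exists f1 f2, hasC1 (U n) (f \o par n) f1 f2.
Definition lipC (f : S -> R) (C : R) :=
  forall n x v, U n x -> `|'D_v (f \o par n) x| <= C * spd n x v.

Lemma sC1_cont f : sC1 f -> continuous f.
Proof.
move=> sf p; have [n dp] := atlas_cover p; have [f1 [f2 h]] := sf n.
have cf : {for crd n p, continuous (f \o par n)} by exact: hasC1_cont h (crd_ccod dp).
have c2 : {for p, continuous ((f \o par n) \o crd n)}.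
  exact: (continuous_comp (crd_continuous dp) cf).
suff : f q @[q --> p] --> f p by [].
rewrite -{2}(crdK dp); apply: cvg_trans c2; apply: near_eq_cvg.
by apply: filterS (near_dom dp) => q dq; rewrite /= crdK.
Qed.

Lemma sC1_curve f C c t : sC1 f -> lipC f C -> c1c c ->
  c1at (f \o c) t /\ `|'D_1 (f \o c) t| <= C * enorm ('D_1 (F \o c) t).
Proof.
move=> sf lf cc; have [c0 h0] := cc.
have [n dt] := atlas_cover (c t); have [f1 [f2 h]] := sf n.
have [d c'] := h0 n t dt; have Ut := crd_ccod dt.
pose g : R -> R * R := crd n \o c.
have eqn : \forall s \near t, ((f \o par n) \o g) s = (f \o c) s.
  have nd : \forall s \near t, cdom n (c s) by exact: c0 _ _ (near_dom dt).
  by apply: filterS nd => s ds; rewrite /g /= crdK.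
have df y : U n y -> differentiable (f \o par n) y by move=> /h[[]].
have E y v : U n y -> 'D_v (f \o par n) y = v.1 * f1 y + v.2 * f2 y by exact: hasC1_D.
have dd s : derivable g s 1 -> U n (g s) -> is_derive s (1 : R) ((f \o par n) \o g) ('D_('D_1 g s) (f \o par n) (g s)).
  by move=> dg Us; apply: is_derive_diff; [exact: derivableP|exact: df].
have Us : \forall s \near t, U n (g s).
  have nd : \forall s \near t, cdom n (c s) by exact: c0 _ _ (near_dom dt).
  by apply: filterS nd => s; exact: crd_ccod.
split.
  apply: (c1at_near eqn); apply: (@c1at_of _ _ _ (fun s => ('D_1 g s).1 * f1 (g s) + ('D_1 g s).2 * f2 (g s))).
    by apply: filterS2 d Us => s ds Us'; rewrite -E//; exact: dd.
  have cg : {for t, continuous g} by apply: continuous_comp; [exact: c0|exact: crd_continuous].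
  have [_ cf1 cf2] := h _ Ut.
  have g1 := cvg_comp ('D_1 g) fst c' (@fst_cont R ('D_1 g t)).
  have g2 := cvg_comp ('D_1 g) snd c' (@snd_cont R ('D_1 g t)).
  have k1 : {for t, continuous (fun s => f1 (g s))} by exact: (continuous_comp cg cf1).
  have k2 : {for t, continuous (fun s => f2 (g s))} by exact: (continuous_comp cg cf2).
  exact: (continuousD (continuousM g1 k1) (continuousM g2 k2)).
have [_ e1] := near_eq_is_derive eqn (dd t (nbhs_singleton d) Ut).
have [_ e2] := F_derive imm cc dt.
by rewrite e1 e2; exact: lf.
Qed.

Lemma lip_curve f C c : sC1 f -> lipC f C -> 0 <= C -> C1_curve c ->
  (`|f (c 1%R) - f (c 0%R)|%:E <= C%:E * curve_length F c)%E.
Proof.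
move=> sf lf C0 /curve_c1c cc; pose g := f \o c.
have cg t : c1at g t := (sC1_curve t sf lf cc).1.
have cD : continuous ('D_1 g) by move=> t; exact: (cg t).2.
have dg t : derivable g t 1 := nbhs_singleton (cg t).1.
have cg0 : continuous g by move=> t; exact: differentiable_continuous (proj1 (derivable1_diffP _ _) (dg t)).
have FTC : (\int[lebesgue_measure]_(x in `[0%R, 1%R]) ('D_1 g x)%:E = (g 1%R)%:E - (g 0%R)%:E)%E.
  apply: continuous_FTC2 => //.
  - by apply: continuous_subspaceT.
  - split; first by move=> x _; exact: dg.
    + exact: cvg_at_right_filter (cg0 0).
    + exact: cvg_at_left_filter (cg0 1).
  - by move=> x _; rewrite derive1E.
have mD : measurable_fun (`[0%R, 1%R] : set (measurableTypeR R)) ('D_1 g : measurableTypeR R -> R).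
  by apply: measurable_funTS; exact: continuous_measurable_fun.
have cn : continuous (fun t => enorm ('D_1 (F \o c) t)).
  by move=> t; exact: (continuous_comp (F_c1at imm t cc).2 (@enorm_cont R _)).
have mn : measurable_fun (`[0%R, 1%R] : set (measurableTypeR R)) ((fun t => enorm ('D_1 (F \o c) t)) : measurableTypeR R -> R).
  by apply: measurable_funTS; exact: continuous_measurable_fun.
have -> : (`|f (c 1%R) - f (c 0%R)|%:E = `|\int[lebesgue_measure]_(x in `[0%R, 1%R]) ('D_1 g x)%:E|)%E by rewrite FTC.
apply: le_trans; first by apply: le_abse_integral => //; exact/measurable_EFinP.
rewrite /curve_length -ge0_integralZl//=; last 2 first.
- exact/measurable_EFinP.
- by move=> t _; rewrite lee_fin enorm_ge0.
apply: ge0_le_integral => //=.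
- by apply/measurable_EFinP; exact: measurableT_comp.
- by apply/measurable_EFinP; exact: measurable_funM.
- by move=> t _; rewrite -EFinM lee_fin; exact: (sC1_curve t sf lf cc).2.
Qed.

(** Integration of the differential along curves. Applied to bumps, this shows that points close in
    [induced_dist] are close in the topology of the surface. *)
Lemma lip_dist f C p q (e : R) : sC1 f -> lipC f C -> 0 <= C -> (induced_dist F p q < e%:E)%E ->
  `|f q - f p| <= C * e.
Proof.
move=> sf lf C0 /ereal_inf_lt[_ [c [cc c0 c1] <-] ce].
have := lip_curve sf lf C0 cc; rewrite c0 c1 => h.
by rewrite -lee_fin EFinM; apply: (le_trans h); apply: lee_wpmul2l; [rewrite lee_fin|exact: ltW].
Qed.

(** The lower bound of the speed by the coordinates, uniform on the box, is what makes a bump on the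
    box Lipschitz for the induced metric. *)
Definition nice n x r m := [/\ 0 < r, 0 < m & forall y, box x r y -> U n y /\
  forall v, m * `|v.1| <= spd n y v /\ m * `|v.2| <= spd n y v].

Lemma nice_exists n x (P : set (R * R)) : U n x -> nbhs x P -> exists r m, nice n x r m /\ box x r `<=` P.
Proof.
move=> Ux /nbhs_box_in[r1 r10 h1]; have [r [K [m [r0 K0 m0 H]]]] := chart_bounds imm Ux.
exists (Num.min r r1), m; split; last first.
  by apply: subset_trans h1; apply: box_le; rewrite ge_min lexx orbT.
have mr : Num.min r r1 <= r by rewrite ge_min lexx.
split=> //; first by rewrite lt_min r0.
by move=> y /(box_le mr)[/H h /h[Uy hv]]; split=> // v; have [] := hv v.
Qed.

Definition bump n x r (p : S) : R := if `[< cdom n p >] then chi x r (crd n p) else 0.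

Lemma bump_par n x r y : U n y -> bump n x r (par n y) = chi x r y.
Proof. by move=> Uy; rewrite /bump asboolT ?parK//; exact: par_cdom. Qed.

Lemma bump_01 n x r p : 0 <= bump n x r p <= 1.
Proof. by rewrite /bump; case: ifP => _; [exact: chi_01|rewrite lexx ler01]. Qed.

Lemma bump_0 n x r m p : nice n x r m -> ~ (par n @` box x r) p -> bump n x r p = 0.
Proof.
move=> [r0 m0 H] nK; rewrite /bump; case: ifP => // /asboolP dp.
by apply: chi_0 => // b; apply: nK; exists (crd n p) => //; exact: crdK.
Qed.

Lemma bump_1 n x r m p : nice n x r m -> (par n @` box x (r / 2)) p -> bump n x r p = 1.
Proof.
move=> [r0 m0 H] [y yb <-]; rewrite bump_par ?chi_1//.
have r2 : r / 2 <= r by rewrite ler_pdivrMr// ler_pMr// ler1n.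
by have [] := H y (box_le r2 yb).
Qed.

Lemma par_box_compact n x r m : nice n x r m -> compact (par n @` box x r).
Proof.
move=> [_ _ H]; apply: continuous_compact (@box_compact R x r).
apply: continuous_in_subspaceT => y /set_mem /H[Uy _]; exact: par_continuous.
Qed.

Lemma par_box_closed n x r m : nice n x r m -> closed (par n @` box x r).
Proof. by move=> h; apply: compact_closed; [exact: surface_hausdorff|exact: par_box_compact h]. Qed.

Lemma par_nbhs n x (B : set (R * R)) : U n x -> nbhs x B -> nbhs (par n x) (par n @` (B `&` U n)).
Proof.
move=> Ux nB; have dx := par_cdom Ux.
have nB' : \forall p \near par n x, B (crd n p).
  by apply: (crd_continuous dx); rewrite /= (parK Ux).
apply: filterS2 nB' (near_dom dx) => p Bp dp; exists (crd n p); last exact: crdK.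
by split=> //; exact: crd_ccod.
Qed.

Lemma scale_add22 (V : lmodType R) (v1 v2 a b c d : R) (x y : V) :
  v1 *: (a *: x + b *: y) + v2 *: (c *: x + d *: y) = (v1 * a + v2 * c) *: x + (v1 * b + v2 * d) *: y.
Proof. by rewrite !scalerDr !scalerDl !scalerA addrACA. Qed.

Lemma mul_add22 (v1 v2 a b c d x y : R) :
  v1 * (a * x + b * y) + v2 * (c * x + d * y) = (v1 * a + v2 * c) * x + (v1 * b + v2 * d) * y.
Proof. by ring. Qed.

Lemma spd_tr k n y v : trdom S k n y -> spd k y v = spd n (tr S k n y)
  (v.1 * tr11 S k n y + v.2 * tr12 S k n y, v.1 * tr21 S k n y + v.2 * tr22 S k n y).
Proof.
move=> Ty; rewrite /spd /vel; have [-> ->] := d_tr imm Ty; congr enorm.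
exact: scale_add22.
Qed.

(** In the domain of chart [n] the chain rule applies; elsewhere the point avoids the compact, hence
    closed, image of the box and the bump is locally 0. The constant adds two partial derivatives of
    size at most 8 / r, against coordinates of size at most speed / m. *)
Lemma bump_local n x r m k y : nice n x r m -> U k y -> exists V g1 g2, [/\ open V, V y,
   hasC1 V (bump n x r \o par k) g1 g2 & forall v, `|'D_v (bump n x r \o par k) y| <= 16 / (r * m) * spd k y v].
Proof.
move=> N; have [r0 m0 H] := N => Uy; have [dy|dy] := pselect (cdom n (par k y)).
  pose V := trdom S k n; have oV : open V by exact: open_trdom.
  have hc := hasC1_fst_snd_comp (@hasC1_tr1 R S k n) (@hasC1_tr2 R S k n) (hasC1_chi x r) (fun _ _ => I).
  have he z : V z -> chi x r (tr S k n z) = (bump n x r \o par k) z.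
    by move=> [Uz dz]; rewrite /= /bump asboolT.
  have hb := hasC1_ext oV hc (fun z Vz => And3 (he z Vz) erefl erefl).
  have Vy : V y by [].
  exists V; do 2 eexists; split; [exact: oV|exact: Vy|exact: hb|] => v.
  rewrite (hasC1_D v hb Vy) (spd_tr v Vy).
  set w := (_, _); set z := tr S k n y.
  have -> : v.1 * (tr11 S k n y * chi1 x r z + tr21 S k n y * chi2 x r z) +
    v.2 * (tr12 S k n y * chi1 x r z + tr22 S k n y * chi2 x r z) = w.1 * chi1 x r z + w.2 * chi2 x r z.
    exact: mul_add22.
  have s0 : 0 <= spd n z w by exact: enorm_ge0.
  have [bz|bz] := pselect (box x r z); last first.
    have [-> ->] := hasC1_off (hasC1_chi x r) (@box_closed R x r) (fun y0 => @chi_0 R x r y0 r0) bz.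
    by rewrite !mulr0 addr0 normr0 mulr_ge0// divr_ge0// ltW// mulr_gt0.
  have [_ /(_ w)[w1 w2]] := H z bz; have [c1 c2] := chi_le x z r0.
  have ww (a : R) : m * `|a| <= spd n z w -> `|a| <= spd n z w / m by rewrite ler_pdivlMr// mulrC.
  have r8 : 0 <= 8 / r by rewrite divr_ge0// ltW.
  apply: le_trans (ler_normD _ _) _; rewrite (normrM w.1) (normrM w.2).
  have b1 := ler_pM (normr_ge0 _) (normr_ge0 _) (ww _ w1) c1.
  have b2 := ler_pM (normr_ge0 _) (normr_ge0 _) (ww _ w2) c2.
  apply: (le_trans (lerD b1 b2)); move: (spd n z w) => t.
  by rewrite le_eqVlt; apply/orP; left; apply/eqP; field; rewrite !gt_eqF.
pose K := par n @` box x r; have cK : closed K by exact: par_box_closed N.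
have nK : ~ K (par k y) by move=> [z /H[Uz _] e]; apply: dy; rewrite -e; exact: par_cdom.
pose V := U k `&` par k @^-1` (~` K).
have oV : open V by apply: open_par; exact: closed_openC.
have Vy : V y by [].
have he z : V z -> 0 = (bump n x r \o par k) z by move=> [_ nz]; rewrite /= (bump_0 N).
have hb := hasC1_ext oV (@hasC1_cst R V 0) (fun z Vz => And3 (he z Vz) erefl erefl).
exists V, (fun=> 0), (fun=> 0); split=> // v.
rewrite (hasC1_D v hb Vy) !mulr0 addr0 normr0 mulr_ge0 ?enorm_ge0// divr_ge0// ltW// mulr_gt0//.
Qed.

Lemma sC1_bump n x r m : nice n x r m -> sC1 (bump n x r).
Proof.
move=> N k; apply: hasC1_local => y Uy.
by have [V [g1 [g2 [oV Vy h _]]]] := bump_local N Uy; exists V, g1, g2.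
Qed.

Lemma lipC_bump n x r m : nice n x r m -> lipC (bump n x r) (16 / (r * m)).
Proof. by move=> N k y v Uy; have [V [g1 [g2 [_ _ _]]]] := bump_local N Uy; apply. Qed.

End Functions.

(** * Consequences of completeness *)

Lemma geometric_small (R : realType) (C e : R) : 0 < e -> exists N : nat, C * (3 / 4) ^+ N < e.
Proof.
move=> e0.
have /cvgrPdist_lt /(_ e e0) [N _ h] : (fun n => C * (3 / 4 : R) ^+ n) @ \oo --> (0 : R).
  apply: (@cvg_geometric R C (3 / 4)); rewrite ger0_norm; last lra.
  lra.
exists N; have := h N (leqnn N); rewrite sub0r normrN; exact: le_lt_trans (ler_norm _).
Qed.

Section Complete.
Variables (R : realType) (S : surface R) (F : S -> 'rV[R]_3).
Hypothesis imm : smooth_immersion F.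
Hypothesis cpl : complete_immersion F.
Local Notation U n := (ccod (atlas S n)).
Local Notation par n := (par (atlas S n)).
Local Notation crd n := (crd (atlas S n)).
Local Notation step := (@step R S F).
Local Notation reach := (@reach R S F).

Definition rle (l : R) p q := exists2 l', l' <= l & reach l' p q.

Lemma rle_refl l p : 0 <= l -> rle l p p.
Proof. by move=> l0; exists 0 => //; exact: reach0. Qed.

Lemma rle_le l l' p q : l <= l' -> rle l p q -> rle l' p q.
Proof. by move=> h [m ml r]; exists m => //; exact: le_trans ml h. Qed.

Lemma rle_trans l1 l2 p q r : rle l1 p q -> rle l2 q r -> rle (l1 + l2) p r.
Proof. by move=> [a a1 ra] [b b1 rb]; exists (a + b); [exact: lerD|exact: reach_trans ra rb]. Qed.

Lemma rle_sym l p q : rle l p q -> rle l q p.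
Proof. by move=> [a a1 ra]; exists a => //; exact: reach_sym. Qed.

Lemma rle_step c p q : step c p q -> rle c p q.
Proof. by move=> st; exists c => //; exact: reach1. Qed.

Lemma rle_split (l m : R) p q : 0 <= m <= l -> rle l p q -> exists2 r, rle m p r & rle (l - m) r q.
Proof.
move=> /andP[m0 ml] [a al ra]; have [am|ma] := leP a m.
  by exists q; [exists a|apply: rle_refl; rewrite subr_ge0].
have [|r r1 r2] := @reach_split _ _ _ _ m _ _ ra; first by rewrite m0 ltW.
by exists r; [exists m|exists (a - m); rewrite ?lerB].
Qed.

Lemma near_rle e p : 0 < e -> \forall q \near p, rle e p q.
Proof. by move=> e0; apply: filterS (near_step imm p e0) => q; exact: rle_step. Qed.

Lemma rle0 p q : rle 0 p q -> q = p.
Proof.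
move=> [a a0 h]; have := a0; elim: h => {a a0 p q} // l c p q r hr IH [c0 _] lc.
by have l0 := reach_ge0 hr; move: lc; rewrite leNgt ltr_wpDl.
Qed.

Lemma rle_dist (l l' : R) p q : rle l p q -> 0 < l' -> 2 * l <= l' -> (induced_dist F p q <= l'%:E)%E.
Proof.
move=> [a al ra] l0 ll; apply: (reach_dist imm ra l0); apply: le_trans ll; by rewrite ler_pM2l.
Qed.

(** A chain of length [l] bounds the distance by 2 l; the factor 3 makes the inequality strict. *)
Lemma lip_rle f C p q l : sC1 f -> lipC F f C -> 0 <= C -> 0 < l -> rle l p q -> `|f q - f p| <= C * (3 * l).
Proof.
move=> sf lf C0 l0 h; apply: (lip_dist imm sf lf C0).
apply: (le_lt_trans (rle_dist h (l' := 2 * l) _ (lexx _))); first by rewrite mulr_gt0.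
by rewrite lte_fin ltr_pM2r// ltr_nat.
Qed.

Lemma bump_at p (W : set S) : nbhs p W -> exists n x r m, [/\ nice F n x r m, U n x, p = par n x &
  par n @` box x r `<=` W].
Proof.
move=> nW; have [n dp] := atlas_cover p; have Ux := crd_ccod dp.
have nB : nbhs (crd n p) (par n @^-1` W).
  by apply: (par_continuous Ux); rewrite /= crdK.
have [r [m [N h]]] := nice_exists imm Ux nB; exists n, (crd n p), r, m; split=> //; first by rewrite crdK.
by move=> _ [y yb <-]; exact: h.
Qed.

(** The coefficient 4 C is the sum of the geometric series C (3/4)^k; keeping the subtracted tail
    makes the induction close. *)
Lemma chain_sum (q : nat -> S) C : 0 <= C -> (forall k, rle (C * (3 / 4) ^+ k) (q k) (q k.+1)) ->
  forall N k, rle (4 * C * (3 / 4) ^+ N - 4 * C * (3 / 4) ^+ (N + k)) (q N) (q (N + k)%N).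
Proof.
move=> C0 H N; elim=> [|k IH]; first by rewrite addn0 subrr; exact: rle_refl.
rewrite addnS; apply: rle_le (rle_trans IH (H _)).
by rewrite exprS le_eqVlt; apply/orP; left; apply/eqP; field.
Qed.

(** Geometric step lengths make [q] a Cauchy sequence for [induced_dist], so completeness gives a
    limit for this distance. Convergence in the topology follows from a bump at the limit, whose
    value cannot drop from 1 to 0 over a small distance. *)
Lemma chain_limit (q : nat -> S) C : 0 <= C -> (forall k, rle (C * (3 / 4) ^+ k) (q k) (q k.+1)) ->
  exists p : S, forall W : set S, nbhs p W -> exists N : nat, forall k, (N <= k)%N -> W (q k).
Proof.
move=> C0 H; have cs := chain_sum C0 H.
have pw k : 0 <= (3 / 4 : R) ^+ k by rewrite exprn_ge0.
have cs' N k : (N <= k)%N -> rle (4 * C * (3 / 4) ^+ N) (q N) (q k).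
  move=> Nk; rewrite -(subnKC Nk); apply: rle_le (cs N _).
  by rewrite gerBl !mulr_ge0.
have [e e0|p hp] := @cpl q.
  have [N hN] := geometric_small (16 * C) e0; exists N => m n Nm Nn.
  have h := rle_trans (rle_sym (cs' N m Nm)) (cs' N n Nn).
  (* Twice the length of the chain is at most 16 C (3/4)^N < e; the mean of this number and [e] is
     positive and still less than [e]. *)
  pose l' := (e + 16 * C * (3 / 4) ^+ N) / 2.
  have h16 : 0 <= 16 * C * (3 / 4) ^+ N by rewrite !mulr_ge0.
  apply: (@le_lt_trans _ _ l'%:E).
    by apply: (rle_dist h); rewrite /l'; move: (_ ^+ N) hN h16 => t hN h16; lra.
  by rewrite lte_fin /l'; move: (_ ^+ N) hN h16 => t hN h16; lra.
exists p => W nW; have [n [x [r [m [N Ux px h]]]]] := bump_at nW.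
have [r0 m0 _] := N.
pose K := 16 / (r * m); have K0 : 0 < K by rewrite divr_gt0// mulr_gt0.
have K20 : 0 < K^-1 / 2 by rewrite divr_gt0// invr_gt0.
have [M _ hM] : \forall k \near \oo, (induced_dist F (q k) p < (K^-1 / 2)%:E)%E.
  have nb : nbhs (0 : \bar R)%E [set x : \bar R | (x < (K^-1 / 2)%:E)%E].
    by apply: open_nbhs_nbhs; split; [exact: open_ereal_lt_ereal|rewrite /= lte_fin].
  exact: hp _ nb.
exists M => k Mk; apply: h; apply: contrapT => nk.
have bp : bump n x r p = 1.
  by rewrite (bump_1 N)//; exists x => //; apply: box_center; rewrite divr_ge0// ltW.
have bk : bump n x r (q k) = 0 by exact: bump_0 N nk.
have := lip_dist imm (sC1_bump imm N) (lipC_bump imm N) (ltW K0) (hM k Mk).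
by rewrite bp bk subr0 normr1 -/K mulrA divff ?gt_eqF// mul1r; lra.
Qed.

(* Otherwise iterate: the radii (3/4)^k s are summable, so the centres converge to a point with
   arbitrarily small bad balls nearby. *)
Lemma point_picking (Bad : S -> R -> Prop) :
  (forall y s, 0 < s -> Bad y s -> exists2 y', rle (2 * s) y y' & Bad y' (3 / 4 * s)) ->
  (forall p : S, exists2 e : R, 0 < e & \forall q \near p, forall s, 0 < s -> s < e -> ~ Bad q s) ->
  forall y s, 0 < s -> ~ Bad y s.
Proof.
move=> step1 good y s s0 bad.
pose T := {z : S * R | 0 < z.2 /\ Bad z.1 z.2}.
have H (z : T) : exists z' : T, rle (2 * (sval z).2) (sval z).1 (sval z').1 /\ (sval z').2 = 3 / 4 * (sval z).2.
  have [z0 bz] := svalP z; have [y' r' b'] := step1 _ _ z0 bz.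
  have z'P : 0 < (y', 3 / 4 * (sval z).2).2 /\ Bad (y', 3 / 4 * (sval z).2).1 (y', 3 / 4 * (sval z).2).2.
    by split=> //=; rewrite mulr_gt0// divr_gt0.
  by exists (exist (fun z : S * R => 0 < z.2 /\ Bad z.1 z.2) _ z'P).
have [f hf] := choice H.
have zP : 0 < (y, s).2 /\ Bad (y, s).1 (y, s).2 by [].
pose z k := iter k f (exist (fun z : S * R => 0 < z.2 /\ Bad z.1 z.2) _ zP : T).
have rad k : (sval (z k)).2 = s * (3 / 4) ^+ k.
  by elim: k => [|k IH]; [rewrite expr0 mulr1|rewrite /z iterS (hf _).2 -/(z k) IH exprS mulrCA].
have stp k : rle (2 * s * (3 / 4) ^+ k) (sval (z k)).1 (sval (z k.+1)).1.
  by rewrite -mulrA -rad; exact: (hf (z k)).1.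
have s20 : 0 <= 2 * s by rewrite mulr_ge0// ltW.
have [p hp] := chain_limit s20 stp.
have [e e0 ge] := good p.
have [N hN] := hp _ ge; have [M hM] := geometric_small s e0.
have [zk bk] := svalP (z (maxn N M)).
apply: (hN (maxn N M) (leq_maxl _ _) _ _ _ bk); first exact: zk.
rewrite rad; apply: le_lt_trans hM; rewrite ler_pM2l//.
by apply: ler_wiXn2l; [|lra|exact: leq_maxr]; lra.
Qed.

(* Hopf-Rinow by point picking: if the balls of radius 3s/4 around all points within 2s of y are
   relatively compact, four steps of length s/4, each with a finite cover, exhaust the ball of radius s. *)
Lemma compact_reach y s : 0 < s -> exists2 K : set S, compact K & forall q, rle s y q -> K q.
Proof.
move=> s0; apply: contrapT => bad0.
pose Bad y s := ~ exists2 K : set S, compact K & forall q, rle s y q -> K q.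
apply: (@point_picking Bad _ _ y s s0) => // {y s s0 bad0}.
- move=> y s s0 bad; apply: contrapT => nx.
  have good y' : rle (2 * s) y y' -> exists2 K : set S, compact K & forall q, rle (3 / 4 * s) y' q -> K q.
    by move=> h; apply: contrapT => nK; apply: nx; exists y'.
  pose d := s / 4; have d0 : 0 < d by rewrite divr_gt0.
  have Hk (k : nat) : (k <= 4)%N -> exists2 K : set S, compact K & forall q, rle (k%:R * d) y q -> K q.
    elim: k => [|k IH] k4.
      exists [set y]; first exact: compact_set1.
      by move=> q; rewrite mul0r => /rle0.
    have [K cK hK] := IH (ltnW k4).
    have kd : 0 <= k%:R * d by rewrite mulr_ge0// ltW.
    have k3 : (k%:R : R) <= 3 by rewrite ler_nat.
    pose P (A : set S) := exists2 K' : set S, compact K' & forall a q, A a -> rle (k%:R * d) y a -> rle d a q -> K' q.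
    have [K' cK' hK'] : P K.
      apply: (compact_ind cK).
      + by exists set0; [exact: compact0|move=> a q []].
      + by move=> B C BC [K' cK' h]; exists K' => // a q Ba; apply: h; exact: BC.
      + move=> B C [K1 c1 h1] [K2 c2 h2]; exists (K1 `|` K2); first exact: compact_setU.
        by move=> a q [Ba|Ca] h3 h4; [left; exact: h1 h4|right; exact: h2 h4].
      + move=> x Kx; exists (rle d x); first exact: near_rle.
        (* With a point y' within d of [x] and within k d <= 3 d of [y], every [q] in question is
           within 3 d = 3s/4 of y', through [x] and [a]. Without such a point no [a] near [x]
           qualifies and nothing has to be covered. *)
        have [[y' xy' yy']|none] := pselect (exists2 y', rle d x y' & rle (k%:R * d) y y').
          have [|K1 c1 h1] := good y'.
            apply: rle_le yy'; apply: (@le_trans _ _ (3 * d)); first by rewrite ler_pM2r.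
            by rewrite /d; lra.
          exists K1 => // a q xa ya aq; apply: h1.
          apply: rle_le (rle_trans (rle_trans (rle_sym xy') xa) aq); rewrite /d; lra.
        by exists set0; [exact: compact0|move=> a q xa ya; case: none; exists a].
    exists K' => // q yq.
    have e : k.+1%:R * d - k%:R * d = d by rewrite -mulrBl -natrB// subSnn mul1r.
    have [|a ya aq] := @rle_split _ (k%:R * d) _ _ _ yq.
      by rewrite kd /= ler_pM2r// ler_nat.
    by rewrite e in aq; apply: hK' aq => //; exact: hK.
  apply: bad; have [K cK hK] := Hk 4%N (leqnn _); exists K => // q yq; apply: hK.
  by have -> : 4%:R * d = s by rewrite /d; field.
- move=> p; have [n [x [r [m [N Ux px _]]]]] := bump_at (@filterT _ (nbhs p) _).
  have [r0 m0 _] := N.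
  pose K := 16 / (r * m); have K0 : 0 < K by rewrite divr_gt0// mulr_gt0.
  (* Over a chain of length less than 1 / (3 K) a function of Lipschitz constant [K] changes by less
     than 1, so the chain cannot lead from the plateau of the bump to the outside of its support. *)
  exists (3 * K)^-1; first by rewrite invr_gt0 mulr_gt0.
  have nb : nbhs p (par n @` (box x (r / 2) `&` U n)).
    by rewrite px; apply: par_nbhs => //; apply: nbhs_box; rewrite divr_gt0.
  apply: filterS nb => q [z [zb Uz] zq] s s0 se; apply.
  exists (par n @` box x r); first exact: par_box_compact N.
  move=> q' qq'; apply: contrapT => nk.
  have := lip_rle (sC1_bump imm N) (lipC_bump imm N) (ltW K0) s0 qq'.
  have -> : bump n x r q = 1 by apply: (bump_1 N); exists z.
  rewrite (bump_0 N nk) sub0r normrN normr1 -/K leNgt => /negP; apply.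
  have k30 : 0 < 3 * K by rewrite mulr_gt0.
  have : 3 * K * s < 3 * K * (3 * K)^-1 by rewrite ltr_pM2l.
  rewrite divff; last by rewrite gt_eqF.
  have -> : K * (3 * s) = 3 * K * s by ring.
  exact.
Qed.

Lemma reach_all p q : exists2 l, 0 <= l & rle l p q.
Proof.
pose A := [set q | exists2 l, 0 <= l & rle l p q].
suff : A = setT by move=> e; have : A q by rewrite e.
apply: connected_clopen.
- exact: surface_connected.
- by exists p, 0 => //; exact: rle_refl.
- rewrite openE => x [l l0 h]; apply: filterS (near_rle x ltr01) => y hy.
  by exists (l + 1); [rewrite addr_ge0|exact: rle_trans h hy].
- rewrite -openC openE => x nx; apply: filterS (near_rle x ltr01) => y hy [l l0 h].
  by apply: nx; exists (l + 1); [rewrite addr_ge0|exact: rle_trans h (rle_sym hy)].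
Qed.

End Complete.

(** * The divergence theorem against a Lipschitz cutoff *)

Section PlaneStokes.
Variable R : realType.
Local Notation I2 := (@I2 R).

(** On a box larger than the support this is uniform continuity on a compact set; outside that box,
    and for |v| < 1, both values are 0. *)
Lemma cc_unif (g : R * R -> R) e : cc g -> 0 < e ->
  exists2 d, 0 < d & forall x v : R * R, `|v| < d -> `|g (x + v) - g x| <= e.
Proof.
move=> cg e0; have [M M0 hM] := cc_box cg; have [cg' _] := cg.
pose P (A : set (R * R)) := exists2 d : R, 0 < d & forall x v : R * R, A x -> `|v| < d -> `|g (x + v) - g x| <= e.
have [d d0 hd] : P (cbox (M + 1)).
  apply: (compact_ind (@cbox_compact R (M + 1))).
  - by exists 1 => // x v [].
  - by move=> B C BC [d d0 h]; exists d => // x v /BC; exact: h.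
  - move=> B C [d1 d10 h1] [d2 d20 h2]; exists (Num.min d1 d2); first by rewrite lt_min d10.
    by move=> x v [Bx|Cx]; rewrite lt_min => /andP[v1 v2]; [exact: h1|exact: h2].
  - move=> x _; have e2 : 0 < e / 2 by rewrite divr_gt0.
    have := cont_near_lt (cg' x) e2 => /nbhs_ballP[d /= d0 h].
    have d20 : 0 < d / 2 by rewrite divr_gt0.
    exists (ball x (d / 2)); first exact: nbhsx_ballx.
    exists (d / 2) => // y v; rewrite -ball_normE /= => xy vd.
    have by1 : ball x d y by rewrite -ball_normE /=; apply: (lt_trans xy); lra.
    have by2 : ball x d (y + v).
      rewrite -ball_normE /= opprD addrA; apply: le_lt_trans (ler_normB _ _) _; lra.
    have h1 := h _ by1; have h2 := h _ by2.
    have -> : g (y + v) - g y = (g (y + v) - g x) - (g y - g x) by ring.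
    by apply: le_trans (ler_normB _ _) _; move: h1 h2 => /= h1 h2; lra.
exists (Num.min d 1); first by rewrite lt_min d0 ltr01.
move=> x v; rewrite lt_min => /andP[vd v1]; have [xM|xM] := pselect (cbox (M + 1) x); first exact: hd.
have x1 : M + 1 < `|x| by rewrite ltNge; apply/negP => /cboxP.
have x2 : M < `|x + v|.
  by have := lerB_normD x v; lra.
rewrite (hM x) ?(hM (x + v)) ?subrr ?normr0 ?ltW//; apply/cboxP; apply/negP; rewrite -ltNge; lra.
Qed.

Lemma cc_shift (f : R * R -> R) (v : R * R) : cc f -> cc (fun x => f (x + v)).
Proof.
move=> [cf [M hM]]; split.
  move=> x; apply: (@continuous_comp _ _ _ (fun x : R * R => x + v) f); last exact: cf.
  by apply: (@continuousD _ _ _ id (fun=> v)); [exact: cvg_id|exact: cvg_cst].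
exists (M + `|v|) => x /hM h; have := ler_normB (x + v) v; rewrite addrK; lra.
Qed.

Lemma diffp_add (x v : R * R) : diffp x (x + v) = v.
Proof. by case: x v => [a b] [c d]; rewrite /diffp /=; congr pair; rewrite addrC addKr. Qed.

Lemma segm_add (x v : R * R) t : segm x (x + v) t = x + (t * v.1, t * v.2).
Proof. by case: x v => [a b] [c d]; rewrite /segm /=; congr pair; rewrite addrAC subrr add0r. Qed.

(* [eta] need not be differentiable: its difference quotients, at most L |xi|, are moved onto [phi] by
   translation invariance. *)
Lemma directional_bound (phi p1 p2 eta : R * R -> R) (M L h0 : R) (xi : R * R) :
  hasC1 setT phi p1 p2 -> (forall x, ~ cbox M x -> phi x = 0) -> cc eta -> 0 < h0 ->
  (forall x (h : R), phi x != 0 -> 0 < h < h0 -> `|eta (x - (h * xi.1, h * xi.2)) - eta x| <= L * h) ->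
  `|I2 (fun x => eta x * (xi.1 * p1 x + xi.2 * p2 x))| <= L * I2 (fun x => `|phi x|).
Proof.
move=> hp h_off ce h00 lip.
have [cphi cp1 cp2] := hasC1_cc hp h_off.
pose psi x := xi.1 * p1 x + xi.2 * p2 x.
have cpsi : cc psi by apply: ccD; exact: ccZ.
have cetac : continuous eta by case: ce.
pose A := I2 (fun x => `|eta x|); have A0 : 0 <= A by apply: I2_ge0; [exact: cc_norm|move=> x; exact: normr_ge0].
apply/ler_addgt0Pr => e e0.
have e1 : 0 < e / (A + 1) by rewrite divr_gt0// ltr_wpDl.
have [d d0 hd] := cc_unif cpsi e1.
pose nx := `|xi.1| + `|xi.2| + 1; have nx0 : 0 < nx by rewrite ltr_wpDl// addr_ge0.
pose h := Num.min (h0 / 2) (d / (2 * nx)).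
have hpos : 0 < h by rewrite lt_min divr_gt0//= divr_gt0// mulr_gt0.
have hh0 : h < h0 by apply: (@le_lt_trans _ _ (h0 / 2)); [rewrite ge_min lexx|lra].
have hd' : h * nx < d.
  have : h <= d / (2 * nx) by rewrite ge_min lexx orbT.
  rewrite ler_pdivlMr ?mulr_gt0// => hh.
  have := mulr_gt0 hpos nx0; move: hh; rewrite mulrCA; move: (h * nx) => t; lra.
pose v : R * R := (h * xi.1, h * xi.2).
have sv (s : R) : 0 <= s <= 1 -> `|(s * v.1, s * v.2) : R * R| < d.
  move=> /andP[s0 s1]; apply: le_lt_trans hd'; rewrite prod_normE /= ge_max !normrM !(ger0_norm s0) !(gtr0_norm hpos).
  have bnd (a : R) : 0 <= a -> a <= nx -> s * (h * a) <= h * nx.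
    move=> a0 an; rewrite -[leRHS]mul1r; apply: ler_pM => //; first by rewrite mulr_ge0// ltW.
    by rewrite ler_pM2l.
  by apply/andP; split; apply: bnd => //; rewrite /nx; have := normr_ge0 xi.1; have := normr_ge0 xi.2; lra.
have mvt x : `|phi (x + v) - phi x - h * psi x| <= h * (e / (A + 1)).
  have dg (t : R) : 0 <= t <= 1 -> is_derive t (1 : R) (fun s => phi (segm x (x + v) s)) (h * psi (x + (t * v.1, t * v.2))).
    move=> _; have := @segm_derive _ setT phi p1 p2 x (x + v) t hp I.
    rewrite diffp_add.
    rewrite segm_add.
    by rewrite /psi mulrDr !mulrA.
  have [t /andP[t0 t1]] := MVT_cc ltr01 dg.
  rewrite segm_0 segm_1 subr0 mulr1 => ->.
  rewrite -mulrBr normrM (gtr0_norm hpos) ler_pM2l//; apply: hd; apply: sv; by rewrite !ltW.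
have cphiv : cc (fun x => phi (x + v)) by exact: cc_shift.
have cetav : cc (fun x => eta (x - v)) by exact: cc_shift.
have cphi0 : continuous phi by case: cphi.
have ceta0 := cetac.
have c1 : cc (fun x => eta x * phi (x + v)) by apply: ccMl.
have c2 : cc (fun x => eta x * phi x) by apply: ccMl.
have c3 : cc (fun x => eta x * psi x) by apply: ccMl.
have c4 : cc (fun x => eta (x - v) * phi x) by apply: ccMl => //; case: cetav.
have E1 : I2 (fun x => eta x * phi (x + v)) = I2 (fun x => eta (x - v) * phi x).
  rewrite -(I2_shift (- v) c1); congr I2; apply/funext => x; by rewrite subrK.
(* Summation by parts: by translation invariance the difference of [phi] becomes a difference of
   [eta], and the remaining integral contains only the Taylor error of [phi]. *)
have E2 : h * I2 (fun x => eta x * psi x) =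
    I2 (fun x => (eta (x - v) - eta x) * phi x) - I2 (fun x => eta x * (phi (x + v) - phi x - h * psi x)).
  have -> : (fun x => (eta (x - v) - eta x) * phi x) = (fun x => eta (x - v) * phi x - eta x * phi x).
    by apply/funext => x; rewrite mulrBl.
  have -> : (fun x => eta x * (phi (x + v) - phi x - h * psi x)) =
    (fun x => (eta x * phi (x + v) - eta x * phi x) - h * (eta x * psi x)).
    by apply/funext => x; ring.
  rewrite (I2B c4 c2) (I2B (ccB c1 c2) (ccZ h c3)) (I2B c1 c2) (I2Z h c3) E1; ring.
have c5 : cc (fun x => (eta (x - v) - eta x) * phi x).
  by apply: ccMl => // x; apply: continuousB; [case: cetav => + _; apply|exact: cetac].
have c6 : cc (fun x => eta x * (phi (x + v) - phi x - h * psi x)).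
  by apply: ccMl => //; apply: ccB; [exact: ccB|exact: ccZ].
have B1 : `|I2 (fun x => (eta (x - v) - eta x) * phi x)| <= h * (L * I2 (fun x => `|phi x|)).
  apply: (le_trans (I2_abs c5)); rewrite mulrA (mulrC h) -(I2Z _ (cc_norm cphi)).
  apply: I2_le; [exact: cc_norm|by apply: ccZ; exact: cc_norm|] => x.
  rewrite normrM; have [->|pn] := eqVneq (phi x) 0; first by rewrite normr0 !mulr0.
  by apply: ler_wpM2r => //; apply: lip => //; rewrite hpos.
have B2 : `|I2 (fun x => eta x * (phi (x + v) - phi x - h * psi x))| <= h * e.
  apply: (le_trans (I2_abs c6)); apply: (@le_trans _ _ (h * (e / (A + 1)) * A)).
    rewrite -(I2Z _ (cc_norm ce)); apply: I2_le; [exact: cc_norm|by apply: ccZ; exact: cc_norm|] => x.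
    by rewrite normrM mulrC ler_wpM2r.
  rewrite -mulrA ler_pM2l// mulrAC ler_pdivrMr ?ltr_wpDl// ler_pM2l//; lra.
have := le_trans (ler_normB _ _) (lerD B1 B2); rewrite -E2 normrM (gtr0_norm hpos) -mulrDr.
by rewrite ler_pM2l.
Qed.

(** With xi_1 = (1/a, 0) and xi_2 = (-b/(a c), 1/c) the field is (P, Q) = (a P + b Q) xi_1 + c Q
    xi_2. When a, b, c come from [frame], these vectors are orthonormal at the centre of the chart
    box, so the bound does not depend on how distorted the coordinates are. *)
Lemma divergence_bound (P P1 P2 Q Q1 Q2 eta : R * R -> R) (M L h0 a b c : R) :
  hasC1 setT P P1 P2 -> hasC1 setT Q Q1 Q2 -> (forall x, ~ cbox M x -> P x = 0) -> (forall x, ~ cbox M x -> Q x = 0) ->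
  cc eta -> 0 < h0 -> a != 0 -> c != 0 -> 0 <= L ->
  (forall x (h : R), (P x != 0 \/ Q x != 0) -> 0 < h < h0 ->
     `|eta (x - (h * a^-1, h * 0)) - eta x| <= L * h /\
     `|eta (x - (h * (- b / (a * c)), h * c^-1)) - eta x| <= L * h) ->
  `|I2 (fun x => eta x * (P1 x + Q2 x))| <= L * (I2 (fun x => `|a * P x + b * Q x|) + I2 (fun x => `|c * Q x|)).
Proof.
move=> hP hQ P0 Q0 ce h00 a0 c0 L0 lip.
have h1 := hasC1_add (hasC1_scale a hP) (hasC1_scale b hQ).
have h2 := hasC1_scale c hQ.
have z1 x : ~ cbox M x -> a * P x + b * Q x = 0 by move=> nx; rewrite P0// Q0// !mulr0 addr0.
have z2 x : ~ cbox M x -> c * Q x = 0 by move=> nx; rewrite Q0// mulr0.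
have PQ x : P x = 0 -> Q x = 0 -> (P x != 0 \/ Q x != 0) -> False by move=> -> -> [] /eqP.
have n1 x : a * P x + b * Q x != 0 -> P x != 0 \/ Q x != 0.
  have [->|] := eqVneq (P x) 0; last by left.
  by have [->|] := eqVneq (Q x) 0; [rewrite !mulr0 addr0 eqxx|right].
have n2 x : c * Q x != 0 -> P x != 0 \/ Q x != 0.
  by rewrite mulf_eq0 negb_or => /andP[_]; right.
have b1 := @directional_bound _ _ _ eta M L h0 (a^-1, 0) h1 z1 ce h00 (fun x h nz hh => (lip x h (n1 x nz) hh).1).
have b2 := @directional_bound _ _ _ eta M L h0 (- b / (a * c), c^-1) h2 z2 ce h00 (fun x h nz hh => (lip x h (n2 x nz) hh).2).
have [_ cc1 cc1'] := hasC1_cc h1 z1; have [_ cc2 cc2'] := hasC1_cc h2 z2.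
have cetac : continuous eta by case: ce.
rewrite mulrDr; apply: le_trans (lerD b1 b2); apply: le_trans (ler_normD _ _); rewrite -I2D; last 2 first.
- by apply: ccMl => //; apply: ccD; exact: ccZ.
- by apply: ccMl => //; apply: ccD; exact: ccZ.
rewrite le_eqVlt; apply/orP; left; apply/eqP; congr (`|_|); congr I2; apply/funext => x /=; field.
by rewrite a0 c0.
Qed.

End PlaneStokes.

(** * Integrals of signed functions on the surface *)

Section SignedIntegral.
Variables (R : realType) (S : surface R) (F : S -> 'rV[R]_3).
Hypothesis imm : smooth_immersion F.
Local Notation lam2 := (@lam2 R).
Local Notation U n := (ccod (atlas S n)).
Local Notation par n := (par (atlas S n)).
Local Notation I2 := (@I2 R).
Local Notation SI := (surface_integral F).

(* [surface_integral] is meant for nonnegative functions; signed functions are integrated through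
   their positive and negative parts. *)
Definition sint_fin (f : S -> R) := continuous f /\ (SI (fun p => (`|f p|)%R) < +oo)%E.
Definition sint (f : S -> R) : R := fine (SI (fun p => pos (f p))) - fine (SI (fun p => pos (- f p))).

Lemma pos_continuous (f : S -> R) : continuous f -> continuous (fun p => pos (f p)).
Proof. by move=> cf p; apply: (continuous_comp (cf p)); exact: pos_cont. Qed.

Lemma abs_continuous (f : S -> R) : continuous f -> continuous (fun p => `|f p|).
Proof. by move=> cf p; apply: (continuous_comp (cf p)); exact: norm_continuous. Qed.

Lemma opp_continuous (f : S -> R) : continuous f -> continuous (fun p => - f p).
Proof. by move=> cf p; apply: continuousN; exact: cf. Qed.

Lemma add_continuous (f g : S -> R) : continuous f -> continuous g -> continuous (fun p => f p + g p).
Proof. by move=> cf cg p; apply: continuousD; [exact: cf|exact: cg]. Qed.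

Lemma mul_continuous (f g : S -> R) : continuous f -> continuous g -> continuous (fun p => f p * g p).
Proof. by move=> cf cg p; apply: continuousM; [exact: cf|exact: cg]. Qed.

Lemma pos_le_abs (t : R) : pos t <= `|t|.
Proof. by rewrite /pos ge_max ler_norm normr_ge0. Qed.

Lemma pos_sub (t : R) : pos t - pos (- t) = t.
Proof.
have [t0|/ltW t0] := leP 0 t; first by rewrite (pos_id t0) (@pos_0 _ (- t)) ?subr0// oppr_le0.
by rewrite (pos_0 t0) (@pos_id _ (- t)) ?oppr_ge0// sub0r opprK.
Qed.

Lemma SI_fin (f g : S -> R) : continuous f -> continuous g -> (forall p, 0 <= f p) -> (forall p, f p <= g p) ->
  (SI g < +oo)%E -> SI f \is a fin_num.
Proof.
move=> cf cg f0 fg gfin; rewrite ge0_fin_numE; last exact: surface_integral_ge0.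
by apply: (le_lt_trans _ gfin); exact: surface_integral_le.
Qed.

Lemma sint_fin_pos f : sint_fin f -> SI (fun p => pos (f p)) \is a fin_num.
Proof.
move=> [cf hf]; apply: (@SI_fin _ (fun p => `|f p|)) => //.
- exact: pos_continuous.
- exact: abs_continuous.
- by move=> p; exact: pos_ge0.
- by move=> p; exact: pos_le_abs.
Qed.

Lemma sint_finN f : sint_fin f -> sint_fin (fun p => - f p).
Proof.
by move=> [cf hf]; split; [exact: opp_continuous|under eq_fun do rewrite normrN].
Qed.

Lemma sint_finD (f g : S -> R) : sint_fin f -> sint_fin g -> sint_fin (fun p => f p + g p).
Proof.
move=> [cf hf] [cg hg]; split; first exact: add_continuous.
have caf := abs_continuous cf; have cag := abs_continuous cg.
apply: (@le_lt_trans _ _ (SI (fun p => (`|f p| + `|g p|)%R))).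
  apply: surface_integral_le => //; first by apply: abs_continuous; exact: add_continuous.
    exact: add_continuous.
  by move=> p; exact: ler_normD.
by rewrite (surface_integralD imm)//; exact: lte_add_pinfty.
Qed.

Lemma fineSID (f g : S -> R) : continuous f -> continuous g -> (forall p, 0 <= f p) -> (forall p, 0 <= g p) ->
  SI f \is a fin_num -> SI g \is a fin_num -> fine (SI (fun p => f p + g p)) = fine (SI f) + fine (SI g).
Proof. by move=> cf cg f0 g0 ff fg; rewrite (surface_integralD imm)// fineD. Qed.

Lemma SI_finD (f g : S -> R) : continuous f -> continuous g -> (forall p, 0 <= f p) -> (forall p, 0 <= g p) ->
  SI f \is a fin_num -> SI g \is a fin_num -> SI (fun p => f p + g p) \is a fin_num.
Proof. by move=> cf cg f0 g0 ff fg; rewrite (surface_integralD imm)// fin_numD ff fg. Qed.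

Lemma sintD (f g : S -> R) : sint_fin f -> sint_fin g -> sint (fun p => f p + g p) = sint f + sint g.
Proof.
have lin (n p a b c d : R) : p + (c + d) = n + (a + b) -> p - n = (a - c) + (b - d) by lra.
move=> hf hg; have hfg := sint_finD hf hg.
have [cf _] := hf; have [cg _] := hg; have [cfg _] := hfg.
have a1 := sint_fin_pos hf; have a2 := sint_fin_pos hg; have a3 := sint_fin_pos hfg.
have b1 := sint_fin_pos (sint_finN hf); have b2 := sint_fin_pos (sint_finN hg); have b3 := sint_fin_pos (sint_finN hfg).
have pc := pos_continuous; have oc := opp_continuous.
have p0 (h : S -> R) p : 0 <= pos (h p) by exact: pos_ge0.
(* Positive parts are not additive; this identity between sums of nonnegative functions with finite
   integrals takes the place of additivity. *)
have E : (fun p => pos (f p + g p) + (pos (- f p) + pos (- g p))) = (fun p => pos (- (f p + g p)) + (pos (f p) + pos (g p))).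
  apply/funext => p; have := pos_sub (f p + g p); have := pos_sub (f p); have := pos_sub (g p); lra.
have c1 := pc _ cf; have c2 := pc _ cg; have c3 := pc _ cfg.
have e1 := pc _ (oc _ cf); have e2 := pc _ (oc _ cg); have e3 := pc _ (oc _ cfg).
have z1 p : 0 <= pos (- f p) + pos (- g p) by rewrite addr_ge0// pos_ge0.
have z2 p : 0 <= pos (f p) + pos (g p) by rewrite addr_ge0// pos_ge0.
have E1 : fine (SI (fun p => pos (f p + g p) + (pos (- f p) + pos (- g p)))) =
  fine (SI (fun p => pos (f p + g p))) + (fine (SI (fun p => pos (- f p))) + fine (SI (fun p => pos (- g p)))).
  rewrite -(@fineSID _ _ e1 e2 (p0 _) (p0 _) b1 b2).
  exact: (@fineSID (fun p => pos (f p + g p)) (fun p => pos (- f p) + pos (- g p)) c3 (add_continuous e1 e2) (p0 _) z1 a3 (@SI_finD _ _ e1 e2 (p0 _) (p0 _) b1 b2)).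
have E2 : fine (SI (fun p => pos (- (f p + g p)) + (pos (f p) + pos (g p)))) =
  fine (SI (fun p => pos (- (f p + g p)))) + (fine (SI (fun p => pos (f p))) + fine (SI (fun p => pos (g p)))).
  rewrite -(@fineSID _ _ c1 c2 (p0 _) (p0 _) a1 a2).
  exact: (@fineSID (fun p => pos (- (f p + g p))) (fun p => pos (f p) + pos (g p)) e3 (add_continuous c1 c2) (p0 _) z2 b3 (@SI_finD _ _ c1 c2 (p0 _) (p0 _) a1 a2)).
by apply: lin; rewrite -E1 -E2 E.
Qed.

Lemma SI0 : SI (fun=> 0) = 0%E.
Proof.
have c0 : continuous (fun _ : S => (0 : R)) by move=> p; exact: cvg_cst.
have := surface_integralZ imm c0 (fun p => lexx 0) (lexx 0).
by rewrite mul0e mulr0.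
Qed.

Lemma sint_ge0 f : (forall p, 0 <= f p) -> sint f = fine (SI f).
Proof.
move=> f0; rewrite /sint.
have -> : (fun p => pos (f p)) = f by apply/funext => p; exact: pos_id.
have -> : (fun p => pos (- f p)) = (fun=> 0) by apply/funext => p; rewrite pos_0// oppr_le0.
by rewrite SI0 subr0.
Qed.

(** Truncation by the box, rather than by the open chart domain, yields a function continuous on the
    whole plane when [f] is supported in the image of the box. *)
Definition ext n x r (f : S -> R) (y : R * R) : R := if `[< box x r y >] then dens F n f y else 0.

Lemma cc_zero_ext (V : set (R * R)) (x : R * R) (r : R) (g : R * R -> R) : open V -> box x r `<=` V ->
  (forall y, V y -> {for y, continuous g}) -> (forall y, V y -> ~ box x r y -> g y = 0) ->
  cc (fun y => if `[< box x r y >] then g y else 0).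
Proof.
move=> oV bV cg g0; split.
  move=> y; have [Vy|nV] := pselect (V y).
    apply: (cont_near _ (cg y Vy)); apply: (near_of_open oV Vy) => z Vz.
    by case: ifPn => // /asboolPn nb; exact: g0.
  have nb : ~ box x r y by move=> /bV.
  apply: (@cont_near _ (fun=> 0)); last exact: cvg_cst.
  apply: (@near_of_open _ (~` box x r)) => //; first by rewrite openC; exact: box_closed.
  by move=> z nz; rewrite asboolF.
exists (`|x| + r) => y; case: ifPn => [/asboolP[h1 h2] _|]; last by rewrite eqxx.
have -> : y = x + (y - x) by rewrite addrC subrK.
apply: le_trans (ler_normD _ _) _; rewrite lerD2l prod_normE /= ge_max; apply/andP; split.
  exact: h1.
exact: h2.
Qed.

Lemma ext_cc n x r (f : S -> R) : box x r `<=` U n -> continuous f -> (forall p, ~ (par n @` box x r) p -> f p = 0) ->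
  cc (ext n x r f).
Proof.
move=> bU cf f0; apply: (@cc_zero_ext (U n)) => //; first exact: oU.
  by move=> y Uy; exact: dens_cont.
move=> y Uy nb; rewrite /dens f0 ?mul0r// => -[z zb e]; apply: nb.
by rewrite -(parK Uy) -e parK//; exact: bU.
Qed.

Lemma sint_chart0 n x r (f : S -> R) : box x r `<=` U n -> continuous f -> (forall p, 0 <= f p) ->
  (forall p, ~ (par n @` box x r) p -> f p = 0) -> SI f = (I2 (ext n x r f))%:E.
Proof.
move=> bU cf f0 foff; have ce := ext_cc bU cf foff.
have E : (\int[lam2]_(y in U n) (dens F n f y)%:E)%E = (I2 (ext n x r f))%:E.
  rewrite (I2_ereal ce) [LHS]integral_mkcond; apply: eq_integral => y _; rewrite patchE.
  rewrite /ext; case: ifPn => [/set_mem Uy|/negP nU]; case: ifPn => [/asboolP yb|/asboolPn nb] //.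
    rewrite /dens foff ?mul0r// => -[z zb e]; apply: nb.
    by rewrite -(parK Uy) -e parK//; exact: bU.
  by case: nU; apply/mem_set; exact: bU.
rewrite -E; apply: (chart_integral imm) => //.
  move=> p ndp; apply: foff => -[z zb e]; apply: ndp; rewrite -e; apply: par_cdom; exact: bU.
by rewrite E ltry.
Qed.

Lemma sint_chart n x r (f : S -> R) : box x r `<=` U n -> continuous f ->
  (forall p, ~ (par n @` box x r) p -> f p = 0) -> sint_fin f /\ sint f = I2 (ext n x r f).
Proof.
move=> bU cf foff.
have cP := pos_continuous cf; have cN := pos_continuous (opp_continuous cf).
have z1 p : ~ (par n @` box x r) p -> pos (f p) = 0 by move=> /foff ->; rewrite pos_0.
have z2 p : ~ (par n @` box x r) p -> pos (- f p) = 0 by move=> /foff ->; rewrite oppr0 pos_0.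
have z3 p : ~ (par n @` box x r) p -> `|f p| = 0 by move=> /foff ->; rewrite normr0.
split; first by split=> //; rewrite (sint_chart0 bU (abs_continuous cf) (fun p => normr_ge0 _) z3) ltry.
rewrite /sint (sint_chart0 bU cP (fun p => pos_ge0 _) z1) (sint_chart0 bU cN (fun p => pos_ge0 _) z2) /=.
rewrite -I2B; [|exact: ext_cc|exact: ext_cc].
congr I2; apply/funext => y; rewrite /ext; case: ifP => _; last by rewrite subrr.
by rewrite /dens -mulrBl pos_sub.
Qed.

End SignedIntegral.

(** * Derivatives in charts and frames at a point *)

Section Gradient.
Variables (R : realType) (S : surface R) (F : S -> 'rV[R]_3).
Hypothesis imm : smooth_immersion F.
Local Notation U n := (ccod (atlas S n)).
Local Notation par n := (par (atlas S n)).
Local Notation crd n := (crd (atlas S n)).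
Local Notation X n := (local_param F n).

Definition e10 : R * R := (1, 0).
Definition e01 : R * R := (0, 1).
Definition gr1 n (f : S -> R) x := 'D_e10 (f \o par n) x.
Definition gr2 n (f : S -> R) x := 'D_e01 (f \o par n) x.

Lemma gr_eq n f V f1 f2 x : hasC1 V (f \o par n) f1 f2 -> V x -> gr1 n f x = f1 x /\ gr2 n f x = f2 x.
Proof.
move=> h Vx; rewrite /gr1 /gr2 (hasC1_D e10 h Vx) (hasC1_D e01 h Vx).
by rewrite /e10 /e01 /= !(mul1r, mul0r) addr0 add0r.
Qed.

Local Opaque e10 e01.

Lemma sC1_hasC1 f n : sC1 f -> hasC1 (U n) (f \o par n) (gr1 n f) (gr2 n f).
Proof.
move=> /(_ n)[f1 [f2 h]]; apply: (hasC1_ext (@oU _ S n) h) => y Uy.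
by have [-> ->] := gr_eq h Uy.
Qed.

Lemma surf_cont (f : S -> R) : (forall n y, U n y -> {for y, continuous (f \o par n)}) -> continuous f.
Proof.
move=> H p; have [n dp] := atlas_cover p.
have c2 : {for p, continuous ((f \o par n) \o crd n)}.
  exact: (continuous_comp (crd_continuous dp) (H n _ (crd_ccod dp))).
suff : f q @[q --> p] --> f p by [].
rewrite -{2}(crdK dp); apply: cvg_trans c2; apply: near_eq_cvg.
by apply: filterS (near_dom dp) => q dq; rewrite /= crdK.
Qed.

Lemma sC1_cst (k : R) : sC1 (fun _ : S => k).
Proof. by move=> n; exists (fun=> 0), (fun=> 0); exact: hasC1_cst. Qed.

Lemma sC1_add (f g : S -> R) : sC1 f -> sC1 g -> sC1 (fun p => f p + g p).
Proof. by move=> /sC1_hasC1 hf /sC1_hasC1 hg n; do 2 eexists; exact: (hasC1_add (hf n) (hg n)). Qed.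

Lemma sC1_mul (f g : S -> R) : sC1 f -> sC1 g -> sC1 (fun p => f p * g p).
Proof. by move=> /sC1_hasC1 hf /sC1_hasC1 hg n; do 2 eexists; exact: (hasC1_mul (hf n) (hg n)). Qed.

Lemma sC1_opp (f : S -> R) : sC1 f -> sC1 (fun p => - f p).
Proof. by move=> /sC1_hasC1 hf n; do 2 eexists; exact: (hasC1_opp (hf n)). Qed.

Lemma gr_mul (f g : S -> R) n x : sC1 f -> sC1 g -> U n x ->
  gr1 n (fun p => f p * g p) x = gr1 n f x * g (par n x) + f (par n x) * gr1 n g x /\
  gr2 n (fun p => f p * g p) x = gr2 n f x * g (par n x) + f (par n x) * gr2 n g x.
Proof. by move=> /sC1_hasC1 hf /sC1_hasC1 hg Ux; exact: (gr_eq (hasC1_mul (hf n) (hg n)) Ux). Qed.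

Lemma gr_add (f g : S -> R) n x : sC1 f -> sC1 g -> U n x ->
  gr1 n (fun p => f p + g p) x = gr1 n f x + gr1 n g x /\
  gr2 n (fun p => f p + g p) x = gr2 n f x + gr2 n g x.
Proof. by move=> /sC1_hasC1 hf /sC1_hasC1 hg Ux; exact: (gr_eq (hasC1_add (hf n) (hg n)) Ux). Qed.

Lemma gr_local_cst (f : S -> R) n x k : U n x -> (\forall q \near par n x, f q = k) ->
  gr1 n f x = 0 /\ gr2 n f x = 0.
Proof.
move=> Ux nf; have : nbhs (par n x) [set q | f q = k] by exact: nf.
rewrite nbhsE => -[B [oB Bx] BE].
have oV := open_par (n := n) oB.
have h : hasC1 (U n `&` par n @^-1` B) (f \o par n) (fun=> 0) (fun=> 0).
  by apply: (hasC1_ext oV (@hasC1_cst R _ k)) => y [Uy By]; rewrite /= (BE _ By).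
exact: (gr_eq h (conj Ux Bx)).
Qed.

Lemma enorm_vec_near (Y : R * R -> 'rV[R]_3) x e : {for x, continuous Y} -> 0 < e ->
  \forall y \near x, enorm (Y y - Y x) < e.
Proof.
move=> cY e0.
have cd : {for x, continuous (fun y => Y y - Y x)}.
  by apply: (@continuousB _ _ _ Y (fun=> Y x)) => //; exact: cvg_cst.
have ce : {for x, continuous (fun y => enorm (Y y - Y x))}.
  exact: (continuous_comp cd (@enorm_cont R _)).
have := cont_near_lt ce e0; apply: filterS => y.
by rewrite subrr enorm0 subr0 => /ltr_normlW.
Qed.

Transparent d1 d2.
Lemma d1_cont n x : U n x -> {for x, continuous (d1 (X n))}.
Proof.
move=> Ux; apply: differentiable_continuous.
exact: (smooth_diff (smooth_pd 0 (@smX _ _ _ imm n)) Ux).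
Qed.
Lemma d2_cont n x : U n x -> {for x, continuous (d2 (X n))}.
Proof.
move=> Ux; apply: differentiable_continuous.
exact: (smooth_diff (smooth_pd 1 (@smX _ _ _ imm n)) Ux).
Qed.
Opaque d1 d2.

(** On the box the metric agrees with that at the centre up to a factor 2, so one frame chosen at
    the centre serves for the whole box. *)
Definition good n x r m := nice F n x r m /\ forall y, box x r y -> forall v,
  spd F n y v <= 2 * spd F n x v /\ spd F n x v <= 2 * spd F n y v.

Lemma enorm_comb (s t : R) (u w : 'rV[R]_3) : enorm (s *: u + t *: w) <= `|s| * enorm u + `|t| * enorm w.
Proof. by apply: le_trans (enormD _ _) _; rewrite !enormZ. Qed.

(** Changes of less than m / 4 in [d1] and [d2] alter the speed of [v] by at most half, as |v_1| and
    |v_2| are at most speed / m. The radius is written 4 r to leave room for shifts of the box of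
    half-side r. *)
Lemma good_exists n x (P : set (R * R)) : U n x -> nbhs x P -> exists r m, good n x (4 * r) m /\ box x (4 * r) `<=` P.
Proof.
have lin3 (a : R) : a / 2 = a / 4 + a / 4 by field.
move=> Ux nP; have [r [m [N bP]]] := nice_exists imm Ux nP; have [r0 m0 H] := N.
have m4 : 0 < m / 4 by rewrite divr_gt0.
have n1 := enorm_vec_near (d1_cont Ux) m4; have n2 := enorm_vec_near (d2_cont Ux) m4.
have [s s0 hs] := nbhs_box_in (filterI n1 n2).
pose t := Num.min r s; have t0 : 0 < t by rewrite lt_min r0.
have tr : t <= r by rewrite ge_min lexx.
have ts : t <= s by rewrite ge_min lexx orbT.
have e4 : 4 * (t / 4) = t by rewrite mulrC divfK.
exists (t / 4), m; rewrite e4; split; last by apply: subset_trans bP; exact: box_le.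
split; first by split=> // y /(box_le tr); exact: H.
have lin1 (a b c : R) : `|a - b| <= c / 2 -> a <= c / 2 + b /\ b <= c / 2 + a.
  by rewrite ler_norml => /andP[h1 h2]; split; lra.
have lin2' (a b : R) : 0 <= b -> `|a - b| <= b / 2 -> a <= 2 * b /\ b <= 2 * a.
  by move=> b0; rewrite ler_norml => /andP[h1 h2]; split; lra.
move=> y yb v; apply: lin2'; first exact: enorm_ge0.
have [h1 h2] := hs y (box_le ts yb).
have [_ /(_ v)[w1 w2]] := H x (box_center x (ltW r0)).
have tri (a b : 'rV[R]_3) : `|enorm a - enorm b| <= enorm (a - b).
  rewrite ler_norml lerBrDl lerBlDl; apply/andP; split.
    by rewrite -(enormN (a - b)) opprB; have := enormD (b - a) a; rewrite subrK.
  by rewrite lerBlDl; have := enormD b (a - b); rewrite (addrC b) subrK.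
apply: le_trans (tri _ _) _.
have -> : vel F n y v - vel F n x v = v.1 *: (d1 (X n) y - d1 (X n) x) + v.2 *: (d2 (X n) y - d2 (X n) x).
  by rewrite /vel !scalerBr opprD addrACA.
apply: (le_trans (enorm_comb _ _ _ _)); rewrite lin3.
have bnd (a b : R) : m * `|a| <= spd F n x v -> b < m / 4 -> `|a| * b <= spd F n x v / 4.
  move=> h b4; rewrite ler_pdivlMr//; apply: le_trans h; rewrite -mulrA mulrC ler_wpM2r//.
  by rewrite mulrC -ler_pdivlMl// mulrC ltW.
by apply: lerD; apply: bnd.
Qed.

Transparent EE FF GG DD.
(** The Cholesky factorization of the first fundamental form: a^2 = E, a b = F and c^2 = (E G - F^2)
    / E. *)
Lemma frame n x : U n x -> exists a b c : R, [/\ a != 0, c != 0 &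
  forall v, spd F n x v ^+ 2 = (a * v.1 + b * v.2) ^+ 2 + (c * v.2) ^+ 2].
Proof.
move=> Ux; have D0 := DD_gt0 (immX imm n) Ux.
have E0 : 0 < EE (X n) x.
  rewrite lt_neqAle EE_ge0 andbT eq_sym; apply: contraTneq D0 => E0.
  by rewrite DDE E0 mul0r sub0r oppr_gt0 -leNgt sqr_ge0.
pose a := Num.sqrt (EE (X n) x); have a0 : a != 0 by rewrite gt_eqF// sqrtr_gt0.
have a2 : a ^+ 2 = EE (X n) x by rewrite sqr_sqrtr// ltW.
pose c := Num.sqrt (DD (X n) x / EE (X n) x); have c0 : c != 0 by rewrite gt_eqF// sqrtr_gt0 divr_gt0.
have c2 : c ^+ 2 = DD (X n) x / EE (X n) x by rewrite sqr_sqrtr// ltW// divr_gt0.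
exists a, (FF (X n) x / a), c; split=> // v.
rewrite spd_sqr [(c * _) ^+ 2]exprMn c2 DDE -a2.
by move: (GG _ _) (FF _ _) => G F0; field.
Qed.
Opaque EE FF GG DD.

End Gradient.

Lemma box_segm (R : realType) (x y z : R * R) (r t : R) : box x r y -> box x r z -> 0 <= t <= 1 -> box x r (segm y z t).
Proof.
move=> [y1 y2] [z1 z2] /andP[t0 t1].
have conv (a b c : R) : `|a - c| <= r -> `|b - c| <= r -> `|a + t * (b - a) - c| <= r.
  move=> ha hb; have -> : a + t * (b - a) - c = (1 - t) * (a - c) + t * (b - c) by ring.
  apply: le_trans (ler_normD _ _) _; rewrite !normrM (ger0_norm t0) ger0_norm ?subr_ge0//.
  have -> : r = (1 - t) * r + t * r by ring.
  by apply: lerD; rewrite ler_wpM2l// subr_ge0.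
by split; exact: conv.
Qed.

Lemma div_identity (R : realType) (e dv W D ch ch1 ch2 g g1 g2 V1 V2 V11 V22 B1 B2 : R) :
  V11 + V22 = W * dv -> V1 * B1 + V2 * B2 = W * D -> B1 = ch1 * g + ch * g1 -> B2 = ch2 * g + ch * g2 ->
  e * (ch * g * dv + D) * W =
  e * ((ch1 * (g * V1) + ch * (g1 * V1 + g * V11)) + (ch2 * (g * V2) + ch * (g2 * V2 + g * V22))).
Proof.
move=> h1 h2 b1 b2; transitivity (e * (ch * g * (W * dv) + W * D)); first by ring.
by rewrite -h1 -h2 b1 b2; ring.
Qed.

Lemma box_norm (R : realType) (x y : R * R) (r : R) : box x r y -> `|y| <= `|x| + r.
Proof.
move=> [h1 h2]; have -> : y = x + (y - x) by rewrite addrC subrK.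
apply: le_trans (ler_normD _ _) _; rewrite lerD2l prod_normE /= ge_max; apply/andP; split.
  exact: h1.
exact: h2.
Qed.

(** * The divergence theorem on the surface *)

Section Stokes.
Variables (R : realType) (S : surface R) (F : S -> 'rV[R]_3).
Hypothesis imm : smooth_immersion F.
Local Notation U n := (ccod (atlas S n)).
Local Notation par n := (par (atlas S n)).
Local Notation crd n := (crd (atlas S n)).
Local Notation X n := (local_param F n).
Local Notation I2 := (@I2 R).
Local Notation SI := (surface_integral F).
Local Notation W n := (area_density (X n)).
Local Notation gr1 := (@gr1 R S).
Local Notation gr2 := (@gr2 R S).

(* A tangential C^1 vector field Y: in chart n, sqrt(det g) times the
   components of Y are V1 n and V2 n; dv = div Y, N = |Y| and Dd f = df(Y). *)
Variables (V1 V2 : nat -> R * R -> R) (dv N : S -> R) (Dd : (S -> R) -> S -> R).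
Hypothesis HV : forall n, exists V11 V12 V21 V22, [/\ hasC1 (U n) (V1 n) V11 V12, hasC1 (U n) (V2 n) V21 V22 &
  forall y, U n y -> V11 y + V22 y = W n y * dv (par n y)].
Hypothesis HD : forall f, sC1 f -> forall n y, U n y ->
  V1 n y * gr1 n f y + V2 n y * gr2 n f y = W n y * Dd f (par n y).
Hypothesis HN : forall n y, U n y -> spd F n y (V1 n y, V2 n y) = W n y * N (par n y).
Hypothesis N_ge0 : forall p, 0 <= N p.
Hypothesis N_cont : continuous N.
Hypothesis N_fin : (SI N < +oo)%E.
Variables (eta : S -> R) (Kc : set S) (L : R).
Hypothesis eta_cont : continuous eta.
Hypothesis Kc_compact : compact Kc.
Hypothesis eta_supp : forall p, ~ Kc p -> eta p = 0.
Hypothesis L_ge0 : 0 <= L.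
Hypothesis eta_lip : forall c p q, step F c p q -> `|eta p - eta q| <= L * c.

Lemma W_gt0 n y : U n y -> 0 < W n y.
Proof. exact: (area_gt0 (immX imm n)). Qed.

Lemma W_cont n y : U n y -> {for y, continuous (W n)}.
Proof. exact: (area_cont (@oU _ S n) (@smX _ _ _ imm n)). Qed.

Lemma divW_cont (g : S -> R) (k : nat -> R * R -> R) :
  (forall n y, U n y -> {for y, continuous (k n)}) ->
  (forall n y, U n y -> k n y = W n y * g (par n y)) -> continuous g.
Proof.
move=> ck kE; apply: surf_cont => n y Uy.
have Wn : {for y, continuous (fun y => (W n y)^-1)}.
  by apply: continuousV; [rewrite gt_eqF// W_gt0|exact: W_cont].
apply: (cont_near _ (continuousM (ck n y Uy) Wn)).
apply: (near_of_open (@oU _ S n) Uy) => z Uz.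
by rewrite [LHS]/= kE// mulrC mulKf// gt_eqF// W_gt0.
Qed.

Lemma dv_cont : continuous dv.
Proof.
have /choice[k hk] : forall n, exists k : R * R -> R, (forall y, U n y -> {for y, continuous k}) /\
   (forall y, U n y -> k y = W n y * dv (par n y)).
  move=> n; have [V11 [V12 [V21 [V22 [h1 h2 h]]]]] := HV n.
  exists (fun y => V11 y + V22 y); split=> // y Uy.
  by apply: continuousD; [have [_ c _] := h1 y Uy|have [_ _ c] := h2 y Uy].
by apply: (@divW_cont _ k) => n; have [h1 h2] := hk n.
Qed.

Lemma Dd_cont f : sC1 f -> continuous (Dd f).
Proof.
move=> sf; apply: (@divW_cont _ (fun n y => V1 n y * gr1 n f y + V2 n y * gr2 n f y)); last exact: HD.
move=> n y Uy; have [V11 [V12 [V21 [V22 [h1 h2 h]]]]] := HV n.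
have [_ c1 c2] := sC1_hasC1 (n := n) sf Uy.
exact: (continuousD (continuousM (hasC1_cont h1 Uy) c1) (continuousM (hasC1_cont h2 Uy) c2)).
Qed.

Lemma Dd_local f p k : sC1 f -> (\forall q \near p, f q = k) -> Dd f p = 0.
Proof.
move=> sf nf; have [n dp] := atlas_cover p; have Ux := crd_ccod dp.
rewrite -(crdK dp) in nf *; have [e1 e2] := gr_local_cst Ux nf.
have := HD sf Ux; rewrite e1 e2 !mulr0 addr0 => /esym/eqP.
by rewrite mulf_eq0 gt_eqF ?W_gt0//= => /eqP.
Qed.

(** The integrand eta div(f Y). *)
Definition T f p := eta p * (f p * dv p + Dd f p).

Lemma T_cont f : sC1 f -> continuous (T f).
Proof.
move=> sf; apply: mul_continuous => //; apply: add_continuous; last exact: Dd_cont.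
by apply: mul_continuous; [exact: sC1_cont|exact: dv_cont].
Qed.

(* This property is stable under sums of functions, so it suffices to verify it for small bumps. *)
Definition Q f := sint_fin F (T f) /\ `|sint F (T f)| <= 8 * L * fine (SI (fun p => f p * N p)).

Lemma NI f : sC1 f -> (forall p, 0 <= f p <= 1) -> SI (fun p => f p * N p) \is a fin_num.
Proof.
move=> sf f01; apply: (SI_fin imm _ N_cont _ _ N_fin).
- by apply: mul_continuous => //; exact: sC1_cont.
- by move=> p; rewrite mulr_ge0//; case/andP: (f01 p).
- by move=> p; rewrite ler_piMl//; case/andP: (f01 p).
Qed.

Lemma Dd_add f g p : sC1 f -> sC1 g -> Dd (fun p => f p + g p) p = Dd f p + Dd g p.
Proof.
move=> sf sg; have [n dp] := atlas_cover p; have Ux := crd_ccod dp.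
have W0 := W_gt0 Ux.
have e := HD (sC1_add sf sg) Ux; have ef := HD sf Ux; have eg := HD sg Ux.
have [e1 e2] := gr_add sf sg Ux; rewrite crdK// in e ef eg.
have Wn : W n (crd n p) != 0 by rewrite gt_eqF.
by apply: (mulfI Wn); rewrite mulrDr -e -ef -eg e1 e2 !mulrDr addrACA.
Qed.

Lemma Q_add f g : sC1 f -> sC1 g -> (forall p, 0 <= f p <= 1) -> (forall p, 0 <= g p <= 1) ->
  Q f -> Q g -> Q (fun p => f p + g p).
Proof.
move=> sf sg f01 g01 [ff bf] [fg bg].
have E : T (fun p => f p + g p) = (fun p => T f p + T g p).
  by apply/funext => p; rewrite /T Dd_add//; ring.
split; first by rewrite E; exact: sint_finD.
rewrite E (sintD imm ff fg); apply: le_trans (ler_normD _ _) _; apply: le_trans (lerD bf bg) _.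
rewrite -mulrDr; have -> : (fun p => (f p + g p) * N p) = (fun p => f p * N p + g p * N p).
  by apply/funext => p; rewrite mulrDl.
have cf := mul_continuous (sC1_cont sf) N_cont; have cg := mul_continuous (sC1_cont sg) N_cont.
have pf p : 0 <= f p * N p by rewrite mulr_ge0//; case/andP: (f01 p).
have pg p : 0 <= g p * N p by rewrite mulr_ge0//; case/andP: (g01 p).
by rewrite (fineSID imm cf cg pf pg (NI sf f01) (NI sg g01)).
Qed.

(** The vector [xi] has length at most 1 at the centre, hence at most 2 on the box of half-side 4 r,
    so the segment joining the shifted point to [y] is a step of bound 2 h. The condition on [h]
    keeps the shifted point in the box of half-side 2 r. *)
Lemma eta_shift n x r m (xi : R * R) (k : R) y h : good F n x (4 * r) m -> 0 < r ->
  `|xi.1| <= k -> `|xi.2| <= k -> spd F n x xi <= 1 -> box x r y -> 0 < h -> h < r / (k + 1) ->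
  box x (2 * r) (y - (h * xi.1, h * xi.2)) /\
  `|eta (par n (y - (h * xi.1, h * xi.2))) - eta (par n y)| <= 2 * L * h.
Proof.
move=> [[_ _ H] G] r0 k1 k2 s1 yb h0 hr.
have k0 : 0 <= k by exact: le_trans k1.
have hk : h * k <= r.
  move: hr; rewrite ltr_pdivlMr ?ltr_wpDl// => /ltW; apply: le_trans; rewrite ler_pM2l//; lra.
have r2 : r <= 2 * r by lra.
have r4 : 2 * r <= 4 * r by lra.
have y'b : box x (2 * r) (y - (h * xi.1, h * xi.2)).
  have bnd (a b c : R) : `|a - b| <= r -> `|c| <= k -> `|a - h * c - b| <= 2 * r.
    move=> ab ck; rewrite addrAC; apply: le_trans (ler_normB _ _) _.
    rewrite normrM (gtr0_norm h0) mulr_natl mulr2n; apply: lerD => //; apply: le_trans hk.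
    by rewrite ler_pM2l.
  by case: yb => b1 b2; split; exact: bnd.
split=> //; set y' := y - _ in y'b *.
have df : diffp y' y = (h * xi.1, h * xi.2).
  by transitivity (diffp y' (y' + (h * xi.1, h * xi.2))); [rewrite subrK|exact: diffp_add].
have st : step F (2 * h) (par n y') (par n y).
  split; first by rewrite mulr_gt0.
  have sb t : 0 <= t <= 1 -> box x (4 * r) (segm y' y t).
    by move=> t01; apply: (box_le r4); apply: box_segm => //; exact: box_le r2 _ yb.
  exists n, y', y; split=> // t t01; first by have [] := H _ (sb t t01).
  rewrite df spdZ (gtr0_norm h0) mulrC ler_pM2r//.
  apply: le_trans (G _ (sb t t01) xi).1 _.
  by rewrite -[leRHS]mulr1 ler_pM2l.
by apply: le_trans (eta_lip st) _; rewrite mulrCA mulrA.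
Qed.

(** The factor 8 is a product of three factors 2: one from [eta_shift], one for comparing the norm
    of the field with its norm in the metric of the centre, and one for the two frame components. *)
Lemma Q_bump n x r m f : good F n x (4 * r) m -> sC1 f -> (forall p, 0 <= f p <= 1) ->
  Q (fun p => bump n x r p * f p).
Proof.
move=> Gd sf f01; have [N4 G] := Gd; have [r40 m0 H] := N4.
have r0 : 0 < r by move: r40; rewrite pmulr_rgt0.
have r24 : 4 * r / 2 = 2 * r by field.
have r4 : r <= 4 * r by lra.
have r2 : r <= 2 * r by lra.
have r42 : 2 * r <= 4 * r by lra.
have bU4 : box x (4 * r) `<=` U n by move=> y /H[].
have bU : box x r `<=` U n by move=> y /(box_le r4)/bU4.
have Nr : nice F n x r m by split=> // y /(box_le r4)/H.
have sb := sC1_bump imm Nr; set th := fun p => _.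
have sth : sC1 th by exact: sC1_mul.
have th01 p : 0 <= th p <= 1.
  have /andP[a0 a1] := bump_01 n x r p; have /andP[b0 b1] := f01 p.
  by rewrite mulr_ge0//= mulr_ile1.
have thoff p : ~ (par n @` box x r) p -> th p = 0.
  by move=> np; rewrite /th (bump_0 Nr np) mul0r.
have Toff p : ~ (par n @` box x r) p -> T th p = 0.
  move=> np; rewrite /T (thoff _ np) (@Dd_local _ _ 0)// ?mul0r ?addr0 ?mulr0//.
  have nK : nbhs p (~` (par n @` box x r)).
    by apply: open_nbhs_nbhs; split=> //; apply: closed_openC; exact: par_box_closed Nr.
  by apply: filterS nK.
have [ff Ei] := sint_chart imm bU (T_cont sth) Toff.
split; first exact: ff.
have [V11 [V12 [V21 [V22 [h1 h2 hdv]]]]] := HV n.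
have hg := sC1_hasC1 (n := n) sf.
have oUn := @oU _ S n.
have chi0 y := @chi_0 R x r y r0.
have hP := hasC1_zero_ext oUn (@box_closed R x r) bU (hasC1_chi x r) chi0 (hasC1_mul hg h1).
have hQ := hasC1_zero_ext oUn (@box_closed R x r) bU (hasC1_chi x r) chi0 (hasC1_mul hg h2).
(* [eta] in the chart, made continuous on the plane by a bump that equals 1 on the box of half-side
   2 r, where all shifted points lie. *)
pose etat y := if `[< box x (4 * r) y >] then chi x (4 * r) y * eta (par n y) else 0.
have ce : cc etat.
  apply: (@cc_zero_ext _ (U n)) => //.
    move=> y Uy; have c1 : {for y, continuous (chi x (4 * r))} by exact: hasC1_cont (hasC1_chi x (4 * r)) I.
    have c2 : {for y, continuous (eta \o par n)}.
      exact: (continuous_comp (par_continuous Uy) (@eta_cont (par n y))).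
    exact: (continuousM c1 c2).
  by move=> y _ nb; rewrite chi_0// mul0r.
have etatE y : box x (2 * r) y -> etat y = eta (par n y).
  move=> yb; have yb4 := box_le r42 yb.
  by rewrite /etat asboolT// (chi_1 r40) ?mul1r// r24.
set P := fun y => _ in hP; set P1 := fun y => _ in hP; set P2 := fun y => _ in hP.
set Q' := fun y => _ in hQ; set Q1 := fun y => _ in hQ; set Q2 := fun y => _ in hQ.
have P0 y : ~ box x r y -> P y = 0 by move=> nb; rewrite /P chi0// mul0r.
have Q0 y : ~ box x r y -> Q' y = 0 by move=> nb; rewrite /Q' chi0// mul0r.
have EI : I2 (ext F n x r (T th)) = I2 (fun y => etat y * (P1 y + Q2 y)).
  congr I2; apply/funext => y; rewrite /ext; case: ifPn => [/asboolP yb|/asboolPn nb]; last first.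
    have [-> _] := hasC1_off hP (@box_closed R x r) P0 nb.
    by have [_ ->] := hasC1_off hQ (@box_closed R x r) Q0 nb; rewrite addr0 mulr0.
  have Uy := bU _ yb; rewrite (etatE _ (box_le r2 yb)) /dens /T.
  have hb : hasC1 (U n) (bump n x r \o par n) (chi1 x r) (chi2 x r).
    apply: (hasC1_ext oUn (hasC1_sub (@subsetT _ (U n)) (hasC1_chi x r))) => z Uz.
    by rewrite /= bump_par.
  have [b1 b2] := gr_eq hb Uy; have [e1 e2] := gr_mul sb sf Uy.
  rewrite bump_par// b1 in e1; rewrite bump_par// b2 in e2.
  have thE : th (par n y) = chi x r y * f (par n y) by rewrite /th bump_par.
  rewrite thE; exact: (div_identity _ (hdv y Uy) (HD sth Uy) e1 e2).
have [a [b [c [a0 c0 fr]]]] := frame imm (bU _ (box_center x (ltW r0))).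
pose k := `|a^-1| + `|- b / (a * c)| + `|c^-1|.
have k0 : 0 <= k by rewrite !addr_ge0.
pose h0 := r / (k + 1); have h00 : 0 < h0 by rewrite divr_gt0// ltr_wpDl.
pose M := `|x| + r.
have PM y : ~ cbox M y -> P y = 0 by move=> nM; apply: P0 => /box_norm h; apply: nM; exact/cboxP.
have QM y : ~ cbox M y -> Q' y = 0 by move=> nM; apply: Q0 => /box_norm h; apply: nM; exact/cboxP.
have L20 : 0 <= 2 * L by rewrite mulr_ge0.
have s0 v : 0 <= spd F n x v by exact: enorm_ge0.
have sp1 v : (a * v.1 + b * v.2) ^+ 2 + (c * v.2) ^+ 2 <= 1 -> spd F n x v <= 1.
  by rewrite -fr => h; rewrite -(ler_pXn2r (n := 2))// ?nnegrE// expr1n.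
have x1 : spd F n x (a^-1, 0) <= 1.
  by apply: sp1; rewrite /= !mulr0 addr0 divff// expr1n expr0n addr0.
have x2 : spd F n x (- b / (a * c), c^-1) <= 1.
  apply: sp1 => /=; rewrite divff// expr1n.
  have -> : a * (- b / (a * c)) + b / c = 0 by field; rewrite a0 c0.
  by rewrite expr0n add0r.
have lip y h : P y != 0 \/ Q' y != 0 -> 0 < h < h0 ->
     `|etat (y - (h * a^-1, h * 0)) - etat y| <= 2 * L * h /\
     `|etat (y - (h * (- b / (a * c)), h * c^-1)) - etat y| <= 2 * L * h.
  move=> nz /andP[hh hh0].
  have yb : box x r y.
    by apply: contrapT => nb; case: nz; rewrite ?P0 ?Q0 ?eqxx.
  have ka : `|a^-1| <= k by rewrite /k -addrA lerDl addr_ge0.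
  have kb : `|- b / (a * c)| <= k by rewrite /k addrAC lerDr addr_ge0.
  have kc : `|c^-1| <= k by rewrite /k lerDr addr_ge0.
  have kz : `|0 : R| <= k by rewrite normr0.
  have [w1 l1] := @eta_shift n x r m (a^-1, 0) k y h Gd r0 ka kz x1 yb hh hh0.
  have [w2 l2] := @eta_shift n x r m (- b / (a * c), c^-1) k y h Gd r0 kb kc x2 yb hh hh0.
  by rewrite (etatE _ w1) (etatE _ w2) (etatE _ (box_le r2 yb)).
have bd := divergence_bound hP hQ PM QM ce h00 a0 c0 L20 lip.
have thN0 p : ~ (par n @` box x r) p -> th p * N p = 0 by move=> /thoff ->; rewrite mul0r.
have cthN := mul_continuous (sC1_cont sth) N_cont.
have pthN p : 0 <= th p * N p by rewrite mulr_ge0//; case/andP: (th01 p).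
have ESI := sint_chart0 imm bU cthN pthN thN0.
have ccx := ext_cc imm bU cthN thN0.
have [cP _ _] := hasC1_cc hP PM; have [cQ _ _] := hasC1_cc hQ QM.
have key y : `|a * P y + b * Q' y| <= 2 * ext F n x r (fun p => th p * N p) y /\
             `|c * Q' y| <= 2 * ext F n x r (fun p => th p * N p) y.
  have [yb|nb] := pselect (box x r y); last first.
    by rewrite P0// Q0// /ext asboolF// !mulr0 addr0 normr0.
  have Uy := bU _ yb; rewrite /ext asboolT// /dens.
  pose q := chi x r y * f (par n y).
  have q0 : 0 <= q by rewrite mulr_ge0//; [case/andP: (chi_01 x r y)|case/andP: (f01 (par n y))].
  have thE : th (par n y) = q by rewrite /th bump_par.
  have PE : P y = q * V1 n y by rewrite /P /= mulrA.
  have QE : Q' y = q * V2 n y by rewrite /Q' /= mulrA.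
  have sE : spd F n x (P y, Q' y) <= 2 * (th (par n y) * N (par n y) * W n y).
    rewrite PE QE (@spdZ _ _ _ n x q (V1 n y, V2 n y)) (ger0_norm q0) thE.
    have := (G y (box_le r4 yb) (V1 n y, V2 n y)).2; rewrite (HN Uy) => hh.
    have -> : 2 * (q * N (par n y) * W n y) = q * (2 * (W n y * N (par n y))) by ring.
    exact: ler_wpM2l.
  have frv := fr (P y, Q' y); rewrite /= in frv.
  have sqle (t u : R) : t ^+ 2 + u ^+ 2 = spd F n x (P y, Q' y) ^+ 2 -> `|t| <= spd F n x (P y, Q' y).
    move=> e; rewrite -(ler_pXn2r (n := 2))// ?nnegrE// real_normK ?num_real// -e lerDl sqr_ge0//.
  split; apply: le_trans sE; first by apply: (sqle _ (c * Q' y)); rewrite -frv.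
  by apply: (sqle _ (a * P y + b * Q' y)); rewrite addrC -frv.
rewrite Ei EI ESI /=; apply: le_trans bd _.
have cP' := cc_norm (ccD (ccZ a cP) (ccZ b cQ)).
have b1 := I2_le cP' (ccZ 2 ccx) (fun y => (key y).1).
have b2 := I2_le (cc_norm (ccZ c cQ)) (ccZ 2 ccx) (fun y => (key y).2).
rewrite (I2Z _ ccx) in b1; rewrite (I2Z _ ccx) in b2.
have -> : 8 * L * I2 (ext F n x r (fun p => th p * N p)) =
  2 * L * (2 * I2 (ext F n x r (fun p => th p * N p)) + 2 * I2 (ext F n x r (fun p => th p * N p))) by ring.
by apply: ler_wpM2l => //; exact: lerD.
Qed.

(** A function [b] equal to 1 near [Kc], off which [eta] vanishes, is assembled from bumps by
    [compact_ind]. Its derivative along the field vanishes on [Kc], so [T b] is the function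
    [eta * dv]. *)
Lemma stokes : sint_fin F (fun p => eta p * dv p) /\
  `|sint F (fun p => eta p * dv p)| <= 8 * L * fine (SI N).
Proof.
pose Pr (A : set S) := exists b : S -> R, [/\ sC1 b, forall p, 0 <= b p <= 1,
  exists2 B, open B & A `<=` B /\ forall p, B p -> b p = 1 &
  forall f, sC1 f -> (forall p, 0 <= f p <= 1) -> Q (fun p => b p * f p)].
have c01 (k : R) : 0 <= k <= 1 -> forall p : S, 0 <= (fun=> k) p <= 1 by [].
have [b [sb b01 [B oB [KB B1]] Qb]] : Pr Kc.
  apply: (compact_ind Kc_compact).
  - exists (fun=> 0); split; [exact: sC1_cst|by move=> p; rewrite lexx ler01|by exists set0; [exact: open0|split; [exact: sub0set|move=> p []]]|].
    move=> f sf f01.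
    have -> : (fun p => (fun=> 0) p * f p) = (fun=> 0 : R) by apply/funext => p; rewrite mul0r.
    have T0 : T (fun=> 0) = (fun=> 0).
      apply/funext => p; rewrite /T (@Dd_local _ _ 0) ?mul0r ?addr0 ?mulr0//; first exact: sC1_cst.
      exact: nearW.
    rewrite /Q T0; split; first by split; [move=> p; exact: cvg_cst|rewrite normr0 (SI0 imm) ltry].
    rewrite (sint_ge0 imm)// (SI0 imm) normr0 mulr_ge0// ?mulr_ge0//.
    by apply: fine_ge0; apply: surface_integral_ge0 => p; rewrite mul0r.
  - move=> A C AC [b [sb b01 [B oB [CB B1]] Qb]]; exists b; split=> //.
    by exists B => //; split=> //; exact: subset_trans AC CB.
  - move=> A C [b [sb b01 [B oB [AB B1]] Qb]] [d [sd d01 [D oD [CD D1]] Qd]].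
    (* Here 1 - e = (1 - b)(1 - d), and e f = b f + d ((1 - b) f). Because the induction hypothesis
       covers all factors [f] with values in [0, 1], no partition of unity has to be built. *)
    pose e := fun p => b p + d p * (1 + - b p).
    have s1 : sC1 (fun p => 1 + - b p) by apply: sC1_add; [exact: sC1_cst|exact: sC1_opp].
    have o01 p : 0 <= 1 + - b p <= 1.
      by have /andP[u0 u1] := b01 p; rewrite subr_ge0 u1 gerBl u0.
    have e01 p : 0 <= e p <= 1.
      have /andP[u0 u1] := b01 p; have /andP[v0 v1] := d01 p; rewrite /e.
      have h1 : 0 <= d p * (1 + - b p) by rewrite mulr_ge0// subr_ge0.
      have h2 : 0 <= (1 - d p) * (1 + - b p) by rewrite mulr_ge0// subr_ge0.
      rewrite addr_ge0//= -subr_ge0.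
      by have -> : 1 - (b p + d p * (1 + - b p)) = (1 - d p) * (1 + - b p) by ring.
    exists e; split; [by apply: sC1_add => //; exact: sC1_mul|exact: e01| |].
    + exists (B `|` D); first exact: openU.
      split; first exact: setUSS.
      by move=> p [/B1 h|/D1 h]; rewrite /e h ?subrr ?mulr0 ?addr0// mul1r addrC subrK.
    + move=> f sf f01.
      have -> : (fun p => e p * f p) = (fun p => b p * f p + d p * ((1 + - b p) * f p)).
        by apply/funext => p; rewrite /e mulrDl mulrA.
      have g01 p : 0 <= (1 + - b p) * f p <= 1.
        by have /andP[u0 u1] := o01 p; have /andP[v0 v1] := f01 p; rewrite mulr_ge0//= mulr_ile1.
      have pr (u v : S -> R) : (forall p, 0 <= u p <= 1) -> (forall p, 0 <= v p <= 1) -> forall p, 0 <= u p * v p <= 1.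
        by move=> hu hv p; have /andP[u0 u1] := hu p; have /andP[v0 v1] := hv p; rewrite mulr_ge0//= mulr_ile1.
      have sg : sC1 (fun p => (1 + - b p) * f p) by exact: sC1_mul.
      by apply: Q_add; [exact: sC1_mul|exact: sC1_mul|exact: pr|exact: pr|exact: Qb|exact: Qd].
  - move=> p _; have [n dp] := atlas_cover p; have Ux := crd_ccod dp.
    have [r [m [Gd _]]] := good_exists imm Ux (@filterT _ (nbhs (crd n p)) _).
    have [[r40 m0 H] _] := Gd; have r0 : 0 < r by move: r40; rewrite pmulr_rgt0.
    have r4 : r <= 4 * r by lra.
    have Nr : nice F n (crd n p) r m by split=> // y /(box_le r4)/H.
    have r20 : 0 < r / 2 by rewrite divr_gt0.
    have [B [oB Bp] BB] : exists2 B, open_nbhs p B & B `<=` par n @` (box (crd n p) (r / 2) `&` U n).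
      by have := par_nbhs Ux (nbhs_box (crd n p) r20); rewrite crdK// nbhsE.
    exists B; first by apply: open_nbhs_nbhs.
    exists (bump n (crd n p) r); split.
    + exact: sC1_bump Nr.
    + exact: bump_01.
    + exists B => //; split=> // q /BB[y [yb Uy] <-].
      by apply: (bump_1 Nr); exists y.
    + by move=> f sf f01; exact: Q_bump Gd sf f01.
have one01 (p : S) : 0 <= (1 : R) <= 1 by rewrite ler01 lexx.
have := Qb (fun=> 1) (@sC1_cst R S 1) one01.
have -> : (fun p => b p * 1) = b by apply/funext => p; rewrite mulr1.
have -> : Q b = (sint_fin F (fun p => eta p * dv p) /\ `|sint F (fun p => eta p * dv p)| <= 8 * L * fine (SI (fun p => b p * N p))).
  rewrite /Q; have -> : T b = (fun p => eta p * dv p) => //.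
  apply/funext => p; rewrite /T; have [Kp|nK] := pselect (Kc p); last by rewrite eta_supp// !mul0r.
  have Bp := KB _ Kp; rewrite B1// mul1r (@Dd_local b p 1) ?addr0//.
  have nB : nbhs p B by apply: open_nbhs_nbhs.
  by apply: filterS nB => q; exact: B1.
move=> [ff bd]; split; first exact: ff.
apply: le_trans bd _; apply: ler_wpM2l; first by rewrite mulr_ge0.
apply: fine_le; [exact: NI|by rewrite ge0_fin_numE// surface_integral_ge0|].
apply: surface_integral_le => //.
- by apply: mul_continuous => //; exact: sC1_cont.
- by move=> p; rewrite mulr_ge0//; case/andP: (b01 p).
- by move=> p; rewrite ler_piMl//; case/andP: (b01 p).
Qed.

End Stokes.

(** * The translator equation *)

Section MeanCurvature.
Variable R : realType.

(* The dual metric applied to two covectors (a1, a2) and (b1, b2). *)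
Definition dualg (E F G a1 a2 b1 b2 : R) : R :=
  (G * (a1 * b1) - F * (a1 * b2 + a2 * b1) + E * (a2 * b2)) / (E * G - F ^+ 2).

Lemma inv2 (A : 'M[R]_2) (e f g : R) : A 0 0 = e -> A 0 1 = f -> A 1 0 = f -> A 1 1 = g ->
  e * g - f ^+ 2 != 0 ->
  [/\ invmx A 0 0 = g / (e * g - f ^+ 2), invmx A 0 1 = - f / (e * g - f ^+ 2),
      invmx A 1 0 = - f / (e * g - f ^+ 2) & invmx A 1 1 = e / (e * g - f ^+ 2)].
Proof.
move=> a00 a01 a10 a11 D0.
have uA : A \in unitmx by rewrite unitmxE det2 a00 a01 a10 a11 -expr2 unitfE.
have M := mulVmx uA.
have ent i j : invmx A i 0 * A 0 j + invmx A i 1 * A 1 j = (i == j)%:R.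
  by move/matrixP/(_ i j): M; rewrite !mxE big_ord_recl big_ord1 /= => <-; congr (_ * _ + _ * _); congr (_ _ _); exact: val_inj.
have s (x y p q : R) : x * e + y * f = p -> x * f + y * g = q ->
  x = (p * g - q * f) / (e * g - f ^+ 2) /\ y = (q * e - p * f) / (e * g - f ^+ 2).
  by move=> <- <-; split; field.
have := s _ _ _ _ (etrans (congr2 +%R (congr1 _ (esym a00)) (congr1 _ (esym a10))) (ent 0 0))
              (etrans (congr2 +%R (congr1 _ (esym a01)) (congr1 _ (esym a11))) (ent 0 1)).
have := s _ _ _ _ (etrans (congr2 +%R (congr1 _ (esym a00)) (congr1 _ (esym a10))) (ent 1 0))
              (etrans (congr2 +%R (congr1 _ (esym a01)) (congr1 _ (esym a11))) (ent 1 1)).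
rewrite !eqxx /= !mul0r !mul1r !subr0 !sub0r.
by move=> [-> ->] [-> ->].
Qed.

Lemma sum22 (V : zmodType) (f : 'I_2 -> 'I_2 -> V) :
  \sum_(i < 2) \sum_(j < 2) f i j = (f 0 0 + f 0 1) + (f 1 0 + f 1 1).
Proof.
have e1 : lift ord0 ord0 = 1 :> 'I_2 by exact: val_inj.
by rewrite big_ord_recl big_ord1 e1 !(big_ord_recl 1) !big_ord1 e1.
Qed.

Implicit Types (X : R * R -> 'rV[R]_3) (x : R * R) (c w : 'rV[R]_3).

Transparent d1 d2 d11 d12 d21 d22.
Lemma pd_0 X : pd X 0 = d1 X. Proof. by []. Qed.
Lemma pd_1 X : pd X 1 = d2 X. Proof. by []. Qed.
Lemma pd2_00 X : pd2 X 0 0 = d11 X. Proof. by []. Qed.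
Lemma pd2_01 X : pd2 X 0 1 = d12 X. Proof. by []. Qed.
Lemma pd2_10 X : pd2 X 1 0 = d21 X. Proof. by []. Qed.
Lemma pd2_11 X : pd2 X 1 1 = d22 X. Proof. by []. Qed.
Opaque d1 d2 d11 d12 d21 d22.

Transparent EE FF GG DD.
Lemma EEE X x : EE X x = dot (d1 X x) (d1 X x). Proof. by []. Qed.
Lemma FFE X x : FF X x = dot (d1 X x) (d2 X x). Proof. by []. Qed.
Lemma GGE X x : GG X x = dot (d2 X x) (d2 X x). Proof. by []. Qed.
Lemma DDE' X x : DD X x = EE X x * GG X x - FF X x ^+ 2. Proof. by []. Qed.
Opaque EE FF GG DD.

Lemma gram_00 X x : gram X x 0 0 = EE X x. Proof. by rewrite gramE pd_0 EEE. Qed.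
Lemma gram_01 X x : gram X x 0 1 = FF X x. Proof. by rewrite gramE pd_0 pd_1 FFE. Qed.
Lemma gram_10 X x : gram X x 1 0 = FF X x. Proof. by rewrite gramE pd_0 pd_1 FFE dotC. Qed.
Lemma gram_11 X x : gram X x 1 1 = GG X x. Proof. by rewrite gramE pd_1 GGE. Qed.

Lemma dot_comb4 (s1 s2 s3 s4 : R) (u1 u2 u3 u4 c : 'rV[R]_3) :
  dot (s1 *: u1 + s2 *: u2 + (s3 *: u3 + s4 *: u4)) c =
  s1 * dot u1 c + s2 * dot u2 c + (s3 * dot u3 c + s4 * dot u4 c).
Proof. by rewrite !dotDl !dotZl. Qed.

Lemma inv_gram X x : 0 < DD X x ->
  [/\ invmx (gram X x) 0 0 = GG X x / DD X x, invmx (gram X x) 0 1 = - FF X x / DD X x,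
      invmx (gram X x) 1 0 = - FF X x / DD X x & invmx (gram X x) 1 1 = EE X x / DD X x].
Proof.
move=> D0; have D : EE X x * GG X x - FF X x ^+ 2 != 0 by rewrite -DDE' gt_eqF.
rewrite DDE'; exact: (inv2 (gram_00 X x) (gram_01 X x) (gram_10 X x) (gram_11 X x) D).
Qed.

Lemma dot_normal X x w c : 0 < DD X x -> dot (normal_part X x w) c =
  dot w c - dualg (EE X x) (FF X x) (GG X x) (dot w (d1 X x)) (dot w (d2 X x)) (dot (d1 X x) c) (dot (d2 X x) c).
Proof.
move=> D0; rewrite /normal_part dotBl sum22 !pd_0 !pd_1.
have [-> -> -> ->] := inv_gram D0.
rewrite dot_comb4 /dualg -DDE'.
have gen (a b p q e f g d t : R) : d != 0 -> t - (g / d * a * p + - f / d * a * q + (- f / d * b * p + e / d * b * q)) =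
  t - (g * (a * p) - f * (a * q + b * p) + e * (b * q)) / d by move=> d0; field.
by apply: gen; rewrite gt_eqF.
Qed.

Lemma dot_mean X x c : 0 < DD X x -> dot (mean_curvature X x) c =
  (GG X x * dot (normal_part X x (d11 X x)) c - FF X x * (dot (normal_part X x (d12 X x)) c + dot (normal_part X x (d21 X x)) c)
   + EE X x * dot (normal_part X x (d22 X x)) c) / DD X x.
Proof.
move=> D0; rewrite /mean_curvature sum22 pd2_00 pd2_01 pd2_10 pd2_11.
have [-> -> -> ->] := inv_gram D0.
rewrite dot_comb4.
have gen (a b p q e f g d : R) : d != 0 -> g / d * a + - f / d * b + (- f / d * p + e / d * q) =
  (g * a - f * (b + p) + e * q) / d by move=> d0; field.
by apply: gen; rewrite gt_eqF.
Qed.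

Lemma dualgE (E F G a1 a2 b1 b2 : R) : dualg E F G a1 a2 b1 b2 =
  (G * (a1 * b1) - F * (a1 * b2 + a2 * b1) + E * (a2 * b2)) / (E * G - F ^+ 2).
Proof. by []. Qed.

Opaque normal_part mean_curvature dualg.

Lemma inv_sqrt_derive (t : R) : 0 < t ->
  is_derive t 1 (fun s : R => (Num.sqrt s)^-1) (- (2 * Num.sqrt t ^+ 3)^-1).
Proof.
move=> t0; have s0 : Num.sqrt t != 0 by rewrite gt_eqF// sqrtr_gt0.
have [d e] := is_deriveV s0 (is_derive1_sqrt t0).
split; first exact: d.
by rewrite [LHS]e /GRing.scale /=; field.
Qed.

(** In coordinates: d_i(w g^{ij} d_j l) = w g^{ij} (l_ij - Gamma_ij^k l_k). The [p] are the products
    of second with first derivatives of the immersion, D1 and D2 the derivatives of the determinant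
    w^2, and the [n] the components of the Hessian of l. *)
Lemma divergence_algebra (e f g w l1 l2 l11 l12 l22 p111 p112 p121 p122 p221 p222 : R) :
  w != 0 -> e != 0 -> e * g - f ^+ 2 = w ^+ 2 ->
  let n11 := l11 - dualg e f g p111 p112 l1 l2 in
  let n12 := l12 - dualg e f g p121 p122 l1 l2 in
  let n22 := l22 - dualg e f g p221 p222 l1 l2 in
  let D1 := 2 * p111 * g + e * (2 * p122) - 2 * f * (p112 + p121) in
  let D2 := 2 * p121 * g + e * (2 * p222) - 2 * f * (p122 + p221) in
  ((2 * p122 * l1 + g * l11 - ((p112 + p121) * l2 + f * l12)) * w^-1 + (g * l1 - f * l2) * (- (2 * w ^+ 3)^-1 * D1)) +
  ((2 * p121 * l2 + e * l22 - ((p122 + p221) * l1 + f * l12)) * w^-1 + (e * l2 - f * l1) * (- (2 * w ^+ 3)^-1 * D2)) =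
  w * ((g * n11 - f * (n12 + n12) + e * n22) / w ^+ 2).
Proof.
move=> w0 e0 h /=; rewrite !dualgE h.
have -> : g = (w ^+ 2 + f ^+ 2) / e by rewrite -h subrK mulrC mulKf.
by field; rewrite w0 e0.
Qed.

End MeanCurvature.

Section TranslatorField.
Variables (R : realType) (S : surface R) (F : S -> 'rV[R]_3).
Hypothesis imm : smooth_immersion F.
Local Notation U n := (ccod (atlas S n)).
Local Notation par n := (par (atlas S n)).
Local Notation X n := (local_param F n).
Local Notation W n := (area_density (X n)).

Lemma EE_gt0 n x : U n x -> 0 < EE (X n) x.
Proof.
move=> Ux; have D0 := DD_gt0 (immX imm n) Ux.
rewrite lt_neqAle EE_ge0 andbT eq_sym; apply: contraTneq D0 => E0.
by rewrite DDE' E0 mul0r sub0r oppr_gt0 -leNgt sqr_ge0.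
Qed.

(* [lin c] is the linear function <F, c>; (dl1, dl2) are its partial derivatives in chart n,
   (Vl1, Vl2) the components of sqrt(det g) grad (lin c), and [cobr] is the inverse metric. *)
Definition dl1 n (c : 'rV[R]_3) x := dot (d1 (X n) x) c.
Definition dl2 n (c : 'rV[R]_3) x := dot (d2 (X n) x) c.
Definition lin (c : 'rV[R]_3) (p : S) : R := dot (F p) c.
Definition cobr n x a1 a2 b1 b2 := dualg (EE (X n) x) (FF (X n) x) (GG (X n) x) a1 a2 b1 b2.
Definition Vl1 n c x := (GG (X n) x * dl1 n c x - FF (X n) x * dl2 n c x) * (W n x)^-1.
Definition Vl2 n c x := (EE (X n) x * dl2 n c x - FF (X n) x * dl1 n c x) * (W n x)^-1.

Lemma W2 n x : U n x -> W n x ^+ 2 = DD (X n) x.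
Proof. by move=> Ux; rewrite area_densityE sqr_sqrtr// ltW//; exact: DD_gt0 (immX imm n) Ux. Qed.

Lemma hasC1_lin n c : hasC1 (U n) (lin c \o par n) (dl1 n c) (dl2 n c).
Proof. exact: hasC1_dotX. Qed.

Lemma sC1_lin c : sC1 (lin c).
Proof. by move=> n; do 2 eexists; exact: hasC1_lin. Qed.

Lemma hasC1_dl1 n c : hasC1 (U n) (dl1 n c) (fun x => dot (d11 (X n) x) c) (fun x => dot (d21 (X n) x) c).
Proof.
have oUn := @oU _ S n; have sX := @smX _ _ _ imm n.
apply: (hasC1_ext oUn (hasC1_dot oUn (hasC1v_d1 sX) (hasC1v_cst c))) => y _.
by split=> //; rewrite (dotC _ 0) dot0l addr0.
Qed.

Lemma hasC1_dl2 n c : hasC1 (U n) (dl2 n c) (fun x => dot (d12 (X n) x) c) (fun x => dot (d22 (X n) x) c).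
Proof.
have oUn := @oU _ S n; have sX := @smX _ _ _ imm n.
apply: (hasC1_ext oUn (hasC1_dot oUn (hasC1v_d2 sX) (hasC1v_cst c))) => y _.
by split=> //; rewrite (dotC _ 0) dot0l addr0.
Qed.

Definition DD1 n x := 2 * dot (d11 (X n) x) (d1 (X n) x) * GG (X n) x + EE (X n) x * (2 * dot (d12 (X n) x) (d2 (X n) x))
  - 2 * FF (X n) x * (dot (d11 (X n) x) (d2 (X n) x) + dot (d12 (X n) x) (d1 (X n) x)).
Definition DD2 n x := 2 * dot (d21 (X n) x) (d1 (X n) x) * GG (X n) x + EE (X n) x * (2 * dot (d22 (X n) x) (d2 (X n) x))
  - 2 * FF (X n) x * (dot (d21 (X n) x) (d2 (X n) x) + dot (d22 (X n) x) (d1 (X n) x)).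

Lemma hasC1_DD n : hasC1 (U n) (DD (X n)) (DD1 n) (DD2 n).
Proof.
have oUn := @oU _ S n; have sX := @smX _ _ _ imm n.
have hE := hasC1_EE oUn sX; have hF := hasC1_FF oUn sX; have hG := hasC1_GG oUn sX.
apply: (hasC1_ext oUn (hasC1_sub' (hasC1_mul hE hG) (hasC1_mul hF hF))) => y _.
have gen (A f t : R) : A - (t * f + f * t) = A - 2 * f * t by ring.
by split; [rewrite DDE'|exact: gen|exact: gen].
Qed.

Lemma hasC1_invW n : hasC1 (U n) (fun x => (W n x)^-1)
  (fun x => - (2 * W n x ^+ 3)^-1 * DD1 n x) (fun x => - (2 * W n x ^+ 3)^-1 * DD2 n x).
Proof.
have oUn := @oU _ S n.
have cF (t : R) : 0 < t -> {for t, continuous (fun s : R => - (2 * Num.sqrt s ^+ 3)^-1)}.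
  move=> t0; apply: continuousN; apply: continuousV.
    by rewrite gt_eqF// mulr_gt0// exprn_gt0// sqrtr_gt0.
  apply: (@continuousM _ _ (fun=> 2) (fun s => Num.sqrt s ^+ 3)); first exact: cvg_cst.
  by apply: (@continuous_comp _ _ _ Num.sqrt (fun s => s ^+ 3)); [exact: sqrt_continuous|exact: exprn_continuous].
have h := @hasC1_comp1 R (U n) [set t | 0 < t] (fun s => (Num.sqrt s)^-1) (fun t => - (2 * Num.sqrt t ^+ 3)^-1)
  _ _ _ (fun t t0 => inv_sqrt_derive t0) cF (@hasC1_DD n) (fun x Ux => DD_gt0 (immX imm n) Ux).
by apply: (hasC1_ext oUn h) => y _; rewrite area_densityE.
Qed.

Definition Vl11 n c x := (2 * dot (d12 (X n) x) (d2 (X n) x) * dl1 n c x + GG (X n) x * dot (d11 (X n) x) c -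
    ((dot (d11 (X n) x) (d2 (X n) x) + dot (d12 (X n) x) (d1 (X n) x)) * dl2 n c x + FF (X n) x * dot (d12 (X n) x) c)) * (W n x)^-1
  + (GG (X n) x * dl1 n c x - FF (X n) x * dl2 n c x) * (- (2 * W n x ^+ 3)^-1 * DD1 n x).
Definition Vl22 n c x := (2 * dot (d21 (X n) x) (d1 (X n) x) * dl2 n c x + EE (X n) x * dot (d22 (X n) x) c -
    ((dot (d21 (X n) x) (d2 (X n) x) + dot (d22 (X n) x) (d1 (X n) x)) * dl1 n c x + FF (X n) x * dot (d21 (X n) x) c)) * (W n x)^-1
  + (EE (X n) x * dl2 n c x - FF (X n) x * dl1 n c x) * (- (2 * W n x ^+ 3)^-1 * DD2 n x).

Lemma hasC1_Vl1 n c : exists V12, hasC1 (U n) (Vl1 n c) (Vl11 n c) V12.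
Proof.
have oUn := @oU _ S n; have sX := @smX _ _ _ imm n.
eexists; exact: (hasC1_mul (hasC1_sub' (hasC1_mul (hasC1_GG oUn sX) (@hasC1_dl1 n c)) (hasC1_mul (hasC1_FF oUn sX) (@hasC1_dl2 n c))) (@hasC1_invW n)).
Qed.

Lemma hasC1_Vl2 n c : exists V21, hasC1 (U n) (Vl2 n c) V21 (Vl22 n c).
Proof.
have oUn := @oU _ S n; have sX := @smX _ _ _ imm n.
eexists; exact: (hasC1_mul (hasC1_sub' (hasC1_mul (hasC1_EE oUn sX) (@hasC1_dl2 n c)) (hasC1_mul (hasC1_FF oUn sX) (@hasC1_dl1 n c))) (@hasC1_invW n)).
Qed.

(** The Laplacian of <F, c> is <H, c>. The translator equation turns it into <e3, c> minus the
    product of the gradients of x_3 and <F, c>. *)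
Lemma div_linear n c x : U n x ->
  mean_curvature (X n) x = normal_part (X n) x (e3 R) ->
  Vl11 n c x + Vl22 n c x = W n x * (dot (e3 R) c - cobr n x (dl1 n (e3 R) x) (dl2 n (e3 R) x) (dl1 n c x) (dl2 n c x)).
Proof.
move=> Ux tr; have D0 := DD_gt0 (immX imm n) Ux.
have W0 : W n x != 0 by rewrite gt_eqF// (area_gt0 (immX imm n)).
have E0 : EE (X n) x != 0 by rewrite gt_eqF// EE_gt0.
have h : EE (X n) x * GG (X n) x - FF (X n) x ^+ 2 = W n x ^+ 2 by rewrite (W2 Ux) DDE'.
have dn w := dot_normal w c D0.
have -> : dot (e3 R) c - cobr n x (dl1 n (e3 R) x) (dl2 n (e3 R) x) (dl1 n c x) (dl2 n c x) = dot (normal_part (X n) x (e3 R)) c.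
  by rewrite dn /cobr /dl1 /dl2 (dotC (e3 R) (d1 _ _)) (dotC (e3 R) (d2 _ _)).
have sym := d12C (@oU _ S n) (@smX _ _ _ imm n) Ux.
have cg (g f e a b p q a' b' p' q' d d' : R) : a = a' -> b = b' -> p = p' -> q = q' -> d = d' ->
  (g * a - f * (b + p) + e * q) / d = (g * a' - f * (b' + p') + e * q') / d' by move=> -> -> -> -> ->.
rewrite -tr; have M := etrans (dot_mean c D0) (cg _ _ _ _ _ _ _ _ _ _ _ _ _ (dn _) (dn _) (dn _) (dn _) (esym (W2 Ux))).
rewrite M /Vl11 /Vl22 /DD1 /DD2 sym.
exact: (divergence_algebra _ _ _ _ _ _ _ _ _ _ _ W0 E0 h).
Qed.

End TranslatorField.

(** * Cutoffs and the barrier below the line *)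

Section Cutoff.
Variables (R : realType) (S : surface R) (F : S -> 'rV[R]_3).
Hypothesis imm : smooth_immersion F.
Hypothesis cpl : complete_immersion F.
Variable p0 : S.

(* intrinsic distance to p0 *)
Definition rho (p : S) : R := inf [set l | 0 <= l /\ rle F l p0 p].

Lemma rho_has_inf p : has_inf [set l | 0 <= l /\ rle F l p0 p].
Proof.
split; last by exists 0 => l [].
by have [l l0 h] := reach_all imm p0 p; exists l.
Qed.

Lemma rho_ge0 p : 0 <= rho p.
Proof. by apply: lb_le_inf; [have [] := rho_has_inf p|move=> l []]. Qed.

Lemma rho_le p l : 0 <= l -> rle F l p0 p -> rho p <= l.
Proof. by move=> l0 h; apply: ge_inf; [have [] := rho_has_inf p|split]. Qed.

Lemma rho_lt p l : rho p < l -> rle F l p0 p.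
Proof.
move=> /inf_lt[|m [m0 hm] ml]; first exact: (rho_has_inf p).1.
exact: rle_le (ltW ml) hm.
Qed.

Lemma rho_lip c p q : step F c p q -> `|rho p - rho q| <= c.
Proof.
have H (p1 q1 : S) : step F c p1 q1 -> rho q1 <= rho p1 + c.
  move=> st; apply/ler_addgt0Pr => e e0.
  have h : rle F (rho p1 + e) p0 p1 by apply: rho_lt; rewrite ltrDl.
  rewrite addrAC; apply: rho_le; last exact: rle_trans h (rle_step st).
  by rewrite addr_ge0 ?addr_ge0 ?rho_ge0// ltW//; case: st.
move=> st; have h1 := H _ _ st; have h2 := H _ _ (step_sym st).
by rewrite ler_norml; apply/andP; split; move: h1 h2; move: (rho p) (rho q) => s t; lra.
Qed.

(** Piecewise linear in the intrinsic distance, so that the Lipschitz constant is 1 / r; [stokes]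
    asks for no differentiability. *)
Definition cutoff (r : R) (p : S) : R := pos (1 - rho p / r).

Lemma pos_lip (s t : R) : `|pos s - pos t| <= `|s - t|.
Proof.
wlog st : s t / s <= t.
  by move=> H; have [/H//|/ltW/H] := leP s t; rewrite distrC (distrC t).
have [t0|t0] := leP t 0; first by rewrite !pos_0 ?subrr ?normr0// (le_trans st).
rewrite (pos_id (ltW t0)); have [s0|s0] := leP s 0.
  by rewrite pos_0// sub0r normrN distrC !ger0_norm ?subr_ge0//; [lra|exact: ltW].
by rewrite pos_id// ltW.
Qed.

Lemma cutoff_lip r c p q : 0 < r -> step F c p q -> `|cutoff r p - cutoff r q| <= r^-1 * c.
Proof.
move=> r0 st; apply: le_trans (pos_lip _ _) _.
have -> : 1 - rho p / r - (1 - rho q / r) = (rho q - rho p) / r by field; rewrite gt_eqF.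
by rewrite normrM normfV (gtr0_norm r0) mulrC ler_pM2l ?invr_gt0// distrC rho_lip.
Qed.

Lemma cutoff_cont r : 0 < r -> continuous (cutoff r).
Proof.
move=> r0 p; apply/cvgrPdist_le => e e0.
have re : 0 < r * e by rewrite mulr_gt0.
apply: filterS (near_step imm p re) => q st.
by apply: le_trans (cutoff_lip r0 st) _; rewrite mulKf// gt_eqF.
Qed.

Lemma cutoff_supp r : 0 < r -> exists2 K : set S, compact K & forall p, ~ K p -> cutoff r p = 0.
Proof.
move=> r0; have [K cK hK] := compact_reach imm cpl p0 r0; exists K => // p nK.
rewrite /cutoff pos_0// subr_le0 ler_pdivlMr// mul1r leNgt; apply/negP => /rho_lt /hK.
exact: nK.
Qed.

Lemma cutoff_ge0 r p : 0 <= cutoff r p. Proof. exact: pos_ge0. Qed.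

Lemma cutoff_half r p : 0 < r -> 2 * rho p <= r -> 2^-1 <= cutoff r p.
Proof.
move=> r0 h; have h2 : rho p / r <= 2^-1 by rewrite ler_pdivrMr// mulrC ler_pdivlMr// mulrC.
rewrite /cutoff pos_id; lra.
Qed.

End Cutoff.

(** * The metric pairing of gradients *)

Section GradientPairing.
Variables (R : realType) (S : surface R) (F : S -> 'rV[R]_3).
Hypothesis imm : smooth_immersion F.
Local Notation U n := (ccod (atlas S n)).
Local Notation par n := (par (atlas S n)).
Local Notation crd n := (crd (atlas S n)).
Local Notation cdom n := (cdom (atlas S n)).
Local Notation X n := (local_param F n).
Local Notation gr1 := (@gr1 R S).
Local Notation gr2 := (@gr2 R S).
Local Notation cobr := (@cobr R S F).

(** Numerator and denominator both acquire the factor (a d - b c)^2. *)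
Lemma dualg_tr (E F0 G a b c d f1 f2 g1 g2 : R) : a * d - b * c != 0 ->
  dualg (a ^+ 2 * E + 2 * a * c * F0 + c ^+ 2 * G) (a * b * E + (a * d + b * c) * F0 + c * d * G)
    (b ^+ 2 * E + 2 * b * d * F0 + d ^+ 2 * G)
    (a * f1 + c * f2) (b * f1 + d * f2) (a * g1 + c * g2) (b * g1 + d * g2) = dualg E F0 G f1 f2 g1 g2.
Proof.
move=> t0; rewrite !dualgE; set Nm := (X in X / _ = _); set Dm := (X in _ / X = _).
have -> : Nm = (a * d - b * c) ^+ 2 * (G * (f1 * g1) - F0 * (f1 * g2 + f2 * g1) + E * (f2 * g2)) by rewrite /Nm; ring.
have -> : Dm = (a * d - b * c) ^+ 2 * (E * G - F0 ^+ 2) by rewrite /Dm; ring.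
by rewrite -mulf_div divff ?mul1r// expf_neq0.
Qed.

Lemma dot_comb (p q r s : R) (u v : 'rV[R]_3) : dot (p *: u + q *: v) (r *: u + s *: v) =
   p * r * dot u u + (p * s + r * q) * dot u v + q * s * dot v v.
Proof. by rewrite !(dotDl, dotDr, dotZl, dotZr) (dotC v u); ring. Qed.

Lemma dot_comb_sqr (p q : R) (u v : 'rV[R]_3) : dot (p *: u + q *: v) (p *: u + q *: v) =
   p ^+ 2 * dot u u + 2 * p * q * dot u v + q ^+ 2 * dot v v.
Proof. by rewrite dot_comb; ring. Qed.

(** The vector [al *: u + be *: v] is the orthogonal projection of [c] to the plane of [u] and [v],
    and the form is its squared length. *)
Lemma dual_bessel (u v c : 'rV[R]_3) : 0 < dot u u * dot v v - dot u v ^+ 2 ->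
  0 <= dualg (dot u u) (dot u v) (dot v v) (dot u c) (dot v c) (dot u c) (dot v c) <= dot c c.
Proof.
move=> D0; set k := dualg _ _ _ _ _ _ _.
have D : dot u u * dot v v - dot u v ^+ 2 != 0 by rewrite gt_eqF.
pose d := dot u u * dot v v - dot u v ^+ 2.
pose al := (dot v v * dot u c - dot u v * dot v c) / d.
pose be := (dot u u * dot v c - dot u v * dot u c) / d.
have tc : dot (al *: u + be *: v) c = k.
  rewrite dotDl !dotZl /k dualgE /al /be /d.
  move: (dot u c) (dot v c) (dot u u) (dot u v) (dot v v) D => l1 l2 e f g D'; by field.
have tt : dot (al *: u + be *: v) (al *: u + be *: v) = k.
  rewrite dot_comb_sqr /k dualgE /al /be /d.
  move: (dot u c) (dot v c) (dot u u) (dot u v) (dot v v) D => l1 l2 e f g D'; by field.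
have k0 : 0 <= k by rewrite -tt dot_ge0.
rewrite k0 /=; have := dot_cauchy (al *: u + be *: v) c; rewrite tc tt expr2.
have [->|kn] := eqVneq k 0; first by rewrite dot_ge0.
by rewrite ler_pM2l// lt_neqAle eq_sym kn.
Qed.

Lemma cobr_tr m n f g x : sC1 f -> sC1 g -> trdom S m n x ->
  cobr m x (gr1 m f x) (gr2 m f x) (gr1 m g x) (gr2 m g x) =
  cobr n (tr S m n x) (gr1 n f (tr S m n x)) (gr2 n f (tr S m n x)) (gr1 n g (tr S m n x)) (gr2 n g (tr S m n x)).
Proof.
move=> sf sg Tx; have Ux : U m x by case: Tx.
have gt h : sC1 h -> gr1 m h x = tr11 S m n x * gr1 n h (tr S m n x) + tr21 S m n x * gr2 n h (tr S m n x) /\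
   gr2 m h x = tr12 S m n x * gr1 n h (tr S m n x) + tr22 S m n x * gr2 n h (tr S m n x).
  move=> sh; have hc := hasC1_fst_snd_comp (@hasC1_tr1 R S m n) (@hasC1_tr2 R S m n) (sC1_hasC1 (n := n) sh) (fun y h => (tr_dom h).1).
  have e y : trdom S m n y -> (h \o par n) (tr S m n y) = (h \o par m) y by move=> [Uy dy]; rewrite /= /tr /= crdK.
  exact: (gr_eq (hasC1_ext (@open_trdom _ S m n) hc (fun y Ty => And3 (e y Ty) erefl erefl)) Tx).
have [-> ->] := gt f sf; have [-> ->] := gt g sg.
have [e1 e2] := d_tr imm Tx.
set y := tr S m n x in e1 e2 *.
have D0 := DD_gt0 (immX imm m) Ux.
have gE : EE (X m) x = tr11 S m n x ^+ 2 * EE (X n) y + 2 * tr11 S m n x * tr21 S m n x * FF (X n) y + tr21 S m n x ^+ 2 * GG (X n) y.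
  by rewrite !EEE FFE GGE e1; exact: dot_comb_sqr.
have gG : GG (X m) x = tr12 S m n x ^+ 2 * EE (X n) y + 2 * tr12 S m n x * tr22 S m n x * FF (X n) y + tr22 S m n x ^+ 2 * GG (X n) y.
  by rewrite !GGE EEE FFE e2; exact: dot_comb_sqr.
have gF : FF (X m) x = tr11 S m n x * tr12 S m n x * EE (X n) y + (tr11 S m n x * tr22 S m n x + tr12 S m n x * tr21 S m n x) * FF (X n) y + tr21 S m n x * tr22 S m n x * GG (X n) y.
  by rewrite !FFE EEE GGE e1 e2; exact: dot_comb.
have t0 : tr11 S m n x * tr22 S m n x - tr12 S m n x * tr21 S m n x != 0.
  apply/eqP => t0; move: D0; rewrite DDE' gE gF gG.
  have -> : forall (a b c d e f g : R), (a ^+ 2 * e + 2 * a * c * f + c ^+ 2 * g) * (b ^+ 2 * e + 2 * b * d * f + d ^+ 2 * g) -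
     (a * b * e + (a * d + b * c) * f + c * d * g) ^+ 2 = (a * d - b * c) ^+ 2 * (e * g - f ^+ 2) by move=> *; ring.
  by rewrite t0 expr0n mul0r ltxx.
by rewrite /cobr gE gF gG dualg_tr.
Qed.

Definition chart_at (p : S) : nat := projT1 (cid (atlas_cover p)).
Lemma chart_atP p : cdom (chart_at p) p. Proof. exact: projT2 (cid (atlas_cover p)). Qed.

(* The metric pairing <grad f, grad g>. *)
Definition br (f g : S -> R) (p : S) : R := let n := chart_at p in let x := crd n p in
  cobr n x (gr1 n f x) (gr2 n f x) (gr1 n g x) (gr2 n g x).

Lemma br_chart f g n x : sC1 f -> sC1 g -> U n x ->
  br f g (par n x) = cobr n x (gr1 n f x) (gr2 n f x) (gr1 n g x) (gr2 n g x).
Proof.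
move=> sf sg Ux; set p := par n x; have dn : cdom n p by exact: par_cdom.
rewrite /br; set m := chart_at p.
have dm : cdom m p by exact: chart_atP.
have Tx : trdom S m n (crd m p) by split; [exact: crd_ccod|rewrite /= crdK].
have e : tr S m n (crd m p) = x by rewrite /tr /= crdK// parK.
apply: (etrans (cobr_tr sf sg Tx)); rewrite e; exact: erefl.
Qed.

Lemma cobr_bessel n x c : U n x -> 0 <= cobr n x (dl1 F n c x) (dl2 F n c x) (dl1 F n c x) (dl2 F n c x) <= dot c c.
Proof.
move=> Ux; have D0 := DD_gt0 (immX imm n) Ux.
rewrite DDE' EEE FFE GGE in D0; rewrite /cobr /dl1 /dl2 EEE FFE GGE; exact: dual_bessel.
Qed.

End GradientPairing.

Lemma dualg_lin (R : realType) (E F G a1 a2 s t b1 b2 p1 p2 q1 q2 : R) :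
  dualg E F G a1 a2 (b1 + s * p1 - t * q1) (b2 + s * p2 - t * q2) =
  dualg E F G a1 a2 b1 b2 + s * dualg E F G a1 a2 p1 p2 - t * dualg E F G a1 a2 q1 q2.
Proof. by rewrite !dualgE; set k := (_ - _)^-1; clearbody k; ring. Qed.

Lemma I2_gt0 (R : realType) (f : R * R -> R) x : cc f -> (forall y, 0 <= f y) -> 0 < f x -> 0 < I2 f.
Proof.
move=> cf f0 fx; have f2 : 0 < f x / 2 by rewrite divr_gt0.
have [r r0 hr] := nbhs_box_in (cont_near_lt (cf.1 x) f2).
pose B : set (R * R) := `[x.1 - r, x.1 + r]%classic `*` `[x.2 - r, x.2 + r]%classic.
have mB : measurable (B : set (measurableTypeR R * measurableTypeR R)) by apply: measurableX; exact: measurable_itv.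
have fB y : B y -> f x / 2 <= f y.
  rewrite /B /= !in_itv /= => -[h1 h2]; have /hr : box x r y by split; rewrite ler_distl.
  by move=> h; have := ltr_normlW (etrans (congr1 (fun t => t < f x / 2) (distrC _ _)) h); move: (f x) (f y) => s t; lra.
have mf : measurable_fun (setT : set (measurableTypeR R * measurableTypeR R)) (fun y => (f y)%:E).
  by apply/measurable_EFinP; apply: cont_measurable2; exact: cf.1.
rewrite -lte_fin (I2_ereal cf).
apply: (@lt_le_trans _ _ (\int[@lam2 R]_(y in B) (f x / 2)%:E)%E).
  have lB : @lam2 R B = ((x.1 + r - (x.1 - r)) * (x.2 + r - (x.2 - r)))%:E by apply: lam2_box; lra.
  rewrite integral_cst//; rewrite [X in (_ < _ * X)%E](_ : _ = @lam2 R B)// lB -EFinM lte_fin; apply: mulr_gt0 => //.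
  by apply: mulr_gt0; lra.
apply: (@le_trans _ _ (\int[@lam2 R]_(y in B) (f y)%:E)%E).
  apply: ge0_le_integral => //.
  - by move=> y _; rewrite lee_fin ltW.
  - exact: measurable_funTS mf.
by apply: ge0_subset_integral => //; move=> y _; rewrite lee_fin.
Qed.

Lemma norm_le_sqr (R : realType) (t : R) : `|t| <= 1 + t ^+ 2.
Proof.
rewrite -(real_normK (num_real t)); move: `|t| => u; have := sqr_ge0 (u - 2^-1).
by rewrite sqrrB => h; nra.
Qed.

(** * The barrier argument below the line *)

Section Barrier.
Variables (R : realType) (S : surface R) (F : S -> 'rV[R]_3).
Hypothesis imm : smooth_immersion F.
Hypothesis cpl : complete_immersion F.
Local Notation U n := (ccod (atlas S n)).
Local Notation par n := (par (atlas S n)).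
Local Notation crd n := (crd (atlas S n)).
Local Notation X n := (local_param F n).
Local Notation W n := (area_density (X n)).
Local Notation gr1 := (@gr1 R S).
Local Notation gr2 := (@gr2 R S).
Local Notation cobr := (@cobr R S F).
Local Notation br := (@br R S F).
Local Notation lin := (@lin R S F).
Local Notation dl1 := (@dl1 R S F).
Local Notation dl2 := (@dl2 R S F).
Local Notation Vl1 := (@Vl1 R S F).
Local Notation Vl2 := (@Vl2 R S F).
Local Notation SI := (surface_integral F).
Local Notation e3 := (e3 R).
Hypothesis tr : forall n x, U n x -> mean_curvature (X n) x = normal_part (X n) x e3.
Variables (v d : 'rV[R]_3) (c0 a eps B0 : R).
Hypothesis eps0 : 0 < eps.
Hypothesis B00 : 0 < B0.
Hypothesis ubd : forall p, lin v p - c0 <= B0.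
Hypothesis uline : forall p, lin e3 p = a -> lin v p = c0.
Hypothesis vv : dot v v = 1.
Hypothesis dd : dot d d = 1.
Hypothesis e3v : dot e3 v = 0.
Hypothesis e3d : dot e3 d = 0.
Hypothesis e3e3 : dot e3 e3 = 1.
Hypothesis frame3 : forall q : 'rV[R]_3, dot q q = dot q v ^+ 2 + dot q d ^+ 2 + dot q e3 ^+ 2.
Hypothesis gauss_fin : (SI (fun p => expR (- (dot (F p) (F p) / 4))) < +oo)%E.

(* the barrier w = u - eps (1 + a - z + y^2/4); (gw1, gw2) are its partial derivatives *)
Definition bw (p : S) : R := lin v p - c0 - eps * (1 + a - lin e3 p + 4^-1 * (lin d p * lin d p)).
Definition gw1 n x := dl1 n v x + eps * dl1 n e3 x - eps / 2 * lin d (par n x) * dl1 n d x.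
Definition gw2 n x := dl2 n v x + eps * dl2 n e3 x - eps / 2 * lin d (par n x) * dl2 n d x.

Lemma hasC1_bw n : hasC1 (U n) (bw \o par n) (gw1 n) (gw2 n).
Proof.
have hl c := @hasC1_lin R S F imm n c.
have h := hasC1_sub' (hasC1_sub' (hl v) (@hasC1_cst R (U n) c0))
   (hasC1_scale eps (hasC1_add (hasC1_sub' (@hasC1_cst R (U n) (1 + a)) (hl e3)) (hasC1_scale 4^-1 (hasC1_mul (hl d) (hl d))))).
have gen (A B C D : R) : A - 0 - eps * (0 - B + 4^-1 * (C * D + D * C)) = A + eps * B - eps / 2 * D * C.
  by field.
apply: (hasC1_ext (@oU _ S n) h) => y _; split=> //; exact: gen.
Qed.

Lemma sC1_bw : sC1 bw.
Proof. by move=> n; do 2 eexists; exact: hasC1_bw. Qed.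

Lemma bw_cont : continuous bw. Proof. exact: sC1_cont sC1_bw. Qed.

(* The field is bh grad w with bh = (w+)^2 e^z on {z < a}.  The factor e^z turns the operator L into a
   divergence.  bh is C^1 across {z = a}, where w < 0. *)
Definition bh (p : S) : R := if lin e3 p < a then sqp (bw p) * expR (lin e3 p) else 0.
Definition bk (p : S) : R := if lin e3 p < a then 2 * pos (bw p) * expR (lin e3 p) else 0.
Definition bh1 n x := bk (par n x) * gw1 n x + bh (par n x) * dl1 n e3 x.
Definition bh2 n x := bk (par n x) * gw2 n x + bh (par n x) * dl2 n e3 x.

Lemma bw_neg p : ~ lin e3 p < a -> a < lin e3 p \/ bw p < 0.
Proof.
move=> /negP; rewrite -leNgt le_eqVlt => /orP[/eqP e|]; last by left.
right; rewrite /bw (uline (esym e)) -e subrr sub0r oppr_lt0.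
have y0 : 0 <= lin d p * lin d p by rewrite -expr2 sqr_ge0.
have lem (e' y : R) : 0 < e' -> 0 <= y -> 0 < e' * (1 + a - a + 4^-1 * y).
  by move=> e1 y1; rewrite mulr_gt0//; lra.
exact: lem.
Qed.

Lemma zero_region p : a < lin e3 p \/ bw p < 0 -> bh p = 0 /\ bk p = 0.
Proof.
rewrite /bh /bk => -[h|h]; first by rewrite ltNge (ltW h).
by rewrite sqp_0 ?(pos_0 (ltW h)) ?ltW//; case: ifP => _; rewrite ?mulr0 ?mul0r.
Qed.

(** A point with z >= a lies in one of the open sets {z > a} and {w < 0} by [bw_neg], and on these
    sets the extended function is identically 0. *)
Lemma hasC1_bh n : hasC1 (U n) (bh \o par n) (bh1 n) (bh2 n).
Proof.
move=> x Ux; have oUn := @oU _ S n.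
have lc c := sC1_cont (@sC1_lin _ _ _ imm c).
have [za|nz] := pselect (lin e3 (par n x) < a).
  pose V := U n `&` par n @^-1` [set p | lin e3 p < a].
  have oV : open V.
    apply: open_par; rewrite (_ : [set p | _] = lin e3 @^-1` [set t | t < a])//.
    by apply: open_comp; [move=> ? _; exact: lc|exact: open_lt].
  have VU : V `<=` U n by move=> y [].
  have c2p : continuous (fun t : R => 2 * pos t).
    by move=> t; apply: (@continuousM _ _ (fun=> 2) (@pos R)); [exact: cvg_cst|exact: pos_cont].
  have h1 := @hasC1_comp1 R V setT (@sqp R) (fun t => 2 * pos t) _ _ _ (fun t _ => sqp_derive t)
    (fun t _ => c2p t) (hasC1_sub VU (@hasC1_bw n)) (fun _ _ => I).
  have h2 := @hasC1_comp1 R V setT (@expR R) (@expR R) _ _ _ (fun t _ => is_derive_expR t)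
    (fun t _ => @continuous_expR R t) (hasC1_sub VU (@hasC1_lin _ _ _ imm n e3)) (fun _ _ => I).
  have gen (A B C E D : R) : A * B * C + D * (C * E) = A * C * B + D * C * E by ring.
  refine (hasC1_ext oV (hasC1_mul h1 h2) _ (conj Ux za)) => y [Uy zy].
  rewrite /bh1 /bh2 /bh /bk /= zy; split=> //; exact: gen.
pose O := [set p | a < lin e3 p] `|` [set p | bw p < 0].
have oO : open O.
  apply: openU.
    by apply: (@open_comp _ _ (lin e3) [set t | a < t]); [move=> ? _; exact: lc|exact: open_gt].
  by apply: (@open_comp _ _ bw [set t | t < 0]); [move=> ? _; exact: bw_cont|exact: open_lt].
have oV := open_par (n := n) oO.
refine (hasC1_ext oV (@hasC1_cst R _ 0) _ (conj Ux (bw_neg nz))) => y [Uy Oy].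
have [h k] := zero_region Oy; split; [exact: esym h|by rewrite /bh1 h k !mul0r addr0|by rewrite /bh2 h k !mul0r addr0].
Qed.

Lemma gr_bw n x : U n x -> gr1 n bw x = gw1 n x /\ gr2 n bw x = gw2 n x.
Proof. by move=> Ux; exact: (gr_eq (@hasC1_bw n) Ux). Qed.

Lemma gr_lin n c x : U n x -> gr1 n (lin c) x = dl1 n c x /\ gr2 n (lin c) x = dl2 n c x.
Proof. by move=> Ux; exact: (gr_eq (@hasC1_lin _ _ _ imm n c) Ux). Qed.

(** With [vw2], the components of sqrt(det g) grad w. *)
Definition vw1 n x := Vl1 n v x + eps * Vl1 n e3 x - eps / 2 * lin d (par n x) * Vl1 n d x.
Definition vw2 n x := Vl2 n v x + eps * Vl2 n e3 x - eps / 2 * lin d (par n x) * Vl2 n d x.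
Definition BV1 n x := bh (par n x) * vw1 n x.
Definition BV2 n x := bh (par n x) * vw2 n x.

Lemma Vl_cobr n c x a1 a2 : U n x -> a1 * Vl1 n c x + a2 * Vl2 n c x = W n x * cobr n x a1 a2 (dl1 n c x) (dl2 n c x).
Proof.
move=> Ux; have W0 : W n x != 0 by rewrite gt_eqF// W_gt0.
rewrite /Vl1 /Vl2 /cobr dualgE -DDE' -(W2 imm Ux).
move: (dl1 _ _ _) (dl2 _ _ _) (EE _ _) (FF _ _) (GG _ _) (W n x) W0 => l1 l2 e f g w w0; by field.
Qed.

Lemma cobr_lin n x a1 a2 (s t : R) b1 b2 p1 p2 q1 q2 :
  cobr n x a1 a2 (b1 + s * p1 - t * q1) (b2 + s * p2 - t * q2) =
  cobr n x a1 a2 b1 b2 + s * cobr n x a1 a2 p1 p2 - t * cobr n x a1 a2 q1 q2.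
Proof.
exact: dualg_lin.
Qed.

Lemma vw_cobr n x a1 a2 : U n x -> a1 * vw1 n x + a2 * vw2 n x = W n x * cobr n x a1 a2 (gw1 n x) (gw2 n x).
Proof.
move=> Ux; rewrite /gw1 /gw2 cobr_lin.
have gen (x1 x2 y1 y2 z1 z2 w p q r s t : R) : a1 * x1 + a2 * x2 = w * p -> a1 * y1 + a2 * y2 = w * q ->
  a1 * z1 + a2 * z2 = w * r -> a1 * (x1 + s * y1 - t * z1) + a2 * (x2 + s * y2 - t * z2) = w * (p + s * q - t * r).
  move=> h1 h2 h3; transitivity ((a1 * x1 + a2 * x2) + s * (a1 * y1 + a2 * y2) - t * (a1 * z1 + a2 * z2)); first by ring.
  by rewrite h1 h2 h3; ring.
exact: gen (Vl_cobr v a1 a2 Ux) (Vl_cobr e3 a1 a2 Ux) (Vl_cobr d a1 a2 Ux).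
Qed.

(** The divergence is <grad bh, grad w> + bh Laplacian(w). Since grad bh = bk grad w + bh grad z, it
    equals bk |grad w|^2 + bh L w, and L w = eps (1 - |grad y|^2 / 2). *)
Definition bdv (p : S) : R := bk p * br bw bw p + bh p * (eps * (1 - br (lin d) (lin d) p / 2)).
Definition bN (p : S) : R := bh p * Num.sqrt (br bw bw p).
Definition bD (f : S -> R) (p : S) : R := bh p * br f bw p.

Lemma br_bw n x : U n x -> br bw bw (par n x) = cobr n x (gw1 n x) (gw2 n x) (gw1 n x) (gw2 n x).
Proof. by move=> Ux; rewrite (br_chart imm sC1_bw sC1_bw Ux); have [-> ->] := gr_bw Ux. Qed.

Lemma br_lin n c x : U n x -> br (lin c) (lin c) (par n x) = cobr n x (dl1 n c x) (dl2 n c x) (dl1 n c x) (dl2 n c x).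
Proof.
by move=> Ux; have s := @sC1_lin _ _ _ imm c; rewrite (br_chart imm s s Ux); have [-> ->] := gr_lin c Ux.
Qed.

Lemma bHD f : sC1 f -> forall n x, U n x ->
  BV1 n x * gr1 n f x + BV2 n x * gr2 n f x = W n x * bD f (par n x).
Proof.
move=> sf n x Ux; rewrite /bD (br_chart imm sf sC1_bw Ux); have [-> ->] := gr_bw Ux.
have gen (h V1 V2 g1 g2 w b : R) : g1 * V1 + g2 * V2 = w * b -> h * V1 * g1 + h * V2 * g2 = w * (h * b).
  by move=> e; rewrite mulrCA -e; ring.
by apply: gen; exact: vw_cobr.
Qed.

(** Raising the index preserves length: the vector g^{ij} l_j is as long as the covector l. *)
Lemma bHN n x : U n x -> spd F n x (BV1 n x, BV2 n x) = W n x * bN (par n x).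
Proof.
move=> Ux; rewrite (@spdZ _ _ _ n x (bh (par n x)) (vw1 n x, vw2 n x)).
have h0 : 0 <= bh (par n x) by rewrite /bh; case: ifP => // _; rewrite mulr_ge0 ?sqp_ge0 ?expR_ge0.
rewrite (ger0_norm h0) /bN (br_bw Ux) mulrCA; congr (_ * _).
have W0 := W_gt0 imm Ux; have D0 := DD_gt0 (immX imm n) Ux.
have vw0 : spd F n x (vw1 n x, vw2 n x) ^+ 2 = W n x ^+ 2 * cobr n x (gw1 n x) (gw2 n x) (gw1 n x) (gw2 n x).
  have e1 : vw1 n x = (GG (X n) x * gw1 n x - FF (X n) x * gw2 n x) / W n x.
    rewrite /vw1 /gw1 /gw2 /Vl1; move: (GG _ _) (FF _ _) (_ ^-1) => g f w; ring.
  have e2 : vw2 n x = (EE (X n) x * gw2 n x - FF (X n) x * gw1 n x) / W n x.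
    rewrite /vw2 /gw1 /gw2 /Vl2; move: (EE _ _) (FF _ _) (_ ^-1) => g f w; ring.
  have h : EE (X n) x * GG (X n) x - FF (X n) x ^+ 2 = W n x ^+ 2 by rewrite (W2 imm Ux) DDE'.
  have sq : spd F n x (vw1 n x, vw2 n x) ^+ 2 =
    vw1 n x ^+ 2 * EE (X n) x + 2 * vw1 n x * vw2 n x * FF (X n) x + vw2 n x ^+ 2 * GG (X n) x := spd_sqr F n x _.
  apply: (etrans sq); rewrite e1 e2.
  have -> : cobr n x (gw1 n x) (gw2 n x) (gw1 n x) (gw2 n x) =
    (GG (X n) x * (gw1 n x * gw1 n x) - FF (X n) x * (gw1 n x * gw2 n x + gw2 n x * gw1 n x) + EE (X n) x * (gw2 n x * gw2 n x)) / W n x ^+ 2.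
    by rewrite -h; exact: dualgE.
  have w0 : W n x != 0 by rewrite gt_eqF.
  have E0 : EE (X n) x != 0 by rewrite gt_eqF// (EE_gt0 imm).
  have gen (e f g w l1 l2 : R) : w != 0 -> e != 0 -> e * g - f ^+ 2 = w ^+ 2 ->
    ((g * l1 - f * l2) / w) ^+ 2 * e + 2 * ((g * l1 - f * l2) / w) * ((e * l2 - f * l1) / w) * f + ((e * l2 - f * l1) / w) ^+ 2 * g =
    w ^+ 2 * ((g * (l1 * l1) - f * (l1 * l2 + l2 * l1) + e * (l2 * l2)) / w ^+ 2).
    move=> w1 e0 hh; have -> : g = (w ^+ 2 + f ^+ 2) / e by rewrite -hh subrK mulrC mulKf.
    by field; rewrite w1 e0.
  exact: gen.
have c0' : 0 <= cobr n x (gw1 n x) (gw2 n x) (gw1 n x) (gw2 n x).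
  by rewrite -(@pmulr_rge0 _ (W n x ^+ 2)) ?exprn_gt0// -vw0 sqr_ge0.
apply/eqP; rewrite -(@eqrXn2 _ 2)//; last 2 first.
- exact: enorm_ge0.
- by rewrite mulr_ge0// ?sqrtr_ge0// ltW.
by apply/eqP; rewrite vw0 exprMn (sqr_sqrtr c0').
Qed.

Lemma bHV n : exists V11 V12 V21 V22, [/\ hasC1 (U n) (BV1 n) V11 V12, hasC1 (U n) (BV2 n) V21 V22 &
  forall y, U n y -> V11 y + V22 y = W n y * bdv (par n y)].
Proof.
have [v12 hv1] := hasC1_Vl1 imm n v; have [v21 hv2] := hasC1_Vl2 imm n v.
have [z12 hz1] := hasC1_Vl1 imm n e3; have [z21 hz2] := hasC1_Vl2 imm n e3.
have [y12 hy1] := hasC1_Vl1 imm n d; have [y21 hy2] := hasC1_Vl2 imm n d.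
have hd := hasC1_scale (eps / 2) (@hasC1_lin _ _ _ imm n d).
have h1 := hasC1_mul (@hasC1_bh n) (hasC1_sub' (hasC1_add hv1 (hasC1_scale eps hz1)) (hasC1_mul hd hy1)).
have h2 := hasC1_mul (@hasC1_bh n) (hasC1_sub' (hasC1_add hv2 (hasC1_scale eps hz2)) (hasC1_mul hd hy2)).
do 4 eexists; split; [exact: h1|exact: h2|] => y Uy /=.
have dv := div_linear imm v Uy (tr Uy); have dz := div_linear imm e3 Uy (tr Uy); have dy := div_linear imm d Uy (tr Uy).
rewrite /bdv (br_bw Uy) (br_lin d Uy).
have e1 := vw_cobr (gw1 n y) (gw2 n y) Uy; have e2 := vw_cobr (dl1 n e3 y) (dl2 n e3 y) Uy.
have e4 := Vl_cobr d (dl1 n d y) (dl2 n d y) Uy.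
have ez : cobr n y (dl1 n e3 y) (dl2 n e3 y) (gw1 n y) (gw2 n y) =
  cobr n y (dl1 n e3 y) (dl2 n e3 y) (dl1 n v y) (dl2 n v y) + eps * cobr n y (dl1 n e3 y) (dl2 n e3 y) (dl1 n e3 y) (dl2 n e3 y)
  - eps / 2 * lin d (par n y) * cobr n y (dl1 n e3 y) (dl2 n e3 y) (dl1 n d y) (dl2 n d y) by exact: cobr_lin.
rewrite e3v in dv; rewrite e3d in dy; rewrite e3e3 in dz; rewrite ez in e2.
rewrite /vw1 /vw2 in e1 e2; rewrite /bh1 /bh2.
have gen (k h w e t g1 g2 z1 z2 y1 y2 A B Y1 Y2 a11 a22 b11 b22 q11 q22 cgg czv czz czy cyy : R) :
  g1 * A + g2 * B = w * cgg -> z1 * A + z2 * B = w * (czv + e * czz - t * czy) ->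
  a11 + a22 = w * (0 - czv) -> b11 + b22 = w * (1 - czz) -> q11 + q22 = w * (0 - czy) -> y1 * Y1 + y2 * Y2 = w * cyy ->
  (k * g1 + h * z1) * A + h * (a11 + e * b11 - (e / 2 * y1 * Y1 + t * q11)) +
  ((k * g2 + h * z2) * B + h * (a22 + e * b22 - (e / 2 * y2 * Y2 + t * q22))) = w * (k * cgg + h * (e * (1 - cyy / 2))).
  move=> i1 i2 i3 i4 i5 i6.
  transitivity (k * (g1 * A + g2 * B) + h * ((z1 * A + z2 * B) + (a11 + a22) + e * (b11 + b22) - t * (q11 + q22) - e / 2 * (y1 * Y1 + y2 * Y2))).
    by field.
  by rewrite i1 i2 i3 i4 i5 i6; field.
exact: gen e1 e2 dv dz dy e4.
Qed.

(** The gradient of w is the tangential part of this vector, whence its bound by [dual_bessel]. *)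
Definition bvec (p : S) : 'rV[R]_3 := v + eps *: e3 + (- (eps / 2 * lin d p)) *: d.

Lemma dot_vec (u p q r : 'rV[R]_3) (s t : R) :
  dot u p + s * dot u q - t * dot u r = dot u (p + s *: q + (- t) *: r).
Proof. by rewrite !dotDr !dotZr mulNr. Qed.

Lemma gw_vec n x : gw1 n x = dl1 n (bvec (par n x)) x /\ gw2 n x = dl2 n (bvec (par n x)) x.
Proof. by split; exact: dot_vec. Qed.

Lemma br_bw_bound p : 0 <= br bw bw p /\ Num.sqrt (br bw bw p) <= 1 + eps + eps / 2 * `|lin d p|.
Proof.
have [n dp] := atlas_cover p; have Ux := crd_ccod dp.
have := cobr_bessel imm (bvec p) Ux; have := gw_vec n (crd n p); rewrite crdK//; move=> [<- <-].
rewrite -(br_bw Ux) crdK// => /andP[h1 h2]; split=> //.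
have e1 : enorm v = 1 by rewrite /enorm vv sqrtr1.
have e2 : enorm d = 1 by rewrite /enorm dd sqrtr1.
have e4 : enorm e3 = 1 by rewrite /enorm e3e3 sqrtr1.
apply: (@le_trans _ _ (enorm (bvec p))); first by rewrite ler_wsqrtr.
apply: le_trans (enormD _ _) _; apply: lerD.
  by apply: le_trans (enormD _ _) _; rewrite enormZ e1 e4 mulr1 gtr0_norm.
by rewrite enormZ e2 mulr1 normrN normrM gtr0_norm// divr_gt0.
Qed.

Lemma br_d_le p : br (lin d) (lin d) p <= 1.
Proof.
have [n dp] := atlas_cover p; have Ux := crd_ccod dp.
by have := cobr_bessel imm d Ux; rewrite -(br_lin d Ux) crdK// dd => /andP[].
Qed.

Lemma bh_ge0 p : 0 <= bh p.
Proof. by rewrite /bh; case: ifP => // _; rewrite mulr_ge0 ?sqp_ge0 ?expR_ge0. Qed.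

Lemma bk_ge0 p : 0 <= bk p.
Proof. by rewrite /bk; case: ifP => // _; rewrite !mulr_ge0 ?pos_ge0 ?expR_ge0. Qed.

Lemma half_pos (t : R) : t <= 1 -> 0 < 1 - t / 2.
Proof. by lra. Qed.

Lemma bdv_ge0 p : 0 <= bdv p.
Proof.
apply: addr_ge0; apply: mulr_ge0; [exact: bk_ge0|exact: (br_bw_bound p).1|exact: bh_ge0|].
by apply: mulr_ge0; [exact: ltW|exact: ltW (half_pos (br_d_le p))].
Qed.

Lemma bdv_gt0 p : lin e3 p < a -> 0 < bw p -> 0 < bdv p.
Proof.
move=> za w0; apply: ltr_wpDl; first by apply: mulr_ge0; [exact: bk_ge0|exact: (br_bw_bound p).1].
apply: mulr_gt0; first by rewrite /bh za mulr_gt0 ?expR_gt0// sqp_gt0.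
by apply: mulr_gt0 => //; exact: half_pos (br_d_le p).
Qed.

Lemma bN_ge0 p : 0 <= bN p.
Proof. by rewrite mulr_ge0 ?sqrtr_ge0 ?bh_ge0. Qed.

Lemma bN_cont : continuous bN.
Proof.
apply: (@divW_cont _ _ _ imm bN (fun n y => spd F n y (BV1 n y, BV2 n y))); last by move=> n y Uy; exact: bHN.
move=> n y Uy; have [V11 [V12 [V21 [V22 [h1 h2 _]]]]] := bHV n.
have c1 := hasC1_cont h1 Uy; have c2 := hasC1_cont h2 Uy.
have cv : {for y, continuous (fun y => BV1 n y *: d1 (X n) y + BV2 n y *: d2 (X n) y)}.
  exact: (continuousD (continuousZ c1 (d1_cont imm Uy)) (continuousZ c2 (d2_cont imm Uy))).
exact: (continuous_comp cv (@enorm_cont R _)).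
Qed.

Lemma region_bounds (z y u : R) : z < a -> u <= B0 -> 0 < u - eps * (1 + a - z + 4^-1 * (y * y)) ->
  [/\ 0 < u, a - z < B0 / eps & y ^+ 2 < 4 * (B0 / eps)].
Proof.
move=> za uB h; have y0 : 0 <= y * y by rewrite -expr2 sqr_ge0.
have t0 : 0 < 1 + a - z + 4^-1 * (y * y) by lra.
have et := mulr_gt0 eps0 t0.
have u0 : 0 < u by lra.
have hB : 1 + a - z + 4^-1 * (y * y) < B0 / eps by rewrite ltr_pdivlMr// mulrC; lra.
by split=> //; rewrite ?expr2; lra.
Qed.

(** Where the field is nonzero, w > 0 bounds u, y and z, so F stays in a fixed ball. There the
    Gaussian weight of centre 0 and scale 1 is bounded below, which turns finite entropy into
    integrability of the field. *)
Lemma bN_bound : exists2 C, 0 <= C & forall p, bN p <= C * expR (- (dot (F p) (F p) / 4)).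
Proof.
pose Z := B0 / eps; have Z0 : 0 < Z by rewrite divr_gt0.
pose B2 := (`|c0| + B0) ^+ 2 + 4 * Z + (`|a| + Z) ^+ 2.
pose C0 := B0 ^+ 2 * expR a * (1 + eps + eps / 2 * (1 + 4 * Z)).
have C00 : 0 <= C0.
  rewrite mulr_ge0//; first by rewrite mulr_ge0 ?sqr_ge0 ?expR_ge0.
  by rewrite !addr_ge0// ?(ltW eps0)// mulr_ge0// ?divr_ge0 ?(ltW eps0)// addr_ge0// mulr_ge0// ltW.
exists (C0 * expR (B2 / 4)); first by rewrite mulr_ge0// expR_ge0.
move=> p; have RHS0 : 0 <= C0 * expR (B2 / 4) * expR (- (dot (F p) (F p) / 4)) by apply: mulr_ge0; [apply: mulr_ge0; [exact: C00|exact: expR_ge0]|exact: expR_ge0].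
have [za|nz] := boolP (lin e3 p < a); last by rewrite /bN /bh (negPf nz) mul0r.
have [w0|w0] := leP (bw p) 0; first by rewrite /bN /bh za sqp_0// !mul0r.
have [u0 z1 y1] := region_bounds za (ubd p) w0.
have wB : bw p <= B0.
  apply: le_trans (ubd p); rewrite /bw gerBl; apply: mulr_ge0; first exact: ltW.
  by have := sqr_ge0 (lin d p); rewrite expr2; move: za; move: (lin e3 p) (_ * _) => s t; lra.
have hb : bh p <= B0 ^+ 2 * expR a.
  rewrite /bh za; apply: ler_pM; [exact: sqp_ge0|exact: expR_ge0| |by rewrite ler_expR ltW].
  by rewrite /sqp (pos_id (ltW w0)) ler_pXn2r ?nnegrE ?(ltW w0) ?(ltW B00).
have yb : `|lin d p| <= 1 + 4 * Z.
  apply: (@le_trans _ _ (1 + lin d p ^+ 2)); last by rewrite lerD2l ltW.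
  exact: norm_le_sqr.
have sb : Num.sqrt (br bw bw p) <= 1 + eps + eps / 2 * (1 + 4 * Z).
  by apply: le_trans (br_bw_bound p).2 _; rewrite lerD2l ler_pM2l// divr_gt0.
have nb : bN p <= C0 by exact: (ler_pM (bh_ge0 p) (sqrtr_ge0 _) hb sb).
have FB : dot (F p) (F p) <= B2.
  have sq (s t : R) : `|s| <= t -> s ^+ 2 <= t ^+ 2.
    by move=> h; rewrite -real_normK ?num_real// ler_pXn2r// nnegrE (le_trans _ h).
  rewrite frame3; apply: lerD; [apply: lerD|].
  - apply: sq; have -> : dot (F p) v = c0 + (lin v p - c0) by rewrite addrC subrK.
    by apply: le_trans (ler_normD _ _) _; rewrite lerD2l gtr0_norm// ubd.
  - exact: ltW.
  - apply: sq; have -> : dot (F p) e3 = a - (a - lin e3 p) by rewrite opprB addrC subrK.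
    apply: le_trans (ler_normB _ _) _; rewrite lerD2l gtr0_norm ?subr_gt0//; exact: ltW.
apply: (le_trans nb); rewrite -mulrA -expRD -[leLHS]mulr1 ler_wpM2l//.
rewrite -[leLHS]expR0 ler_expR; move: FB; move: (dot _ _) => t; clearbody B2; lra.
Qed.

Lemma bN_fin : (SI bN < +oo)%E.
Proof.
have [C C0 h] := bN_bound.
have cg : continuous (fun p => expR (- (dot (F p) (F p) / 4))).
  have E : (fun p => expR (- (dot (F p) (F p) / 4))) = (fun p => expR (- 4^-1 * (lin v p * lin v p + lin d p * lin d p + lin e3 p * lin e3 p))).
    by apply/funext => p; rewrite frame3 !expr2 mulrC mulNr mulrC.
  rewrite E => p; have lc c := sC1_cont (@sC1_lin _ _ _ imm c).
  have c1 := add_continuous (add_continuous (mul_continuous (lc v) (lc v)) (mul_continuous (lc d) (lc d))) (mul_continuous (lc e3) (lc e3)).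
  have c2 := continuousM (@cst_continuous S R (- 4^-1) p) (c1 p).
  exact: (continuous_comp c2 (@continuous_expR R _)).
apply: (@le_lt_trans _ _ (SI (fun p => C * expR (- (dot (F p) (F p) / 4))))).
  apply: surface_integral_le => //; [exact: bN_cont| |exact: bN_ge0].
  by move=> p; apply: (continuousM (@cst_continuous S R C p)); exact: cg.
rewrite (surface_integralZ imm cg (fun p => expR_ge0 _) C0).
exact: lte_mul_pinfty.
Qed.

(** If w > 0 at [p1], the divergence has a positive integral [c] against a bump there, and every
    large cutoff retains at least c / 2, whereas [stokes] bounds the total by 8 M / Rr. *)
Lemma barrier_le p1 : lin e3 p1 < a -> bw p1 <= 0.
Proof.
move=> za; rewrite leNgt; apply/negP => w0.
have dv0 := bdv_gt0 za w0.
have [n [x [r [m [N Ux px hW]]]]] := bump_at imm (near_step imm p1 ltr01).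
have [r0 m0 H] := N.
have bU : box x r `<=` U n by move=> y /H[].
have cdv := dv_cont imm bHV.
pose f p := bump n x r p * bdv p.
have cf : continuous f by apply: mul_continuous => //; exact: sC1_cont (sC1_bump imm N).
have f0 p : 0 <= f p by rewrite mulr_ge0 ?bdv_ge0//; case/andP: (bump_01 n x r p).
have foff p : ~ (par n @` box x r) p -> f p = 0 by move=> np; rewrite /f (bump_0 N np) mul0r.
have ef := sint_chart0 imm bU cf f0 foff.
set c := I2 _ in ef.
have c0' : 0 < c.
  have xb : box x r x by exact: box_center (ltW r0).
  apply: (I2_gt0 (x := x)); first exact: ext_cc.
    by move=> y; rewrite /ext; case: ifP => // _; rewrite mulr_ge0 ?area_ge0.
  rewrite /ext asboolT// /dens mulr_gt0//; last exact: W_gt0.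
  rewrite /f -px mulr_gt0// (bump_1 N)//; exists x => //; apply: box_center; by rewrite divr_ge0// ltW.
pose M := fine (SI bN).
have M0 : 0 <= M by apply: fine_ge0; exact: surface_integral_ge0 bN_ge0.
(* Rr >= 2 makes the cutoff at least 1/2 up to distance 1 from [p1], and (c / 2) Rr = c + 16 M
   exceeds 8 M. *)
pose Rr := 2 + 32 * M / c.
have R2 : 2 <= Rr by rewrite /Rr lerDl divr_ge0 ?mulr_ge0// ltW.
have R0 : 0 < Rr by apply: lt_le_trans R2.
have [K cK Ksupp] := cutoff_supp imm cpl p1 R0.
have Ri : 0 <= Rr^-1 by rewrite invr_ge0 ltW.
have [ff bd] := @stokes _ _ _ imm _ _ _ _ _ bHV bHD bHN bN_ge0 bN_cont bN_fin (cutoff F p1 Rr) K Rr^-1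
  (@cutoff_cont _ _ _ imm p1 Rr R0) cK Ksupp Ri (fun c p q => @cutoff_lip _ _ _ imm p1 Rr c p q R0).
have g0 p : 0 <= cutoff F p1 Rr p * bdv p by rewrite mulr_ge0 ?bdv_ge0 ?cutoff_ge0.
rewrite (sint_ge0 imm g0) ger0_norm in bd; last by apply: fine_ge0; exact: surface_integral_ge0.
have [cg gfin] := ff.
have gE : (fun p => `|cutoff F p1 Rr p * bdv p|) = (fun p => cutoff F p1 Rr p * bdv p).
  by apply/funext => p; rewrite ger0_norm.
rewrite gE in gfin.
have h20 : 0 <= (2^-1 : R) by rewrite invr_ge0.
have fg p : 2^-1 * f p <= cutoff F p1 Rr p * bdv p.
  have [Kp|np] := pselect ((par n @` box x r) p); last by rewrite foff// mulr0.
  have st : step F 1 p1 p by exact: hW.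
  have rp : rho F p1 p <= 1 by apply: (rho_le imm); [exact: ler01|exact: rle_step].
  have hc : 2^-1 <= cutoff F p1 Rr p by apply: cutoff_half => //; apply: le_trans R2; rewrite -[leRHS]mulr1 ler_pM2l.
  rewrite /f mulrA ler_wpM2r ?bdv_ge0//; apply: le_trans hc.
  by rewrite -[leRHS]mulr1 ler_wpM2l//; case/andP: (bump_01 n x r p).
have le1 : (SI (fun p => 2^-1 * f p)%R <= SI (fun p => cutoff F p1 Rr p * bdv p)%R)%E.
  apply: surface_integral_le => //.
    by move=> p; apply: (continuousM (@cst_continuous S R 2^-1 p)); exact: cf.
  by move=> p; rewrite mulr_ge0.
rewrite (surface_integralZ imm cf f0 h20) ef in le1.
have : 2^-1 * c <= 8 * Rr^-1 * M.
  apply: le_trans bd; rewrite -lee_fin fineK; last by rewrite ge0_fin_numE// surface_integral_ge0.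
  by rewrite EFinM.
apply/negP; rewrite -ltNge mulrAC ltr_pdivrMr//.
have -> : 2^-1 * c * Rr = c + 16 * M by rewrite /Rr; field; rewrite gt_eqF.
by move: c0' M0; clearbody M c => *; lra.
Qed.

End Barrier.

(** Instead of a limit eps -> 0, eps is chosen at a point with u > 0 so that the correction term
    equals u / 2 there, which leaves w = u / 2 > 0. *)
Lemma slab_half (R : realType) (S : surface R) (F : S -> 'rV[R]_3) (v d : 'rV[R]_3) (c0 a B0 : R) :
  smooth_immersion F -> complete_immersion F ->
  (forall n x, ccod (atlas S n) x ->
      mean_curvature (local_param F n) x = normal_part (local_param F n) x (e3 R)) ->
  0 < B0 -> (forall p, lin F v p - c0 <= B0) -> (forall p, lin F (e3 R) p = a -> lin F v p = c0) ->
  dot v v = 1 -> dot d d = 1 -> dot (e3 R) v = 0 -> dot (e3 R) d = 0 -> dot (e3 R) (e3 R) = 1 ->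
  (forall q : 'rV[R]_3, dot q q = dot q v ^+ 2 + dot q d ^+ 2 + dot q (e3 R) ^+ 2) ->
  (surface_integral F (fun p => expR (- (dot (F p) (F p) / 4))) < +oo)%E ->
  forall p, lin F (e3 R) p < a -> lin F v p <= c0.
Proof.
move=> imm cpl tr B00 ubd uline vv dd e3v e3d e3e3 fr gf p za.
rewrite -subr_le0 leNgt; apply/negP => u0.
pose t := 1 + a - lin F (e3 R) p + 4^-1 * (lin F d p * lin F d p).
have t0 : 0 < t.
  have := sqr_ge0 (lin F d p); rewrite expr2 /t; move: za; move: (lin F (e3 R) p) (_ * _) => s w; lra.
have e0 : 0 < (lin F v p - c0) / (2 * t) by rewrite divr_gt0// mulr_gt0.
have := barrier_le imm cpl tr e0 B00 ubd uline vv dd e3v e3d e3e3 fr gf za.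
rewrite /bw -/t; have -> : (lin F v p - c0) / (2 * t) * t = (lin F v p - c0) / 2 by field; rewrite gt_eqF.
by move: u0; move: (lin F v p - c0) => u; lra.
Qed.

(** * Unique continuation in the plane *)

Section Energy.
Variable R : realType.
Local Notation I2 := (@I2 R).

Lemma cc_of (V K : set (R * R)) (M : R) (f : R * R -> R) : open V -> closed K -> K `<=` V -> K `<=` cbox M ->
  (forall y, V y -> {for y, continuous f}) -> (forall y, ~ K y -> f y = 0) -> cc f.
Proof.
move=> oV cK KV KM cf f0; split.
  move=> y; have [Vy|nV] := pselect (V y); first exact: cf.
  apply: (@cont_near _ (fun=> 0)); last exact: cvg_cst.
  have nK : ~ K y by move=> /KV.
  apply: (@near_of_open _ (~` K)) => //; first by rewrite openC.
  by move=> z nz; rewrite f0.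
by exists M => y fy; apply/cboxP/KM; apply: contrapT => /f0 e; rewrite e eqxx in fy.
Qed.

(** The first order Taylor expansion is uniform in the base point because the directional derivative
    is uniformly continuous. *)
Lemma cc_diff_unif (phi p1 p2 : R * R -> R) (M e : R) (xi : R * R) :
  hasC1 setT phi p1 p2 -> (forall x, ~ cbox M x -> phi x = 0) -> 0 < e ->
  exists2 h0, 0 < h0 & forall x (h : R), `|h| < h0 ->
    `|phi (x + (h * xi.1, h * xi.2)) - phi x - h * (xi.1 * p1 x + xi.2 * p2 x)| <= `|h| * e.
Proof.
move=> hp h_off e0; have [cphi cp1 cp2] := hasC1_cc hp h_off.
pose psi x := xi.1 * p1 x + xi.2 * p2 x.
have cpsi : cc psi by apply: ccD; exact: ccZ.
have [d d0 hd] := cc_unif cpsi e0.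
pose nx := `|xi.1| + `|xi.2| + 1; have nx0 : 0 < nx by rewrite ltr_wpDl// addr_ge0.
exists (d / nx); first by rewrite divr_gt0.
move=> x h; rewrite ltr_pdivlMr// => hh.
pose v : R * R := (h * xi.1, h * xi.2).
have sv (s : R) : 0 <= s <= 1 -> `|(s * v.1, s * v.2) : R * R| < d.
  move=> /andP[s0 s1]; apply: le_lt_trans hh; rewrite prod_normE /= ge_max !normrM !(ger0_norm s0).
  have bnd (a : R) : 0 <= a -> a <= nx -> s * (`|h| * a) <= `|h| * nx.
    move=> a0 an; rewrite -[leRHS]mul1r; apply: ler_pM => //; first by rewrite mulr_ge0.
    by rewrite ler_wpM2l.
  by apply/andP; split; apply: bnd => //; rewrite /nx; have := normr_ge0 xi.1; have := normr_ge0 xi.2; lra.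
have dg (t : R) : 0 <= t <= 1 -> is_derive t (1 : R) (fun s => phi (segm x (x + v) s)) (h * psi (x + (t * v.1, t * v.2))).
  move=> _; have := @segm_derive _ setT phi p1 p2 x (x + v) t hp I.
  rewrite diffp_add segm_add.
  by rewrite /psi mulrDr !mulrA.
have [t /andP[t0 t1]] := MVT_cc ltr01 dg.
rewrite segm_0 segm_1 subr0 mulr1 => ->.
rewrite -mulrBr normrM ler_wpM2l//; apply: hd; apply: sv; by rewrite !ltW.
Qed.

Lemma ccM (f g : R * R -> R) : cc f -> cc g -> cc (fun x => f x * g x).
Proof. by move=> cf [cg _]; exact: ccMr. Qed.

(* [p] and [q] are only C^1, so one derivative is replaced by a difference quotient before
   integrating by parts. *)
Lemma null_lagrangian (p p1 p2 q q1 q2 : R * R -> R) (M : R) :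
  hasC1 setT p p1 p2 -> hasC1 setT q q1 q2 ->
  (forall x, ~ cbox M x -> p x = 0) -> (forall x, ~ cbox M x -> q x = 0) ->
  I2 (fun x => p1 x * q2 x - p2 x * q1 x) = 0.
Proof.
move=> hp hq p0 q0; have [cp cp1 cp2] := hasC1_cc hp p0; have [cq cq1 cq2] := hasC1_cc hq q0.
pose A := I2 (fun x => `|q2 x|) + I2 (fun x => `|p2 x|).
have A0 : 0 <= A by apply: addr_ge0; apply: I2_ge0 => //; exact: cc_norm.
apply/eqP; rewrite -normr_le0; apply/ler_addgt0Pr => e e0; rewrite add0r.
have e1 : 0 < e / (A + 1) by rewrite divr_gt0// ltr_wpDl.
have [h1 h10 Hp] := cc_diff_unif (1, 0) hp p0 e1; have [h2 h20 Hq] := cc_diff_unif (1, 0) hq q0 e1.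
pose h := Num.min h1 h2 / 2; have m0 : 0 < Num.min h1 h2 by rewrite lt_min h10.
have hpos : 0 < h by rewrite divr_gt0.
have hm : h < Num.min h1 h2 by rewrite /h; lra.
have hh1 : h < h1 by apply: (lt_le_trans hm); rewrite ge_min lexx.
have hh2 : h < h2 by apply: (lt_le_trans hm); rewrite ge_min lexx orbT.
pose v : R * R := (h * 1, h * 0).
pose P x := p (x + v); pose P2 x := p2 (x + v).
have cP : cc P by exact: cc_shift.
have cP2 : cc P2 by exact: cc_shift.
pose E x := p (x + v) - p x - h * p1 x.
pose G x := q (x - v) - q x + h * q1 x.
have EB x : `|E x| <= h * (e / (A + 1)).
  by have := Hp x h; rewrite !(gtr0_norm hpos) => /(_ hh1) /=; rewrite mul1r mul0r addr0.
have GB x : `|G x| <= h * (e / (A + 1)).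
  have := Hq x (- h); rewrite !normrN !(gtr0_norm hpos) => /(_ hh2) /=.
  have -> : (- h * 1, - h * 0) = - v by rewrite !mulNr.
  by have -> : q (x - v) - q x - - h * (1 * q1 x + 0 * q2 x) = G x by rewrite /G; ring.
have cE : cc E by apply: ccB; [exact: ccB|exact: ccZ].
have cG : cc G by apply: ccD; [apply: ccB => //; exact: cc_shift|exact: ccZ].
have ibp (f f1 f2 : R * R -> R) : hasC1 setT f f1 f2 -> cc f -> cc f2 -> I2 (fun x => f x * q2 x) = - I2 (fun x => f2 x * q x).
  move=> hf cf cf2.
  have hz x : ~ cbox M x -> f x * q x = 0 by move=> nx; rewrite q0// mulr0.
  have [_ e0'] := I2_deriv (hasC1_mul hf hq) hz.
  by move: e0'; rewrite I2D; [move=> /eqP; rewrite addrC addr_eq0 => /eqP|exact: ccM|exact: ccM].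
have hP : hasC1 setT P (fun x => p1 (x + v)) P2.
  have ha := hasC1_add (@hasC1_fst R setT) (@hasC1_cst R setT v.1).
  have hb := hasC1_add (@hasC1_snd R setT) (@hasC1_cst R setT v.2).
  have hc := hasC1_comp2 ha hb hp (fun _ _ => I).
  have e' (x : R * R) : (x.1 + v.1, x.2 + v.2) = x + v by case: x.
  by apply: (hasC1_ext openT hc) => x _; rewrite e' !addr0 !mul1r !mul0r addr0 add0r.
have i1 := ibp _ _ _ hp cp cp2; have i2 := ibp _ _ _ hP cP cP2.
have i3 : I2 (fun x => P2 x * q x) = I2 (fun x => p2 x * q (x - v)).
  rewrite -(I2_shift (- v) (ccM cP2 cq)); congr I2; apply/funext => x; by rewrite /P2 subrK.
have cqs : cc (fun x => q (x - v)) by exact: cc_shift.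
have j1 : I2 (fun x => E x * q2 x) = I2 (fun x => P x * q2 x) - I2 (fun x => p x * q2 x) - h * I2 (fun x => p1 x * q2 x).
  have -> : (fun x => E x * q2 x) = (fun x => (P x * q2 x - p x * q2 x) - h * (p1 x * q2 x)).
    by apply/funext => x; rewrite /E /P; ring.
  by rewrite I2B; [rewrite I2B; [rewrite I2Z; [|exact: ccM]|exact: ccM|exact: ccM]|apply: ccB; exact: ccM|apply: ccZ; exact: ccM].
have j2 : I2 (fun x => p2 x * G x) = I2 (fun x => p2 x * q (x - v)) - I2 (fun x => p2 x * q x) + h * I2 (fun x => p2 x * q1 x).
  have -> : (fun x => p2 x * G x) = (fun x => (p2 x * q (x - v) - p2 x * q x) + h * (p2 x * q1 x)).
    by apply/funext => x; rewrite /G; ring.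
  by rewrite I2D; [rewrite I2B; [rewrite I2Z; [|exact: ccM]|exact: ccM|exact: ccM]|apply: ccB; exact: ccM|apply: ccZ; exact: ccM].
(* The main terms cancel: integration by parts in the second variable and translation turn both
   difference quotients into the same integrals, and only the Taylor errors [E] and [G] remain. *)
have key : h * I2 (fun x => p1 x * q2 x - p2 x * q1 x) = - I2 (fun x => E x * q2 x) - I2 (fun x => p2 x * G x).
  rewrite I2B; [|exact: ccM|exact: ccM].
  rewrite j1 j2 i1 i2 i3; ring.
have b1 : `|I2 (fun x => E x * q2 x)| <= h * (e / (A + 1)) * I2 (fun x => `|q2 x|).
  apply: (le_trans (I2_abs (ccM cE cq2))); rewrite -I2Z; last exact: cc_norm.
  by apply: I2_le; [exact: cc_norm (ccM cE cq2)|apply: ccZ; exact: cc_norm|move=> x; rewrite normrM ler_wpM2r].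
have b2 : `|I2 (fun x => p2 x * G x)| <= h * (e / (A + 1)) * I2 (fun x => `|p2 x|).
  apply: (le_trans (I2_abs (ccM cp2 cG))); rewrite -I2Z; last exact: cc_norm.
  by apply: I2_le; [exact: cc_norm (ccM cp2 cG)|apply: ccZ; exact: cc_norm|move=> x; rewrite normrM mulrC ler_wpM2r].
have : h * `|I2 (fun x => p1 x * q2 x - p2 x * q1 x)| <= h * e.
  rewrite -[X in X * `|_|](gtr0_norm hpos) -normrM key -opprD normrN.
  apply: le_trans (ler_normD _ _) _; apply: le_trans (lerD b1 b2) _.
  rewrite -mulrDr -/A -mulrA ler_pM2l// mulrAC ler_pdivrMr ?ltr_wpDl// ler_pM2l//; lra.
by rewrite ler_pM2l.
Qed.

Section OnDomain.
Variables (V K : set (R * R)) (M : R).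
Hypothesis oV : open V.
Hypothesis cK : closed K.
Hypothesis KV : K `<=` V.
Hypothesis KM : K `<=` cbox M.
Variables (y y1 y2 z z1 z2 z11 zm z22 : R * R -> R).
Hypothesis hy : hasC1 V y y1 y2.
Hypothesis hz : hasC1 V z z1 z2.
Hypothesis hz1 : hasC1 V z1 z11 zm.
Hypothesis hz2 : hasC1 V z2 zm z22.
(* In the coordinates (y, z): Dy f = J f_y and Dz f = J f_z. *)
Definition J x := y1 x * z2 x - y2 x * z1 x.
Definition Dy (f1 f2 : R * R -> R) x := f1 x * z2 x - f2 x * z1 x.
Definition Dz (f1 f2 : R * R -> R) x := y1 x * f2 x - y2 x * f1 x.
Hypothesis Jpos : forall x, V x -> 0 < J x.

Let cy x (Vx : V x) : {for x, continuous y1} := let: And3 _ a _ := hy Vx in a.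
Let cy' x (Vx : V x) : {for x, continuous y2} := let: And3 _ _ a := hy Vx in a.
Let cz x (Vx : V x) : {for x, continuous z1} := let: And3 _ a _ := hz Vx in a.
Let cz' x (Vx : V x) : {for x, continuous z2} := let: And3 _ _ a := hz Vx in a.

Lemma J_cont x : V x -> {for x, continuous J}.
Proof. by move=> Vx; exact: (continuousB (continuousM (cy Vx) (cz' Vx)) (continuousM (cy' Vx) (cz Vx))). Qed.

Lemma Ji_cont x : V x -> {for x, continuous (fun x => (J x)^-1)}.
Proof. by move=> Vx; apply: continuousV; [rewrite gt_eqF// Jpos|exact: J_cont]. Qed.

Lemma Dy_cont f1 f2 x : V x -> {for x, continuous f1} -> {for x, continuous f2} -> {for x, continuous (Dy f1 f2)}.
Proof. by move=> Vx c1 c2; exact: (continuousB (continuousM c1 (cz' Vx)) (continuousM c2 (cz Vx))). Qed.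

Lemma Dz_cont f1 f2 x : V x -> {for x, continuous f1} -> {for x, continuous f2} -> {for x, continuous (Dz f1 f2)}.
Proof. by move=> Vx c1 c2; exact: (continuousB (continuousM (cy Vx) c2) (continuousM (cy' Vx) c1)). Qed.

Lemma cont_sqr (f : R * R -> R) x : {for x, continuous f} -> {for x, continuous (fun x => f x ^+ 2)}.
Proof. by move=> c; exact: (continuousM c c). Qed.

Let KM' x : ~ cbox M x -> ~ K x. Proof. by move=> h /KM. Qed.

(* J p^2 + 2 (y - yq) p (J p_y) is a divergence. *)
Lemma poincare (p p1 p2 : R * R -> R) (yq r : R) : hasC1 setT p p1 p2 -> (forall x, ~ K x -> p x = 0) ->
  (forall x, K x -> `|y x - yq| <= r) ->
  cc (fun x => J x * p x ^+ 2) /\ cc (fun x => Dy p1 p2 x ^+ 2 * (J x)^-1) /\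
  I2 (fun x => J x * p x ^+ 2) <= 4 * r ^+ 2 * I2 (fun x => Dy p1 p2 x ^+ 2 * (J x)^-1).
Proof.
move=> hp p0 yr.
have cp x : {for x, continuous p} := hasC1_cont hp I.
have cp1 x : {for x, continuous p1} := let: And3 _ a _ := hp x I in a.
have cp2 x : {for x, continuous p2} := let: And3 _ _ a := hp x I in a.
have off x : ~ K x -> p1 x = 0 /\ p2 x = 0 by move=> nK; exact: hasC1_off hp cK p0 nK.
have c1 : cc (fun x => J x * p x ^+ 2).
  apply: (cc_of oV cK KV KM); last by move=> x /p0 ->; rewrite expr0n mulr0.
  by move=> x Vx; exact: (continuousM (J_cont Vx) (cont_sqr (cp x))).
have c2 : cc (fun x => Dy p1 p2 x ^+ 2 * (J x)^-1).
  apply: (cc_of oV cK KV KM); last by move=> x /off[e1 e2]; rewrite /Dy e1 e2 !mul0r subrr expr0n mul0r.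
  by move=> x Vx; exact: (continuousM (cont_sqr (Dy_cont Vx (cp1 x) (cp2 x))) (Ji_cont Vx)).
split=> //; split=> //.
pose Y x := y x - yq.
have hY : hasC1 V Y y1 y2.
  by apply: (hasC1_ext oV (hasC1_sub' hy (@hasC1_cst R V yq))) => x _; rewrite !subr0.
have hpV := hasC1_sub (@subsetT _ V) hp.
pose B x := 2 * (Y x * (p x * Dy p1 p2 x)).
have cB : cc B.
  apply: (cc_of oV cK KV KM); last by move=> x /p0 e; rewrite /B e mul0r !mulr0.
  move=> x Vx; have cYx : {for x, continuous Y} by exact: hasC1_cont hY Vx.
  have cc0 : {for x, continuous (fun x => Y x * (p x * Dy p1 p2 x))}.
    exact: (continuousM cYx (continuousM (cp x) (Dy_cont Vx (cp1 x) (cp2 x)))).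
  exact: (continuousM (cvg_cst (2 : R)) cc0).
have hf := hasC1_mul hp (hasC1_zero_ext oV cK KV hp p0 hY).
have fK x : ~ K x -> p x * (p x * Y x) = 0 by move=> nK; rewrite (p0 _ nK) mul0r.
have ha := hasC1_zero_ext oV cK KV hf fK hz2.
have hb := hasC1_zero_ext oV cK KV hf fK hz1.
have aK x : ~ cbox M x -> p x * (p x * Y x) * z2 x = 0 by move=> nx; rewrite (p0 _ (KM' nx)) !mul0r.
have bK x : ~ cbox M x -> p x * (p x * Y x) * z1 x = 0 by move=> nx; rewrite (p0 _ (KM' nx)) !mul0r.
have [ia _] := I2_deriv ha aK; have [_ ib] := I2_deriv hb bK.
have [_ ca _] := hasC1_cc ha aK; have [_ _ cb] := hasC1_cc hb bK.
(* With f = p^2 (y - yq), the divergence is d_1(f z_2) - d_2(f z_1); the mixed derivatives [zm]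
   cancel. *)
have E : I2 (fun x => J x * p x ^+ 2) + I2 B = 0.
  rewrite -I2D//.
  have <- : I2 (fun x => ((p1 x * (p x * Y x) + p x * (p1 x * Y x + p x * y1 x)) * z2 x + p x * (p x * Y x) * zm x) -
     ((p2 x * (p x * Y x) + p x * (p2 x * Y x + p x * y2 x)) * z1 x + p x * (p x * Y x) * zm x)) = 0.
    by rewrite (I2B ca cb) ia ib subrr.
  by congr I2; apply/funext => x; rewrite /B /J /Dy; ring.
have Bb : - I2 B <= I2 (fun x => 2^-1 * (J x * p x ^+ 2) + 2 * r ^+ 2 * (Dy p1 p2 x ^+ 2 * (J x)^-1)).
  rewrite -I2N//; apply: I2_le; [exact: ccN|by apply: ccD; exact: ccZ|] => x.
  have [Kx|nK] := pselect (K x); last first.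
    by have [e1 e2] := off _ nK; rewrite /B (p0 _ nK) /Dy e1 e2 !mul0r subrr expr0n !mulr0 mul0r mulr0 oppr0 addr0.
  have J0 := Jpos (KV Kx); have := yr x Kx; rewrite -/(Y x) /B.
  set D := Dy p1 p2 x => hr.
  have r0 : 0 <= r by exact: le_trans hr.
  have h1 : - (Y x * (p x * D)) <= r * (`|p x| * `|D|).
    apply: le_trans (ler_norm _) _; rewrite normrN !normrM; apply: ler_wpM2r => //; exact: mulr_ge0.
  have young (a b j : R) : 0 < j -> 2 * (r * (a * b)) <= 2^-1 * (j * a ^+ 2) + 2 * r ^+ 2 * (b ^+ 2 * j^-1).
    move=> j0; rewrite -subr_ge0.
    have -> : 2^-1 * (j * a ^+ 2) + 2 * r ^+ 2 * (b ^+ 2 * j^-1) - 2 * (r * (a * b)) = 2^-1 * j^-1 * (j * a - 2 * r * b) ^+ 2.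
      by field; rewrite gt_eqF.
    by rewrite mulr_ge0 ?sqr_ge0// mulr_ge0 ?invr_ge0// ltW.
  have := young `|p x| `|D| (J x) J0; rewrite !real_normK ?num_real//; apply: le_trans.
  by rewrite -mulrN ler_pM2l.
move: Bb; rewrite (I2D (ccZ _ c1) (ccZ _ c2)) (I2Z _ c1) (I2Z _ c2).
have lin (a b c : R) : a + b = 0 -> - b <= 2^-1 * a + 2 * r ^+ 2 * c -> a <= 4 * r ^+ 2 * c.
  move=> h1 h2; have -> : 4 * r ^+ 2 * c = 2 * (2 * r ^+ 2 * c) by ring.
  by move: h2; move: (2 * r ^+ 2 * c) => t; lra.
exact: lin.
Qed.

(* The cross terms of T integrate to a multiple of the null Lagrangian of (p, q). *)
Lemma energy (p p1 p2 q q1 q2 : R * R -> R) (yq r : R) :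
  hasC1 setT p p1 p2 -> hasC1 setT q q1 q2 -> (forall x, ~ K x -> p x = 0) -> (forall x, ~ K x -> q x = 0) ->
  (forall x, K x -> `|y x - yq| <= r) ->
  let T x := ((Dy p1 p2 x - Dz q1 q2 x) ^+ 2 + (Dz p1 p2 x + Dy q1 q2 x) ^+ 2) * (J x)^-1 in
  [/\ cc T, cc (fun x => J x * (p x ^+ 2 + q x ^+ 2)) &
  I2 (fun x => J x * (p x ^+ 2 + q x ^+ 2)) <= 4 * r ^+ 2 * I2 T].
Proof.
move=> hp hq p0 q0 yr T.
have cp1 x : {for x, continuous p1} := let: And3 _ a _ := hp x I in a.
have cp2 x : {for x, continuous p2} := let: And3 _ _ a := hp x I in a.
have cq1 x : {for x, continuous q1} := let: And3 _ a _ := hq x I in a.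
have cq2 x : {for x, continuous q2} := let: And3 _ _ a := hq x I in a.
have offp x : ~ K x -> p1 x = 0 /\ p2 x = 0 by move=> nK; exact: hasC1_off hp cK p0 nK.
have offq x : ~ K x -> q1 x = 0 /\ q2 x = 0 by move=> nK; exact: hasC1_off hq cK q0 nK.
have cT : cc T.
  apply: (cc_of oV cK KV KM); last first.
    by move=> x nK; have [e1 e2] := offp x nK; have [e3 e4] := offq x nK;
      rewrite /T /Dy /Dz e1 e2 e3 e4 !mul0r !mulr0 !subrr addr0 expr0n addr0 mul0r.
  move=> x Vx; have a1 := Dy_cont Vx (cp1 x) (cp2 x); have a2 := Dz_cont Vx (cq1 x) (cq2 x).
  have a3 := Dz_cont Vx (cp1 x) (cp2 x); have a4 := Dy_cont Vx (cq1 x) (cq2 x).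
  exact: (continuousM (continuousD (cont_sqr (continuousB a1 a2)) (cont_sqr (continuousD a3 a4))) (Ji_cont Vx)).
have [cp [cDp bp]] := poincare hp p0 yr; have [cq [cDq bq]] := poincare hq q0 yr.
have Es : (fun x => J x * (p x ^+ 2 + q x ^+ 2)) = (fun x => J x * p x ^+ 2 + J x * q x ^+ 2).
  by apply/funext => x; rewrite mulrDr.
have pM x : ~ cbox M x -> p x = 0 by move=> nx; exact: p0 (KM' nx).
have qM x : ~ cbox M x -> q x = 0 by move=> nx; exact: q0 (KM' nx).
have nl := null_lagrangian hp hq pM qM.
have [_ ccp1 ccp2] := hasC1_cc hp pM; have [_ ccq1 ccq2] := hasC1_cc hq qM.
have cN : cc (fun x => p1 x * q2 x - p2 x * q1 x) by apply: ccB; exact: ccM.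
have le1 : I2 (fun x => Dy p1 p2 x ^+ 2 * (J x)^-1) + I2 (fun x => Dy q1 q2 x ^+ 2 * (J x)^-1) <= I2 T.
  rewrite -(I2D cDp cDq) -[leRHS]addr0 -(mulr0 2) -nl -(I2Z _ cN) -(I2D cT (ccZ _ cN)).
  apply: I2_le; [exact: ccD|by apply: ccD => //; exact: ccZ|] => x.
  have [Kx|nK] := pselect (K x); last first.
    by have [e1 e2] := offp x nK; have [e3 e4] := offq x nK;
      rewrite /T /Dy /Dz e1 e2 e3 e4 !mul0r !mulr0 !subrr !addr0 expr0n !addr0 mul0r mulr0 addr0.
  have J0 := Jpos (KV Kx).
  have cross : J x * (p1 x * q2 x - p2 x * q1 x) = Dy p1 p2 x * Dz q1 q2 x - Dz p1 p2 x * Dy q1 q2 x.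
    by rewrite /J /Dy /Dz; ring.
  have gen (a b c d j n : R) : 0 < j -> j * n = a * d - b * c ->
    a ^+ 2 * j^-1 + c ^+ 2 * j^-1 <= ((a - d) ^+ 2 + (b + c) ^+ 2) * j^-1 + 2 * n.
    move=> j0 h; rewrite -subr_ge0.
    have -> : n = (a * d - b * c) * j^-1 by rewrite -h mulrC mulKf// gt_eqF.
    have -> : ((a - d) ^+ 2 + (b + c) ^+ 2) * j^-1 + 2 * ((a * d - b * c) * j^-1) - (a ^+ 2 * j^-1 + c ^+ 2 * j^-1) =
      (d ^+ 2 + b ^+ 2) * j^-1 by ring.
    by rewrite mulr_ge0 ?addr_ge0 ?sqr_ge0// invr_ge0 ltW.
  exact: gen J0 cross.
split=> //; first by rewrite Es; exact: ccD.
rewrite Es (I2D cp cq); apply: le_trans (lerD bp bq) _; rewrite -mulrDr.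
by rewrite ler_wpM2l// mulr_ge0// sqr_ge0.
Qed.

End OnDomain.
End Energy.

(** * Singular weights and the L^2 estimate *)

Section Plane.
Variable R : realType.

Lemma hasC1_inv (U : set (R * R)) (f f1 f2 : R * R -> R) : hasC1 U f f1 f2 -> (forall x, U x -> f x != 0) ->
  hasC1 U (fun x => (f x)^-1) (fun x => - (f x ^+ 2)^-1 * f1 x) (fun x => - (f x ^+ 2)^-1 * f2 x).
Proof.
move=> hf f0.
have dF (t : R) : t != 0 -> is_derive t (1 : R) (fun s : R => s^-1) (- (t ^+ 2)^-1).
  move=> t0; have := @is_deriveV _ id t (1 : R) 1 t0 (is_derive_id _ _).
  by rewrite /GRing.scale /= mulr1.
have cF (t : R) : t != 0 -> {for t, continuous (fun s : R => - (s ^+ 2)^-1)}.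
  move=> t0; apply: continuousN; apply: continuousV; first by rewrite expf_neq0.
  exact: exprn_continuous.
exact: (@hasC1_comp1 R U [set t | t != 0] (fun s : R => s^-1) (fun t => - (t ^+ 2)^-1) _ _ _ dF cF hf f0).
Qed.

Section Holo.
Variables (V : set (R * R)) (y y1 y2 z z1 z2 : R * R -> R).
Hypothesis hy : hasC1 V y y1 y2.
Hypothesis hz : hasC1 V z z1 z2.
Variable (yq zq : R).
Definition NN (x : R * R) := (y x - yq) ^+ 2 + (z x - zq) ^+ 2.
Definition VN : set (R * R) := [set x | V x /\ NN x != 0].

(* A + i B = ((y - yq) + i (z - zq))^{-n} *)
Lemma holo_pow (n : nat) : exists A A1 A2 B B1 B2, [/\ hasC1 VN A A1 A2, hasC1 VN B B1 B2 &
  forall x, VN x -> [/\ Dy z1 z2 A1 A2 x = Dz y1 y2 B1 B2 x, Dz y1 y2 A1 A2 x = - Dy z1 z2 B1 B2 x &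
    A x ^+ 2 + B x ^+ 2 = (NN x)^-1 ^+ n]].
Proof.
have sV : VN `<=` V by move=> x [].
have hY := hasC1_sub' (hasC1_sub sV hy) (@hasC1_cst R VN yq).
have hZ := hasC1_sub' (hasC1_sub sV hz) (@hasC1_cst R VN zq).
have hN : hasC1 VN NN _ _ := hasC1_add (hasC1_mul hY hY) (hasC1_mul hZ hZ).
have hI := hasC1_inv hN (fun x h => h.2).
have ha := hasC1_mul hY hI.
have hb := hasC1_opp (hasC1_mul hZ hI).
elim: n => [|n [A [A1 [A2 [B [B1 [B2 [hA hB h]]]]]]]].
  exists (fun=> 1), (fun=> 0), (fun=> 0), (fun=> 0), (fun=> 0), (fun=> 0); split=> [||x _].
  - exact: hasC1_cst.
  - exact: hasC1_cst.
  by rewrite /Dy /Dz !mul0r !mulr0 subrr oppr0 expr0 expr1n expr0n addr0.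
(* Multiplication by 1 / zeta, whose real and imaginary parts are the functions in [ha] and [hb]. *)
have hA' := hasC1_sub' (hasC1_mul hA ha) (hasC1_mul hB hb).
have hB' := hasC1_add (hasC1_mul hA hb) (hasC1_mul hB ha).
do 6 eexists; split; [exact: hA'|exact: hB'|].
move=> x Vx; have [e1 e2 e3] := h x Vx; have [_ N0] := Vx.
move: e1 e2 e3 N0; rewrite /Dy /Dz /NN /= => {hA' hB' hA hB ha hb hI hN hY hZ h}.
move: (A x) (A1 x) (A2 x) (B x) (B1 x) (B2 x) (y1 x) (y2 x) (z1 x) (z2 x) (y x - yq) (z x - zq).
move=> {x Vx} {}A {}A1 {}A2 {}B {}B1 {}B2 u1 u2 v1 v2 Y Z e1 e2 e3 N0.
rewrite [_^-1 ^+ n.+1]exprS -e3.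
set I := (Y ^+ 2 + Z ^+ 2)^-1.
have hI : I * (Y ^+ 2 + Z ^+ 2) = 1 by rewrite mulVf.
have eI : ((Y ^+ 2 + Z ^+ 2) ^+ 2)^-1 = I ^+ 2 by rewrite exprVn.
rewrite eI; move: I hI {eI} => I hI.
split.
- apply/eqP; rewrite -subr_eq0; apply/eqP.
  transitivity ((A1 * v2 - A2 * v1 - (u1 * B2 - u2 * B1)) * (Y * I) + ((u1 * A2 - u2 * A1) + (B1 * v2 - B2 * v1)) * (Z * I)
    + 2 * A * (u1 * v2 - u2 * v1) * I * (1 - I * (Y ^+ 2 + Z ^+ 2))); first by ring.
  by rewrite e1 e2 hI; ring.
- apply/eqP; rewrite -subr_eq0 opprK; apply/eqP.
  transitivity ((A1 * v2 - A2 * v1 - (u1 * B2 - u2 * B1)) * - (Z * I) + ((u1 * A2 - u2 * A1) + (B1 * v2 - B2 * v1)) * (Y * I)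
    + 2 * B * (u1 * v2 - u2 * v1) * I * (1 - I * (Y ^+ 2 + Z ^+ 2))); first by ring.
  by rewrite e1 e2 hI; ring.
- have : (A * (Y * I) - B * - (Z * I)) ^+ 2 + (A * - (Z * I) + B * (Y * I)) ^+ 2 = (I * (Y ^+ 2 + Z ^+ 2)) * I * (A ^+ 2 + B ^+ 2) by ring.
  by rewrite hI mul1r.
Qed.
End Holo.

(** By Cramer's rule, j |a| and j |b| are each at most M (|dy| + |dz|) + 2 M e (|a| + |b|). The
    choice 8 M e = j makes the two error terms add up to half of j (|a| + |b|), which is
    absorbed. *)
Lemma quasi_inv (p1 p2 q1 q2 a b dy dz M e : R) : 0 < p1 * q2 - p2 * q1 ->
  `|p1| <= M -> `|p2| <= M -> `|q1| <= M -> `|q2| <= M -> e * (8 * M) = p1 * q2 - p2 * q1 ->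
  `|dy - (a * p1 + b * p2)| <= e * (`|a| + `|b|) -> `|dz - (a * q1 + b * q2)| <= e * (`|a| + `|b|) ->
  `|a| + `|b| <= 4 * M / (p1 * q2 - p2 * q1) * (`|dy| + `|dz|).
Proof.
set j := p1 * q2 - p2 * q1 => j0 h1 h2 h3 h4 he hy hz.
have M0 : 0 <= M by exact: le_trans h1.
have gen (u v c : R) : `|u| <= M -> `|v| <= M -> j * c = u * dy - v * dz - (u * (dy - (a * p1 + b * p2)) - v * (dz - (a * q1 + b * q2))) ->
  j * `|c| <= M * (`|dy| + `|dz|) + M * (2 * (e * (`|a| + `|b|))).
  move=> hu hv ec; rewrite -[X in X * `|c|](gtr0_norm j0) -normrM ec.
  have bd (s t s' : R) : `|s| <= M -> `|t| <= s' -> `|s * t| <= M * s' by move=> *; rewrite normrM ler_pM.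
  have b1 := bd _ _ _ hu (lexx `|dy|); have b2 := bd _ _ _ hv (lexx `|dz|); have b3 := bd _ _ _ hu hy; have b4 := bd _ _ _ hv hz.
  apply: le_trans (ler_normB _ _) _; apply: le_trans (lerD (ler_normB _ _) (ler_normB _ _)) _.
  apply: le_trans (lerD (lerD b1 b2) (lerD b3 b4)) _; move: (e * (`|a| + `|b|)) (`|dy|) (`|dz|) => t t1 t2.
  by rewrite le_eqVlt; apply/orP; left; apply/eqP; ring.
have ga := gen q2 p2 a h4 h2; have gb := gen (- q1) (- p1) b; rewrite !normrN in gb.
have {}ga := ga (ltac:(rewrite /j; ring)); have {}gb := gb h3 h1 (ltac:(rewrite /j; ring)).
rewrite mulrAC ler_pdivlMr// mulrC.
have e4 : M * (2 * (e * (`|a| + `|b|))) = j * (`|a| + `|b|) / 4 by rewrite -he; field.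
rewrite e4 in ga gb.
have : j * (`|a| + `|b|) <= 2 * (M * (`|dy| + `|dz|)) + j * (`|a| + `|b|) / 2.
  rewrite [leLHS]mulrDr; move: ga gb; move: (j * `|a|) (j * `|b|) (M * _) (j * (_ + _)) => s t u v; lra.
rewrite -[4 * M * _]mulrA; move: (j * _) (M * _) => s t; lra.
Qed.

(** A quantitative inverse function theorem: on a small box the increments of [y] and [z] are close
    to their linear parts at [x0], by the mean value theorem for each function separately, and
    [quasi_inv] inverts the linear part. *)
Lemma loc_inj (V : set (R * R)) (y y1 y2 z z1 z2 : R * R -> R) (x0 : R * R) : open V -> V x0 ->
  hasC1 V y y1 y2 -> hasC1 V z z1 z2 -> 0 < J y1 y2 z1 z2 x0 ->
  exists s C : R, [/\ 0 < s, 0 <= C, box x0 s `<=` V & forall x x', box x0 s x -> box x0 s x' ->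
    `|x'.1 - x.1| + `|x'.2 - x.2| <= C * (`|y x' - y x| + `|z x' - z x|)].
Proof.
move=> oV Vx0 hy hz J0.
pose M := `|y1 x0| + `|y2 x0| + `|z1 x0| + `|z2 x0| + 1.
have n1 := normr_ge0 (y1 x0); have n2 := normr_ge0 (y2 x0); have n3 := normr_ge0 (z1 x0); have n4 := normr_ge0 (z2 x0).
have M0 : 0 < M by rewrite ltr_wpDl// !addr_ge0.
have [_ c1 c2] := hy x0 Vx0; have [_ c3 c4] := hz x0 Vx0.
pose e := J y1 y2 z1 z2 x0 / (8 * M).
have e0 : 0 < e by rewrite divr_gt0// mulr_gt0.
have nV : nbhs x0 V by exact: open_nbhs_nbhs.
have nb : nbhs x0 (V `&` (([set w | `|y1 w - y1 x0| < e] `&` [set w | `|y2 w - y2 x0| < e]) `&`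
    ([set w | `|z1 w - z1 x0| < e] `&` [set w | `|z2 w - z2 x0| < e]))).
  apply: filterI => //; apply: filterI; apply: filterI.
  - exact: cont_near_lt c1 e0.
  - exact: cont_near_lt c2 e0.
  - exact: cont_near_lt c3 e0.
  - exact: cont_near_lt c4 e0.
have [s s0 hs] := nbhs_box_in nb.
have sV : box x0 s `<=` V by move=> x /hs[].
exists s, (4 * M / J y1 y2 z1 z2 x0); split=> //; first by rewrite divr_ge0 ?ltW// mulr_gt0.
move=> x x' bx bx'.
have mv (f f1 f2 : R * R -> R) : hasC1 V f f1 f2 ->
  (forall w, box x0 s w -> `|f1 w - f1 x0| < e) -> (forall w, box x0 s w -> `|f2 w - f2 x0| < e) ->
  `|f x' - f x - ((x'.1 - x.1) * f1 x0 + (x'.2 - x.2) * f2 x0)| <= e * (`|x'.1 - x.1| + `|x'.2 - x.2|).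
  move=> hf h1 h2.
  have dg (t : R) : 0 <= t <= 1 -> is_derive t (1 : R) (fun s => f (segm x x' s))
    ((diffp x x').1 * f1 (segm x x' t) + (diffp x x').2 * f2 (segm x x' t)).
    by move=> t01; apply: (segm_derive hf); apply: sV; exact: box_segm.
  have [t /andP[t0 t1]] := MVT_cc ltr01 dg.
  have bt : box x0 s (segm x x' t) by apply: box_segm => //; rewrite !ltW.
  rewrite segm_0 segm_1 subr0 mulr1 => ->; rewrite /diffp /=.
  move: (h1 _ bt) (h2 _ bt); move: (f1 (segm x x' t)) (f2 (segm x x' t)) (f1 x0) (f2 x0) (x'.1 - x.1) (x'.2 - x.2).
  clear=> p q p0 q0 a b h1 h2.
  have -> : a * p + b * q - (a * p0 + b * q0) = a * (p - p0) + b * (q - q0) by ring.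
  apply: le_trans (ler_normD _ _) _; rewrite !normrM mulrDr ![e * _]mulrC.
  by apply: lerD; apply: ler_wpM2l => //; exact: ltW.
have hY := mv _ _ _ hy (fun w h => (hs w h).2.1.1) (fun w h => (hs w h).2.1.2).
have hZ := mv _ _ _ hz (fun w h => (hs w h).2.2.1) (fun w h => (hs w h).2.2.2).
have m1 : `|y1 x0| <= M by rewrite /M; lra.
have m2 : `|y2 x0| <= M by rewrite /M; lra.
have m3 : `|z1 x0| <= M by rewrite /M; lra.
have m4 : `|z2 x0| <= M by rewrite /M; lra.
have He : e * (8 * M) = y1 x0 * z2 x0 - y2 x0 * z1 x0 by rewrite /e mulfVK// gt_eqF// mulr_gt0.
exact: (quasi_inv J0 m1 m2 m3 m4 He hY hZ).
Qed.

(** With P + i Q = (A + i B)(al - i be), this is the product rule for J (d_y + i d_z) applied to c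
    (P + i Q). The factor A + i B is holomorphic in y + i z by the first two equations, and the
    third makes J (d_y + i d_z)(al - i be) real, with value [E]. *)
Lemma cut_identity (c c1 c2 A A1 A2 B B1 B2 al a1 a2 be b1 b2 y1 y2 z1 z2 E : R) :
  A1 * z2 - A2 * z1 = y1 * B2 - y2 * B1 -> y1 * A2 - y2 * A1 = - (B1 * z2 - B2 * z1) ->
  y1 * a2 - y2 * a1 = b1 * z2 - b2 * z1 -> (a1 * z2 - a2 * z1) + (y1 * b2 - y2 * b1) = E ->
  let P := A * al + B * be in let Q := B * al - A * be in
  let p1 := c1 * P + c * (A1 * al + A * a1 + (B1 * be + B * b1)) in
  let p2 := c2 * P + c * (A2 * al + A * a2 + (B2 * be + B * b2)) in
  let q1 := c1 * Q + c * (B1 * al + B * a1 - (A1 * be + A * b1)) in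
  let q2 := c2 * Q + c * (B2 * al + B * a2 - (A2 * be + A * b2)) in
  p1 * z2 - p2 * z1 - (y1 * q2 - y2 * q1) = (c1 * z2 - c2 * z1) * P - (y1 * c2 - y2 * c1) * Q + c * (A * E) /\
  y1 * p2 - y2 * p1 + (q1 * z2 - q2 * z1) = (y1 * c2 - y2 * c1) * P + (c1 * z2 - c2 * z1) * Q + c * (B * E).
Proof.
move=> e1 e2 h1 h2 P Q p1 p2 q1 q2; split.
- transitivity ((c1 * z2 - c2 * z1) * P - (y1 * c2 - y2 * c1) * Q + c * (A * ((a1 * z2 - a2 * z1) + (y1 * b2 - y2 * b1)))
    + c * ((A1 * z2 - A2 * z1 - (y1 * B2 - y2 * B1)) * al + (y1 * A2 - y2 * A1 + (B1 * z2 - B2 * z1)) * be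
    + B * (b1 * z2 - b2 * z1 - (y1 * a2 - y2 * a1)))).
    by rewrite /p1 /p2 /q1 /q2; ring.
  by rewrite e1 e2 h1 h2; ring.
- transitivity ((y1 * c2 - y2 * c1) * P + (c1 * z2 - c2 * z1) * Q + c * (B * ((a1 * z2 - a2 * z1) + (y1 * b2 - y2 * b1)))
    + c * ((y1 * A2 - y2 * A1 + (B1 * z2 - B2 * z1)) * al - (A1 * z2 - A2 * z1 - (y1 * B2 - y2 * B1)) * be
    - A * (b1 * z2 - b2 * z1 - (y1 * a2 - y2 * a1)))).
    by rewrite /p1 /p2 /q1 /q2; ring.
  by rewrite e1 e2 h1 h2; ring.
Qed.

(** The weight [k] has to be bounded by [t] only where the cutoff has a derivative. In the other
    term it stays inside (c P)^2 + (c Q)^2, ready to be absorbed. *)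
Lemma cut_bound (c u1 u2 A B al be g h j k t C X Y : R) : 0 < j -> A ^+ 2 + B ^+ 2 = k ->
  `|g| <= C -> `|h| <= C -> k <= t \/ u1 = 0 /\ u2 = 0 -> 0 <= t ->
  let P := A * al + B * be in let Q := B * al - A * be in
  X = u1 * P - u2 * Q + c * (A * (j * (al * g + be * h))) -> Y = u2 * P + u1 * Q + c * (B * (j * (al * g + be * h))) ->
  (X ^+ 2 + Y ^+ 2) * j^-1 <= t * (2 * (u1 ^+ 2 + u2 ^+ 2) * (al ^+ 2 + be ^+ 2) * j^-1) +
    4 * C ^+ 2 * (j * ((c * P) ^+ 2 + (c * Q) ^+ 2)).
Proof.
move=> j0 ek hg hh ht t0 P Q eX eY; set E := j * (al * g + be * h).
have sq (a b : R) : (a + b) ^+ 2 <= 2 * a ^+ 2 + 2 * b ^+ 2.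
  rewrite -subr_ge0; have -> : 2 * a ^+ 2 + 2 * b ^+ 2 - (a + b) ^+ 2 = (a - b) ^+ 2 by ring.
  exact: sqr_ge0.
have b1 : X ^+ 2 + Y ^+ 2 <= 2 * (u1 ^+ 2 + u2 ^+ 2) * (k * (al ^+ 2 + be ^+ 2)) + 2 * (c ^+ 2 * (k * E ^+ 2)).
  rewrite eX eY; apply: le_trans (lerD (sq _ _) (sq _ _)) _; rewrite le_eqVlt; apply/orP; left; apply/eqP.
  by rewrite -ek /P /Q -/E; ring.
have k0 : 0 <= k by rewrite -ek addr_ge0 ?sqr_ge0.
have S0 : 0 <= al ^+ 2 + be ^+ 2 by rewrite addr_ge0 ?sqr_ge0.
have U0 : 0 <= u1 ^+ 2 + u2 ^+ 2 by rewrite addr_ge0 ?sqr_ge0.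
have b2 : (u1 ^+ 2 + u2 ^+ 2) * (k * (al ^+ 2 + be ^+ 2)) <= (u1 ^+ 2 + u2 ^+ 2) * (t * (al ^+ 2 + be ^+ 2)).
  case: ht => [kt|[-> ->]]; first by rewrite ler_wpM2l// ler_wpM2r.
  by rewrite expr0n addr0 !mul0r.
have C0 : 0 <= C by exact: le_trans hg.
have sqC (x : R) : `|x| <= C -> x ^+ 2 <= C ^+ 2 by move=> hx; rewrite -[x ^+ 2]real_normK ?num_real// lerXn2r// nnegrE.
have b3 : (al * g + be * h) ^+ 2 <= 2 * C ^+ 2 * (al ^+ 2 + be ^+ 2).
  apply: (@le_trans _ _ ((al ^+ 2 + be ^+ 2) * (g ^+ 2 + h ^+ 2))).
    rewrite -subr_ge0; have -> : (al ^+ 2 + be ^+ 2) * (g ^+ 2 + h ^+ 2) - (al * g + be * h) ^+ 2 = (al * h - be * g) ^+ 2 by ring.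
    exact: sqr_ge0.
  by rewrite mulrC ler_wpM2r// mulr2n mulrDl !mul1r lerD// sqC.
have b4 : c ^+ 2 * (k * E ^+ 2) <= c ^+ 2 * (k * (j ^+ 2 * (2 * C ^+ 2 * (al ^+ 2 + be ^+ 2)))).
  by rewrite ler_wpM2l ?sqr_ge0// ler_wpM2l// /E exprMn ler_wpM2l// sqr_ge0.
have jj : j * j^-1 = 1 by rewrite mulfV// gt_eqF.
apply: (@le_trans _ _ ((2 * ((u1 ^+ 2 + u2 ^+ 2) * (t * (al ^+ 2 + be ^+ 2))) + 2 * (c ^+ 2 * (k * (j ^+ 2 * (2 * C ^+ 2 * (al ^+ 2 + be ^+ 2)))))) * j^-1)).
  apply: ler_wpM2r; first by rewrite invr_ge0 ltW.
  by apply: le_trans b1 _; rewrite -mulrA; apply: lerD; rewrite ler_pM2l.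
rewrite le_eqVlt; apply/orP; left; apply/eqP; rewrite -ek /P /Q.
transitivity (t * (2 * (u1 ^+ 2 + u2 ^+ 2) * (al ^+ 2 + be ^+ 2) * j^-1) + 4 * C ^+ 2 * (j * j^-1 * (j * ((c * P) ^+ 2 + (c * Q) ^+ 2)))).
  by rewrite /P /Q; ring.
by rewrite jj mul1r.
Qed.

(** The product of the constants 4 r^2 and 4 C^2 is at most 1/2, so half of [e] remains on the
    left. *)
Lemma absorb (r C e t m : R) : 16 * r ^+ 2 * C ^+ 2 <= 2^-1 ->
  0 <= e -> e <= 4 * r ^+ 2 * t -> t <= m + 4 * C ^+ 2 * e -> e <= 8 * r ^+ 2 * m.
Proof.
move=> small h0 h1 h2; have r2 : 0 <= 4 * r ^+ 2 by rewrite mulr_ge0 ?sqr_ge0.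
have h3 := le_trans h1 (ler_wpM2l r2 h2).
have h4 : 16 * r ^+ 2 * C ^+ 2 * e <= 2^-1 * e by rewrite ler_wpM2r.
have h5 : 4 * r ^+ 2 * (m + 4 * C ^+ 2 * e) = 4 * r ^+ 2 * m + 16 * r ^+ 2 * C ^+ 2 * e by ring.
have -> : 8 * r ^+ 2 * m = 2 * (4 * r ^+ 2 * m) by ring.
rewrite h5 in h3; move: h3 h4; move: (4 * r ^+ 2 * m) (16 * _ * _ * e) => u v; clear=> *; lra.
Qed.

Lemma far_bound (s C a b : R) : (s / 4) ^+ 2 <= (C * (`|a| + `|b|)) ^+ 2 ->
  s ^+ 2 <= (a ^+ 2 + b ^+ 2) * (64 * (2 * C ^+ 2 + 1)).
Proof.
move=> hs.
  have ab : (`|a| + `|b|) ^+ 2 <= 2 * (a ^+ 2 + b ^+ 2).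
    rewrite -(real_normK (num_real a)) -(real_normK (num_real b)) -subr_ge0.
    have -> : 2 * (`|a| ^+ 2 + `|b| ^+ 2) - (`|a| + `|b|) ^+ 2 = (`|a| - `|b|) ^+ 2 by ring.
    exact: sqr_ge0.
  have := ler_wpM2l (sqr_ge0 C) ab; rewrite [(C * _) ^+ 2]exprMn in hs; move=> h'.
  have h4 := le_trans hs h'.
  have e1 : (a ^+ 2 + b ^+ 2) * (64 * (2 * C ^+ 2 + 1)) = 64 * (C ^+ 2 * (2 * (a ^+ 2 + b ^+ 2))) + 64 * (a ^+ 2 + b ^+ 2) by ring.
  have e2 : (s / 4) ^+ 2 = s ^+ 2 / 16 by field.
  rewrite e1; rewrite e2 in h4.
  have := sqr_ge0 a; have := sqr_ge0 b; have := sqr_ge0 s.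
  move: h4; move: (C ^+ 2 * (2 * (a ^+ 2 + b ^+ 2))) (s ^+ 2) (a ^+ 2) (b ^+ 2); clear=> *; lra.
Qed.

Lemma two_close (a b c d e f t : R) : (a - e) ^+ 2 + (b - f) ^+ 2 < t / 8 -> (c - e) ^+ 2 + (d - f) ^+ 2 < t / 8 ->
  (a - c) ^+ 2 + (b - d) ^+ 2 < t / 2.
Proof.
move=> h1 h2; have sq (u v w : R) : (u - v) ^+ 2 <= 2 * (u - w) ^+ 2 + 2 * (v - w) ^+ 2.
  rewrite -subr_ge0; have -> : 2 * (u - w) ^+ 2 + 2 * (v - w) ^+ 2 - (u - v) ^+ 2 = (u + v - 2 * w) ^+ 2 by ring.
  exact: sqr_ge0.
have := sq a c e; have := sq b d f; lra.
Qed.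

Section Carleman.
Variables (V : set (R * R)) (y y1 y2 z z1 z2 z11 zm z22 al a1 a2 be b1 b2 g h : R * R -> R).
Hypothesis oV : open V.
Hypothesis hy : hasC1 V y y1 y2.
Hypothesis hz : hasC1 V z z1 z2.
Hypothesis hz1 : hasC1 V z1 z11 zm.
Hypothesis hz2 : hasC1 V z2 zm z22.
Hypothesis hal : hasC1 V al a1 a2.
Hypothesis hbe : hasC1 V be b1 b2.
Local Notation J := (J y1 y2 z1 z2).
Local Notation Dy := (Dy z1 z2).
Local Notation Dz := (Dz y1 y2).
Hypothesis Jpos : forall x, V x -> 0 < J x.
Hypothesis H1 : forall x, V x -> Dz a1 a2 x = Dy b1 b2 x.
Hypothesis H2 : forall x, V x -> Dy a1 a2 x + Dz b1 b2 x = J x * (al x * g x + be x * h x).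
Variables (x0 : R * R) (s r C t1 yq zq : R).
Hypothesis s0 : 0 < s.
Local Notation K := (box x0 s).
Hypothesis KV : K `<=` V.
Hypothesis gC : forall x, K x -> `|g x| <= C.
Hypothesis hC : forall x, K x -> `|h x| <= C.
Hypothesis yr : forall x, K x -> `|y x - yq| <= r.
Hypothesis small : 16 * r ^+ 2 * C ^+ 2 <= 2^-1.
Hypothesis t10 : 0 < t1.
Local Notation N := (NN y z yq zq).
Hypothesis far : forall x, K x -> ~ box x0 (s / 2) x -> t1 <= N x.
Hypothesis Vq : forall x, V x -> N x = 0 -> \forall w \near x, al w = 0 /\ be w = 0.
Local Notation ch := (chi x0 s).
(** The density of |f dbar(chi)|^2 without the singular weight; the factor 2 comes from the square
    of a sum in [cut_bound]. *)
Definition mm x := 2 * (Dy (chi1 x0 s) (chi2 x0 s) x ^+ 2 + Dz (chi1 x0 s) (chi2 x0 s) x ^+ 2) * (al x ^+ 2 + be x ^+ 2) * (J x)^-1.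

(** At the pole of the weight f vanishes in a neighbourhood together with its partial derivatives,
    so the weighted function is 0 there and C^1, whatever values the weight takes. *)
Let zero_at x : V x -> N x = 0 -> exists W, [/\ open W, W x, W `<=` V &
  forall w, W w -> (al w = 0 /\ a1 w = 0 /\ a2 w = 0) /\ (be w = 0 /\ b1 w = 0 /\ b2 w = 0)].
Proof.
move=> Vx Nx; have nW : nbhs x ([set w | al w = 0 /\ be w = 0] `&` V).
  by apply: filterI; [exact: Vq|exact: open_nbhs_nbhs].
pose W := ([set w | al w = 0 /\ be w = 0] `&` V)°.
have oW : open W by exact: open_interior.
have W0 w : W w -> al w = 0 /\ be w = 0 by move=> /interior_subset[].
have WV : W `<=` V by move=> w /interior_subset[].
exists W; split=> //.
have z0 (f : R * R -> R) : (forall w, W w -> f w = 0) -> hasC1 W f (fun=> 0) (fun=> 0).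
  by move=> f0; apply: (hasC1_ext oW (@hasC1_cst R W 0)) => w Ww; rewrite f0.
move=> w Ww.
have [ea1 ea2] := hasC1_unique (hasC1_sub WV hal) (z0 _ (fun w Ww => (W0 w Ww).1)) Ww.
have [eb1 eb2] := hasC1_unique (hasC1_sub WV hbe) (z0 _ (fun w Ww => (W0 w Ww).2)) Ww.
by have [ea eb] := W0 w Ww.
Qed.

Let box2 (x : R * R) : V x -> N x != 0 \/ N x = 0.
Proof. by move=> _; case: (eqVneq (N x) 0); [right|left]. Qed.

Let K_cbox : K `<=` cbox (`|x0| + s).
Proof. by move=> x bx; apply/cboxP; exact: box_norm bx. Qed.

Let chi_off x : ~ K x -> chi1 x0 s x = 0 /\ chi2 x0 s x = 0.
Proof. by move=> nK; exact: hasC1_off (@hasC1_chi R x0 s) (@box_closed R x0 s) (fun w => chi_0 s0) nK. Qed.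

Let chi_flat x : box x0 (s / 2) x -> chi x0 s x = 1.
Proof. exact: chi_1. Qed.

Lemma mm_cc : cc mm.
Proof.
apply: (cc_of oV (@box_closed R x0 s) KV K_cbox) => [x Vx|x nK]; last first.
  by have [e1 e2] := chi_off nK; rewrite /mm /Dy /Dz e1 e2 !mul0r !mulr0 !subrr expr0n addr0 mulr0 !mul0r.
have [_ c1 c2] := @hasC1_chi R x0 s x I.
have d1 := Dy_cont hz Vx c1 c2; have d2 := Dz_cont hy Vx c1 c2.
have ca : {for x, continuous al} := hasC1_cont hal Vx.
have cb : {for x, continuous be} := hasC1_cont hbe Vx.
exact: (continuousM (continuousM (continuousM (cvg_cst (2 : R)) (continuousD (cont_sqr d1) (cont_sqr d2))) (continuousD (cont_sqr ca) (cont_sqr cb))) (Ji_cont hy hz Jpos Vx)).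
Qed.

(* p + i q = chi zeta^{-n} (al - i be): the energy estimate absorbs the zeroth order terms on K by [small],
   and the terms with derivatives of chi live where |zeta|^2 >= t1. *)
Lemma weighted n : exists p q : R * R -> R, [/\ cc (fun x => J x * (p x ^+ 2 + q x ^+ 2)),
  forall x, 0 <= J x * (p x ^+ 2 + q x ^+ 2),
  I2 (fun x => J x * (p x ^+ 2 + q x ^+ 2)) <= 8 * r ^+ 2 * (t1^-1 ^+ n * I2 mm) &
  forall x, V x -> box x0 (s / 2) x -> al x ^+ 2 + be x ^+ 2 <= N x ^+ n * (p x ^+ 2 + q x ^+ 2)].
Proof.
have [A [A1 [A2 [B [B1 [B2 [hA hB hAB]]]]]]] := holo_pow hy hz yq zq n.
have VNV : VN V y z yq zq `<=` V by move=> x [].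
have hal' := hasC1_sub VNV hal; have hbe' := hasC1_sub VNV hbe.
pose P x := A x * al x + B x * be x; pose Q x := B x * al x - A x * be x.
have hP' := hasC1_add (hasC1_mul hA hal') (hasC1_mul hB hbe').
have hQ' := hasC1_sub' (hasC1_mul hB hal') (hasC1_mul hA hbe').
pose P1 x := A1 x * al x + A x * a1 x + (B1 x * be x + B x * b1 x).
pose P2 x := A2 x * al x + A x * a2 x + (B2 x * be x + B x * b2 x).
pose Q1 x := B1 x * al x + B x * a1 x - (A1 x * be x + A x * b1 x).
pose Q2 x := B2 x * al x + B x * a2 x - (A2 x * be x + A x * b2 x).
have hP : hasC1 V P P1 P2.
  move=> x Vx; have [N0|N0] := box2 Vx; first exact: hP'.
  have [W [oW Wx WV W0]] := zero_at Vx N0.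
  have hW : hasC1 W P P1 P2; last exact: hW Wx.
  apply: (hasC1_ext oW (@hasC1_cst R W 0)) => w Ww; have [[e1 [e2 e3]] [e4 [e5 e6]]] := W0 w Ww.
  by rewrite /P /P1 /P2 e1 e2 e3 e4 e5 e6 !mulr0 !addr0.
have hQ : hasC1 V Q Q1 Q2.
  move=> x Vx; have [N0|N0] := box2 Vx; first exact: hQ'.
  have [W [oW Wx WV W0]] := zero_at Vx N0.
  have hW : hasC1 W Q Q1 Q2; last exact: hW Wx.
  apply: (hasC1_ext oW (@hasC1_cst R W 0)) => w Ww; have [[e1 [e2 e3]] [e4 [e5 e6]]] := W0 w Ww.
  by rewrite /Q /Q1 /Q2 e1 e2 e3 e4 e5 e6 !mulr0 !addr0 subrr.
pose c := ch.
have hc := @hasC1_chi R x0 s.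
have c0 x : ~ K x -> ch x = 0 by exact: chi_0.
have hp := hasC1_zero_ext oV (@box_closed R x0 s) KV hc c0 hP.
have hq := hasC1_zero_ext oV (@box_closed R x0 s) KV hc c0 hQ.
have p0 x : ~ K x -> ch x * P x = 0 by move=> /c0 ->; rewrite mul0r.
have q0 x : ~ K x -> ch x * Q x = 0 by move=> /c0 ->; rewrite mul0r.
have [cT cE en] := energy oV (@box_closed R x0 s) KV K_cbox hy hz hz1 hz2 Jpos hp hq p0 q0 yr.
have pos x : 0 <= J x * ((ch x * P x) ^+ 2 + (ch x * Q x) ^+ 2).
  have [Kx|nK] := pselect (K x); last by rewrite p0// q0// expr0n addr0 mulr0.
  by apply: mulr_ge0; [exact: ltW (Jpos (KV Kx))|rewrite addr_ge0 ?sqr_ge0].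
exists (fun x => ch x * P x), (fun x => ch x * Q x); split=> //.
- set E := I2 _ in en *; set T := (fun x => _) in cT en.
  have tn0 : 0 <= t1^-1 ^+ n by rewrite exprn_ge0// invr_ge0 ltW.
  have TB : I2 T <= t1^-1 ^+ n * I2 mm + 4 * C ^+ 2 * E.
    rewrite -(I2Z _ mm_cc) -(I2Z _ cE) -(I2D (ccZ _ mm_cc) (ccZ _ cE)).
    apply: I2_le => //; first by apply: ccD; [exact: ccZ mm_cc|exact: ccZ cE].
    have RZ x : mm x = 0 -> ch x * P x = 0 -> ch x * Q x = 0 ->
      t1^-1 ^+ n * mm x + 4 * C ^+ 2 * (J x * ((ch x * P x) ^+ 2 + (ch x * Q x) ^+ 2)) = 0.
      by move=> -> -> ->; rewrite !expr0n addr0 !mulr0 addr0.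
    have TZ x : chi1 x0 s x * P x + ch x * P1 x = 0 -> chi2 x0 s x * P x + ch x * P2 x = 0 ->
      chi1 x0 s x * Q x + ch x * Q1 x = 0 -> chi2 x0 s x * Q x + ch x * Q2 x = 0 -> T x = 0.
      by move=> h1 h2 h3 h4; rewrite /T /Dy /Dz h1 h2 h3 h4 !mul0r !mulr0 !subrr addr0 expr0n addr0 mul0r.
    move=> x; have [Kx|nK] := pselect (K x); last first.
      have [e1 e2] := chi_off nK; have e0 := c0 _ nK.
      have T0 : T x = 0 by apply: TZ; rewrite e0 ?e1 ?e2 !mul0r addr0.
      rewrite T0 (RZ x) ?p0 ?q0//.
      by rewrite /mm /Dy /Dz e1 e2 !mul0r !mulr0 !subrr expr0n addr0 mulr0 !mul0r.
    have Vx := KV Kx.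
    have [N0|N0] := box2 Vx; last first.
      have [W [oW Wx WV W0]] := zero_at Vx N0.
      have [[e1 [e2 e3]] [e4 [e5 e6]]] := W0 x Wx.
      have PZ : P x = 0 /\ P1 x = 0 /\ P2 x = 0 by rewrite /P /P1 /P2 e1 e2 e3 e4 e5 e6 !mulr0 !addr0.
      have QZ : Q x = 0 /\ Q1 x = 0 /\ Q2 x = 0 by rewrite /Q /Q1 /Q2 e1 e2 e3 e4 e5 e6 !mulr0 !addr0 !subrr.
      have [k1 [k2 k3]] := PZ; have [k4 [k5 k6]] := QZ.
      have T0 : T x = 0 by apply: TZ; rewrite ?k1 ?k2 ?k3 ?k4 ?k5 ?k6 !mulr0 addr0.
      rewrite T0 (RZ x) ?k1 ?k4 ?mulr0//.
      by rewrite /mm e1 e4 expr0n addr0 mulr0 mul0r.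
    have [e1 e2 e3] := hAB x (conj Vx N0).
    have [f1 f2] := cut_identity (ch x) (chi1 x0 s x) (chi2 x0 s x) (A x) (B x) (al x) (be x) e1 e2 (H1 Vx) (H2 Vx).
    apply: (cut_bound (Jpos Vx) e3 (gC Kx) (hC Kx) _ tn0 f1 f2).
    have [bx|nbx] := pselect (box x0 (s / 2) x); last first.
      left; rewrite lerXn2r ?nnegrE ?invr_ge0 ?(ltW t10) ?(le_trans (ltW t10) (far Kx nbx))//.
      by rewrite lef_pV2 ?posrE ?far// (lt_le_trans t10 (far Kx nbx)).
    by right; have [-> ->] := chi_d0 s0 bx; rewrite !mul0r !mulr0 subrr.
  have E0 : 0 <= E.
    exact: I2_ge0.
  exact: (absorb small E0 en TB).
- move=> x Vx bx; rewrite chi_flat// !mul1r.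
  have [N0|N0] := box2 Vx; last first.
    have [W [oW Wx WV W0]] := zero_at Vx N0; have [[-> _] [-> _]] := W0 x Wx.
    rewrite expr0n addr0 mulr_ge0 ?addr_ge0 ?sqr_ge0// exprn_ge0//.
    by rewrite addr_ge0 ?sqr_ge0.
  have [_ _ e3] := hAB x (conj Vx N0).
  have -> : P x ^+ 2 + Q x ^+ 2 = (A x ^+ 2 + B x ^+ 2) * (al x ^+ 2 + be x ^+ 2) by rewrite /P /Q; ring.
  by rewrite e3 mulrA -exprMn mulfV// expr1n mul1r.
Qed.
End Carleman.

Lemma geometric_absurd (e c : R) : 0 < e -> ~ forall n, e <= 2^-1 ^+ n * c.
Proof.
move=> e0 H.
have c0 : 0 < c by have := H 0; rewrite expr0 mul1r; exact: lt_le_trans.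
have [n hn] : exists n : nat, c < n%:R * e.
  exists (Num.bound (c / e)); rewrite -ltr_pdivrMr//.
  by apply: archi_boundP; rewrite divr_ge0 ?ltW.
have := H n; rewrite exprVn mulrC ler_pdivlMr ?exprn_gt0// => h.
have h2 : (n%:R : R) <= 2 ^+ n by rewrite -natrX ler_nat ltnW// ltn_expl.
have := le_lt_trans h hn; rewrite mulrC ltr_pM2r// => h3.
by have := lt_le_trans h3 h2; rewrite ltxx.
Qed.

(** The pole is put at a point [q] near [x0] around which f vanishes. Near [x0] the squared weight
    is at least (t1/2)^{-n}, and where the cutoff varies it is at most t1^{-n}. Hence the energy of
    f near [x0] is at most 2^{-n} times a constant for every n. *)
Lemma unique_cont (V : set (R * R)) (y y1 y2 z z1 z2 z11 zm z22 al a1 a2 be b1 b2 g h : R * R -> R) (x0 : R * R) :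
  open V -> V x0 -> hasC1 V y y1 y2 -> hasC1 V z z1 z2 -> hasC1 V z1 z11 zm -> hasC1 V z2 zm z22 ->
  hasC1 V al a1 a2 -> hasC1 V be b1 b2 ->
  (forall x, V x -> {for x, continuous g}) -> (forall x, V x -> {for x, continuous h}) ->
  (forall x, V x -> 0 < J y1 y2 z1 z2 x) ->
  (forall x, V x -> Dz y1 y2 a1 a2 x = Dy z1 z2 b1 b2 x) ->
  (forall x, V x -> Dy z1 z2 a1 a2 x + Dz y1 y2 b1 b2 x = J y1 y2 z1 z2 x * (al x * g x + be x * h x)) ->
  (forall W, nbhs x0 W -> exists2 q, W q & \forall w \near q, al w = 0 /\ be w = 0) ->
  \forall w \near x0, al w = 0 /\ be w = 0.
Proof.
move=> oV Vx0 hy hz hz1 hz2 hal hbe cg ch Jpos H1 H2 H3.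
have [s1 [C0 [s10 C00 sV inj]]] := loc_inj oV Vx0 hy hz (Jpos x0 Vx0).
have bd (f : R * R -> R) : (forall x, V x -> {for x, continuous f}) -> exists2 C, 0 <= C & forall x, box x0 s1 x -> `|f x| <= C.
  move=> cf; apply: (compact_bounded_fun (@box_compact R x0 s1)).
  by apply: continuous_in_subspaceT => x; rewrite inE => /sV; exact: cf.
have [Cg Cg0 hg] := bd g cg; have [Ch Ch0 hh] := bd h ch.
pose C := Cg + Ch.
have CgC x : box x0 s1 x -> `|g x| <= C by move=> /hg; rewrite /C; lra.
have ChC x : box x0 s1 x -> `|h x| <= C by move=> /hh; rewrite /C; lra.
have C_ge0 : 0 <= C by rewrite addr_ge0.
(* Then 16 (r C)^2 <= 16/64, which is small enough for [absorb]. *)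
pose r := (8 * (C + 1))^-1.
have C1 : 0 < 8 * (C + 1) by rewrite mulr_gt0// ltr_wpDl.
have r0 : 0 < r by rewrite invr_gt0.
have small : 16 * r ^+ 2 * C ^+ 2 <= 2^-1.
  have rC : 0 <= r * C <= 8^-1.
    apply/andP; split; first by rewrite mulr_ge0// ltW.
    by rewrite /r [leLHS]mulrC ler_pdivrMr// mulrA mulVf// mul1r lerDl.
  have -> : 16 * r ^+ 2 * C ^+ 2 = 16 * (r * C) ^+ 2 by ring.
  have := ler_pM (andP rC).1 (andP rC).1 (andP rC).2 (andP rC).2.
  by rewrite -expr2; move: ((r * C) ^+ 2) => t; clear=> *; lra.
have r2 : 0 < r / 2 by rewrite divr_gt0.
have [s2 s20 hs2] := nbhs_box_in (cont_near_lt (hasC1_cont hy Vx0) r2).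
pose s := Num.min (s1 / 2) s2.
have s0 : 0 < s by rewrite lt_min s20 divr_gt0.
have ss1 : s <= s1 / 2 by rewrite ge_min lexx.
have ss1' : s <= s1 by apply: le_trans ss1 _; move: s10; clear; lra.
have ss2 : s <= s2 by rewrite ge_min lexx orbT.
pose V' := (box x0 s1)°.
have oV' : open V' by exact: open_interior.
have V's x : V' x -> box x0 s1 x by move=> /interior_subset.
have V'V : V' `<=` V by move=> x /V's/sV.
have KV' : box x0 s `<=` V'.
  move=> x [h1 h2]; have : nbhs x (box x (s1 / 2)) by apply: nbhs_box; rewrite divr_gt0.
  apply: filterS => w [k1 k2].
  have tri (a b c : R) : `|a - b| <= s1 / 2 -> `|b - c| <= s -> `|a - c| <= s1.
    by move=> i1 i2; have := ler_distD b a c; move: i1 i2 ss1; clear; lra.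
  by split; [exact: tri k1 h1|exact: tri k2 h2].
(* A point of the box outside the half box is at coordinate distance at least s/4 from [q]; by [inj]
   and [far_bound] its image is at squared distance at least [t1] from that of [q]. *)
pose t1 := s ^+ 2 / (64 * (2 * C0 ^+ 2 + 1)).
have D0 : 0 < 64 * (2 * C0 ^+ 2 + 1) by rewrite mulr_gt0// ltr_wpDl// mulr_ge0// sqr_ge0.
have t10 : 0 < t1 by rewrite divr_gt0// exprn_gt0.
pose N0 := NN y z (y x0) (z x0).
have cN (yq zq : R) x : V x -> {for x, continuous (NN y z yq zq)}.
  move=> Vx; have cy := hasC1_cont hy Vx; have cz := hasC1_cont hz Vx.
  exact: (continuousD (cont_sqr (continuousB cy (cvg_cst yq))) (cont_sqr (continuousB cz (cvg_cst zq)))).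
have nN (yq zq t : R) x : V x -> NN y z yq zq x < t -> \forall w \near x, NN y z yq zq w < t.
  move=> Vx Nt; have e0 : 0 < t - NN y z yq zq x by rewrite subr_gt0.
  apply: filterS (cont_near_lt (cN yq zq x Vx) e0) => w.
  by move=> /ltr_normlW; move: (NN y z yq zq w) (NN y z yq zq x); clear=> *; lra.
(* Both [q] and the points where f is shown to vanish are taken from this neighbourhood. By
   [two_close] their images are at squared distance less than t1 / 2. *)
have nW0 : nbhs x0 [set w | box x0 (s / 8) w /\ N0 w < t1 / 8].
  apply: filterI; first by apply: nbhs_box; rewrite divr_gt0.
  apply: nN => //; rewrite /N0 /NN !subrr expr0n addr0 divr_gt0//.
have [q [bq Nq] nq] := H3 _ nW0.
pose yq := y q; pose zq := z q.
have bqs : box x0 s q by apply: box_le bq; move: s0; clear; lra.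
have far x : box x0 s x -> ~ box x0 (s / 2) x -> t1 <= NN y z yq zq x.
  move=> bx nbx; have h1 := inj q x (box_le ss1' bqs) (box_le ss1' bx).
  have h2 : s / 4 <= `|x.1 - q.1| + `|x.2 - q.2|.
    rewrite leNgt; apply/negP => hlt; apply: nbx; have [k1 k2] := bq.
    have tri (a b c d : R) : 0 <= d -> `|a - b| + d < s / 4 -> `|b - c| <= s / 8 -> `|a - c| <= s / 2.
      by move=> d0 i1 i2; have := ler_distD b a c; move: i1 i2 s0 d0; clear; lra.
    split; first exact: tri (normr_ge0 _) hlt k1.
    by rewrite addrC in hlt; exact: tri (normr_ge0 _) hlt k2.
  have h3 := le_trans h2 h1.
  rewrite -/yq -/zq in h3.
  rewrite /t1 ler_pdivrMr// /NN.
  have s4 : 0 <= s / 4 by rewrite divr_ge0 ?ltW.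
  have := ler_pM s4 s4 h3 h3; rewrite -!expr2.
  exact: far_bound.
have Vq x : V' x -> NN y z yq zq x = 0 -> \forall w \near x, al w = 0 /\ be w = 0.
  move=> V'x Nx; suff -> : x = q by [].
  have h1 := inj q x (box_le ss1' bqs) (V's _ V'x).
  move: Nx; rewrite /NN => /eqP; rewrite paddr_eq0 ?sqr_ge0// !sqrf_eq0 => /andP[/eqP e1 /eqP e2].
  rewrite -/yq -/zq e1 e2 normr0 addr0 mulr0 in h1.
  have h2 : `|x.1 - q.1| + `|x.2 - q.2| == 0 by rewrite eq_le h1 addr_ge0.
  move: h2; rewrite paddr_eq0// !normr_eq0 !subr_eq0 => /andP[/eqP h3 /eqP h4].
  by rewrite [x]surjective_pairing [q]surjective_pairing h3 h4.
have yr x : box x0 s x -> `|y x - yq| <= r.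
  move=> bx; have h1 : `|y x - y x0| < r / 2 by apply: hs2; exact: box_le bx.
  have h2 : `|y q - y x0| < r / 2 by apply: hs2; exact: box_le bqs.
  have := ler_distD (y x0) (y x) yq; rewrite [`|y x0 - _|]distrC.
  by move: h1 h2; rewrite -/yq; move: `|y x - y x0| `|_ - _| `|_ - _|; clear=> *; lra.
have sub (f f1 f2 : R * R -> R) := @hasC1_sub R V V' f f1 f2 V'V.
have wt := @weighted V' y y1 y2 z z1 z2 z11 zm z22 al a1 a2 be b1 b2 g h oV' (sub _ _ _ hy) (sub _ _ _ hz) (sub _ _ _ hz1)
  (sub _ _ _ hz2) (sub _ _ _ hal) (sub _ _ _ hbe) (fun x h => Jpos x (V'V x h)) (fun x h => H1 x (V'V x h))
  (fun x h => H2 x (V'V x h)) x0 s r C t1 yq zq s0 KV' (fun x h => CgC x (box_le ss1' h)) (fun x h => ChC x (box_le ss1' h)) yr small t10 far Vq.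
apply: filterS nW0 => x1 [bx1 Nx1]; apply: contrapT => nz.
have bx1s : box x0 s x1 by apply: box_le bx1; move: s0; clear; lra.
have S1 : 0 < al x1 ^+ 2 + be x1 ^+ 2.
  rewrite lt_neqAle eq_sym addr_ge0 ?sqr_ge0// andbT paddr_eq0 ?sqr_ge0// !sqrf_eq0.
  by apply/negP => /andP[/eqP e1 /eqP e2]; apply: nz.
have Nqx1 : NN y z yq zq x1 < t1 / 2.
  exact: two_close Nx1 Nq.
have nU : nbhs x1 [set w | box x0 (s / 2) w /\ NN y z yq zq w < t1 / 2].
  apply: filterI; last by apply: nN => //; apply: V'V; exact: KV'.
  have : nbhs x1 (box x1 (s / 8)) by apply: nbhs_box; rewrite divr_gt0.
  apply: filterS => w [k1 k2]; have [h1 h2] := bx1.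
  have tri (a b c : R) : `|a - b| <= s / 8 -> `|b - c| <= s / 8 -> `|a - c| <= s / 2.
    by move=> i1 i2; have := ler_distD b a c; move: i1 i2 s0; clear; lra.
  by split; [exact: tri k1 h1|exact: tri k2 h2].
have [r' r'0 hr'] := nbhs_box_in nU.
have bV w : box x1 r' w -> V' w.
  by move=> /hr'[bw _]; apply: KV'; apply: box_le bw; move: s0; clear; lra.
(* A compactly supported minorant of the energy density, positive at [x1] if f does not vanish
   there. *)
pose f w := J y1 y2 z1 z2 w * (al w ^+ 2 + be w ^+ 2) * chi x1 r' w.
have cf : cc f.
  apply: (cc_of oV' (@box_closed R x1 r') bV (M := `|x1| + r')).
  - by move=> w bw; apply/cboxP; exact: box_norm bw.
  - move=> w V'w; have Vw := V'V _ V'w.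
    have ca : {for w, continuous al} := hasC1_cont hal Vw.
    have cb : {for w, continuous be} := hasC1_cont hbe Vw.
    have cx : {for w, continuous (chi x1 r')} := hasC1_cont (@hasC1_chi R x1 r') I.
    exact: (continuousM (continuousM (J_cont hy hz Vw) (continuousD (cont_sqr ca) (cont_sqr cb))) cx).
  - by move=> w nb; rewrite /f chi_0// mulr0.
have f0 w : 0 <= f w.
  have [bw|nb] := pselect (box x1 r' w); last by rewrite /f chi_0// mulr0.
  have /andP[c0 _] := @chi_01 R x1 r' w.
  apply: mulr_ge0 => //; apply: mulr_ge0; first exact: ltW (Jpos _ (V'V _ (bV _ bw))).
  by rewrite addr_ge0 ?sqr_ge0.
have fx1 : 0 < f x1.
  rewrite /f chi_1 ?mulr1//; last by apply: box_center; rewrite divr_ge0 ?ltW.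
  by apply: mulr_gt0 => //; exact: (Jpos _ (V'V _ (bV _ (box_center _ (ltW r'0))))).
have If := I2_gt0 cf f0 fx1.
set m := mm _ _ _ _ _ _ _ _ in wt.
apply: (geometric_absurd (c := 8 * r ^+ 2 * I2 m) If) => n.
have [p' [q' [cE Epos Eb El]]] := wt n.
have fE w : f w <= (t1 / 2) ^+ n * (J y1 y2 z1 z2 w * (p' w ^+ 2 + q' w ^+ 2)).
  have [bw|nb] := pselect (box x1 r' w); last first.
    by rewrite /f chi_0// mulr0 mulr_ge0// exprn_ge0// divr_ge0// ltW.
  have [bw2 Nw] := hr' _ bw; have /andP[c0 c1] := @chi_01 R x1 r' w.
  have Jw : 0 <= J y1 y2 z1 z2 w := ltW (Jpos _ (V'V _ (bV _ bw))).
  have h1 := El w (bV _ bw) bw2.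
  have h2 : NN y z yq zq w ^+ n * (p' w ^+ 2 + q' w ^+ 2) <= (t1 / 2) ^+ n * (p' w ^+ 2 + q' w ^+ 2).
    rewrite ler_wpM2r ?addr_ge0 ?sqr_ge0// lerXn2r ?nnegrE//; last exact: ltW.
      by rewrite /NN addr_ge0 ?sqr_ge0.
    by rewrite divr_ge0// ltW.
  rewrite mulrCA /f -[leRHS]mulr1; apply: ler_pM => //.
    by rewrite mulr_ge0// addr_ge0 ?sqr_ge0.
  by rewrite ler_wpM2l//; exact: le_trans h1 h2.
have := I2_le cf (ccZ _ cE) fE; rewrite (I2Z _ cE) => h1.
apply: le_trans h1 _; apply: le_trans (ler_wpM2l _ Eb) _; first by rewrite exprn_ge0// divr_ge0// ltW.
have gen (a' b' c' d' : R) : a' * (c' * (b' * d')) = (a' * b') * (c' * d') by ring.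
rewrite gen -exprMn le_eqVlt; apply/orP; left; apply/eqP.
by congr (_ ^+ n * _); rewrite mulrAC mulfV ?mul1r// gt_eqF.
Qed.
End Plane.

(** * Unique continuation on the translator *)

(** With du = al dy + be dz, the last hypothesis is L u = 0. Multiplied out, it is the translating
    graph equation (1 + be^2) al_y - al be (al_z + be_y) + (1 + al^2) be_z + be (1 + al^2 + be^2) =
    0. Solved for al_y + be_z, every remaining term contains a factor [al] or [be]. *)
Lemma graph_equation (R : realType) (y1 y2 z1 z2 al be a1 a2 b1 b2 : R)
  (u1 := al * y1 + be * z1) (u2 := al * y2 + be * z2)
  (e := u1 * u1 + y1 * y1 + z1 * z1) (f := u1 * u2 + y1 * y2 + z1 * z2) (g := u2 * u2 + y2 * y2 + z2 * z2)
  (j := y1 * z2 - y2 * z1) :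
  j != 0 -> e * g - f ^+ 2 != 0 -> y1 * a2 - y2 * a1 = b1 * z2 - b2 * z1 ->
  dualg e f g a1 a2 y1 y2 + dualg e f g b1 b2 z1 z2 + be = 0 ->
  (a1 * z2 - a2 * z1) + (y1 * b2 - y2 * b1) =
  j * (al * ((be * ((y1 * a2 - y2 * a1) + (b1 * z2 - b2 * z1)) - al * (y1 * b2 - y2 * b1)) * j^-1) +
       be * (- (be * (a1 * z2 - a2 * z1)) * j^-1 - (1 + al ^+ 2 + be ^+ 2))).
Proof.
move=> j0 D0 h; rewrite !dualgE -mulrDl => eq0.
have eq1 : g * (a1 * y1) - f * (a1 * y2 + a2 * y1) + e * (a2 * y2) + (g * (b1 * z1) - f * (b1 * z2 + b2 * z1) + e * (b2 * z2))
   + be * (e * g - f ^+ 2) = 0.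
  have gen (N D b : R) : D != 0 -> N / D + b = 0 -> N + b * D = 0.
    by move=> D1 e0; rewrite -[N](mulfVK D1) -mulrDl e0 mul0r.
  exact: gen D0 eq0.
have eq2 : j * ((1 + be ^+ 2) * (a1 * z2 - a2 * z1) - al * be * ((y1 * a2 - y2 * a1) + (b1 * z2 - b2 * z1)) +
   (1 + al ^+ 2) * (y1 * b2 - y2 * b1) + be * j * (1 + al ^+ 2 + be ^+ 2)) = 0.
  by rewrite -[RHS]eq1 /e /f /g /j /u1 /u2; ring.
move: eq2 => /eqP; rewrite mulf_eq0 (negPf j0) /= => /eqP eq3.
have : (a1 * z2 - a2 * z1) + (y1 * b2 - y2 * b1) = al * (be * ((y1 * a2 - y2 * a1) + (b1 * z2 - b2 * z1)) - al * (y1 * b2 - y2 * b1)) 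
  - be * (be * (a1 * z2 - a2 * z1)) - be * j * (1 + al ^+ 2 + be ^+ 2).
  apply/eqP; rewrite -subr_eq0; apply/eqP; rewrite -[RHS]eq3; ring.
move=> ->; field; exact: j0.
Qed.

Lemma hasC1_eq (R : realType) (U : set (R * R)) (f f1 f2 g : R * R -> R) : open U -> hasC1 U f f1 f2 ->
  (forall x, U x -> g x = f x) -> hasC1 U g f1 f2.
Proof. by move=> oU hf e; apply: (hasC1_ext oU hf) => x Ux; rewrite e. Qed.

Lemma cramer_zero1 (R : realType) (a b j : R) : (0 * a - 0 * b) * j = 0.
Proof. by rewrite !mul0r subrr mul0r. Qed.

Lemma cramer_zero2 (R : realType) (a b j : R) : (a * 0 - b * 0) * j = 0.
Proof. by rewrite !mulr0 subrr mul0r. Qed.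

Lemma combination_zero (R : realType) (s t a b y1 y2 z1 z2 u1 u2 : R) : a = 0 -> b = 0 ->
  u1 = a * y1 + b * z1 -> u2 = a * y2 + b * z2 -> s * u1 + t * u2 = 0.
Proof. by move=> -> -> -> ->; rewrite !mul0r !addr0 !mulr0 addr0. Qed.

Section Continuation.
Variables (R : realType) (S : surface R) (F : S -> 'rV[R]_3) (v d : 'rV[R]_3) (c0 : R).
Hypothesis imm : smooth_immersion F.
Hypothesis tr : forall n x, ccod (atlas S n) x ->
      mean_curvature (local_param F n) x = normal_part (local_param F n) x (e3 R).
Hypothesis e3v : dot (e3 R) v = 0.
Hypothesis e3d : dot (e3 R) d = 0.
Hypothesis e3e3 : dot (e3 R) (e3 R) = 1.
Hypothesis fr : forall p q : 'rV[R]_3, dot p q = dot p v * dot q v + dot p d * dot q d + dot p (e3 R) * dot q (e3 R).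
Local Notation U n := (ccod (atlas S n)).
Local Notation par n := (par (atlas S n)).
Local Notation X n := (local_param F n).
Local Notation W n := (area_density (X n)).
Local Notation e3 := (e3 R).
Local Notation lin := (lin F).
Local Notation dl1 := (dl1 F).
Local Notation dl2 := (dl2 F).
Local Notation Vl1 := (Vl1 F).
Local Notation Vl2 := (Vl2 F).
Local Notation cobr := (cobr F).

(** The interior is taken so that du vanishes on an open set; unique continuation is the statement
    that this set is also closed. *)
Definition Zset : set S := [set p | lin v p = c0]°.

Lemma Zset_d n x : U n x -> Zset (par n x) -> dl1 n v x = 0 /\ dl2 n v x = 0.
Proof.
move=> Ux Zx; pose O := [set w | U n w /\ Zset (par n w)]°.
have nO : nbhs x [set w | U n w /\ Zset (par n w)].
  apply: filterI; first by apply: open_nbhs_nbhs; split=> //; exact: oU.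
  by apply: (par_continuous Ux); apply: open_nbhs_nbhs; split=> //; exact: open_interior.
have OU : O `<=` U n by move=> w /interior_subset[].
have h1 := hasC1_sub OU (@hasC1_lin _ _ _ imm n v).
have h2 : hasC1 O (lin v \o par n) (fun=> 0) (fun=> 0).
  apply: (hasC1_ext (@open_interior _ _) (@hasC1_cst R _ c0)) => w /interior_subset[_ /interior_subset Zw].
  by rewrite /= Zw.
exact: hasC1_unique h1 h2 nO.
Qed.

Definition JJ n x := dl1 n d x * dl2 n e3 x - dl2 n d x * dl1 n e3 x.

Lemma DD_frame n x (u1 := dl1 n v x) (u2 := dl2 n v x) (y1 := dl1 n d x) (y2 := dl2 n d x) (z1 := dl1 n e3 x) (z2 := dl2 n e3 x) :
  [/\ EE (X n) x = u1 * u1 + y1 * y1 + z1 * z1, FF (X n) x = u1 * u2 + y1 * y2 + z1 * z2 &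
      GG (X n) x = u2 * u2 + y2 * y2 + z2 * z2].
Proof. by rewrite EEE FFE GGE; split; exact: fr. Qed.


(* du = aln dy + ben dz *)
Definition aln n x := (dl1 n v x * dl2 n e3 x - dl2 n v x * dl1 n e3 x) * (JJ n x)^-1.
Definition ben n x := (dl1 n d x * dl2 n v x - dl2 n d x * dl1 n v x) * (JJ n x)^-1.
Definition VJ n : set (R * R) := [set x | U n x /\ 0 < JJ n x].

Lemma dl_cont n c x : U n x -> {for x, continuous (dl1 n c)} /\ {for x, continuous (dl2 n c)}.
Proof. by move=> Ux; split; [exact: hasC1_cont (@hasC1_dl1 _ _ _ imm n c) Ux|exact: hasC1_cont (@hasC1_dl2 _ _ _ imm n c) Ux]. Qed.

Lemma hasC1_JJ n : exists j1 j2, hasC1 (U n) (JJ n) j1 j2.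
Proof.
do 2 eexists; exact: (hasC1_sub' (hasC1_mul (@hasC1_dl1 _ _ _ imm n d) (@hasC1_dl2 _ _ _ imm n e3))
  (hasC1_mul (@hasC1_dl2 _ _ _ imm n d) (@hasC1_dl1 _ _ _ imm n e3))).
Qed.

Lemma VJ_open n : open (VJ n).
Proof.
rewrite openE => x [Ux J0]; have [j1 [j2 hJ]] := hasC1_JJ n.
have nU : nbhs x (U n) by apply: open_nbhs_nbhs; split=> //; exact: oU.
apply: filterI => //.
apply: filterS (cont_near_lt (hasC1_cont hJ Ux) J0) => w.
by rewrite distrC => /ltr_normlW; move: (JJ n w) (JJ n x) => s t; lra.
Qed.

Lemma hasC1_alben n : exists a1 a2 b1 b2, hasC1 (VJ n) (aln n) a1 a2 /\ hasC1 (VJ n) (ben n) b1 b2.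
Proof.
have sV : VJ n `<=` U n by move=> x [].
have [j1 [j2 hJ]] := hasC1_JJ n.
have hI := hasC1_inv (hasC1_sub sV hJ) (fun x (h : VJ n x) => lt0r_neq0 h.2).
have hs c := hasC1_sub sV (@hasC1_dl1 _ _ _ imm n c); have ht c := hasC1_sub sV (@hasC1_dl2 _ _ _ imm n c).
do 4 eexists; split.
- exact: (hasC1_mul (hasC1_sub' (hasC1_mul (hs v) (ht e3)) (hasC1_mul (ht v) (hs e3))) hI).
- exact: (hasC1_mul (hasC1_sub' (hasC1_mul (hs d) (ht v)) (hasC1_mul (ht d) (hs v))) hI).
Qed.

Lemma dlv n x : VJ n x -> dl1 n v x = aln n x * dl1 n d x + ben n x * dl1 n e3 x /\
  dl2 n v x = aln n x * dl2 n d x + ben n x * dl2 n e3 x.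
Proof.
move=> [_ J0]; have {J0} := lt0r_neq0 J0; rewrite /aln /ben /JJ.
move: (dl1 n v x) (dl2 n v x) (dl1 n d x) (dl2 n d x) (dl1 n e3 x) (dl2 n e3 x) => u1 u2 y1 y2 z1 z2 j0.
by split; field.
Qed.

Section OnVJ.
Variables (n : nat) (a1 a2 b1 b2 : R * R -> R).
Hypothesis ha : hasC1 (VJ n) (aln n) a1 a2.
Hypothesis hb : hasC1 (VJ n) (ben n) b1 b2.
Local Notation y1 := (dl1 n d).
Local Notation y2 := (dl2 n d).
Local Notation z1 := (dl1 n e3).
Local Notation z2 := (dl2 n e3).

Let sV : VJ n `<=` U n. Proof. by move=> x []. Qed.

(** The equation d(du) = 0: the mixed second derivatives of u, y and z drop out by symmetry. *)
Lemma alben_symm x : VJ n x -> Dz y1 y2 a1 a2 x = Dy z1 z2 b1 b2 x.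
Proof.
move=> Vx; have Ux := sV Vx.
have hs c := hasC1_sub sV (@hasC1_dl1 _ _ _ imm n c); have ht c := hasC1_sub sV (@hasC1_dl2 _ _ _ imm n c).
have r1 := hasC1_add (hasC1_mul ha (hs d)) (hasC1_mul hb (hs e3)).
have r2 := hasC1_add (hasC1_mul ha (ht d)) (hasC1_mul hb (ht e3)).
have r1' := hasC1_eq (@VJ_open n) r1 (fun w Vw => (dlv Vw).1).
have r2' := hasC1_eq (@VJ_open n) r2 (fun w Vw => (dlv Vw).2).
have [_ e1] := hasC1_unique (hs v) r1' Vx; have [e2 _] := hasC1_unique (ht v) r2' Vx.
have c12 : d12 (X n) x = d21 (X n) x := d12C (@oU _ S n) (@smX _ _ _ imm n) Ux.
move: e1 e2; rewrite /= c12 => e1; rewrite e1 /Dz /Dy => e2.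
move: e2; move: (dot _ d) (dot _ e3) (aln n x) (ben n x) (a1 x) (a2 x) (b1 x) (b2 x) (y1 x) (y2 x) (z1 x) (z2 x).
move=> p q al be A1 A2 B1 B2 Y1 Y2 Z1 Z2 e2; apply/eqP; rewrite -subr_eq0; apply/eqP.
by move/eqP: e2; rewrite -subr_eq0 => /eqP <-; ring.
Qed.

Lemma cobr_comb x p1 p2 (s t : R) q1 q2 r1 r2 :
  cobr n x p1 p2 (s * q1 + t * r1) (s * q2 + t * r2) = s * cobr n x p1 p2 q1 q2 + t * cobr n x p1 p2 r1 r2.
Proof. by rewrite /cobr !dualgE; ring. Qed.

(** The divergence of grad u = al grad y + be grad z is computed directly and by the product rule;
    the values of the Laplacian on u, y and z from [div_linear] leave this equation. *)
Lemma alben_div x : VJ n x -> cobr n x (a1 x) (a2 x) (y1 x) (y2 x) + cobr n x (b1 x) (b2 x) (z1 x) (z2 x) + ben n x = 0.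
Proof.
move=> Vx; have Ux := sV Vx.
have V12 c : exists V12, hasC1 (VJ n) (Vl1 n c) (Vl11 F n c) V12.
  by have [k hk] := @hasC1_Vl1 _ _ _ imm n c; exists k; exact: hasC1_sub hk.
have V21 c : exists V21, hasC1 (VJ n) (Vl2 n c) V21 (Vl22 F n c).
  by have [k hk] := @hasC1_Vl2 _ _ _ imm n c; exists k; exact: hasC1_sub hk.
have [kd hd] := V12 d; have [ke he] := V12 e3; have [kv hv] := V12 v.
have [ld gd] := V21 d; have [le ge] := V21 e3; have [lv gv] := V21 v.
have r1 := hasC1_add (hasC1_mul ha hd) (hasC1_mul hb he).
have r2 := hasC1_add (hasC1_mul ha gd) (hasC1_mul hb ge).
have v1 w : VJ n w -> Vl1 n v w = aln n w * Vl1 n d w + ben n w * Vl1 n e3 w.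
  by move=> Vw; have [k1 k2] := dlv Vw; rewrite /Vl1 k1 k2; ring.
have v2 w : VJ n w -> Vl2 n v w = aln n w * Vl2 n d w + ben n w * Vl2 n e3 w.
  by move=> Vw; have [k1 k2] := dlv Vw; rewrite /Vl2 k1 k2; ring.
have r1' := hasC1_eq (@VJ_open n) r1 v1.
have r2' := hasC1_eq (@VJ_open n) r2 v2.
have [e1 _] := hasC1_unique hv r1' Vx; have [_ e2] := hasC1_unique gv r2' Vx.
have T c := div_linear imm c Ux (tr Ux).
have Tv := T v; have Td := T d; have Te := T e3.
rewrite /= in e1 e2; rewrite e1 e2 e3v in Tv; rewrite e3d in Td; rewrite e3e3 in Te.
have [k1 k2] := dlv Vx; rewrite k1 k2 cobr_comb in Tv.
have Wa := @Vl_cobr _ _ _ imm n d x (a1 x) (a2 x) Ux; have Wb := @Vl_cobr _ _ _ imm n e3 x (b1 x) (b2 x) Ux.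
have W0 : W n x != 0 by rewrite gt_eqF// (W_gt0 imm).
move: Tv Td Te Wa Wb W0.
move: (cobr n x (a1 x) _ _ _) (cobr n x (b1 x) _ _ _) (cobr n x (z1 x) _ (y1 x) _) (cobr n x (z1 x) _ (z1 x) _) (W n x).
move: (Vl11 F n d x) (Vl22 F n d x) (Vl11 F n e3 x) (Vl22 F n e3 x) (Vl1 n d x) (Vl2 n d x) (Vl1 n e3 x) (Vl2 n e3 x) (a1 x) (a2 x) (b1 x) (b2 x) (aln n x) (ben n x).
clear=> D1 D2 E1 E2 P1 P2 Q1 Q2 A1 A2 B1 B2 al be ca cb c1 c2 w Tv Td Te Wa Wb W0.
apply: (mulfI W0); rewrite mulr0.
transitivity ((A1 * P1 + A2 * P2) + (B1 * Q1 + B2 * Q2) + w * be); first by rewrite Wa Wb; ring.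
transitivity ((A1 * P1 + al * D1 + (B1 * Q1 + be * E1) + (A2 * P2 + al * D2 + (B2 * Q2 + be * E2))) - al * (D1 + D2) - be * (E1 + E2) + w * be); first by ring.
by rewrite Tv Td Te; ring.
Qed.

Lemma alben_cauchy x : VJ n x -> Dy z1 z2 a1 a2 x + Dz y1 y2 b1 b2 x = JJ n x *
  (aln n x * ((ben n x * (Dz y1 y2 a1 a2 x + Dy z1 z2 b1 b2 x) - aln n x * Dz y1 y2 b1 b2 x) * (JJ n x)^-1) +
   ben n x * (- (ben n x * Dy z1 z2 a1 a2 x) * (JJ n x)^-1 - (1 + aln n x ^+ 2 + ben n x ^+ 2))).
Proof.
move=> Vx; have Ux := sV Vx.
have eq := alben_div Vx; have [k1 k2] := dlv Vx.
have [eE eF eG] := @DD_frame n x; rewrite k1 k2 in eE eF eG.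
have D0 := DD_gt0 (immX imm n) Ux; rewrite DDE' in D0.
have j0 : dl1 n d x * dl2 n e3 x - dl2 n d x * dl1 n e3 x != 0 := lt0r_neq0 Vx.2.
rewrite /cobr eE eF eG in eq; rewrite eE eF eG in D0.
exact: graph_equation j0 (lt0r_neq0 D0) (alben_symm Vx) eq.
Qed.
End OnVJ.

(** Unique continuation makes du vanish near the point, so u is constant on a box; the box meets
    [Zset], so the constant is [c0]. *)
Lemma closure_Zset_pos n x0 : VJ n x0 -> closure Zset (par n x0) -> Zset (par n x0).
Proof.
move=> Vx0 clx; have Ux0 := Vx0.1.
have sV : VJ n `<=` U n by move=> x [].
have oV := @VJ_open n.
have nU : nbhs x0 (VJ n) by exact: open_nbhs_nbhs.
have [a1 [a2 [b1 [b2 [ha hb]]]]] := hasC1_alben n.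
have hs c := hasC1_sub sV (@hasC1_dl1 _ _ _ imm n c); have ht c := hasC1_sub sV (@hasC1_dl2 _ _ _ imm n c).
have hl c := hasC1_sub sV (@hasC1_lin _ _ _ imm n c).
have ht' : hasC1 (VJ n) (dl2 n e3) (fun x => dot (d21 (X n) x) e3) (fun x => dot (d22 (X n) x) e3).
  by apply: (hasC1_ext oV (ht e3)) => w Vw; rewrite (d12C (@oU _ S n) (@smX _ _ _ imm n) (sV _ Vw)).
have cJ x (Vx : VJ n x) : {for x, continuous (fun w => (JJ n w)^-1)}.
  by apply: (Ji_cont (hl d) (hl e3)) => // w [].
have c1 x (Vx : VJ n x) : {for x, continuous a1} := let: And3 _ c _ := ha x Vx in c.
have c2 x (Vx : VJ n x) : {for x, continuous a2} := let: And3 _ _ c := ha x Vx in c.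
have c3 x (Vx : VJ n x) : {for x, continuous b1} := let: And3 _ c _ := hb x Vx in c.
have c4 x (Vx : VJ n x) : {for x, continuous b2} := let: And3 _ _ c := hb x Vx in c.
have ca x (Vx : VJ n x) : {for x, continuous (aln n)} := hasC1_cont ha Vx.
have cb x (Vx : VJ n x) : {for x, continuous (ben n)} := hasC1_cont hb Vx.
have cDy f1 f2 x (Vx : VJ n x) : {for x, continuous f1} -> {for x, continuous f2} ->
  {for x, continuous (Dy (dl1 n e3) (dl2 n e3) f1 f2)} := Dy_cont (hl e3) Vx.
have cDz f1 f2 x (Vx : VJ n x) : {for x, continuous f1} -> {for x, continuous f2} ->
  {for x, continuous (Dz (dl1 n d) (dl2 n d) f1 f2)} := Dz_cont (hl d) Vx.
pose g w := (ben n w * (Dz (dl1 n d) (dl2 n d) a1 a2 w + Dy (dl1 n e3) (dl2 n e3) b1 b2 w) - aln n w * Dz (dl1 n d) (dl2 n d) b1 b2 w) * (JJ n w)^-1.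
pose h w := - (ben n w * Dy (dl1 n e3) (dl2 n e3) a1 a2 w) * (JJ n w)^-1 - (1 + aln n w ^+ 2 + ben n w ^+ 2).
have cg x : VJ n x -> {for x, continuous g}.
  move=> Vx; have e1 := cDz _ _ _ Vx (c1 _ Vx) (c2 _ Vx); have e2 := cDy _ _ _ Vx (c3 _ Vx) (c4 _ Vx).
  have e3' := cDz _ _ _ Vx (c3 _ Vx) (c4 _ Vx).
  exact: (continuousM (continuousB (continuousM (cb _ Vx) (continuousD e1 e2)) (continuousM (ca _ Vx) e3')) (cJ _ Vx)).
have ch x : VJ n x -> {for x, continuous h}.
  move=> Vx; have e1 := cDy _ _ _ Vx (c1 _ Vx) (c2 _ Vx).
  exact: (continuousB (continuousM (continuousN (continuousM (cb _ Vx) e1)) (cJ _ Vx))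
    (continuousD (continuousD (cvg_cst (1 : R)) (cont_sqr (ca _ Vx))) (cont_sqr (cb _ Vx)))).
have H3 O : nbhs x0 O -> exists2 q, O q & \forall w \near q, aln n w = 0 /\ ben n w = 0.
  move=> nO; have nOV : nbhs x0 (O `&` VJ n) by exact: filterI.
  have [p [Zp [w [[Ow Vw] _] ew]]] := clx _ (par_nbhs Ux0 nOV).
  exists w => //; rewrite -ew in Zp.
  have nZ : \forall q \near w, VJ n q /\ Zset (par n q).
    apply: filterI; first exact: open_nbhs_nbhs.
    apply: (par_continuous Vw.1); apply: open_nbhs_nbhs; split=> //; exact: open_interior.
  apply: filterS nZ => q [Vq Zq]; have [k1 k2] := Zset_d Vq.1 Zq.
  by rewrite /aln /ben k1 k2; split; [exact: cramer_zero1|exact: cramer_zero2].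
have ab := unique_cont oV Vx0 (hl d) (hl e3) (hs e3) ht' ha hb cg ch (fun x Vx => Vx.2)
   (fun x Vx => alben_symm ha hb Vx) (fun x Vx => alben_cauchy ha hb Vx) H3.
have [r r0 hr] := nbhs_box_in (filterI nU ab).
have nB : nbhs (par n x0) (par n @` (box x0 r `&` U n)) := par_nbhs Ux0 (nbhs_box x0 r0).
have [p [Zp [w1 [bw1 Uw1] e1]]] := clx _ nB.
apply: filterS nB => _ [w2 [bw2 Uw2] <-].
have dg (t : R) : 0 <= t <= 1 -> is_derive t (1 : R) (fun s => (lin v \o par n) (segm w1 w2 s)) 0.
  move=> t01; have bs : box x0 r (segm w1 w2 t) by exact: box_segm.
  have [Vs [as0 bs0]] := hr _ bs; have := segm_derive (hl v) Vs.
  have [k1 k2] := dlv Vs; have -> // := combination_zero (diffp w1 w2).1 (diffp w1 w2).2 as0 bs0 k1 k2.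
have [t _] := MVT_cc ltr01 dg.
rewrite mul0r segm_0 segm_1 /= e1 => /eqP; rewrite subr_eq0 => /eqP ->.
exact: (interior_subset Zp).
Qed.
End Continuation.

Lemma JJ_alg (R : realType) (y1 y2 z1 z2 y1' y2' : R) : y1' = - y1 -> y2' = - y2 -> y1' * z2 - y2' * z1 = - (y1 * z2 - y2 * z1).
Proof. by move=> -> ->; ring. Qed.

(** Where du = 0, the Gram determinant is the square of the Jacobian of (y, z). *)
Lemma JJ_neq0 (R : realType) (S : surface R) (F : S -> 'rV[R]_3) (v d : 'rV[R]_3) n x : smooth_immersion F ->
  (forall p q : 'rV[R]_3, dot p q = dot p v * dot q v + dot p d * dot q d + dot p (e3 R) * dot q (e3 R)) ->
  ccod (atlas S n) x -> dl1 F n v x = 0 -> dl2 F n v x = 0 -> JJ F d n x != 0.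
Proof.
move=> imm fr Ux k1 k2.
have D0 := DD_gt0 (immX imm n) Ux; apply: contraTneq D0 => J0.
have [eE eF eG] := DD_frame F fr n x.
rewrite DDE' eE eF eG k1 k2 -leNgt; move: J0; rewrite /JJ.
move: (dl1 F n d x) (dl2 F n d x) (dl1 F n (e3 R) x) (dl2 F n (e3 R) x) => y1 y2 z1 z2 J0.
have -> : (0 * 0 + y1 * y1 + z1 * z1) * (0 * 0 + y2 * y2 + z2 * z2) - (0 * 0 + y1 * y2 + z1 * z2) ^+ 2 = (y1 * z2 - y2 * z1) ^+ 2 by ring.
by rewrite J0 expr0n.
Qed.

(** At a limit point of [Zset] du = 0 by continuity, so (y, z) has nonzero Jacobian there; if it is
    negative, [d] is replaced by [- d]. *)
Lemma unique_continuation (R : realType) (S : surface R) (F : S -> 'rV[R]_3) (v d : 'rV[R]_3) (c0 : R) :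
  smooth_immersion F ->
  (forall n x, ccod (atlas S n) x ->
      mean_curvature (local_param F n) x = normal_part (local_param F n) x (e3 R)) ->
  dot (e3 R) v = 0 -> dot (e3 R) d = 0 -> dot (e3 R) (e3 R) = 1 ->
  (forall p q : 'rV[R]_3, dot p q = dot p v * dot q v + dot p d * dot q d + dot p (e3 R) * dot q (e3 R)) ->
  (exists p, Zset F v c0 p) -> forall p, lin F v p = c0.
Proof.
move=> imm tr e3v e3d e3e3 fr Zne p.
suff ZT : Zset F v c0 = [set: S] by have := @interior_subset _ [set p | lin F v p = c0] p; apply; rewrite -/(Zset F v c0) ZT.
apply: connected_clopen => //; first exact: surface_connected.
- exact: open_interior.
rewrite closure_id; apply/seteqP; split; first exact: subset_closure.
move=> q clq; have [n dq] := atlas_cover q.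
have Ux := crd_ccod dq; rewrite -(crdK dq) in clq *.
move: (crd _ q) Ux clq => x Ux clq.
have [k1 k2] : dl1 F n v x = 0 /\ dl2 F n v x = 0.
  have zero (f : R * R -> R) : {for x, continuous f} -> (forall w, ccod (atlas S n) w -> Zset F v c0 (par (atlas S n) w) -> f w = 0) -> f x = 0.
    move=> cf f0; apply/eqP; apply: contrapT => /negP nz.
    have e0 : 0 < `|f x| by rewrite normr_gt0.
    have [p' [Zp [w [fw Uw] ew]]] := clq _ (par_nbhs Ux (cont_near_lt cf e0)).
    by move: fw; rewrite f0 ?ew// sub0r normrN ltxx.
  have [c1 c2] := dl_cont imm v Ux.
  by split; apply: zero => // w Uw Zw; have [] := Zset_d imm Uw Zw.
have J0 := JJ_neq0 imm fr Ux k1 k2.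
case: (ltgtP 0 (JJ F d n x)) J0 => // J0 _.
  exact: (closure_Zset_pos imm tr e3v e3d e3e3 fr (conj Ux J0) clq).
have fr' a b : dot a b = dot a v * dot b v + dot a (- d) * dot b (- d) + dot a (e3 R) * dot b (e3 R).
  by rewrite -!(dotC (- d)) !dotNl !(dotC d) mulrNN.
have e3d' : dot (e3 R) (- d) = 0 by rewrite dotC dotNl dotC e3d oppr0.
have J0' : 0 < JJ F (- d) n x.
  have gen c : JJ F (- c) n x = - JJ F c n x by apply: JJ_alg; rewrite /dl1 /dl2 dotC dotNl dotC.
  by rewrite gen oppr_gt0.
exact: (closure_Zset_pos imm tr e3v e3d' e3e3 fr' (conj Ux J0') clq).
Qed.

(** * Sections of the local isometry *)

Section PlaneMaps.
Variable R : realType.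

(** Interval induction in the form of Cousin's lemma: the supremum of the [t] with [P 0 t] is
    attained and cannot be less than 1. It transports local properties along segments. *)
Lemma cousin (P : R -> R -> Prop) :
  (forall a b c, 0 <= a -> a <= b -> b <= c -> c <= 1 -> P a b -> P b c -> P a c) ->
  (forall t, 0 <= t <= 1 -> exists2 e, 0 < e & forall a b, 0 <= a -> a <= t -> t <= b -> b <= 1 ->
     t - e < a -> b < t + e -> P a b) -> P 0 1.
Proof.
move=> tr loc.
pose A := [set t | 0 <= t <= 1 /\ P 0 t].
have P00 : P 0 0.
  have [|e e0 he] := loc 0; first by rewrite lexx ler01.
  by apply: he; rewrite ?lexx ?ler01//; lra.
have supA : has_sup A.
  by split; [exists 0; split=> //; rewrite lexx ler01|exists 1 => t [/andP[]]].
have m01 : 0 <= sup A <= 1.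
  apply/andP; split; first by apply: (ub_le_sup supA.2); split=> //; rewrite lexx ler01.
  by apply: (ge_sup supA.1) => t [/andP[]].
have [e e0 he] := loc _ m01; have /andP[m0 m1] := m01.
have [t [/andP[t0 t1] P0t] tm] := sup_adherent e0 supA.
have tle : t <= sup A by apply: (ub_le_sup supA.2); split=> //; rewrite t0.
have ext b : sup A <= b -> b <= 1 -> b < sup A + e -> P 0 b.
  move=> h1 h2 h3; apply: (tr 0 t b) => //; first exact: le_trans h1.
  exact: he.
have [mlt|mge] := ltP (sup A) 1; last by apply: ext; rewrite ?(le_trans m1)//; lra.
exfalso; pose b := Num.min 1 (sup A + e / 2).
have b1 : b <= 1 by rewrite ge_min lexx.
have mb : sup A < b by rewrite lt_min mlt ltrDl divr_gt0.
have be : b < sup A + e by apply: (@le_lt_trans _ _ (sup A + e / 2)); [rewrite ge_min lexx orbT|lra].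
have : b <= sup A by apply: (ub_le_sup supA.2); split; [rewrite (le_trans m0 (ltW mb)) b1|apply: ext => //; exact: ltW].
by rewrite leNgt mb.
Qed.

Lemma loc_inj_neq (V : set (R * R)) (y y1 y2 z z1 z2 : R * R -> R) (x0 : R * R) : open V -> V x0 ->
  hasC1 V y y1 y2 -> hasC1 V z z1 z2 -> J y1 y2 z1 z2 x0 != 0 ->
  exists s C : R, [/\ 0 < s, 0 <= C, box x0 s `<=` V & forall x x', box x0 s x -> box x0 s x' ->
    `|x'.1 - x.1| + `|x'.2 - x.2| <= C * (`|y x' - y x| + `|z x' - z x|)].
Proof.
move=> oV Vx0 hy hz; case: ltgtP => // J0 _; last exact: loc_inj J0.
have J0' : 0 < J (fun x => - y1 x) (fun x => - y2 x) z1 z2 x0 by move: J0; rewrite /J !mulNr; lra.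
have [s [C [s0 C0 sV h]]] := loc_inj oV Vx0 (hasC1_opp hy) hz J0'.
by exists s, C; split=> // x x' bx bx'; have := h x x' bx bx'; rewrite -opprD normrN.
Qed.

Lemma critical (y1 y2 z1 z2 Y Z : R) : y1 * z2 - y2 * z1 != 0 ->
  y1 * Y + Y * y1 + (z1 * Z + Z * z1) = 0 -> y2 * Y + Y * y2 + (z2 * Z + Z * z2) = 0 -> Y = 0 /\ Z = 0.
Proof.
move=> j0 e1 e2; have hY : (y1 * z2 - y2 * z1) * (2 * Y) = 0.
  transitivity (z2 * (y1 * Y + Y * y1 + (z1 * Z + Z * z1)) - z1 * (y2 * Y + Y * y2 + (z2 * Z + Z * z2))); first by ring.
  by rewrite e1 e2 !mulr0 subrr.
have hZ : (y1 * z2 - y2 * z1) * (2 * Z) = 0.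
  transitivity (y1 * (y2 * Y + Y * y2 + (z2 * Z + Z * z2)) - y2 * (y1 * Y + Y * y1 + (z1 * Z + Z * z1))); first by ring.
  by rewrite e1 e2 !mulr0 subrr.
have gen (t : R) : (y1 * z2 - y2 * z1) * (2 * t) = 0 -> t = 0.
  by move=> /eqP; rewrite mulf_eq0 (negPf j0) mulf_eq0 pnatr_eq0 /= => /eqP.
by split; exact: gen.
Qed.

Lemma slice_min (f df : R -> R) (c e : R) : 0 < e -> is_derive c (1 : R) f (df c) ->
  (forall t, `|t - c| <= e -> is_derive t (1 : R) f (df t)) -> (forall t, `|t - c| <= e -> f c <= f t) -> df c = 0.
Proof.
move=> e0 dc dt fm.
have nc : `|c - c| <= e by rewrite subrr normr0 ltW.
have cin : c \in `](c - e), (c + e)[ by rewrite in_itv /=; apply/andP; split; lra.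
have ab : c - e <= c + e by lra.
have inn t : t \in `](c - e), (c + e)[ -> `|t - c| <= e.
  by rewrite in_itv /= => /andP[h1 h2]; rewrite ler_distl; apply/andP; split; lra.
have dd t : t \in `](c - e), (c + e)[ -> derivable f t 1 by move=> /inn/dt[].
have [_ h1] := derive1_at_min ab dd cin (fun t ht => fm t (inn t ht)).
by have [_ <-] := dc.
Qed.

(** The squared distance of (y, z) to the target attains its minimum on the compact box. It is small
    at [x0] and large outside the half box, so the minimum is interior, and at a critical point with
    nonzero Jacobian the distance is 0. *)
Lemma loc_surj (V : set (R * R)) (y y1 y2 z z1 z2 : R * R -> R) (x0 : R * R) (s C : R) :
  hasC1 V y y1 y2 -> hasC1 V z z1 z2 -> 0 < s -> box x0 s `<=` V ->
  (forall x, box x0 s x -> J y1 y2 z1 z2 x != 0) ->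
  (forall x x', box x0 s x -> box x0 s x' -> `|x'.1 - x.1| + `|x'.2 - x.2| <= C * (`|y x' - y x| + `|z x' - z x|)) ->
  exists2 r : R, 0 < r & forall a b, `|a - y x0| < r -> `|b - z x0| < r -> exists w, [/\ box x0 s w, y w = a & z w = b].
Proof.
move=> hy hz s0 sV J0 inj.
have D0 : 0 < 64 * (2 * C ^+ 2 + 1) by rewrite mulr_gt0// ltr_wpDl// mulr_ge0// sqr_ge0.
pose t1 := s ^+ 2 / (64 * (2 * C ^+ 2 + 1)).
have t10 : 0 < t1 by rewrite divr_gt0// exprn_gt0.
(* Each coordinate of the target contributes less than t1 / 32, so the value at [x0] is below the t1
   / 8 required by [two_close]. *)
exists (Num.sqrt (t1 / 32)) => [|a b]; first by rewrite sqrtr_gt0 divr_gt0.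
have sq (u : R) : `|u| < Num.sqrt (t1 / 32) -> u ^+ 2 < t1 / 32.
  have e32 : Num.sqrt (t1 / 32) ^+ 2 = t1 / 32 by rewrite sqr_sqrtr// divr_ge0// ltW.
  by move=> hu; rewrite -e32 -[u ^+ 2]real_normK ?num_real// ltr_pXn2r ?nnegrE ?sqrtr_ge0.
move=> /sq ha /sq hb.
have bx0 : box x0 s x0 by apply: box_center; exact: ltW.
have s2 : 0 < s / 2 by rewrite divr_gt0.
have cf x : V x -> {for x, continuous (NN y z a b)}.
  move=> Vx; have cy := hasC1_cont hy Vx; have cz := hasC1_cont hz Vx.
  exact: (continuousD (cont_sqr (continuousB cy (cvg_cst a))) (cont_sqr (continuousB cz (cvg_cst b)))).
have [w bw wmin] : exists2 w, w \in box x0 s & forall t, t \in box x0 s -> NN y z a b w <= NN y z a b t.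
  apply: compact_EVT_min; [by exists x0|exact: box_compact|].
  by apply: continuous_in_subspaceT => x; rewrite inE => /sV; exact: cf.
rewrite inE in bw.
have N0 : NN y z a b x0 < t1 / 8.
  rewrite /NN -(sqrrN (y x0 - a)) -(sqrrN (z x0 - b)) !opprB; move: ha hb t10; clear; lra.
have Nw : NN y z a b w < t1 / 8 by apply: le_lt_trans (wmin x0 _) N0; rewrite inE.
have bw2 : box x0 (s / 2) w.
  apply: contrapT => nb; have := two_close Nw N0; apply/negP; rewrite -leNgt.
  apply: (@le_trans _ _ t1); first by move: t10; clear; lra.
  have h1 := inj x0 w bx0 bw.
  have h2 : s / 4 <= `|w.1 - x0.1| + `|w.2 - x0.2|.
    rewrite leNgt; apply/negP => hlt; apply: nb.
    have n1 := normr_ge0 (w.1 - x0.1); have n2 := normr_ge0 (w.2 - x0.2).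
    have g (p q : R) : 0 <= p -> 0 <= q -> p + q < s / 4 -> p <= s / 2 by move: s0; clear; lra.
    by split; [exact: g n1 n2 hlt|rewrite addrC in hlt; exact: g n2 n1 hlt].
  have h3 := le_trans h2 h1; have s4 : 0 <= s / 4 by rewrite divr_ge0 ?ltW.
  rewrite /t1 ler_pdivrMr//; apply: far_bound; rewrite !expr2; exact: ler_pM.
have [N1 [N2 [hN e1 e2]]] : exists N1 N2, [/\ hasC1 V (NN y z a b) N1 N2,
    N1 w = y1 w * (y w - a) + (y w - a) * y1 w + (z1 w * (z w - b) + (z w - b) * z1 w) &
    N2 w = y2 w * (y w - a) + (y w - a) * y2 w + (z2 w * (z w - b) + (z w - b) * z2 w)].
  do 2 eexists; split.
  - exact: (hasC1_add (hasC1_mul (hasC1_sub' hy (@hasC1_cst R V a)) (hasC1_sub' hy (@hasC1_cst R V a)))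
      (hasC1_mul (hasC1_sub' hz (@hasC1_cst R V b)) (hasC1_sub' hz (@hasC1_cst R V b)))).
  - by rewrite /= !subr0.
  - by rewrite /= !subr0.
have Nmin t : box x0 s t -> NN y z a b w <= NN y z a b t by move=> bt; apply: wmin; rewrite inE.
have tri (p q c : R) : `|p - q| <= s / 2 -> `|q - c| <= s / 2 -> `|p - c| <= s.
  by move=> h1 h2; have := ler_distD q p c; move: h1 h2; clear; lra.
have [k1 k2] := bw2; have le2 : s / 2 <= s by move: s0; clear; lra.
have ew : (w.1, w.2) = w by case: (w).
have c1 (t : R) : `|t - w.1| <= s / 2 -> box x0 s (t, w.2) by move=> ht; split; [exact: tri ht k1|exact: le_trans k2 le2].
have c2 (t : R) : `|t - w.2| <= s / 2 -> box x0 s (w.1, t) by move=> ht; split; [exact: le_trans k1 le2|exact: tri ht k2].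
have z1w : N1 (w.1, w.2) = 0.
  have d1 t : `|t - w.1| <= s / 2 -> is_derive t (1 : R) (fun u => NN y z a b (u, w.2)) (N1 (t, w.2)).
    by move=> ht; apply: (hasC1_slice1 hN); apply: sV; exact: c1.
  apply: (slice_min s2 (d1 _ _) d1); first by rewrite subrr normr0 ltW.
  by move=> t ht; rewrite ew; apply: Nmin; exact: c1.
have z2w : N2 (w.1, w.2) = 0.
  have d2 t : `|t - w.2| <= s / 2 -> is_derive t (1 : R) (fun u => NN y z a b (w.1, u)) (N2 (w.1, t)).
    by move=> ht; apply: (hasC1_slice2 hN); apply: sV; exact: c2.
  apply: (slice_min (df := fun t => N2 (w.1, t)) s2 (d2 _ _) d2); first by rewrite subrr normr0 ltW.
  by move=> t ht; rewrite ew; apply: Nmin; exact: c2.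
rewrite ew e1 in z1w; rewrite ew e2 in z2w.
have [Y0 Z0] := critical (J0 _ bw) z1w z2w.
by exists w; split=> //; apply/eqP; rewrite -subr_eq0; apply/eqP.
Qed.
End PlaneMaps.

Lemma le_abs_sum (R : realType) (s a b : R) : 0 <= s -> s ^+ 2 = a * a + b * b -> s <= `|a| + `|b|.
Proof.
move=> s0 e; have h : s ^+ 2 <= (`|a| + `|b|) ^+ 2.
  rewrite e -!expr2 -(real_normK (num_real a)) -(real_normK (num_real b)) -subr_ge0.
  have -> : (`|a| + `|b|) ^+ 2 - (`|a| ^+ 2 + `|b| ^+ 2) = 2 * (`|a| * `|b|) by ring.
  by rewrite !mulr_ge0.
by move: h; rewrite ler_pXn2r// nnegrE// addr_ge0.
Qed.

Lemma near_norm (R : realType) (y : R * R) (e : R) : 0 < e -> \forall w \near y, `|w - y| < e.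
Proof.
move=> e0; have e2 : 0 < e / 2 by rewrite divr_gt0.
apply: filterS (nbhs_box y e2) => w [h1 h2].
have lt2 : e / 2 < e by lra.
by rewrite prod_normE /= gt_max (le_lt_trans h1)// (le_lt_trans h2).
Qed.

Lemma norm_coord (R : realType) (a b : R * R) : `|a.1 - b.1| <= `|a - b| /\ `|a.2 - b.2| <= `|a - b|.
Proof. by rewrite prod_normE /= !le_max !lexx orbT. Qed.

Lemma dot_comb2 (R : realType) (s t : R) (a b c : 'rV[R]_3) : dot (s *: a + t *: b) c = s * dot a c + t * dot b c.
Proof. by rewrite dotDl !dotZl. Qed.

Lemma comb_close (R : realType) (m a b p q p' q' p0 q0 e : R) : m = a * p' + b * q' ->
  `|p - p0| < e -> `|q - q0| < e -> `|p' - p0| < e -> `|q' - q0| < e ->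
  `|a * p + b * q| <= `|m| + 2 * e * (`|a| + `|b|).
Proof.
move=> -> h1 h2 h3 h4.
have -> : a * p + b * q = (a * p' + b * q') + (a * (p - p') + b * (q - q')) by ring.
apply: le_trans (ler_normD _ _) _; rewrite lerD2l; apply: le_trans (ler_normD _ _) _; rewrite !normrM.
have bd (c u u' u0 : R) : `|u - u0| < e -> `|u' - u0| < e -> `|c| * `|u - u'| <= 2 * e * `|c|.
  move=> k1 k2; rewrite [leRHS]mulrC ler_wpM2l//.
  by have := ler_distD u0 u u'; rewrite [`|u0 - u'|]distrC; move: k1 k2; clear; lra.
by rewrite mulrDr; apply: lerD; [exact: bd h1 h3|exact: bd h2 h4].
Qed.

Lemma speed_le (R : realType) (A B y z e C n : R) : 0 <= e -> 0 <= y -> 0 <= z ->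
  A <= y + 2 * e * n -> B <= z + 2 * e * n -> n <= C * (y + z) -> e * C <= 8^-1 -> A + B <= 2 * (y + z).
Proof.
move=> e0 y0 z0 h1 h2 h3 h4.
have h5 : e * n <= 8^-1 * (y + z).
  by apply: le_trans (ler_wpM2l e0 h3) _; rewrite mulrA ler_wpM2r// addr_ge0.
move: h1 h2 h5; rewrite -!mulrA; move: (e * n) => t; lra.
Qed.

Lemma zero_diff (R : realType) (w w' : R * R) : `|w'.1 - w.1| + `|w'.2 - w.2| <= 0 -> w = w'.
Proof.
move=> h; have : `|w'.1 - w.1| + `|w'.2 - w.2| == 0 by rewrite eq_le h addr_ge0.
rewrite paddr_eq0// !normr_eq0 !subr_eq0 => /andP[/eqP h1 /eqP h2].
by rewrite [w]surjective_pairing [w']surjective_pairing h1 h2.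
Qed.

Lemma double_le (R : realType) (C t : R) : 0 <= t -> C * (t + t) <= t * (2 * C + 1).
Proof. by move=> t0; have -> : t * (2 * C + 1) = C * (t + t) + t; [ring|rewrite lerDl]. Qed.

Lemma cont_affine' (R : realType) (a k : R) : continuous (fun t : R => a + t * k).
Proof.
move=> t; apply: (@continuousD _ _ _ (fun=> a) (fun t : R => t * k)); first exact: cvg_cst.
exact: mulrr_continuous.
Qed.

Lemma near_r (R : realType) (t b e : R) : t <= b -> b < t + e -> `|b - t| < e.
Proof. by move=> h1 h2; rewrite ger0_norm ?subr_ge0//; lra. Qed.

Lemma near_l (R : realType) (t a e : R) : a <= t -> t - e < a -> `|a - t| < e.
Proof. by move=> h1 h2; rewrite distrC ger0_norm ?subr_ge0//; lra. Qed.

Lemma segm_diff (R : realType) (y x : R * R) (a b : R) : `|segm y x b - segm y x a| = `|b - a| * `|x - y|.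
Proof.
rewrite -normrZ; congr `|_|; rewrite /segm [RHS]surjective_pairing /=; congr pair; rewrite /GRing.scale /=; ring.
Qed.

Lemma segm_ball (R : realType) (y x c : R * R) (r t : R) : 0 <= t <= 1 -> `|y - c| < r -> `|x - c| < r -> `|segm y x t - c| < r.
Proof.
move=> /andP[t0 t1] hy hx.
have -> : segm y x t - c = (1 - t) *: (y - c) + t *: (x - c).
  by rewrite /segm [RHS]surjective_pairing /=; congr pair; rewrite /GRing.scale /=; ring.
apply: le_lt_trans (ler_normD _ _) _; rewrite !normrZ (ger0_norm t0) ger0_norm ?subr_ge0//.
have [->|tn] := eqVneq t 0; first by rewrite mul0r addr0 subr0 mul1r.
have tp : 0 < t by rewrite lt_neqAle eq_sym tn.
have h1 : t * `|x - c| < t * r by rewrite ltr_pM2l.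
have h2 : (1 - t) * `|y - c| <= (1 - t) * r by rewrite ler_wpM2l ?subr_ge0// ltW.
have -> : r = (1 - t) * r + t * r by ring.
exact: ler_ltD.
Qed.

Lemma quarter_lt (R : realType) (s t : R) : 0 < s -> t < s / 2 -> t < 3 / 4 * s.
Proof. by move=> *; lra. Qed.

Lemma quarter_le (R : realType) (s t : R) : t < s / 2 -> 4 * t <= 2 * s.
Proof. by move=> *; lra. Qed.

Lemma half_quarter_lt (R : realType) (s t : R) : 0 < s -> t < s / 4 -> 2^-1 * t < 3 / 4 * s.
Proof. by move=> *; lra. Qed.

Lemma half_sum_lt (R : realType) (r s a b : R) : a < s -> b < r / 2 -> s < r / 2 -> a + b < r.
Proof. by move=> *; lra. Qed.

Lemma shift_lt (R : realType) (a b r : R) : a < r -> a + b < b + r + 1.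
Proof. by move=> *; lra. Qed.

(** * The projection (y, z) and its sections *)

Section Cover.
Variables (R : realType) (S : surface R) (F : S -> 'rV[R]_3) (v d : 'rV[R]_3) (c0 : R).
Hypothesis imm : smooth_immersion F.
Hypothesis cpl : complete_immersion F.
Hypothesis fr : forall p q : 'rV[R]_3, dot p q = dot p v * dot q v + dot p d * dot q d + dot p (e3 R) * dot q (e3 R).
Hypothesis uc : forall p, lin F v p = c0.
Local Notation U n := (ccod (atlas S n)).
Local Notation par n := (par (atlas S n)).
Local Notation crd n := (crd (atlas S n)).
Local Notation e3 := (e3 R).
Local Notation lin := (lin F).
Local Notation dl1 := (dl1 F).
Local Notation dl2 := (dl2 F).
Local Notation rle := (rle F).
Local Notation spd := (spd F).

Definition G (p : S) : R * R := (lin d p, lin e3 p).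

Lemma dlv0 n x : U n x -> dl1 n v x = 0 /\ dl2 n v x = 0.
Proof.
move=> Ux; apply: (Zset_d (c0 := c0) imm Ux); rewrite /Zset.
by apply: filterS (@filterT _ (nbhs (par n x)) _) => q _; exact: uc.
Qed.

Lemma J_neq0 n x : U n x -> JJ F d n x != 0.
Proof. by move=> Ux; have [k1 k2] := dlv0 Ux; exact: JJ_neq0 imm fr Ux k1 k2. Qed.

(** As u is constant, the induced metric is dy^2 + dz^2. *)
Lemma spd_G n x (e : R * R) : U n x ->
  spd n x e <= `|e.1 * dl1 n d x + e.2 * dl2 n d x| + `|e.1 * dl1 n e3 x + e.2 * dl2 n e3 x|.
Proof.
move=> Ux; apply: le_abs_sum; first exact: enorm_ge0.
have gen c : dot (vel F n x e) c = e.1 * dl1 n c x + e.2 * dl2 n c x by exact: dot_comb2.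
have [k1 k2] := dlv0 Ux; have kv : dot (vel F n x e) v = 0 by rewrite gen k1 k2 !mulr0 addr0.
by rewrite enorm_sqr (fr (vel F n x e)) kv (gen d) (gen e3) mul0r add0r.
Qed.

Lemma G_cont : continuous G.
Proof.
move=> p W nW; have [r r0 hr] := nbhs_box_in nW.
have near c : \forall q \near p, `|lin c q - lin c p| <= r.
  have cl : continuous (lin c) by exact: sC1_cont (sC1_lin imm c).
  have /cvgrPdist_le/(_ r r0) := cl p.
  by apply: filterS => q; rewrite distrC.
by apply: filterS2 (near d) (near e3) => q h1 h2; apply: hr.
Qed.

(** A chart segment in a small box has speed at most twice the sum of the increments of y and z
    between its ends, and this sum is at most twice their sup norm, whence the factor 4. The section
    comes from [loc_surj], its continuity from the bound in [loc_inj_neq]. *)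
Lemma local_iso p : exists (O : set S) (r : R) (sg : R * R -> S), [/\ nbhs p O, 0 < r,
  forall q q', O q -> O q' -> G q = G q' -> q = q',
  forall q q', O q -> O q' -> rle (4 * `|G q' - G q|) q q' &
  forall y, `|y - G p| < r -> [/\ O (sg y), G (sg y) = y & {for y, continuous sg}]].
Proof.
have [n dp] := atlas_cover p; have Ux := crd_ccod dp; rewrite -(crdK dp).
move: (crd n p) Ux => x0 Ux0 {dp}.
have oUn := @oU _ S n.
have hl c := @hasC1_lin _ _ _ imm n c.
have [s1 [C [s10 C0 sU inj]]] := loc_inj_neq oUn Ux0 (hl d) (hl e3) (J_neq0 Ux0).
(* With e C <= 1/8, the oscillation error, 4 e times the coordinate length of the segment, is at
   most half the increment of (y, z). *)
pose e := (8 * (C + 1))^-1.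
have C1 : 0 < 8 * (C + 1) by rewrite mulr_gt0// ltr_wpDl.
have e0 : 0 < e by rewrite invr_gt0.
have eC : e * C <= 8^-1 by rewrite /e [leLHS]mulrC ler_pdivrMr// mulrA mulVf// mul1r lerDl.
have dc c := dl_cont imm c Ux0.
have nb : nbhs x0 (([set w | `|dl1 n d w - dl1 n d x0| < e] `&` [set w | `|dl2 n d w - dl2 n d x0| < e]) `&`
    ([set w | `|dl1 n e3 w - dl1 n e3 x0| < e] `&` [set w | `|dl2 n e3 w - dl2 n e3 x0| < e])).
  apply: filterI; apply: filterI.
  - exact: cont_near_lt (dc d).1 e0.
  - exact: cont_near_lt (dc d).2 e0.
  - exact: cont_near_lt (dc e3).1 e0.
  - exact: cont_near_lt (dc e3).2 e0.
have [s2 s20 hs2] := nbhs_box_in nb.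
pose s := Num.min s1 s2.
have s0 : 0 < s by rewrite lt_min s10.
have bs1 : box x0 s `<=` box x0 s1 by apply: box_le; rewrite ge_min lexx.
have bs2 : box x0 s `<=` box x0 s2 by apply: box_le; rewrite ge_min lexx orbT.
have bU : box x0 s `<=` U n by move=> w /bs1/sU.
have inj' x x' : box x0 s x -> box x0 s x' ->
   `|x'.1 - x.1| + `|x'.2 - x.2| <= C * (`|lin d (par n x') - lin d (par n x)| + `|lin e3 (par n x') - lin e3 (par n x)|).
  by move=> /bs1 h /bs1 h'; exact: inj.
have [r r0 hr] := loc_surj (hl d) (hl e3) s0 bU (fun x bx => J_neq0 (bU x bx)) inj'.
have [psi hpsi] : {psi : R * R -> R * R & forall y, `|y - G (par n x0)| < r ->
   [/\ box x0 s (psi y), lin d (par n (psi y)) = y.1 & lin e3 (par n (psi y)) = y.2]}.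
  apply: (@choice _ _ (fun y w => `|y - G (par n x0)| < r -> [/\ box x0 s w, lin d (par n w) = y.1 & lin e3 (par n w) = y.2])) => y.
  have [yr|ny] := pselect (`|y - G (par n x0)| < r); last by exists x0.
  have [h1 h2] := norm_coord y (G (par n x0)).
  by have [w hw] := hr y.1 y.2 (le_lt_trans h1 yr) (le_lt_trans h2 yr); exists w.
exists (par n @` (box x0 s `&` U n)), r, (par n \o psi); split=> //.
- by apply: par_nbhs => //; exact: nbhs_box.
- move=> _ _ [w [bw _] <-] [w' [bw' _] <-] [g1 g2].
  have := inj' w w' bw bw'; rewrite g1 g2 !subrr normr0 addr0 mulr0 => h.
  by rewrite (zero_diff h).
- move=> _ _ [w [bw _] <-] [w' [bw' _] <-].
  have hD := inj' w w' bw bw'; have [m1 m2] := norm_coord (G (par n w')) (G (par n w)).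
  rewrite /= in m1 m2; set dy := `|lin d _ - _| in hD m1; set dz := `|lin e3 _ - _| in hD m2.
  have dy0 : 0 <= dy by exact: normr_ge0.
  have dz0 : 0 <= dz by exact: normr_ge0.
  have le4 : 2 * (dy + dz) <= 4 * `|G (par n w') - G (par n w)|.
    by move: m1 m2; move: `|G _ - G _| => t; clear; lra.
  apply: rle_le le4 _.
  have [D0|D0] := eqVneq (dy + dz) 0.
    by rewrite D0 mulr0 in hD *; rewrite (zero_diff hD); exact: rle_refl.
  have Dp : 0 < dy + dz by rewrite lt_neqAle eq_sym D0 addr_ge0.
  apply: rle_step; split; first by rewrite mulr_gt0.
  exists n, w, w'.
  have bseg t : 0 <= t <= 1 -> box x0 s (segm w w' t) by move=> t01; exact: box_segm.
  split=> // t t01; first exact: bU (bseg t t01).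
  have mv c : exists2 t', 0 <= t' <= 1 & lin c (par n w') - lin c (par n w) =
      (w'.1 - w.1) * dl1 n c (segm w w' t') + (w'.2 - w.2) * dl2 n c (segm w w' t').
    have dg (u : R) : 0 <= u <= 1 -> is_derive u (1 : R) (fun s => (lin c \o par n) (segm w w' s))
      ((diffp w w').1 * dl1 n c (segm w w' u) + (diffp w w').2 * dl2 n c (segm w w' u)).
      by move=> u01; apply: (segm_derive (hl c)); exact: bU (bseg u u01).
    have [t' /andP[t0 t1]] := MVT_cc ltr01 dg.
    rewrite segm_0 segm_1 subr0 mulr1 => ht; exists t' => //; by rewrite !ltW.
  apply: le_trans (spd_G _ (bU _ (bseg t t01))) _; rewrite /diffp /=.
  have [ty ty01 ey] := mv d; have [tz tz01 ez] := mv e3.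
  have [[ha hb] [hc hd]] := hs2 _ (bs2 _ (bseg t t01)).
  have [[ha' hb'] _] := hs2 _ (bs2 _ (bseg ty ty01)).
  have [_ [hc' hd']] := hs2 _ (bs2 _ (bseg tz tz01)).
  have q1 := comb_close ey ha hb ha' hb'.
  have q2 := comb_close ez hc hd hc' hd'.
  exact: speed_le (ltW e0) dy0 dz0 q1 q2 hD eC.
- move=> y yr; have [b1 b2 b3] := hpsi y yr; split.
  + by exists (psi y) => //; split=> //; exact: bU.
  + by rewrite /G /= b2 b3; case: (y).
  + have cpar : {for psi y, continuous (par n)} := @par_continuous _ _ _ _ (bU _ b1).
    apply: continuous_comp => //.
    move=> W nW; have [rho rho0 hrho] := nbhs_box_in nW.
    have k0 : 0 < rho / (2 * C + 1) by rewrite divr_gt0// ltr_wpDl// mulr_ge0.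
    have ry : 0 < r - `|y - G (par n x0)| by rewrite subr_gt0.
    apply: filterS2 (near_norm y k0) (near_norm y ry) => y' h1 h2; apply: hrho.
    have y'r : `|y' - G (par n x0)| < r.
      apply: le_lt_trans (ler_distD y _ _) _; move: h2; rewrite ltrBrDr; exact.
    have [b1' b2' b3'] := hpsi y' y'r.
    have := inj' _ _ b1 b1'; rewrite b2 b3 b2' b3'.
    have [m1 m2] := norm_coord y' y.
    have := normr_ge0 ((psi y').1 - (psi y).1); have := normr_ge0 ((psi y').2 - (psi y).2).
    move: h1; rewrite ltr_pdivlMr ?ltr_wpDl ?mulr_ge0// => h1 n1 n2 h3.
    have m3 : C * (`|y'.1 - y.1| + `|y'.2 - y.2|) <= C * (`|y' - y| + `|y' - y|) by rewrite ler_wpM2l// lerD.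
    have n3 := normr_ge0 (y' - y).
    have h4 : `|(psi y').1 - (psi y).1| + `|(psi y').2 - (psi y).2| <= rho.
      apply: le_trans h3 _; apply: le_trans m3 _; apply: le_trans (ltW h1).
      exact: double_le.
    by split; apply: le_trans h4; rewrite ?lerDl ?lerDr.
Qed.

Lemma segm_continuous (y x : R * R) : continuous (segm y x).
Proof.
move=> t; have h1 := @cont_affine' R y.1 (x.1 - y.1) t; have h2 := @cont_affine' R y.2 (x.2 - y.2) t.
exact: (cvg_pair h1 h2).
Qed.

Lemma near_segm (y x : R * R) t (W : set (R * R)) : nbhs (segm y x t) W ->
  exists2 e : R, 0 < e & forall a, `|a - t| < e -> W (segm y x a).
Proof.
by move=> /segm_continuous/nbhs_ballP[e e0 he]; exists e => // a ha; apply: he; rewrite /ball /= distrC.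
Qed.

(** Near a point of agreement the local injectivity of [G] propagates agreement; near a point of
    disagreement the Hausdorff property excludes agreement, and the implication [P a b] holds
    vacuously. *)
Lemma section_uniq (sg tau : R * R -> S) (y x : R * R) :
  (forall t : R, 0 <= t <= 1 -> [/\ {for segm y x t, continuous sg}, {for segm y x t, continuous tau},
     G (sg (segm y x t)) = segm y x t & G (tau (segm y x t)) = segm y x t]) ->
  sg y = tau y -> sg x = tau x.
Proof.
move=> H e0.
pose P (a b : R) := sg (segm y x a) = tau (segm y x a) -> sg (segm y x b) = tau (segm y x b).
suff : P 0 1 by rewrite /P segm_0 segm_1; exact.
apply: cousin => [a b c _ _ _ _ h1 h2 /h1/h2 //|t t01].
have [c1 c2 g1 g2] := H t t01.
have [et|ne] := pselect (sg (segm y x t) = tau (segm y x t)).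
  have [Q [r [_ [nO _ inj _ _]]]] := local_iso (sg (segm y x t)).
  have nO' : nbhs (tau (segm y x t)) Q by rewrite -et.
  have n1 : nbhs (segm y x t) (sg @^-1` Q) := c1 _ nO.
  have n2 : nbhs (segm y x t) (tau @^-1` Q) := c2 _ nO'.
  have [e e0' he] := near_segm (filterI n1 n2).
  exists e => // a b a0 at0 tb b1 ha hb _.
  have [h1 h2] := he b (near_r tb hb).
  have b01 : 0 <= b <= 1 by rewrite b1 (le_trans _ tb)// (le_trans a0).
  have [_ _ g3 g4] := H b b01.
  by apply: inj => //; rewrite g3 g4.
have [A [B [nA nB AB]]] : exists A B, [/\ nbhs (sg (segm y x t)) A, nbhs (tau (segm y x t)) B & forall q, A q -> B q -> False].
  have := surface_hausdorff (s := S); rewrite open_hausdorff => hS.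
  have [|[A B] [/= mA mB] [oA oB AB]] := hS (sg (segm y x t)) (tau (segm y x t)); first exact/eqP.
  rewrite inE in mA; rewrite inE in mB.
  exists A, B; split; [exact: open_nbhs_nbhs|exact: open_nbhs_nbhs|] => q Aq Bq.
  by have : (A `&` B) q by []; rewrite (eqP AB).
have n1 : nbhs (segm y x t) (sg @^-1` A) := c1 _ nA.
have n2 : nbhs (segm y x t) (tau @^-1` B) := c2 _ nB.
have [e e0' he] := near_segm (filterI n1 n2).
exists e => // a b a0 at0 tb b1 ha hb eqa; exfalso.
have [h1 h2] := he a (near_l at0 ha).
by apply: (AB _ h1); rewrite eqa.
Qed.

(* a continuous section of G over the ball of radius s around G p *)
Definition sec p (s : R) (sg : R * R -> S) := sg (G p) = p /\
  forall y, `|y - G p| < s -> {for y, continuous sg} /\ G (sg y) = y.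

(** The bound 4 |G q' - G q| of [local_iso] adds up along the image of the segment from [G p] to
    [y]. *)
Lemma section_rle p s sg y : sec p s sg -> `|y - G p| < s -> rle (4 * `|y - G p|) p (sg y).
Proof.
move=> [sp hs] ys.
have GpGp : `|G p - G p| < s by rewrite subrr normr0; exact: le_lt_trans (normr_ge0 _) ys.
have inb (t : R) : 0 <= t <= 1 -> `|segm (G p) y t - G p| < s by move=> t01; exact: segm_ball.
pose P (a b : R) := rle (4 * ((b - a) * `|y - G p|)) (sg (segm (G p) y a)) (sg (segm (G p) y b)).
suff : P 0 1 by rewrite /P segm_0 segm_1 sp subr0 mul1r.
apply: cousin => [a b c _ _ _ _ h1 h2|t t01].
  have := rle_trans h1 h2; apply: rle_le; rewrite le_eqVlt; apply/orP; left; apply/eqP; ring.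
have [ct gt] := hs _ (inb t t01).
have [Q [r [_ [nQ _ _ hr _]]]] := local_iso (sg (segm (G p) y t)).
have nQ' : nbhs (segm (G p) y t) (sg @^-1` Q) := ct _ nQ.
have [e e0 he] := near_segm nQ'.
exists e => // a b a0 at0 tb b1 ha hb.
have a01 : 0 <= a <= 1 by rewrite a0 (le_trans at0)// (le_trans tb).
have b01 : 0 <= b <= 1 by rewrite b1 (le_trans _ tb)// (le_trans a0).
have := hr _ _ (he a (near_l at0 ha)) (he b (near_r tb hb)).
have [_ ->] := hs _ (inb a a01); have [_ ->] := hs _ (inb b b01).
by rewrite segm_diff ger0_norm// subr_ge0 (le_trans at0).
Qed.

(* If sections over balls of radius 3s/4 exist at all points within 2s of p, then
   x |-> tau_m(x), with m the midpoint of G p and x and tau_m the section at m, is one over the ball of radius s. *)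
Lemma sec_exists p s : 0 < s -> exists sg, sec p s sg.
Proof.
move=> s0; apply: contrapT.
apply: (point_picking imm cpl (Bad := fun p s => ~ exists sg, sec p s sg)) => // {}p.
- move=> {}s {}s0 bad; apply: contrapT => H; apply: bad.
  have good q : rle (2 * s) p q -> exists sg, sec q (3 / 4 * s) sg.
    by move=> pq; apply: contrapT => nq; apply: H; exists q.
  have s34 : 3 / 4 * s = s / 2 + s / 4 by field.
  have s4 : 0 < s / 4 by rewrite divr_gt0.
  have s2 : 0 < s / 2 by rewrite divr_gt0.
  have [sg0 [sp0 hs0]] := good p (rle_refl F p (mulr_ge0 (ler0n _ 2) (ltW s0))).
  have lt34 (t : R) : t < s / 2 -> t < 3 / 4 * s by exact: quarter_lt.
  have [tau htau] : {tau : R * R -> R * R -> S & forall y, `|y - G p| < s / 2 -> sec (sg0 y) (3 / 4 * s) (tau y)}.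
    apply: (@choice _ _ (fun y f => `|y - G p| < s / 2 -> sec (sg0 y) (3 / 4 * s) f)) => y.
    have [yr|ny] := pselect (`|y - G p| < s / 2); last by exists (fun=> p).
    have [f hf] : exists f, sec (sg0 y) (3 / 4 * s) f; last by exists f.
    (* For |y - G p| < s/2 the chain bound is 4 (s/2) = 2 s, which is the radius in
       [point_picking]. *)
    apply: good; have := section_rle (conj sp0 hs0) (lt34 _ yr); apply: rle_le.
    exact: quarter_le.
  pose m x := segm (G p) x 2^-1.
  have halfE (x : R * R) : segm (G p) x 2^-1 - G p = segm (G p) x 2^-1 - segm (G p) x 0 by rewrite segm_0.
  have mG x : `|m x - G p| = 2^-1 * `|x - G p|.
    by rewrite /m halfE segm_diff subr0 ger0_norm.
  have mx x : `|x - m x| = 2^-1 * `|x - G p|.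
    rewrite /m -{1}(segm_1 (G p) x) segm_diff; congr (_ * _).
    by rewrite (_ : 1 - 2^-1 = 2^-1 :> R) ?ger0_norm//; field.
  have mm x x' : `|m x' - m x| = 2^-1 * `|x' - x|.
    have -> : m x' - m x = 2^-1 *: (x' - x).
      by rewrite /m /segm [RHS]surjective_pairing /=; congr pair; rewrite /GRing.scale /=; ring.
    by rewrite normrZ ger0_norm.
  have half_lt (t : R) : t < s -> 2^-1 * t < s / 2 by rewrite mulrC ltr_pM2r.
  have mGlt x : `|x - G p| < s -> `|m x - G p| < s / 2 by rewrite mG; exact: half_lt.
  have mxlt x : `|x - G p| < s -> `|x - m x| < s / 2 by rewrite mx; exact: half_lt.
  have G0 y : `|y - G p| < s / 2 -> G (sg0 y) = y by move=> /lt34/hs0[].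
  have tm y : `|y - G p| < s / 2 -> tau y y = sg0 y.
    by move=> hy; have [] := htau y hy; rewrite G0.
  have tc y z : `|y - G p| < s / 2 -> `|z - y| < 3 / 4 * s -> {for z, continuous (tau y)} /\ G (tau y z) = z.
    by move=> hy hz; have [_] := htau y hy; apply; rewrite G0.
  have p34 : 0 < 3 / 4 * s by rewrite s34 addr_gt0.
  (* By uniqueness along the segment from m x' to x' it suffices to agree at m x'. There the section
     [tau (m x)] agrees with [sg0], by uniqueness along the segment from m x to m x'. *)
  have agree x x' : `|x - G p| < s -> `|x' - G p| < s -> `|x' - x| < s / 4 -> tau (m x) x' = tau (m x') x'.
    move=> hx hx' hxx.
    have ax := mGlt _ hx; have ax' := mGlt _ hx'.
    have d1 : `|m x' - m x| < 3 / 4 * s.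
      by rewrite mm; exact: half_quarter_lt.
    have d2 : `|x' - m x| < 3 / 4 * s.
      apply: le_lt_trans (ler_distD x _ _) _; rewrite s34 addrC; apply: ltrD => //; exact: mxlt.
    have d3 : `|x' - m x'| < 3 / 4 * s by exact: lt34 (mxlt _ hx').
    have d0 (y : R * R) : `|y - y| < 3 / 4 * s by rewrite subrr normr0.
    apply: (section_uniq (y := m x')) => [t t01|].
      have [c1 g1] := tc (m x) _ ax (segm_ball t01 d1 d2).
      have [c2 g2] := tc (m x') _ ax' (segm_ball t01 (d0 _) d3).
      by split.
    rewrite (tm _ ax'); apply: (section_uniq (y := m x)) => [t t01|]; last by rewrite tm.
    have [c1 g1] := tc (m x) _ ax (segm_ball t01 (d0 _) d1).
    have [c2 g2] := hs0 _ (segm_ball t01 (lt34 _ ax) (lt34 _ ax')).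
    by split.
  exists (fun x => tau (m x) x); split.
    have GG : `|G p - G p| < s / 2 by rewrite subrr normr0.
    have mGp : m (G p) = G p by rewrite /m /segm !subrr !mulr0 !addr0; case: (G p).
    by rewrite mGp tm.
  move=> x xs; have [cx gx] := tc (m x) x (mGlt _ xs) (lt34 _ (mxlt _ xs)); split=> //.
  (* Near x the patched function coincides with the fixed section [tau (m x)], hence is
     continuous. *)
  move=> W nW; have nW' : nbhs x (tau (m x) @^-1` W) := cx _ nW.
  have xs' : 0 < s - `|x - G p| by rewrite subr_gt0.
  apply: filterS2 nW' (filterI (near_norm x s4) (near_norm x xs')) => x' Wx' [h1 h2].
  rewrite /= -(agree x x')//.
  by apply: le_lt_trans (ler_distD x _ _) _; move: h2; rewrite ltrBrDr.
- have [Q [r [sg [nO r0 inj _ hs]]]] := local_iso p.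
  exists (r / 2); first by rewrite divr_gt0.
  have nG : \forall q \near p, `|G q - G p| < r / 2.
    by have r2 : 0 < r / 2 by [rewrite divr_gt0]; exact: (G_cont (near_norm (G p) r2)).
  apply: filterS2 nO nG => q Qq Gq {s0}s s0 sr; apply; exists sg.
  have tri y : `|y - G q| < s -> `|y - G p| < r.
    move=> h; apply: le_lt_trans (ler_distD (G q) _ _) _.
    exact: half_sum_lt h Gq sr.
  split.
    have [|h1 h2 h3] := hs (G q); first by apply: tri; rewrite subrr normr0.
    exact: inj.
  by move=> y /tri/hs[].
Qed.

Lemma G_surj (p : S) y : exists q, G q = y.
Proof.
have s0 : 0 < `|y - G p| + 1 by rewrite ltr_wpDl.
have [sg [_ hs]] := sec_exists p s0.
by exists (sg y); have [|] := hs y; first by rewrite ltrDl.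
Qed.

Lemma sec_agree p s1 s2 sg1 sg2 y : sec p s1 sg1 -> sec p s2 sg2 -> `|y - G p| < s1 -> `|y - G p| < s2 -> sg1 y = sg2 y.
Proof.
move=> [e1 h1] [e2 h2] y1 y2; apply: (section_uniq (y := G p)) => [t t01|]; last by rewrite e1 e2.
have c0' s : `|y - G p| < s -> `|G p - G p| < s by rewrite subrr normr0; exact: le_lt_trans.
have [c1 g1] := h1 _ (segm_ball t01 (c0' _ y1) y1).
have [c2 g2] := h2 _ (segm_ball t01 (c0' _ y2) y2).
by split.
Qed.

(* the image of the global section through p *)
Definition leaf p : set S := [set q | exists s sg, [/\ sec p s sg, `|G q - G p| < s & sg (G q) = q]].

Lemma leaf_open p : open (leaf p).
Proof.
rewrite openE => q [s [sg [hsec qs eq]]]; have [_ hs] := hsec.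
have [Q [r [_ [nQ _ inj _ _]]]] := local_iso q.
have [cq _] := hs _ qs.
have nQ' : nbhs (G q) (sg @^-1` Q) by apply: cq; rewrite eq.
have qs' : 0 < s - `|G q - G p| by rewrite subr_gt0.
apply: filterS2 nQ (G_cont (filterI nQ' (near_norm (G q) qs'))) => q' Qq' [Qs h].
have q's : `|G q' - G p| < s by apply: le_lt_trans (ler_distD (G q) _ _) _; move: h; rewrite ltrBrDr.
by exists s, sg; split=> //; apply: inj => //; have [_ ->] := hs _ q's.
Qed.

(** A section over a ball containing the ball of radius [r] around [G q] agrees with the local
    section [tau] at a nearby point of the leaf, hence at [G q]. *)
Lemma leaf_closed p : closed (leaf p).
Proof.
move=> q clq; have [Q [r [tau [nQ r0 inj _ htau]]]] := local_iso q.
pose s := `|G q - G p| + r + 1.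
have s0 : 0 < s by rewrite ltr_wpDl// addr_ge0// ltW.
have [sg hsec] := sec_exists p s0; have [_ hs] := hsec.
have inb y : `|y - G q| < r -> `|y - G p| < s.
  by move=> h; apply: le_lt_trans (ler_distD (G q) _ _) _; exact: shift_lt.
have [q' [[s' [sg' [hsec' q's' eq']]] [Qq' hq']]] := clq _ (filterI nQ (G_cont (near_norm (G q) r0))).
have GG : `|G q - G q| < r by rewrite subrr normr0.
have e1 : sg (G q') = q' by rewrite (sec_agree hsec hsec' (inb _ hq') q's').
have e2 : tau (G q') = q'.
  by have [h1 h2 _] := htau _ hq'; apply: inj.
exists s, sg; split=> //; first exact: inb.
have -> : sg (G q) = tau (G q).
  apply: (section_uniq (y := G q')) => [t t01|]; last by rewrite e1 e2.
  have bt := segm_ball t01 hq' GG; have [c1 g1] := hs _ (inb _ bt); have [_ g2 c2] := htau _ bt.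
  by split.
by have [h1 h2 _] := htau _ GG; apply: inj => //; exact: nbhs_singleton nQ.
Qed.

(** The leaf of [p] is the whole surface, so [q] is the value at [G q = G p] of a section through
    [p]. *)
Lemma G_inj : injective G.
Proof.
move=> p q e.
have lT : leaf p = [set: S].
  apply: connected_clopen; [exact: surface_connected| |exact: leaf_open|exact: leaf_closed].
  have [sg hsec] := sec_exists p (@ltr01 R).
  by exists p, 1, sg; split; [exact: hsec|rewrite subrr normr0|exact: hsec.1].
have : leaf p q by rewrite lT.
by move=> [s [sg [[sp _] _ <-]]]; rewrite -e.
Qed.
End Cover.

(** * The theorem *)

Lemma dot_e3 (R : realType) (p : 'rV[R]_3) : dot p (e3 R) = x3 p.
Proof.
have e0 : e3 R 0 0 = 0 by rewrite mxE.
have e1 : e3 R 0 1 = 0 by rewrite mxE.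
have e2 : e3 R 0 ord_max = 1 by rewrite mxE !eqxx.
by rewrite dotE e0 e1 e2 !mulr0 !add0r mulr1.
Qed.

(** The vector [d] is [v] rotated by a right angle about the vertical axis. *)
Lemma rotated_frame (R : realType) (v : 'rV[R]_3) : dot v v = 1 -> x3 v = 0 -> exists d : 'rV[R]_3, [/\ dot d d = 1, x3 d = 0 &
  forall p q : 'rV[R]_3, dot p q = dot p v * dot q v + dot p d * dot q d + dot p (e3 R) * dot q (e3 R)].
Proof.
move=> vv v3; rewrite /x3 in v3.
pose d : 'rV[R]_3 := \row_i (if i == 0 then - v 0 1 else if i == 1 then v 0 0 else 0).
have d0 : d 0 0 = - v 0 1 by rewrite mxE eqxx.
have d1 : d 0 1 = v 0 0 by rewrite mxE.
have d2 : d 0 ord_max = 0 by rewrite mxE.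
have vv' : v 0 0 * v 0 0 + v 0 1 * v 0 1 = 1 by move: vv; rewrite dotE v3 mulr0 addr0.
exists d; split.
- by rewrite dotE d0 d1 d2 mulr0 addr0 mulrNN addrC.
- exact: d2.
move=> p q; rewrite !dot_e3 /x3 !dotE v3 d0 d1 d2.
move: (v 0 0) (v 0 1) (p 0 0) (p 0 1) (p 0 ord_max) (q 0 0) (q 0 1) (q 0 ord_max) vv' => v0 v1 p0 p1 p2 q0 q1 q2 h.
transitivity ((v0 * v0 + v1 * v1) * (p0 * q0 + p1 * q1) + p2 * q2); first by rewrite h mul1r.
ring.
Qed.

Lemma lt_pinfty_scale (R : realType) (k : R) (x y : \bar R) : 0 < k -> (k%:E * x <= y -> y < +oo -> x < +oo)%E.
Proof.
move=> k0 kx y_fin; rewrite ltey; apply/eqP => e; move: kx.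
by rewrite e gt0_muley ?lte_fin// leye_eq => /eqP e'; rewrite e' in y_fin.
Qed.

(** One member of the supremum suffices, that of centre 0 and scale 1. *)
Lemma entropy_gauss (R : realType) (S : surface R) (F : S -> 'rV[R]_3) : (entropy F < +oo)%E ->
  (surface_integral F (fun p => expR (- (dot (F p) (F p) / 4))) < +oo)%E.
Proof.
move=> h; set I := surface_integral _ _.
have hI : I = surface_integral F (fun p => expR (- (enorm (F p - 0) ^+ 2 / (4 * 1)))).
  by rewrite /I; congr surface_integral; apply/funext => p; rewrite subr0 enorm_sqr mulr1.
have c0 : 0 < (4 * pi * 1)^-1 :> R.
  by rewrite mulr1 invr_gt0; apply: mulr_gt0; [exact: ltr0n|exact: pi_gt0].
have le : (((4 * pi * 1)^-1)%:E * I <= entropy F)%E.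
  by rewrite hI; apply: ereal_sup_ubound; exists (0, 1) => //=.
exact: lt_pinfty_scale c0 le h.
Qed.

Theorem theorem1p7 (R : realType) (S : surface R) (F : S -> 'rV[R]_3)
    (b w : R) (v : 'rV[R]_3)
    (Ftranslator : translator F)
    (Fentropy : (entropy F < +oo)%E)
    (w_gt0 : 0 < w) (v_unit : enorm v = 1) (v_horizontal : dot v (e3 R) = 0)
    (Fslab : range F `<=` vertical_slab b w v)
    (a : R) (a_regular : regular_value F (@x3 R) a)
    (a_line : exists q d : 'rV[R]_3, [/\ d != 0, dot d v = 0 &
       range F `&` [set p | x3 p = a] = line q d])
    (a_below : range F `&` [set p | x3 p < a] !=set0) :
  injective F /\ exists c : R, range F = [set p | dot p v = c].
Proof.
have [imm cpl tr] := Ftranslator.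
have vv : dot v v = 1 by rewrite -enorm_sqr v_unit expr1n.
have v3 : x3 v = 0 by rewrite -dot_e3.
have [d [dd d3 fr]] := rotated_frame vv v3.
have e3v : dot (e3 R) v = 0 by rewrite dotC.
have e3d : dot (e3 R) d = 0 by rewrite dotC dot_e3.
have e3e3 : dot (e3 R) (e3 R) = 1 by rewrite dot_e3 /x3 /e3 mxE !eqxx.
have [q0 [l [_ lv linE]]] := a_line.
pose c0 := dot q0 v.
have [_ [[p0 _ <-] /= below]] := a_below.
have on_line p : lin F (e3 R) p = a -> lin F v p = c0.
  rewrite /lin dot_e3 => h.
  have : line q0 l (F p) by rewrite -linE; split=> //; exists p.
  by move=> [t _ <-]; rewrite dotDl dotZl lv mulr0 addr0.
have slab p : b < dot (F p) v < b + w by apply: Fslab; exists p.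
(* One bound for u and for -u, so that [slab_half] applies to [v] and to [- v]. *)
pose B0 := `|b| + `|w| + `|c0| + 1.
have B00 : 0 < B0 by rewrite ltr_wpDl// !addr_ge0.
have bnd (t : R) : b < t < b + w -> t - c0 <= B0 /\ - t - - c0 <= B0.
  by move=> /andP[h1 h2]; rewrite /B0; have := ler_norm b; have := ler_norm (- b); have := ler_norm c0; have := ler_norm (- c0);
    have := ler_norm w; rewrite !normrN; split; lra.
have gauss := entropy_gauss Fentropy.
have up p : lin F (e3 R) p < a -> lin F v p <= c0.
  apply: (slab_half imm cpl tr B00 _ on_line vv dd e3v e3d e3e3 _ gauss).
    by move=> q; have [] := bnd _ (slab q).
  by move=> q; rewrite fr !expr2.
have linN p : lin F (- v) p = - lin F v p by rewrite /lin dotC dotNl dotC.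
have down p : lin F (e3 R) p < a -> c0 <= lin F v p.
  move=> h; rewrite -lerN2 -linN; move: p h.
  apply: (slab_half imm cpl tr B00 _ _ _ dd _ e3d e3e3 _ gauss).
  - by move=> q; rewrite linN; have [] := bnd _ (slab q).
  - by move=> q hq; rewrite linN (on_line q hq).
  - by rewrite dotNl dotC dotNl opprK.
  - by rewrite dotC dotNl dotC e3v oppr0.
  - by move=> q; rewrite fr (dotC q (- v)) dotNl sqrrN (dotC v q) !expr2.
(* The region below the line is open and nonempty, and u vanishes on it by the two inequalities; it
   is the starting set of the unique continuation. *)
have Z0 : Zset F v c0 p0.
  have cz : continuous (lin F (e3 R)) by exact: sC1_cont (sC1_lin imm (e3 R)).
  have a0 : lin F (e3 R) p0 < a by rewrite /lin dot_e3.
  have nb : nbhs p0 [set p | lin F (e3 R) p < a] := cz p0 _ (open_nbhs_nbhs (conj (@open_lt R a) a0)).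
  by rewrite /Zset; apply: filterS nb => p h; apply/eqP; rewrite eq_le up ?down.
have uc := unique_continuation imm tr e3v e3d e3e3 fr (ex_intro _ p0 Z0).
split.
  move=> p q e; apply: (G_inj imm cpl fr uc); by rewrite /G /lin e.
exists c0; apply/seteqP; split=> [_ [p _ <-]|P /= hP]; first exact: uc.
(* A point of the surface with the same y and z as [P] is mapped to [P], since the remaining frame
   coordinate equals [c0] for both. Injectivity is that of (y, z). *)
have [q hq] := G_surj imm cpl fr uc p0 (dot P d, dot P (e3 R)).
have [g1 g2] : dot (F q) d = dot P d /\ dot (F q) (e3 R) = dot P (e3 R) by case: hq.
exists q => //; apply/eqP; rewrite -subr_eq0; apply/eqP; apply: dot_eq0.
rewrite fr !dotBl g1 g2 hP; have := uc q; rewrite /lin => ->.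
by rewrite !subrr !mulr0 !addr0.
Qed.
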